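(* Suppose $\operatorname{char}(\mathbf{k})=p>0$. Then for every $b\geq 0$ \[\mathcal{N}_{pb+p-1}(t,u) = \mathcal{N}_b(t,u^p),\] and for every $b\ge 0$ and each $i=0,\dots,p-2$, \[\mathcal{N}_{pb+i}(t,u) = \mathcal{N}_b(t,u^p) + \left(t\cdot u^{pb+i+1} + t^2\cdot u^{pb+p}\right) \cdot \mathcal{A}(t,u).\]
   Context: $\mathbf{k}$ is an algebraically closed field. $Fl_n$ is the variety of complete flags $0\subset V_1\subset\cdots\subset V_{n-1}\subset V_n=\mathbf{k}^n$, $\dim V_i=i$. For $\lambda\in\mathbb{Z}^n$, $\mathcal{O}_{Fl_n}(\lambda)=\bigotimes_{i=1}^n (\mathcal{V}_{n+1-i}/\mathcal{V}_{n-i})^{\otimes\lambda_i}$, where $\mathcal{V}_i$ is the tautological rank $i$ subbundle of $\mathbf{k}^n\otimes\mathcal{O}_{Fl_n}$ (so that $H^0(Fl_n,\mathcal{O}_{Fl_n}(d,0,\dots,0))=\operatorname{Sym}^d(\mathbf{k}^n)$). For $\lambda\in\mathbb{Z}^r$ with $\lambda_1+\cdots+\lambda_r=0$, the group $H^j(Fl_n,\mathcal{O}_{Fl_n}(\lambda_1,\dots,\lambda_r,0,\dots,0))$ is, for $n\gg 0$, a finite dimensional vector space with trivial $\operatorname{GL}_n$-action, independent of $n$; $h^j_{st}(\lambda)$ denotes its dimension. For $a\geq 1$, $b\geq 0$ let $H_{a,b}(t)=\sum_{j\ge 0}h^j_{st}(-a-b,a,1^b)\,t^j$, where $1^b$ means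 $1$ repeated $b$ times. For $b\ge 0$ let \[\mathcal{N}_b(t,u)=\frac{u^b}{t^b}\sum_{a\geq 1}H_{a,b}(t)\,u^a\in\mathbb{Z}[t,t^{-1}][[u]],\qquad \mathcal{A}(t,u)=\prod_{i\geq 1}\frac{1+t\cdot u^{p^i}}{1-t^2\cdot u^{p^i}}.\] *)

(* Defs.v *)
From HB Require Import structures.
From mathcomp Require Import all_boot all_order all_algebra.
From mathcomp Require Import boolp classical_sets functions fsbigop topology.
From mathcomp Require Import mpoly.

Set Implicit Arguments.
Unset Strict Implicit.
Unset Printing Implicit Defensive.
Import Order.TTheory GRing.Theory Num.Theory.
Local Open Scope classical_set_scope.
Local Open Scope ring_scope.

Record opens (T : topologicalType) : Type :=
  Opens { opens_set :> set T ; opens_open : open opens_set }.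

Definition opens_full (T : topologicalType) : opens T := Opens (@openT T).

Record sheaf (K : fieldType) (T : topologicalType) : Type := Sheaf {
  sec :> opens T -> lmodType K ;
  res : forall U V : opens T, V `<=` U -> {linear sec U -> sec V} ;
  res_id : forall (U : opens T) (h : U `<=` U) (s : sec U), res h s = s ;
  res_res : forall (U V W : opens T) (hVU : V `<=` U) (hWV : W `<=` V)
      (hWU : W `<=` U) (s : sec U),
    res hWV (res hVU s) = res hWU s ;
  (* [s] is a family indexed by the cover [C]; its values off [C] are unused *)
  sheaf_glue : forall (U : opens T) (C : set (opens T)),
    U = \bigcup_(V in C) V :> set T ->
    forall s : (forall V : opens T, sec V),
    (forall (V1 V2 W : opens T) (h1 : W `<=` V1) (h2 : W `<=` V2),
       C V1 -> C V2 -> res h1 (s V1) = res h2 (s V2)) ->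
    exists! x : sec U,
      forall (V : opens T) (hVU : V `<=` U), C V -> res hVU x = s V }.

Arguments res {K T} _ {U V} _.

Record sheafHom (K : fieldType) (T : topologicalType) (F G : sheaf K T) :
    Type := SheafHom {
  hom_sec :> forall U : opens T, {linear F U -> G U} ;
  hom_res : forall (U V : opens T) (h : V `<=` U) (s : F U),
    hom_sec V (res F h s) = res G h (hom_sec U s) }.

(* Kernels of sheaf morphisms are computed sectionwise, so this is the usual *)
(* notion of monomorphism of sheaves.                                        *)
Definition sheaf_mono (K : fieldType) (T : topologicalType) (F G : sheaf K T)
    (f : sheafHom F G) : Prop :=
  forall U : opens T, injective (f U).

Definition sheaf_injective (K : fieldType) (T : topologicalType)
    (I : sheaf K T) : Prop :=
  forall (F G : sheaf K T) (m : sheafHom F G) (f : sheafHom F I),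
    sheaf_mono m ->
    exists g : sheafHom G I,
      forall (U : opens T) (s : F U), g U (m U s) = f U s.

(* Images are sheafified: a section is in the image iff it is so locally.    *)
Definition sheaf_exact (K : fieldType) (T : topologicalType)
    (F G H : sheaf K T) (f : sheafHom F G) (g : sheafHom G H) : Prop :=
  forall (U : opens T) (y : G U),
    g U y = 0 <->
    (forall x : T, (U : set T) x ->
       exists (V : opens T) (hVU : V `<=` U),
         (V : set T) x /\ exists z : F V, f V z = res G hVU y).

Record injective_resolution (K : fieldType) (T : topologicalType)
    (F : sheaf K T) : Type := InjectiveResolution {
  ires :> nat -> sheaf K T ;
  iaug : sheafHom F (ires 0%N) ;
  idiff : forall j : nat, sheafHom (ires j) (ires j.+1) ;
  ires_injective : forall j : nat, sheaf_injective (ires j) ;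
  iaug_mono : sheaf_mono iaug ;
  iaug_exact : sheaf_exact iaug (idiff 0%N) ;
  idiff_exact : forall j : nat, sheaf_exact (idiff j) (idiff j.+1) }.

Definition cocycles (K : fieldType) (T : topologicalType) (F : sheaf K T)
    (I : injective_resolution F) (j : nat) : set (I j (opens_full T)) :=
  [set x | idiff I j (opens_full T) x = 0].

Definition coboundaries (K : fieldType) (T : topologicalType) (F : sheaf K T)
    (I : injective_resolution F) (j : nat) : set (I j (opens_full T)) :=
  match j with
  | 0%N => [set 0]
  | i.+1 => range (idiff I i (opens_full T))
  end.

(* dim (Z / B) = d : some d vectors of Z induce a basis of Z / B.            *)
Definition quotient_dim (K : fieldType) (V : lmodType K) (Z B : set V)
    (d : nat) : Prop :=
  exists e : 'I_d -> V,
    (forall i : 'I_d, Z (e i)) /\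
    (forall x : V, Z x ->
       exists! c : {ffun 'I_d -> K}, B (x - \sum_(i < d) c i *: e i)).

(* dim H^j(T, F) = d, where H^j(T, -) is the j-th right derived functor of   *)
(* global sections on sheaves of K-vector spaces; the choice of the          *)
(* injective resolution is immaterial.                                       *)
Definition cohomology_dim (K : fieldType) (T : topologicalType)
    (F : sheaf K T) (j d : nat) : Prop :=
  exists I : injective_resolution F,
    quotient_dim (@cocycles K T F I j) (@coboundaries K T F I j) d.

(* A closed point of Fl_n.  V_0 = 0 and V_n = k^n are forced by dimensions.  *)
Record flag (k : fieldType) (n : nat) : Type := Flag {
  flag_space :> 'I_n.+1 -> {vspace 'rV[k]_n} ;
  flag_dim : forall i : 'I_n.+1, \dim (flag_space i) = i ;
  flag_mono : forall i j : 'I_n.+1,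
    (i <= j)%N -> (flag_space i <= flag_space j)%VS }.

HB.instance Definition _ (k : fieldType) (n : nat) := gen_eqMixin (flag k n).
HB.instance Definition _ (k : fieldType) (n : nat) :=
  gen_choiceMixin (flag k n).

(* V_i is spanned by the first i rows of g, for every i <= n.  As            *)
(* \dim V_n = n, this forces g to be invertible.                             *)
Definition adapted (k : fieldType) (n : nat) (V : flag k n) (g : 'M[k]_n) :
    Prop :=
  forall i : 'I_n.+1, V i = (\sum_(j < n | (j < i)%N) <[row j g]>)%VS.

(* The preimage of A in GL_n under the quotient map GL_n -> Fl_n.            *)
Definition frames (k : fieldType) (n : nat) (A : set (flag k n)) :
    set 'M[k]_n :=
  [set g | exists2 V : flag k n, A V & adapted V g].

Definition mxeval (k : fieldType) (n : nat) (P : {mpoly k[n * n]})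
    (g : 'M[k]_n) : k :=
  P.@[mxvec g 0].

(* Zariski topology: A is open iff its preimage in GL_n is.                  *)
Definition flag_open (k : fieldType) (n : nat) (A : set (flag k n)) : Prop :=
  forall g : 'M[k]_n, frames A g ->
    exists2 Q : {mpoly k[n * n]}, mxeval Q g != 0 &
      forall h : 'M[k]_n, frames setT h -> mxeval Q h != 0 -> frames A h.

Lemma flag_ext (k : fieldType) (n : nat) (V W : flag k n) (g : 'M[k]_n) :
  adapted V g -> adapted W g -> V = W.
Proof.
case: V W => [V dV mV] [W dW mW] /= aV aW.
have eVW : V = W by apply/funext => i; have /= -> := aV i; have /= -> := aW i.
subst W; congr Flag; exact: Prop_irrelevance.
Qed.

Lemma adapted_trig (k : fieldType) (n : nat) (V W : flag k n)
    (b g : 'M[k]_n) :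
  is_trig_mx b -> adapted V g -> adapted W (b *m g) -> V = W.
Proof.
move=> /is_trig_mxP tb aV aW.
suff eVW : flag_space W = flag_space V.
  apply: (@flag_ext _ _ _ _ (b *m g)) => // i.
  by rewrite -eVW; exact: aW.
apply/funext => i; apply/eqP; rewrite eqEdim !flag_dim leqnn andbT.
rewrite (aW i) (aV i); apply/subv_sumP => j ji.
rewrite -memvE row_mul mulmx_sum_row; apply: memv_suml => l _; rewrite mxE.
have [jl|lj] := ltnP j l; first by rewrite tb // scale0r mem0v.
apply/memvZ/(subvP (sumv_sup l _ (subvv _))); last exact: memv_line.
exact: leq_ltn_trans lj ji.
Qed.

Lemma mxevalM (k : fieldType) (n : nat) (P Q : {mpoly k[n * n]})
    (g : 'M[k]_n) : mxeval (P * Q) g = mxeval P g * mxeval Q g.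
Proof. exact: mevalM. Qed.

Lemma mxevalD (k : fieldType) (n : nat) (P Q : {mpoly k[n * n]})
    (g : 'M[k]_n) : mxeval (P + Q) g = mxeval P g + mxeval Q g.
Proof. exact: mevalD. Qed.

Lemma mxevalZ (k : fieldType) (n : nat) c (P : {mpoly k[n * n]})
    (g : 'M[k]_n) : mxeval (c *: P) g = c * mxeval P g.
Proof. exact: mevalZ. Qed.

Lemma mxevalC (k : fieldType) (n : nat) (c : k) (g : 'M[k]_n) :
  mxeval c%:MP g = c.
Proof. exact: mevalC. Qed.

Lemma flag_openT (k : fieldType) (n : nat) : flag_open [set: flag k n].
Proof.
move=> g _; exists 1%:MP; rewrite ?mxevalC ?oner_eq0 //.
Qed.

Lemma flag_openI (k : fieldType) (n : nat) : setI_closed (@flag_open k n).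
Proof.
move=> A B oA oB g [V [AV BV] aV].
have [Q Qg hQ] := oA g (ex_intro2 _ _ V AV aV).
have [P Pg hP] := oB g (ex_intro2 _ _ V BV aV).
exists (Q * P); first by rewrite mxevalM mulf_neq0.
move=> h fh; rewrite mxevalM mulf_eq0 negb_or => /andP[Qh Ph].
have [W AW aW] := hQ h fh Qh; have [W' BW aW'] := hP h fh Ph.
by exists W => //; split=> //; rewrite (flag_ext aW aW').
Qed.

Lemma flag_open_bigU (k : fieldType) (n : nat) (I : Type)
    (f : I -> set (flag k n)) :
  (forall i, flag_open (f i)) -> flag_open (\bigcup_i f i).
Proof.
move=> of_ g [V [i _ fiV] aV].
have [Q Qg hQ] := of_ i g (ex_intro2 _ _ V fiV aV).
exists Q => // h fh Qh; have [W fW aW] := hQ h fh Qh.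
by exists W => //; exists i.
Qed.

HB.instance Definition _ (k : fieldType) (n : nat) :=
  isOpenTopological.Build (flag k n)
    (@flag_openT k n) (@flag_openI k n) (@flag_open_bigU k n).

(* The line bundle O(lambda).  For l : 'I_n, lambda l (the (l+1)-st entry)   *)
(* is the exponent of V_(n-l) / V_(n-l-1).  A frame g adapted to V           *)
(* trivialises this quotient by the class of the row number rev_ord l of g,  *)
(* hence trivialises the fibre of O(lambda) at V, and a section of O(lambda) *)
(* is recorded by its coordinates f g in these trivialisations:              *)
(*    s(V) = f g * \bigotimes_l [row (rev_ord l) g]^(lambda l).              *)
(* Two frames of the same flag differ by an invertible lower triangular b,   *)
(* which multiplies [row i g] by b i i.  The section is regular iff f is     *)
(* locally a quotient of polynomials in the entries of g.                    *)

Definition trig_weight (k : fieldType) (n : nat) (lam : 'I_n -> int)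
    (b : 'M[k]_n) : k :=
  \prod_(l < n) b (rev_ord l) (rev_ord l) ^ lam l.

Definition is_section (k : fieldType) (n : nat) (lam : 'I_n -> int)
    (A : set (flag k n)) (f : frames A -> k^o) : Prop :=
  (forall (g h : frames A) (b : 'M[k]_n),
     is_trig_mx b -> \val h = b *m \val g ->
     f h * trig_weight lam b = f g) /\
  (forall g : frames A,
     exists P Q : {mpoly k[n * n]},
       mxeval Q (\val g) != 0 /\
       forall h : frames A, mxeval Q (\val h) != 0 ->
         f h = mxeval P (\val h) / mxeval Q (\val h)).

Definition section_pred (k : fieldType) (n : nat) (lam : 'I_n -> int)
    (A : set (flag k n)) : {pred (frames A -> k^o)} :=
  fun f => `[< is_section lam f >].

Arguments section_pred {k n} lam A f.

Record lb_section (k : fieldType) (n : nat) (lam : 'I_n -> int)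
    (A : set (flag k n)) : Type := LbSection {
  lb_fun :> frames A -> k^o ;
  lb_funP : lb_fun \in section_pred lam A }.

Lemma section_submod (k : fieldType) (n : nat) (lam : 'I_n -> int)
    (A : set (flag k n)) : submod_closed (section_pred lam A).
Proof.
split.
  apply/asboolP; split=> [g h b _ _|g]; first by rewrite mul0r.
  exists 0, 1%:MP; rewrite mxevalC oner_eq0; split=> // h _.
  by rewrite mxevalC divr1 /mxeval meval0.
move=> c f1 f2 /asboolP[e1 r1] /asboolP[e2 r2]; apply/asboolP.
have E h : (c *: f1 + f2) h = c * f1 h + f2 h by [].
split.
  move=> g h b tb hg; rewrite !E -(e1 g h b tb hg) -(e2 g h b tb hg).
  by rewrite mulrDl -mulrA.
move=> g; have [P1 [Q1 [Q1g h1]]] := r1 g; have [P2 [Q2 [Q2g h2]]] := r2 g.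
exists (c *: (P1 * Q2) + P2 * Q1), (Q1 * Q2).
rewrite mxevalM mulf_neq0 //; split=> // h.
rewrite mxevalM mulf_eq0 negb_or => /andP[Q1h Q2h].
rewrite mxevalD mxevalZ !mxevalM mulrDl.
have K x y z : z != 0 -> x / y = (x * z) / (y * z) :> k.
  by move=> z0; rewrite -mulf_div divff // mulr1.
rewrite E h1 // h2 // (K _ _ (mxeval Q2 (\val h))) // mulrA.
by rewrite [in X in _ + X](K _ _ (mxeval Q1 (\val h))) // (mulrC (mxeval Q2 _)).
Qed.

HB.instance Definition _ (k : fieldType) (n : nat) (lam : 'I_n -> int)
    (A : set (flag k n)) :=
  GRing.isSubmodClosed.Build k (frames A -> k^o) (section_pred lam A)
    (GRing.submod_closed_semi (section_submod lam A)).
HB.instance Definition _ (k : fieldType) (n : nat) (lam : 'I_n -> int)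
    (A : set (flag k n)) := [isSub for @lb_fun k n lam A].
HB.instance Definition _ (k : fieldType) (n : nat) (lam : 'I_n -> int)
    (A : set (flag k n)) := [Choice of lb_section lam A by <:].
HB.instance Definition _ (k : fieldType) (n : nat) (lam : 'I_n -> int)
    (A : set (flag k n)) :=
  [SubChoice_isSubLmodule of lb_section lam A by <:].

Lemma frames_sub (k : fieldType) (n : nat) (A B : set (flag k n)) :
  B `<=` A -> frames B `<=` frames A.
Proof. by move=> sBA g [V BV aV]; exists V => //; exact: sBA. Qed.

Definition frames_incl (k : fieldType) (n : nat) (A B : set (flag k n))
    (h : B `<=` A) (g : frames B) : frames A :=
  exist _ (\val g) (mem_set (frames_sub h (set_valP g))).

Lemma lb_res_subproof (k : fieldType) (n : nat) (lam : 'I_n -> int)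
    (A B : set (flag k n)) (h : B `<=` A) (f : lb_section lam A) :
  (f \o frames_incl h : frames B -> k^o) \in section_pred lam B.
Proof.
case: f => f /= /asboolP[ef rf]; apply/asboolP; split.
  by move=> g g' b tb hg; apply: ef.
move=> g; have [P [Q [Qg hPQ]]] := rf (frames_incl h g).
by exists P, Q; split=> // g' Qg'; apply: hPQ.
Qed.

Definition lb_res_fun (k : fieldType) (n : nat) (lam : 'I_n -> int)
    (A B : set (flag k n)) (h : B `<=` A) (f : lb_section lam A) :
    lb_section lam B :=
  LbSection (lb_res_subproof h f).

Lemma lb_res_linear (k : fieldType) (n : nat) (lam : 'I_n -> int)
    (A B : set (flag k n)) (h : B `<=` A) : linear (@lb_res_fun k n lam A B h).
Proof. by move=> c f1 f2; apply/val_inj. Qed.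

Definition lb_res (k : fieldType) (n : nat) (lam : 'I_n -> int)
    (U V : opens (flag k n)) (h : V `<=` U) :
    {linear lb_section lam U -> lb_section lam V} :=
  HB.pack (@lb_res_fun k n lam U V h)
    (GRing.isLinear.Build _ _ _ _ _ (@lb_res_linear k n lam U V h)).

Lemma lb_glue (k : fieldType) (n : nat) (lam : 'I_n -> int)
    (U : opens (flag k n)) (C : set (opens (flag k n))) :
  U = \bigcup_(V in C) V :> set (flag k n) ->
  forall s : (forall V : opens (flag k n), lb_section lam V),
  (forall (V1 V2 W : opens (flag k n)) (h1 : W `<=` V1) (h2 : W `<=` V2),
     C V1 -> C V2 -> lb_res lam h1 (s V1) = lb_res lam h2 (s V2)) ->
  exists! x : lb_section lam U,
    forall (V : opens (flag k n)) (hVU : V `<=` U), C V ->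
      lb_res lam hVU x = s V.
Proof.
move=> eU s compat.
have agree (V1 V2 : opens (flag k n)) (g1 : frames V1) (g2 : frames V2) :
    C V1 -> C V2 -> \val g1 = \val g2 -> s V1 g1 = s V2 g2.
  move=> CV1 CV2 eg.
  pose W := Opens (openI (opens_open V1) (opens_open V2)).
  have h1 : W `<=` V1 by move=> x [].
  have h2 : W `<=` V2 by move=> x [].
  have fW : frames W (\val g1).
    have [X1 VX1 a1] := set_valP g1; have [X2 VX2 a2] := set_valP g2.
    exists X1 => //; split=> //; rewrite -eg in a2.
    by rewrite (flag_ext a1 a2).
  pose gW : frames W := exist _ (\val g1) (mem_set fW).
  have := congr1 (fun F : lb_section lam W => F gW)
    (compat _ _ _ h1 h2 CV1 CV2).
  have -> : g1 = frames_incl h1 gW by apply/val_inj.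
  by have -> : g2 = frames_incl h2 gW by apply/val_inj.
have subU (V : opens (flag k n)) : C V -> V `<=` U.
  by move=> CV x Vx; rewrite eU; exists V.
have pickV (g : frames U) :
    {V : opens (flag k n) | C V /\ frames V (\val g)}.
  apply: cid; have [X UX aX] := set_valP g.
  have [V CV VX] : (\bigcup_(V in C) V) X by rewrite -eU.
  by exists V; split=> //; exists X.
pose at_ (V : opens (flag k n)) h (hV : frames V h) : frames V :=
  exist _ h (mem_set hV).
pose f (g : frames U) : k^o := s _ (at_ _ _ (projT2 (pickV g)).2).
have fE (g : frames U) (V : opens (flag k n)) (g' : frames V) :
    C V -> \val g' = \val g -> f g = s V g'.
  by move=> CV eg; apply: agree => //; case: (projT2 (pickV g)).
have fP : f \in section_pred lam U.
  apply/asboolP; split.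
    move=> g h b tb hg; case: (pickV g) => V [CV Vg].
    have Vh : frames V (\val h).
      have [X VX aX] := Vg; exists X => //.
      have [Y _ aY] := set_valP h.
      by rewrite hg in aY *; rewrite (adapted_trig tb aX aY).
    rewrite (fE g V (at_ _ _ Vg)) // (fE h V (at_ _ _ Vh)) //.
    by have /asboolP[+ _] := lb_funP (s V); apply.
  move=> g; case: (pickV g) => V [CV Vg].
  have /asboolP[_ /(_ (at_ _ _ Vg))[P [Q [Qg hPQ]]]] := lb_funP (s V).
  have oV : flag_open V := opens_open V.
  have [Q' Q'g hQ'] := oV _ Vg.
  exists (P * Q'), (Q * Q'); rewrite mxevalM mulf_neq0 //; split=> // h.
  rewrite !mxevalM mulf_eq0 negb_or => /andP[Qh Q'h].
  have Vh : frames V (\val h).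
    by apply: hQ' => //; apply: frames_sub (set_valP h).
  rewrite (fE h V (at_ _ _ Vh)) // hPQ //= -mulf_div divff // mulr1 //.
exists (LbSection fP); split=> [V hVU CV|y hy].
  by apply/val_inj/funext => g /=; apply: fE.
apply/val_inj/funext => g /=; case: (pickV g) => V [CV Vg].
rewrite (fE g V (at_ _ _ Vg)) // -(hy V (subU V CV) CV) /=.
by congr (y _); apply/val_inj.
Qed.

Definition line_bundle (k : fieldType) (n : nat) (lam : 'I_n -> int) :
    sheaf k (flag k n).
Proof.
refine (@Sheaf k (flag k n) (fun U => lb_section lam U : lmodType k)
  (@lb_res k n lam) _ _ (@lb_glue k n lam)).
- by move=> U h s; apply/val_inj/funext => g /=; congr (s _); apply/val_inj.
- by move=> U V W h1 h2 h3 s; apply/val_inj/funext => g /=; congr (s _); apply/val_inj.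
Defined.

(* O(lambda_1, .., lambda_r, 0, .., 0), meaningful when r <= n               *)
Definition flag_bundle (k : fieldType) (n : nat) (lam : seq int) :
    sheaf k (flag k n) :=
  line_bundle k (fun l : 'I_n => nth 0 lam l).

Definition stable_cohomology_dim (k : fieldType) (lam : seq int) (j d : nat) :
    Prop :=
  exists N : nat, forall n : nat, (N <= n)%N ->
    cohomology_dim (flag_bundle k n lam) j d.

(* h^j_st(lambda); the default 0 is only used where there is no stable       *)
(* dimension.                                                                *)
Definition h_st (k : fieldType) (lam : seq int) (j : nat) : nat :=
  xget 0%N [set d | stable_cohomology_dim k lam j d].

(* Power series in u over the field Q(t), which contains Z[t, t^-1], given   *)
(* by their coefficients.  Products and powers below are never the pointwise *)
(* ones.                                                                     *)

Definition coefT : fieldType := {fraction {poly int}}.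

Definition tvar : coefT := tofrac 'X.

Definition fps : zmodType := nat -> coefT.

Definition fps_mono (c : coefT) (e : nat) : fps :=
  fun m => if m == e then c else 0.

Definition fps_mul (f g : fps) : fps :=
  fun m => \sum_(i < m.+1) f i * g (m - i)%N.

Definition fps1 : fps := fps_mono 1 0.

(* 1 / (1 - f) = \sum_j f^j, for f without constant term, so that f^j has no *)
(* term of degree < j.                                                       *)
Definition fps_geom (f : fps) : fps :=
  fun m => \sum_(j < m.+1) iter j (fps_mul f) fps1 m.

(* f(u) |-> f(u^p)                                                           *)
Definition fps_subst (p : nat) (f : fps) : fps :=
  fun m => if (p %| m)%N then f (m %/ p)%N else 0.

Definition hook_weight (a b : nat) : seq int :=
  - (a%:Z + b%:Z) :: a%:Z :: nseq b 1.

(* [\sum_(j \in _)] is the sum of a finitely supported family.               *)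
Definition H_series (k : fieldType) (a b : nat) : coefT :=
  \sum_(j \in [set: nat]) (h_st k (hook_weight a b) j)%:R * tvar ^+ j.

Definition N_series (k : fieldType) (b : nat) : fps :=
  fps_mul (fps_mono (tvar ^- b) b)
    (fun a => if (0 < a)%N then H_series k a b else 0).

Definition A_factor (p i : nat) : fps :=
  fps_mul (fps1 + fps_mono tvar (p ^ i)%N)
    (fps_geom (fps_mono (tvar ^+ 2) (p ^ i)%N)).

(* For 1 < p the factors with i > m are 1 modulo u^(m+1) and do not affect   *)
(* the coefficient of u^m.                                                   *)
Definition A_series (p : nat) : fps :=
  fun m => (\big[fps_mul/fps1]_(1 <= i < m.+1) A_factor p i) m.

(* Main.v *)
(* Pulling a section back along the bundle of frames identifies O(lambda) with
   the sheaf of regular functions on GL_n that are semi-invariant under the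
   Borel subgroup B.  It is resolved by the sheaves of regular functions with
   values in the terms of the standard resolution of a rational B-module; these
   are acyclic (partitions of unity from the Nullstellensatz, LU charts), so
   H^j(Fl_n, O(lambda)) = H^j(B, k[GL_n] (x) lambda).  For the hook (a, 1^b)
   of degree d = a + b, Koszul complexes on projective spaces reduce the group
   to the cohomology of B in polynomials of degree <= N on an affine line.
   There f |-> f^p and the divided derivatives yield, for the shifted Poincare
   polynomials F(b, d),
     F(pb+p-1, d) = [p | d] F(b, d/p),
     F(pb+i, d) = F(pb+p-1, d) + t F(p-2-i, d-pb-i-1)   (i < p - 1),
   and A(t, u) appears on iterating the second identity. *)
Require Import Defs.
From HB Require Import structures.
From mathcomp Require Import all_boot all_order all_algebra.
From mathcomp Require Import boolp classical_sets functions fsbigop topology.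
From mathcomp Require Import fingroup perm mxpoly mpoly ring zify.

Set Implicit Arguments.
Unset Strict Implicit.
Unset Printing Implicit Defensive.
Import Order.TTheory GRing.Theory Num.Theory.
Local Open Scope classical_set_scope.
Local Open Scope ring_scope.
Implicit Types k : fieldType.

(** No spectral sequence is used: each reduction is a short exact sequence of rational B-modules
    with an acyclic term. Apart from the bound on the cohomological dimension of projective space
    given by its charts, the vanishing rests on one fact: a weight of degree -1 along a projective
    line P/B is acyclic, even with coefficients in a P-module. Vanishing on projective spaces, Serre
    duality and the acyclicity of k[GL_n] over B are drawn from it. The recursion for F(b, d)
    concerns polynomials of degree at most b. For c = pb + i + 1 those of degree < c lie among those
    of degree < p(b + 1), and the divided derivative of order c maps the latter onto polynomials of
    degree < p - i - 1 with d lowered by c, the binomials involved being nonzero mod p. The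
    cohomology of the middle term is zero or the image of f |-> f^p, and a derivative of order prime
    to p kills p-th powers. So the long exact sequence breaks up, and the connecting map gives the
    factor t. The vanishing results hold for n large compared with d, which is how stability
    enters. *)

Definition mkLin k (U V : lmodType k) (f : U -> V)
  (lf : linear f) : {linear U -> V} :=
 HB.pack f (GRing.isLinear.Build _ _ _ _ f lf).

(** * Extension of linear maps, and functions of finite rank *)

Section LinearExtension.
Context k (B E : lmodType k).

Let closed (R : set (B * E)) : Prop :=
 forall c u v, R u -> R v -> R (c *: u.1 + v.1, c *: u.2 + v.2).
Let functional (R : set (B * E)) : Prop := forall e, R (0, e) -> e = 0.

Variable base : set (B * E).
Hypotheses (base0 : base (0, 0)) (base_closed : closed base) (base_fun : functional base).
Let good R := [/\ base `<=` R, closed R & functional R].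

(** Partial maps are handled as linear relations, so that a map can be prescribed on data with many
    representatives, such as germs of sections. Zorn's lemma gives a maximal functional relation,
    and a maximal one is total. *)
Lemma lin_ext_rel :
 exists g : {linear B -> E}, forall b e, base (b, e) -> g b = e.
have chain (F : set (set (B * E))) : F `<=` [set R | R = set0 \/ good R] ->
  total_on F subset -> (\bigcup_(X in F) X = set0 \/ good (\bigcup_(X in F) X)).
 move=> FP Ft; have [->|] := pselect (\bigcup_(X in F) X = set0); first by left.
 move=> /eqP/set0P[u [X FX Xu]]; right.
 have gX Y v : F Y -> Y v -> good Y.
  by move=> FY Yv; case: (FP Y FY) => // Y0; rewrite Y0 in Yv.
 split.
 - by move=> v bv; exists X => //; case: (gX _ _ FX Xu) => + _ _; apply.
 - move=> c v w [Y FY Yv] [Z FZ Zw].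
  have [YZ|ZY] := Ft _ _ FY FZ.
   by exists Z => //; case: (gX _ _ FZ Zw) => _ cl _; apply: cl=> //; exact: YZ.
  by exists Y => //; case: (gX _ _ FY Yv) => _ cl _; apply: cl=> //; exact: ZY.
 - by move=> e [Y FY Ye]; case: (gX _ _ FY Ye) => _ _; apply.
have [R [gR maxR]] := Zorn_bigcup chain.
have {gR}[bR clR fR] : good R.
 case: gR=> // R0; case: (maxR base); last by right; split=> //; exact: subset_refl.
 split=> [u|/(_ (0, 0))]; rewrite R0 //.
 by apply.
have R00 : R (0, 0) by exact: bR.
have tot b : exists e, R (b, e).
 apply: contrapT=> nb.
 (* [R'] sends the missing vector [b] to 0. If it were not functional, some c b + u.1 = 0 with c
    nonzero would already place [b] in the domain of [R]. *)
 pose R' : set (B * E) := [set v | exists c u, R u /\ v = (c *: b + u.1, u.2)].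
 have RR' : R `<=` R'.
  by move=> u Ru; exists 0, u; rewrite scale0r add0r -surjective_pairing.
 case: (maxR R').
  split=> // /(_ (b, 0)) h; apply: nb; exists 0; apply: h.
  by exists 1, (0, 0); rewrite scale1r addr0.
 right; split; first exact: subset_trans bR RR'.
  move=> c _ _ [c1 [u1 [Ru1 ->]]] [c2 [u2 [Ru2 ->]]] /=.
  exists (c * c1 + c2), (c *: u1.1 + u2.1, c *: u1.2 + u2.2).
  split; first exact: clR.
  by rewrite /= scalerDr scalerA scalerDl addrACA.
 move=> e [c [[u1 u2] [Ru /= [ub ->]]]].
 have [c0|c0] := eqVneq c 0.
  by move: ub; rewrite c0 scale0r add0r => u10; apply: fR; rewrite u10.
 case: nb; exists (- c^-1 *: u2).
 have := clR (- c^-1) _ _ Ru R00; rewrite /= !addr0.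
 suff -> : - c^-1 *: u1 = b by [].
 have -> : u1 = - (c *: b) by apply/eqP; rewrite -addr_eq0 addrC ub.
 by rewrite scaleNr scalerN opprK scalerA mulVf // scale1r.
pose g b := projT1 (cid (tot b)).
have gE b e : R (b, e) -> g b = e.
 rewrite /g; case: cid=> e' /= Re' Re; apply/eqP; rewrite -subr_eq0.
 apply/eqP/fR; have := clR (-1) _ _ Re Re'.
 by rewrite /= !scaleN1r addNr addrC.
have lg : linear g.
 move=> c x y; apply: gE.
 have Rg z : R (z, g z) by rewrite /g; case: cid.
 exact: clR (Rg x) (Rg y).
by exists (mkLin lg) => b e be /=; apply: gE; exact: bR.
Qed.
End LinearExtension.

Lemma lin_ext k (A B E : lmodType k) (m : {linear A -> B})
  (f : {linear A -> E}) : injective m ->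
 exists g : {linear B -> E}, forall a, g (m a) = f a.
move=> inj_m.
have [| | |g gE] := @lin_ext_rel k B E [set u | exists a, u = (m a, f a)].
- by exists 0; rewrite !linear0.
- by move=> c u v [a ->] [b ->]; exists (c *: a + b); rewrite !linearP.
- move=> e [a [ma ->]]; suff -> : a = 0 by rewrite linear0.
 by apply: inj_m; rewrite linear0.
- by exists g => a; apply: gE; exists a.
Qed.

Lemma dual_sep k (W : lmodType k) (w : W) :
 w != 0 -> exists l : {linear W -> k^o}, l w = 1.
move=> w0.
have lm : linear (fun c : k^o => c *: w).
 by move=> a x y; rewrite scalerDl scalerA.
have im : injective (mkLin lm).
 move=> a b /= /eqP; rewrite -subr_eq0 -scalerBl scaler_eq0 (negPf w0) orbF.
 by rewrite subr_eq0 => /eqP.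
have [g gE] := @lin_ext k k^o W k^o (mkLin lm) idfun im.
by exists g; have := gE 1; rewrite /= scale1r.
Qed.

(** The image of the tensor product of [P] and [W] among the functions [X -> W]. With this
    presentation regularity statements become inductions on the number of terms. *)
Inductive fsp k (X : Type) (P : set (X -> k)) (W : lmodType k) :
  (X -> W) -> Prop :=
| fsp0 : fsp P (fun=> 0)
| fspD a w f : P a -> fsp P f -> fsp P (fun x => a x *: w + f x).

Definition fsub k (X : Type) (P : set (X -> k)) : Prop :=
 P (fun=> 0) /\ forall c f g, P f -> P g -> P (fun x => c * f x + g x).

Lemma fsp_eq0 k X (P : set (X -> k)) (W : lmodType k) (f : X -> W) :
 (forall x, f x = 0) -> fsp P f.
by move=> f0; rewrite (_ : f = fun=> 0); [exact: fsp0|apply/funext]. Qed.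

Section FSpan.
Context k (X : Type) (P : set (X -> k)).
Implicit Types V W : lmodType k.

Lemma fsp_add W (f g : X -> W) :
 fsp P f -> fsp P g -> fsp P (fun x => f x + g x).
elim=> [|a w h Pa _ IH] Pg.
 by have -> : (fun x => 0 + g x) = g by apply/funext=> x; rewrite add0r.
have -> : (fun x => a x *: w + h x + g x) = (fun x => a x *: w + (h x + g x)).
 by apply/funext=> x; rewrite addrA.
by apply: fspD=> //; exact: IH.
Qed.

Lemma fsp_lin V W (l : V -> W) (f : X -> V) :
 linear l -> fsp P f -> fsp P (fun x => l (f x)).
move=> ll; pose L := mkLin ll; elim=> [|a w h Pa _ IH].
 have -> : (fun=> l 0) = (fun=> 0) :> (X -> W).
  by apply/funext=> x; rewrite -[l 0]/(L 0) linear0.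
 exact: fsp0.
have -> : (fun x => l (a x *: w + h x)) = (fun x => a x *: l w + l (h x)).
 by apply/funext=> x; apply: (linearP L).
exact: fspD.
Qed.

Lemma fsp_scale W c (f : X -> W) : fsp P f -> fsp P (fun x => c *: f x).
by apply: (@fsp_lin W W (fun w => c *: w)) => a x y;
  rewrite scalerDr !scalerA mulrC.
Qed.

Lemma fsp1 W a (w : W) : P a -> fsp P (fun x => a x *: w).
move=> Pa; have -> : (fun x => a x *: w) = (fun x => a x *: w + 0).
 by apply/funext=> x; rewrite addr0.
by apply: fspD=> //; exact: fsp0.
Qed.

Lemma fsp_sum W (I : Type) (r : seq I) (f : I -> X -> W) :
 (forall i, fsp P (f i)) -> fsp P (fun x => \sum_(i <- r) f i x).
move=> Pf; elim: r=> [|i r IH].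
 have -> : (fun x => \sum_(i <- [::]) f i x) = (fun=> 0).
  by apply/funext=> x; rewrite big_nil.
 exact: fsp0.
have -> : (fun x => \sum_(j <- i :: r) f j x) =
     (fun x => f i x + \sum_(j <- r) f j x).
 by apply/funext=> x; rewrite big_cons.
exact: fsp_add.
Qed.

Lemma fsp_scalar (f : X -> k^o) : fsub P -> fsp P f -> P f.
move=> [P0 PD]; elim=> // a w h Pa _ Ph.
have -> : (fun x => a x *: w + h x) = (fun x => w * a x + h x).
 by apply/funext=> x; rewrite mulrC.
exact: PD.
Qed.

(** The values span a finite-dimensional space, so the function is rebuilt from finitely many
    coordinates. The list grows only when the new vector is not fixed by the projection built so
    far. *)
Lemma fsp_dual W (f : X -> W) : fsp P f ->
 exists s : seq ({linear W -> k^o} * W),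
  forall x, f x = \sum_(lw <- s) lw.1 (f x) *: lw.2.
elim=> [|a w h Pa _ [s hs]].
 by exists [::] => x; rewrite big_nil.
pose pr v := \sum_(lw <- s) lw.1 v *: lw.2.
have lpr : linear pr.
 move=> c u v; rewrite /pr scaler_sumr -big_split /=; apply: eq_bigr=> lw _.
 by rewrite linearP scalerDl scalerA.
pose q v := v - pr v.
have lq : linear q.
 by move=> c u v; rewrite /q lpr scalerBr opprD addrACA.
have qE c u v : q (c *: u + v) = c *: q u + q v by exact: lq.
have qh x : q (h x) = 0 by rewrite /q /pr -hs subrr.
have prE v : v = pr v + q v by rewrite /q addrC subrK.
have [qw|qw] := eqVneq (q w) 0.
 by exists s => x; rewrite {1}[LHS]prE qE qw qh scaler0 !addr0.
have [l lw1] := dual_sep qw.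
have ll : linear (fun v => l (q v)) by move=> c u v; rewrite qE linearP.
exists ((mkLin ll : {linear W -> k^o}, q w) :: s) => x.
rewrite big_cons /= {1}[LHS]prE addrC; congr (_ + _).
by rewrite qE qh addr0 linearZ /= lw1 [_ *: 1]mulr1.
Qed.

(** The coefficient vectors can be taken among the values of [f]: pivot on a point where the last
    coefficient does not vanish, as in Gauss elimination. Hence [f] lifts through a linear map as
    soon as its values do. *)
Lemma fsp_pts W (f : X -> W) : fsub P -> fsp P f ->
 exists s : seq ((X -> k) * X), foldr (fun u Q => P u.1 /\ Q) True s /\
  forall x, f x = \sum_(u <- s) u.1 x *: f u.2.
move=> sP Pf.
have [m [a [w [Pa fE]]]] : exists m (a : nat -> X -> k) (w : nat -> W),
  (forall i, P (a i)) /\ forall x, f x = \sum_(i < m) a i x *: w i.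
 elim: Pf=> [|a w h Pa _ [m [b [v [Pb hE]]]]].
  exists 0%N, (fun _ _ => 0), (fun=> 0); split=> [_|x]; first by case: sP.
  by rewrite big_ord0.
 exists m.+1, (fun i => if i is j.+1 then b j else a),
  (fun i => if i is j.+1 then v j else w); split; first by case.
 by move=> x; rewrite big_ord_recl hE.
elim: m f a w Pa fE {Pf} => [|m IH] f a w Pa fE.
 by exists [::]; split=> // x; rewrite fE big_ord0 big_nil.
have [z|] := pselect (forall x, a m x = 0).
 apply: (IH f a w Pa) => x; by rewrite fE big_ord_recr /= z scale0r addr0.
move=> /existsNP[x0 /eqP ax0].
pose am x := (a m x0)^-1 * a m x + 0.
have Pam : P am by case: sP=> P0 PD; apply: PD.
have amE x : am x * a m x0 = a m x.
 by rewrite /am addr0 mulrAC mulVf // mul1r.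
pose b i x := - a i x0 * am x + a i x.
have Pb i : P (b i) by case: sP=> _ PD; apply: PD.
have fE' x : f x - am x *: f x0 = \sum_(i < m) b i x *: w i.
 rewrite !fE !big_ord_recr /= scalerDr scalerA amE opprD addrACA subrr addr0.
 rewrite scaler_sumr -sumrB.
 apply: eq_bigr=> i _; rewrite /b scalerDl scalerA mulNr scaleNr addrC.
 by rewrite [am x * _]mulrC.
have [s [Ps sE]] := IH (fun x => f x - am x *: f x0) b w Pb fE'.
pose sg x := \sum_(u <- s) am u.2 * u.1 x.
pose g x := -1 * sg x + am x.
have gE x : g x = am x - sg x by rewrite /g mulN1r addrC.
exists ((g, x0) :: s); split.
 split=> //=.
 case: (sP) => P0 PD; apply: PD=> //.
 elim: s Ps {sE gE g} @sg => [_|v s IHs [/= Pv Ps]] /=.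
  suff -> : (fun x : X => \sum_(u <- [::]) am u.2 * u.1 x) = (fun=> 0) by [].
  by rewrite funeqE => x; rewrite big_nil.
 suff -> : (fun x => \sum_(u <- v :: s) am u.2 * u.1 x) =
  (fun x => am v.2 * v.1 x + \sum_(u <- s) am u.2 * u.1 x).
  by case: sP=> _; apply => //; exact: IHs.
 by rewrite funeqE => x; rewrite big_cons.
move=> x; rewrite big_cons /=.
rewrite -[f x in LHS](subrK (am x *: f x0)) sE gE /sg scalerBl scaler_suml.
rewrite addrC -addrA; congr (_ + _); rewrite [RHS]addrC -sumrB.
by apply: eq_bigr=> u _; rewrite scalerBr scalerA mulrC.
Qed.
End FSpan.

(** The tensor product of [P] and [Q] as functions of two variables; comultiplications and coactions
    are expressed with it. *)
Inductive dspan k (X Y : Type) (P : set (X -> k)) (Q : set (Y -> k)) :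
  (X -> Y -> k) -> Prop :=
| dspan0 : dspan P Q (fun _ _ => 0)
| dspanD a b f : P a -> Q b -> dspan P Q f ->
  dspan P Q (fun x y => a x * b y + f x y).

Definition fmod_pred k (X : Type) (P : set (X -> k))
  (W : lmodType k) : {pred (X -> W)} := fun f => `[< fsp P f >].
Arguments fmod_pred {k X} P W f.

Record fmod k (X : Type) (P : set (X -> k)) (W : lmodType k) :
 Type := FMod { fm_fun :> X -> W ; fm_funP : fm_fun \in fmod_pred P W }.

Lemma fmod_submod k X (P : set (X -> k))
  (W : lmodType k) : submod_closed (fmod_pred P W).
split; first by apply/asboolP; exact: fsp0.
move=> c f g /asboolP Pf /asboolP Pg; apply/asboolP.
exact: (fsp_add (fsp_scale c Pf) Pg).
Qed.

HB.instance Definition _ k (X : Type) (P : set (X -> k))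
  (W : lmodType k) :=
 GRing.isSubmodClosed.Build k (X -> W) (fmod_pred P W)
  (GRing.submod_closed_semi (fmod_submod P W)).
HB.instance Definition _ k (X : Type) (P : set (X -> k))
  (W : lmodType k) := [isSub for @fm_fun k X P W].
HB.instance Definition _ k (X : Type) (P : set (X -> k))
  (W : lmodType k) := [Choice of fmod P W by <:].
HB.instance Definition _ k (X : Type) (P : set (X -> k))
  (W : lmodType k) := [SubChoice_isSubLmodule of fmod P W by <:].

Definition mkfm k (X : Type) (P : set (X -> k)) (W : lmodType k)
  (f : X -> W) (Pf : fsp P f) : fmod P W := FMod (asboolT Pf).

Section FmodTheory.
Context k (X : Type) (P : set (X -> k)) (W : lmodType k).
Implicit Types f g : fmod P W.

Lemma fmP f : fsp P f.
by apply/asboolP; exact: fm_funP. Qed.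
Lemma fm_ext f g : (forall x, f x = g x) -> f = g.
by move=> fg; apply/val_inj/funext. Qed.
Lemma fmE0 x : (0 : fmod P W) x = 0. Proof. by []. Qed.
Lemma fmED f g x : (f + g) x = f x + g x. Proof. by []. Qed.
Lemma fmEZ c f x : (c *: f) x = c *: f x. Proof. by []. Qed.
Lemma fmEB f g x : (f - g) x = f x - g x. Proof. by []. Qed.
Lemma fmod_ind' (Q : fmod P W -> Prop) :
 Q 0 ->
 (forall a w (Pa : P a) f, Q f -> Q (mkfm (fsp1 w Pa) + f)) ->
 forall f, Q f.
move=> Q0 QD f; have Pf := fmP f.
suff H h : fsp P h -> forall Ph : fsp P h, Q (mkfm Ph).
 by rewrite (_ : f = mkfm Pf); [exact: H|apply: fm_ext].
elim=> [|a w g Pa Pg IH] Ph.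
 by rewrite (_ : mkfm _ = 0) //; apply: fm_ext.
rewrite (_ : mkfm _ = mkfm (fsp1 w Pa) + mkfm Pg); first exact: QD.
by apply: fm_ext.
Qed.
End FmodTheory.

(** * Affine groups, rational modules and the standard resolution *)

Record agr k : Type := AGroup {
 ag :> Type ;
 agM : ag -> ag -> ag ;
 ag1 : ag ;
 agV : ag -> ag ;
 agMA : forall x y z, agM x (agM y z) = agM (agM x y) z ;
 ag1M : forall x, agM ag1 x = x ;
 agM1 : forall x, agM x ag1 = x ;
 agVM : forall x, agM (agV x) x = ag1 ;
 agMV : forall x, agM x (agV x) = ag1 ;
 agO : set (ag -> k) ;
 agO_sub : fsub agO ;
 agO_1 : agO (fun=> 1) ;
 agO_mul : forall f g, agO f -> agO g -> agO (fun x => f x * g x) ;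
 agO_inv : forall f, agO f -> agO (fun x => f (agV x)) ;
 agO_co : forall f, agO f -> dspan agO agO (fun x y => f (agM x y)) }.

Arguments agO {k a}.
Arguments ag1 {k a}.

(** [ra_rat] is the comodule condition: every orbit map is a regular function with values in a
    finite-dimensional subspace. *)
Record rmod k (S : agr k) : Type := RMod {
 rc :> lmodType k ;
 ra : S -> rc -> rc ;
 ra_lin : forall g, linear (ra g) ;
 ra_1 : forall v, ra ag1 v = v ;
 ra_M : forall g h v, ra (agM g h) v = ra g (ra h v) ;
 ra_rat : forall v, fsp agO (fun g => ra g v) }.

Section RmodTheory.
Context k (S : agr k) (N : rmod S).

Definition ral (g : S) : {linear N -> N} := mkLin (@ra_lin k S N g).

Lemma ra0 g : ra g (0 : N) = 0. Proof. exact: (linear0 (ral g)). Qed.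
Lemma raD g (u v : N) : ra g (u + v) = ra g u + ra g v.
exact: (linearD (ral g)). Qed.
Lemma raB g (u v : N) : ra g (u - v) = ra g u - ra g v.
exact: (linearB (ral g)). Qed.
Lemma raN g (u : N) : ra g (- u) = - ra g u.
exact: (linearN (ral g)). Qed.
Lemma raZ g c (u : N) : ra g (c *: u) = c *: ra g u.
exact: (linearZ_LR (ral g)). Qed.
End RmodTheory.

Lemma rmod_eq k (S : agr k) (W : lmodType k)
  (a : S -> W -> W) l1 l1' l2 l2' l3 l3' l4 l4' :
 @RMod k S W a l1 l2 l3 l4 = @RMod k S W a l1' l2' l3' l4'.
by congr RMod; exact: Prop_irrelevance. Qed.

(** [gP] is asked to be a comodule rather than an algebra, because it also has to cover homogeneous
    polynomials of a fixed degree, polynomials of bounded degree, and functions supported on a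
    chart. *)
Record gspace k (S : agr k) : Type := GSpace {
 gsp :> Type ;
 gact : gsp -> S -> gsp ;
 gact1 : forall x, gact x ag1 = x ;
 gactM : forall x g h, gact x (agM g h) = gact (gact x g) h ;
 gP : set (gsp -> k) ;
 gP_sub : fsub gP ;
 gP_co : forall p, gP p -> dspan gP agO (fun x g => p (gact x g)) }.

Arguments gP {k S}.

Section Dspan.
Context k (X Y : Type) (P : set (X -> k)) (Q : set (Y -> k)).

Lemma dspan_eq0 f : (forall x y, f x y = 0) -> dspan P Q f.
by move=> f0; rewrite (_ : f = fun _ _ => 0); [exact: dspan0|apply/funeq2P]. Qed.
Lemma dspan_l f y : fsub P -> dspan P Q f -> P (fun x => f x y).
move=> [P0 PD]; elim=> // a b h Pa _ _ Ph.
rewrite (_ : (fun x => _) = (fun x => b y * a x + h x y)); last first.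
 by apply/funext=> x; rewrite mulrC.
exact: PD.
Qed.

Lemma dspan_r f x : fsub Q -> dspan P Q f -> Q (fun y => f x y).
by move=> [Q0 QD]; elim=> // a b h _ Qb _ Qh; exact: QD. Qed.
Lemma dspan_fsp f (W : lmodType k) (w : W) (l : Y -> fmod P W) :
 dspan P Q f -> (forall y x, l y x = f x y *: w) -> fsp Q l.
move=> df; elim: df l => [|a b h Pa Qb _ IH] l lE.
 by apply: fsp_eq0=> y; apply: fm_ext=> x; rewrite lE scale0r.
pose u := mkfm (fsp1 w Pa).
rewrite (_ : l = fun y => b y *: u + (l y - b y *: u)); last first.
 by apply/funext=> y; rewrite addrC subrK.
apply: fspD=> //; apply: IH=> y x.
by rewrite fmEB fmEZ lE /= scalerDl scalerA mulrC addrC addKr.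
Qed.
End Dspan.

Lemma fsp_mul k X (P : set (X -> k)) (W : lmodType k)
  (a : X -> k) (f : X -> W) :
 (forall b, P b -> P (fun x => a x * b x)) -> fsp P f ->
 fsp P (fun x => a x *: f x).
move=> Pm; elim=> [|b w h Pb _ IH].
 by apply: fsp_eq0=> x; rewrite scaler0.
rewrite (_ : (fun x => _) = (fun x => (a x * b x) *: w + a x *: h x)).
 by apply: fspD=> //; exact: Pm.
by apply/funext=> x; rewrite scalerDr scalerA.
Qed.

Section FunctionModule.
Context k (S : agr k) (E : gspace S) (N : rmod S).

Lemma fm_act_subproof (g : S) (F : fmod (gP E) N) :
 fsp (gP E) (fun x => ra g (F (gact x g))).
apply: (@fsp_lin _ _ _ _ _ (ra g)); first exact: ra_lin.
elim: (fmP F) => [|a w h Pa _ IH]; first exact: fsp0.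
apply: fspD=> //.
exact: (@dspan_l _ _ _ _ _ _ g (gP_sub E) (gP_co Pa)).
Qed.

Definition fm_act (g : S) (F : fmod (gP E) N) : fmod (gP E) N :=
 mkfm (fm_act_subproof g F).

Lemma fm_act_lin g : linear (fm_act g).
by move=> c F G; apply: fm_ext=> x /=; rewrite raD raZ. Qed.
Lemma fm_act_1 F : fm_act ag1 F = F.
by apply: fm_ext=> x /=; rewrite gact1 ra_1. Qed.
Lemma fm_act_M g h F : fm_act (agM g h) F = fm_act g (fm_act h F).
by apply: fm_ext=> x /=; rewrite gactM ra_M. Qed.
Lemma fm_act_rat F : fsp agO (fun g => fm_act g F).
elim/fmod_ind': F => [|a w Pa F IH].
 by apply: fsp_eq0=> g; exact: (linear0 (mkLin (fm_act_lin g))).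
rewrite (_ : (fun g => _) =
  fun g => fm_act g (mkfm (fsp1 w Pa)) + fm_act g F); last first.
 by apply/funext=> g; exact: (linearD (mkLin (fm_act_lin g))).
apply: fsp_add=> //.
have tP g : gP E (fun x => a (gact x g)).
 exact: (@dspan_l _ _ _ _ _ _ g (gP_sub E) (gP_co Pa)).
pose T g (v : N) : fmod (gP E) N := mkfm (fsp1 v (tP g)).
rewrite (_ : (fun g => _) = fun g => T g (ra g w)); last first.
 by apply/funext=> g; apply: fm_ext=> x /=; rewrite raZ.
have T0 v : fsp agO (fun g => T g v).
 by apply: (@dspan_fsp _ _ _ _ _ _ _ v _ (gP_co Pa)).
suff H h : fsp agO h -> fsp agO (fun g => T g (h g)).
 by apply: H; exact: ra_rat.
elim=> [|b v h' Pb _ IHh].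
 by apply: fsp_eq0=> g; apply: fm_ext=> x /=; rewrite scaler0.
rewrite (_ : (fun g => _) = fun g => b g *: T g v + T g (h' g)).
 apply: fsp_add=> //; apply: fsp_mul=> // c Oc; exact: agO_mul.
apply/funext=> g; apply: fm_ext=> x.
by rewrite fmED fmEZ /= scalerDr !scalerA mulrC.
Qed.

Definition FM : rmod S :=
 @RMod k S (fmod (gP E) N) fm_act fm_act_lin fm_act_1 fm_act_M fm_act_rat.
End FunctionModule.

Definition triv k (S : agr k) (W : lmodType k) : rmod S.
refine (@RMod k S W (fun _ v => v) _ _ _ _) => // v.
rewrite (_ : (fun=> v) = (fun x => (fun=> 1) x *: v)).
 by apply: fsp1; exact: agO_1.
by apply/funext=> x; rewrite scale1r.
Defined.

Definition greg k (S : agr k) : gspace S :=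
 @GSpace k S S (@agM k S) (@agM1 k S) (@agMA k S) agO (agO_sub S) (@agO_co k S).

(** The cofree module k[S] tensor W; a module embeds by its orbit maps into the one built on its
    underlying space. *)
Definition ind k (S : agr k) (W : lmodType k) : rmod S :=
 FM (greg S) (triv S W).

Section Cosyzygy.
Context k (S : agr k) (N : rmod S).

(** The cokernel of the embedding of [N] into k[S] tensor N by orbit maps. It is realised as the
    complement formed by the functions vanishing at 1, with [norm] as projection, so that no
    quotient space appears. *)
Definition csz_pred : {pred (fmod (@agO k S) N)} := fun f => f ag1 == 0.

Record csz_car : Type :=
 CosyzCar { pc_fun :> fmod (@agO k S) N ; pc_funP : pc_fun \in csz_pred }.

Lemma csz_submod : submod_closed csz_pred.
split; first by apply/eqP.
by move=> c f g /eqP f1 /eqP g1; apply/eqP; rewrite fmED fmEZ f1 g1 scaler0 addr0.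
Qed.

HB.instance Definition _ :=
 GRing.isSubmodClosed.Build k (fmod (@agO k S) N) csz_pred
  (GRing.submod_closed_semi csz_submod).
HB.instance Definition _ := [isSub for pc_fun].
HB.instance Definition _ := [Choice of csz_car by <:].
HB.instance Definition _ := [SubChoice_isSubLmodule of csz_car by <:].

Lemma pc_ext (f g : csz_car) : (forall x, f x = g x) -> f = g.
by move=> fg; apply/val_inj/fm_ext. Qed.
Lemma pcED (f g : csz_car) x : (f + g) x = f x + g x. Proof. by []. Qed.
Lemma pcEZ c (f : csz_car) x : (c *: f) x = c *: f x. Proof. by []. Qed.
Lemma pc1 (f : csz_car) : f ag1 = 0.
by apply/eqP; exact: pc_funP. Qed.

(* The projection of regular functions onto those vanishing at 1 along the    *)
(* orbit maps x |-> x v.                                                      *)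
Lemma norm_subproof1 (f : fmod (@agO k S) N) :
 fsp agO (fun x => f x - ra x (f ag1)).
apply: fsp_add; first exact: fmP.
rewrite (_ : (fun x => _) = (fun x => -1 *: ra x (f ag1))).
 by apply: fsp_scale; exact: ra_rat.
by apply/funext=> x; rewrite scaleN1r.
Qed.

Lemma norm_subproof2 f : mkfm (norm_subproof1 f) \in csz_pred.
by apply/eqP=> /=; rewrite ra_1 subrr. Qed.

Definition norm f : csz_car := CosyzCar (norm_subproof2 f).

Lemma normE f x : norm f x = f x - ra x (f ag1). Proof. by []. Qed.
Lemma norm_lin : linear norm.
move=> c f g; apply: pc_ext=> x; rewrite pcED pcEZ !normE.
by rewrite !fmED !fmEZ raD raZ scalerBr opprD addrACA.
Qed.

Definition pc_act (g : S) (f : csz_car) : csz_car :=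
 norm (@ra k S (ind S N) g f).

Lemma pc_actE g f x : pc_act g f x = f (agM x g) - ra x (f g).
by rewrite /pc_act /= ag1M. Qed.
Lemma pc_act_lin g : linear (pc_act g).
by move=> c f h; rewrite /pc_act -norm_lin; congr norm; apply: fm_ext.
Qed.

Lemma pc_act_1 f : pc_act ag1 f = f.
by apply: pc_ext=> x; rewrite pc_actE agM1 pc1 ra0 subr0. Qed.
Lemma pc_act_M g h f : pc_act (agM g h) f = pc_act g (pc_act h f).
apply: pc_ext=> x; rewrite !pc_actE agMA raB ra_M opprB.
by rewrite addrA subrK.
Qed.

Lemma pc_act_rat f : fsp agO (fun g => pc_act g f).
apply: (@fsp_lin _ _ _ _ _ norm); first exact: norm_lin.
exact: (@ra_rat k S (ind S N) f).
Qed.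

Definition csz : rmod S :=
 @RMod k S csz_car pc_act pc_act_lin pc_act_1 pc_act_M pc_act_rat.

Lemma orb_subproof (v : N) : fsp agO (fun x => ra x v).
exact: ra_rat. Qed.

Definition orb (v : N) : ind S N := mkfm (orb_subproof v).

Lemma bd_subproof1 (v : N) : fsp agO (fun x => ra x v - v).
apply: fsp_add; first exact: ra_rat.
rewrite (_ : (fun=> _) = (fun x => (fun=> 1) x *: - v)).
 by apply: fsp1; exact: agO_1.
by apply/funext=> x; rewrite scale1r.
Qed.

Lemma bd_subproof2 v : mkfm (bd_subproof1 v) \in csz_pred.
by apply/eqP=> /=; rewrite ra_1 subrr. Qed.

(** Up to sign, the projection of the constant function v. The invariants of k[S] tensor N are the
    constants, so the range of [bd] is what has to be divided out of the invariants of [csz]. *)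
Definition bd (v : N) : csz := CosyzCar (bd_subproof2 v).

Lemma bdE v x : bd v x = ra x v - v. Proof. by []. Qed.
Lemma bd_lin : linear bd.
move=> c u v; apply: pc_ext=> x; rewrite pcED pcEZ !bdE.
by rewrite raD raZ scalerBr opprD addrACA.
Qed.

Definition invt (v : N) : Prop := forall g, ra g v = v.

Lemma bd0P v : bd v = 0 <-> invt v.
split=> [b0 g|iv].
 have : bd v g = 0 by rewrite b0.
 by rewrite bdE => /eqP; rewrite subr_eq0 => /eqP.
by apply: pc_ext=> x; rewrite bdE iv subrr.
Qed.
End Cosyzygy.

Lemma invt_bd k (S : agr k) (N : rmod S) (v : N) : invt (bd v).
move=> g; apply: pc_ext=> x; rewrite pc_actE !bdE raB ra_M opprB.
by rewrite addrC addrA subrK.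
Qed.

(** The invariants of [csz N] are the crossed homomorphisms and the [bd v] the principal ones, so
    H^1 of [N] is a quotient of spaces of invariants. Iterating [csz] gives all higher degrees. *)
Lemma invt_cszP k (S : agr k) (N : rmod S) (f : csz N) :
 invt f <-> forall x g, f (agM x g) = f x + ra x (f g).
split=> [fi x g|fE g].
 by have := congr1 (fun h : csz N => h x) (fi g); rewrite pc_actE => <-;
   rewrite subrK.
by apply: pc_ext=> x; rewrite pc_actE fE addrK.
Qed.

(** * Dimensions of subquotients *)

Definition sublin k (V : lmodType k) (A : set V) : Prop :=
 A 0 /\ forall c u v, A u -> A v -> A (c *: u + v).

Section Sublin.
Context k (V : lmodType k) (A : set V).
Hypothesis sA : sublin A.

Lemma sl0 : A 0. Proof. by case: sA. Qed.
Lemma slD u v : A u -> A v -> A (u + v).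
by case: sA=> _ h Au Av; rewrite -[u]scale1r; exact: h. Qed.
Lemma slZ c u : A u -> A (c *: u).
by case: sA=> A0 h Au; rewrite -[_ *: _]addr0; exact: h. Qed.
Lemma slN u : A u -> A (- u).
by rewrite -scaleN1r; exact: slZ. Qed.
Lemma slB u v : A u -> A v -> A (u - v).
by move=> Au Av; apply: slD=> //; exact: slN. Qed.
Lemma sl_sum (I : Type) (r : seq I) (f : I -> V) :
 (forall i, A (f i)) -> A (\sum_(i <- r) f i).
by move=> Af; elim/big_ind: _ => //; [exact: sl0|exact: slD]. Qed.
End Sublin.

Lemma qdimP k (V : lmodType k) (Z B : set V) d : sublin B ->
 quotient_dim Z B d <->
 exists e : 'I_d -> V, [/\ forall i, Z (e i),
  forall x, Z x -> exists c : 'I_d -> k, B (x - \sum_i c i *: e i) &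
  forall c : 'I_d -> k, B (\sum_i c i *: e i) -> forall i, c i = 0].
move=> sB; split=> [[e [Ze eP]]|[e [Ze sp ind]]]; exists e.
 split=> // [x Zx|c Bc].
  by have [c [Bc _]] := eP x Zx; exists c.
 move=> i; have [c0 [B0 u0]] := eP (e i) (Ze i).
 have E : c0 = [ffun j => c0 j + c j] :> {ffun 'I_d -> k}.
  apply: u0; rewrite (_ : \sum_j _ = \sum_j c0 j *: e j + \sum_j c j *: e j).
   by rewrite opprD addrA; exact: slB.
  by rewrite -big_split; apply: eq_bigr=> j _; rewrite ffunE scalerDl.
 have := congr1 (fun g : {ffun 'I_d -> k} => g i - c0 i) E.
 by rewrite ffunE subrr addrAC subrr add0r => /esym.
split=> // x Zx; have [c Bc] := sp x Zx; exists [ffun i => c i]; split.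
 by under eq_bigr do rewrite ffunE.
move=> c' Bc'; apply/ffunP=> i; rewrite ffunE; apply/eqP; rewrite -subr_eq0.
apply/eqP; apply: (ind (fun j => c j - c' j)).
under eq_bigr do rewrite scalerBl; rewrite sumrB.
rewrite -[X in B (X - _)]opprK addrC -opprD -[\sum_i c' i *: _]opprK -opprD.
rewrite opprK; have := slB sB Bc' Bc.
by rewrite opprB addrC addrA subrK addrC.
Qed.

(** The comparison is a relation [R], since connecting homomorphisms are defined on representatives
    only up to choices, and it is semilinear along [s], since Frobenius is one of the maps that it
    serves. *)
Lemma qdim_iso k (V V' : lmodType k) (Z B : set V)
  (Z' B' : set V') (R : V -> V' -> Prop) (s : {rmorphism k -> k}) d :
 sublin B -> sublin B' -> sublin Z -> sublin Z' -> bijective s ->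
 R 0 0 ->
 (forall c u v u' v', R u u' -> R v v' -> R (c *: u + v) (s c *: u' + v')) ->
 (forall u, Z u -> exists u', Z' u' /\ R u u') ->
 (forall u', Z' u' -> exists u u'', [/\ Z u, Z' u'', R u u'' & B' (u' - u'')]) ->
 (forall u u', Z u -> Z' u' -> R u u' -> B u <-> B' u') ->
 quotient_dim Z B d -> quotient_dim Z' B' d.
move=> sB sB' sZ sZ' [si siK sK] R0 lR tR oR bR /(qdimP Z d sB)[e [Ze sp ind]].
apply/(qdimP Z' d sB').
have /choice[e' e'P] i : exists u', Z' u' /\ R (e i) u' by exact: tR.
have Rsum (c : 'I_d -> k) : R (\sum_i c i *: e i) (\sum_i s (c i) *: e' i).
 elim: (index_enum _) => [|i r IH]; first by rewrite !big_nil.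
 by rewrite !big_cons; apply: lR=> //; case: (e'P i).
have Zsum (c : 'I_d -> k) : Z (\sum_i c i *: e i).
 by apply: sl_sum=> // i; exact: slZ.
have Zsum' (c : 'I_d -> k) : Z' (\sum_i c i *: e' i).
 by apply: sl_sum=> // i; apply: slZ=> //; case: (e'P i).
exists e'; split=> [i|x' Zx'|c' Bc' i]; first by case: (e'P i).
 have [u [u'' [Zu Zu'' Ru Bu]]] := oR x' Zx'.
 have [c Bc] := sp u Zu; exists (fun i => s (c i)).
 rewrite -(subrK u'' x') -addrA; apply: slD=> //.
 have := lR (-1) _ _ _ _ (Rsum c) Ru; rewrite rmorphN1 !scaleN1r.
 rewrite [- _ + u]addrC [- _ + u'']addrC => Rd.
 by have [+ _] := bR _ _ (slB sZ Zu (Zsum c)) (slB sZ' Zu'' (Zsum' _)) Rd; apply.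
pose c j := si (c' j).
have c'E : \sum_j c' j *: e' j = \sum_j s (c j) *: e' j.
 by apply: eq_bigr=> j _; rewrite /c sK.
have /ind/(_ i) ci0 : B (\sum_j c j *: e j).
 by rewrite (bR _ _ _ _ (Rsum c)) // -c'E.
by rewrite -[c' i]sK -/(c i) ci0 rmorph0.
Qed.

(** Additivity along a short exact sequence of subquotients whose first map is again only a
    relation. It counts dimensions at the places where a long exact sequence breaks up. *)
Lemma qdim_add k (V1 V2 V3 : lmodType k) (Z1 B1 : set V1)
  (Z2 B2 : set V2) (Z3 B3 : set V3) (R : V1 -> V2 -> Prop)
  (f : {linear V2 -> V3}) d1 d3 :
 sublin B1 -> sublin B2 -> sublin B3 -> sublin Z1 -> sublin Z2 -> sublin Z3 ->
 R 0 0 ->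
 (forall c u v u' v', R u u' -> R v v' -> R (c *: u + v) (c *: u' + v')) ->
 (forall u, Z1 u -> exists u', Z2 u' /\ R u u') ->
 (forall u u', Z1 u -> R u u' -> Z2 u' /\ (B1 u <-> B2 u')) ->
 (forall u, Z2 u -> Z3 (f u)) -> (forall u, B2 u -> B3 (f u)) ->
 (forall z, Z3 z -> exists u, Z2 u /\ B3 (z - f u)) ->
 (forall u u', Z1 u -> R u u' -> B3 (f u')) ->
 (forall u, Z2 u -> B3 (f u) -> exists v v', [/\ Z1 v, R v v' & B2 (u - v')]) ->
 quotient_dim Z1 B1 d1 -> quotient_dim Z3 B3 d3 -> quotient_dim Z2 B2 (d1 + d3).
move=> sB1 sB2 sB3 sZ1 sZ2 sZ3 R0 lR tR bR fZ fB of_ f0 ef.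
move=> /(qdimP Z1 d1 sB1)[e [Ze sp ind]] /(qdimP Z3 d3 sB3)[g [Zg spg indg]].
apply/(qdimP Z2 _ sB2).
have /choice[e' e'P] i : exists u', Z2 u' /\ R (e i) u' by exact: tR.
have /choice[g' g'P] i : exists u, Z2 u /\ B3 (g i - f u) by exact: of_.
have Rsum (c : 'I_d1 -> k) : R (\sum_i c i *: e i) (\sum_i c i *: e' i).
 elim: (index_enum _) => [|i r IH]; first by rewrite !big_nil.
 by rewrite !big_cons; apply: lR=> //; case: (e'P i).
have Zsum (c : 'I_d1 -> k) : Z1 (\sum_i c i *: e i).
 by apply: sl_sum=> // i; exact: slZ.
have Zg' (c : 'I_d3 -> k) : Z2 (\sum_i c i *: g' i).
 by apply: sl_sum=> // i; apply: slZ=> //; case: (g'P i).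
have fg' (c : 'I_d3 -> k) : B3 (\sum_i c i *: g i - f (\sum_i c i *: g' i)).
 rewrite linear_sum -sumrB; apply: sl_sum=> // i.
 by rewrite linearZ_LR -scalerBr; apply: slZ=> //; case: (g'P i).
pose h (i : 'I_(d1 + d3)) := match fintype.split i with inl j => e' j | inr j => g' j end.
have hE (c : 'I_(d1 + d3) -> k) : \sum_i c i *: h i =
  \sum_i c (lshift d3 i) *: e' i + \sum_i c (rshift d1 i) *: g' i.
 rewrite big_split_ord /=; congr (_ + _); apply: eq_bigr=> i _; rewrite /h.
  by rewrite (unsplitK (inl i)).
 by rewrite (unsplitK (inr i)).
exists h; split=> [i|x Zx|c Bc].
- by rewrite /h; case: (fintype.split i) => j; [case: (e'P j)|case: (g'P j)].
- have [c3 Bc3] := spg _ (fZ x Zx).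
 pose y := x - \sum_i c3 i *: g' i.
 have Zy : Z2 y by exact: slB.
 have Bfy : B3 (f y).
  rewrite /y linearB -(subrK (\sum_i c3 i *: g i) (f x)) -addrA.
  exact: slD.
 have [v [v' [Zv Rv Bv]]] := ef _ Zy Bfy.
 have [c1 Bc1] := sp v Zv.
 exists (fun i => match fintype.split i with inl j => c1 j | inr j => c3 j end).
 rewrite hE.
 under eq_bigr do rewrite (unsplitK (inl _)).
 under [X in _ - (_ + X)]eq_bigr do rewrite (unsplitK (inr _)).
 rewrite opprD addrC -addrA [- _ + x]addrC -/y addrC -(subrK v' y) -addrA.
 apply: slD=> //.
 have := lR (-1) _ _ _ _ (Rsum c1) Rv; rewrite !scaleN1r.
 rewrite [- _ + v]addrC [- _ + v']addrC => Rd.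
 by have [_ [+ _]] := bR _ _ (slB sZ1 Zv (Zsum c1)) Rd; apply.
- rewrite hE in Bc.
 have c3 i : c (rshift d1 i) = 0.
  apply: (indg (fun i => c (rshift d1 i))).
  rewrite -(subrK (f (\sum_i c (rshift d1 i) *: g' i)) (\sum_i _ *: g i)).
  apply: slD=> //.
  have := slB sB3 (fB _ Bc) (f0 _ _ (Zsum _) (Rsum (fun i => c (lshift d3 i)))).
  by rewrite linearD addrAC subrr add0r.
 have c1 i : c (lshift d3 i) = 0.
  apply: (ind (fun i => c (lshift d3 i))).
  have [_ ->] := bR _ _ (Zsum _) (Rsum (fun i => c (lshift d3 i))).
  move: Bc; rewrite [X in _ + X]big1 ?addr0 // => j _.
  by rewrite c3 scale0r.
 by move=> i; rewrite -(fintype.splitK i); case: (fintype.split i) => j /=.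
Qed.

Lemma qdim0P k (V : lmodType k) (Z B : set V) : sublin B ->
 quotient_dim Z B 0 <-> (forall x, Z x -> B x).
move=> sB; rewrite qdimP //; split=> [[e [_ sp _]] x /sp[c]|ZB].
 by rewrite big_ord0 subr0.
exists (fun i => 0); split=> [[]|x /ZB Bx|_ _ []] //.
by exists (fun=> 0); rewrite big_ord0 subr0.
Qed.

(** Expressing one basis through the other gives a coefficient matrix with independent rows. *)
Lemma qdim_uniq k (V : lmodType k) (Z B : set V) d d' :
 sublin B -> quotient_dim Z B d -> quotient_dim Z B d' -> d = d'.
move=> sB.
suff le d1 d2 : quotient_dim Z B d1 -> quotient_dim Z B d2 -> (d1 <= d2)%N.
 by move=> q q'; apply/eqP; rewrite eqn_leq !le.
move=> /(qdimP Z d1 sB)[e [Ze _ ind]] /(qdimP Z d2 sB)[g [_ sp _]].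
have /choice[c cP] i : exists c, B (e i - \sum_j c j *: g j) by exact: sp.
pose A : 'M[k]_(d1, d2) := \matrix_(i, j) c i j.
rewrite -[d1](_ : \rank A = d1) ?rank_leq_col //.
apply/eqP; rewrite -[_ == _]/(row_free A); apply/row_freeP.
apply/row_freeP; apply: inj_row_free=> v vA.
apply/rowP=> i; rewrite mxE; apply: (ind (fun i => v 0 i)).
have S0 : \sum_i v 0 i *: \sum_j c i j *: g j = 0.
 under eq_bigr do rewrite scaler_sumr.
 rewrite exchange_big big1 //= => j _.
 under eq_bigr do rewrite scalerA.
 rewrite -scaler_suml (_ : \sum_i _ = (v *m A) 0 j).
  by rewrite vA mxE scale0r.
 by rewrite !mxE; apply: eq_bigr=> l _; rewrite mxE.
rewrite (_ : \sum_i _ = \sum_i v 0 i *: e i - \sum_i v 0 i *: \sum_j c i j *: g j).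
 by rewrite -sumrB; apply: sl_sum=> // j; rewrite -scalerBr; exact: slZ.
by rewrite S0 subr0.
Qed.

(** * Sheaves of vector spaces and their injective resolutions *)

Section DProd.
Context k (I : Type) (V : I -> lmodType k).

Definition dprod : Type := forall i, V i.
HB.instance Definition _ := gen_eqMixin dprod.
HB.instance Definition _ := gen_choiceMixin dprod.

Definition dp_add (f g : dprod) : dprod := fun i => f i + g i.
Definition dp_opp (f : dprod) : dprod := fun i => - f i.
Definition dp_zero : dprod := fun=> 0.
Definition dp_scale (c : k) (f : dprod) : dprod := fun i => c *: f i.

Lemma dp_ext (f g : dprod) : (forall i, f i = g i) -> f = g.
exact: functional_extensionality_dep. Qed.
Lemma dp_addA : associative dp_add.
by move=> f g h; apply: dp_ext=> i; exact: addrA. Qed.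
Lemma dp_addC : commutative dp_add.
by move=> f g; apply: dp_ext=> i; exact: addrC. Qed.
Lemma dp_add0 : left_id dp_zero dp_add.
by move=> f; apply: dp_ext=> i; exact: add0r. Qed.
Lemma dp_addN : left_inverse dp_zero dp_opp dp_add.
by move=> f; apply: dp_ext=> i; exact: addNr. Qed.
HB.instance Definition _ := GRing.isZmodule.Build dprod dp_addA dp_addC dp_add0 dp_addN.

Lemma dp_scaleA a b f : dp_scale a (dp_scale b f) = dp_scale (a * b) f.
by apply: dp_ext=> i; exact: scalerA. Qed.
Lemma dp_scale1 : left_id 1 dp_scale.
by move=> f; apply: dp_ext=> i; exact: scale1r. Qed.
Lemma dp_scaleDr : right_distributive dp_scale +%R.
by move=> c f g; apply: dp_ext=> i; exact: scalerDr. Qed.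
Lemma dp_scaleDl f : {morph dp_scale^~ f : a b / a + b}.
by move=> a b; apply: dp_ext=> i; exact: scalerDl. Qed.
HB.instance Definition _ :=
 GRing.Zmodule_isLmodule.Build k dprod dp_scaleA dp_scale1 dp_scaleDr dp_scaleDl.

Lemma dpL (c : k) (f g : dprod) i : (c *: f + g : dprod) i = c *: f i + g i.
by []. Qed.
End DProd.
Section SheafBasics.
Context k (T : topologicalType).
Implicit Types (F G : sheaf k T) (U V W : opens T).

Lemma res_irr F U V (h h' : V `<=` U) (s : F U) : res F h s = res F h' s.
by rewrite (Prop_irrelevance h h'). Qed.

Definition capI U V : opens T := Opens (openI (opens_open U) (opens_open V)).
Lemma capIl U V : capI U V `<=` U. Proof. by move=> x []. Qed.
Lemma capIr U V : capI U V `<=` V. Proof. by move=> x []. Qed.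
Lemma sheaf_sep F U (s : F U) :
 (forall x, (U : set T) x -> exists V (h : V `<=` U), (V : set T) x /\ res F h s = 0) -> s = 0.
move=> loc; pose C : set (opens T) := [set V : opens T | exists h : V `<=` U, res F h s = 0].
have UC : U = \bigcup_(V in C) V :> set T.
 apply/seteqP; split=> [x Ux|x [V [h _]]]; last exact: h.
 by have [V [h [Vx s0]]] := loc x Ux; exists V => //; exists h.
have c0 (V1 V2 W : opens T) (h1 : W `<=` V1) (h2 : W `<=` V2) :
  C V1 -> C V2 -> res F h1 (0 : F V1) = res F h2 (0 : F V2) by rewrite !linear0.
have [x [_ xu]] := @sheaf_glue _ _ F U C UC (fun V => 0) c0.
have h0 V (h : V `<=` U) : C V -> res F h 0 = 0 by rewrite linear0.
have hs V (h : V `<=` U) : C V -> res F h s = 0 by move=> [h' hs]; rewrite (res_irr h h').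
by rewrite -(xu _ hs) (xu _ h0).
Qed.

Record subpre F : Type := SubPre {
 sp :> forall U, set (F U) ;
 sp0 : forall U, @sp U 0 ;
 spL : forall U c s t, @sp U s -> @sp U t -> @sp U (c *: s + t) ;
 spR : forall U V (h : V `<=` U) s, @sp U s -> @sp V (res F h s) }.

Section SubPre.
Variables (F : sheaf k T) (K : subpre F).
Definition slocal U (s : F U) : Prop := forall x, (U : set T) x ->
 exists V (h : V `<=` U), (V : set T) x /\ @sp F K V (res F h s).
End SubPre.

Definition sp_zero F : subpre F.
refine (@SubPre F (fun U => [set 0]) _ _ _) => //.
- by move=> U c _ _ -> ->; rewrite scaler0 addr0.
- by move=> U V h _ ->; rewrite linear0.
Defined.

Definition sp_full F : subpre F.
by refine (@SubPre F (fun U => setT) _ _ _). Defined.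

Section HomSub.
Variables (F G : sheaf k T) (f : sheafHom F G).

Definition sp_ker : subpre F.
refine (@SubPre F (fun U => [set s | f U s = 0]) _ _ _) => /=.
- by move=> U; rewrite linear0.
- by move=> U c s t fs ft; rewrite linearP fs ft scaler0 addr0.
- by move=> U V h s fs; rewrite hom_res fs linear0.
Defined.

Definition sp_im : subpre G.
refine (@SubPre G (fun U => [set y | exists z, f U z = y]) _ _ _) => /=.
- by move=> U; exists 0; rewrite linear0.
- by move=> U c _ _ [s <-] [t <-]; exists (c *: s + t); rewrite linearP.
- by move=> U V h _ [s <-]; exists (res F h s); rewrite hom_res.
Defined.
End HomSub.

Definition hom_comp F G H (g : sheafHom G H) (f : sheafHom F G) : sheafHom F H.
refine (@SheafHom k T F H (fun U => (g U \o f U : {linear F U -> H U})) _).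
by move=> U V h s; rewrite /= !hom_res.
Defined.

(** A substitute for the stalk: a section becomes the family of all its restrictions, inside the
    product over all opens. Agreement near a point is then a linear condition on such families. *)
Definition germ F U (t : F U) : dprod F :=
 fun W => if pselect (W `<=` U) is left h then res F h t else 0.

Lemma germE F U (t : F U) W (h : W `<=` U) : germ t W = res F h t.
by rewrite /germ; case: pselect=> // h'; exact: res_irr. Qed.
Lemma germ_lin F U : linear (@germ F U).
move=> c s t; apply: dp_ext=> W; rewrite dpL /germ; case: pselect=> h; first by rewrite linearP.
by rewrite scaler0 addr0.
Qed.
End SheafBasics.
Section PS.
Context k (T : topologicalType) (M : lmodType k).
Implicit Types U V W : opens T.

Definition ps_sec U : lmodType k := ((U : set T) -> M : lmodType k).
Definition ps_pt U x (Ux : (U : set T) x) : (U : set T) := exist _ x (mem_set Ux).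
Definition ps_incl U V (h : V `<=` U) (x : (V : set T)) : (U : set T) :=
 ps_pt (h _ (set_valP x)).
Definition ps_res U V (h : V `<=` U) : {linear ps_sec U -> ps_sec V}.
refine (@mkLin k (ps_sec U) (ps_sec V) (fun f => f \o ps_incl h) _).
by move=> c f g; apply/funext.
Defined.

Lemma ps_ptE U (x y : (U : set T)) : \val x = \val y -> x = y.
exact: val_inj. Qed.
Lemma ps_glue U (C : set (opens T)) : U = \bigcup_(V in C) V :> set T ->
 forall s : (forall V, ps_sec V),
 (forall V1 V2 W (h1 : W `<=` V1) (h2 : W `<=` V2), C V1 -> C V2 ->
  ps_res h1 (s V1) = ps_res h2 (s V2)) ->
 exists! x : ps_sec U, forall V (hVU : V `<=` U), C V -> ps_res hVU x = s V.
move=> UC s compat.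
have sU V : C V -> V `<=` U by rewrite UC => CV y Vy; exists V.
have pk (x : (U : set T)) : {V | C V /\ (V : set T) (\val x)}.
 by apply: cid; have [V CV Vx] : (\bigcup_(V in C) V) (\val x) by [rewrite -UC; exact: set_valP]; exists V.
pose f (x : (U : set T)) : M := s _ (ps_pt (projT2 (pk x)).2).
have fE (x : (U : set T)) V (y : (V : set T)) : C V -> \val y = \val x -> f x = s V y.
 move=> CV yx; rewrite /f; case: (pk x) => V' [CV' V'x] /=.
 have Wx : (capI V' V : set T) (\val x) by split=> //; rewrite -yx; exact: set_valP.
 have := congr1 (fun F : ps_sec (capI V' V) => F (ps_pt Wx)) (compat _ _ _ (@capIl _ V' V) (@capIr _ V' V) CV' CV).
 rewrite /= => e; have -> : y = ps_incl (@capIr _ V' V) (ps_pt Wx) by apply: ps_ptE.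
 by rewrite -e; congr (s _ _); apply: ps_ptE.
exists f; split=> [V h CV|g gE].
 by apply/funext=> x; exact: fE.
apply/funext=> x; case: (projT2 (pk x)) => CV Vx.
rewrite (fE x _ (ps_pt Vx)) // -(gE _ (sU _ CV) CV) /=; congr (g _); exact: ps_ptE.
Qed.

(** The product over all points of the skyscraper sheaves with value [M]. *)
Definition PS : sheaf k T.
refine (@Sheaf k T ps_sec ps_res _ _ ps_glue).
- by move=> U h s; apply/funext=> x /=; congr (s _); exact: ps_ptE.
- by move=> U V W h1 h2 h3 s; apply/funext=> x /=; congr (s _); exact: ps_ptE.
Defined.

Lemma ps_resE U V (h : V `<=` U) (s : PS U) x (Vx : (V : set T) x) (Ux : (U : set T) x) :
 res PS h s (ps_pt Vx) = s (ps_pt Ux).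
by rewrite /=; congr (s _); exact: ps_ptE. Qed.

Section RelInj.
Variables (A B : sheaf k T) (d : sheafHom A B) (f : sheafHom A PS).
Hypothesis df : forall U s, d U s = 0 -> f U s = 0.

Let base x : set (dprod B * M) := [set v | exists U (Ux : (U : set T) x) (s : A U),
 (forall W (h : W `<=` U), (W : set T) x -> v.1 W = res B h (d U s)) /\ v.2 = f U s (ps_pt Ux)].

Let base_lin x : exists g : {linear dprod B -> M}, forall b e, base x (b, e) -> g b = e.
apply: lin_ext_rel.
- exists (opens_full T), I, 0; split=> [W h _|]; first by rewrite /= !linear0.
 by rewrite linear0.
- move=> c u v [U1 [x1 [s1 [e1 e1']]]] [U2 [x2 [s2 [e2 e2']]]].
 pose h1 := @capIl _ U1 U2; pose h2 := @capIr _ U1 U2.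
 exists (capI U1 U2), (conj x1 x2), (c *: res A h1 s1 + res A h2 s2); split=> [W h Wx|].
  have i1 : W `<=` U1 by exact: subset_trans h h1.
  have i2 : W `<=` U2 by exact: subset_trans h h2.
  rewrite /= dpL (e1 _ i1) // (e2 _ i2) // !linearP !hom_res.
  by rewrite (res_res h1 h i1) (res_res h2 h i2).
 rewrite /= linearP !hom_res e1' e2'.
 by congr (_ *: _ + _); symmetry; exact: ps_resE.
- move=> e [U [Ux [s [e1 /= ->]]]]; rewrite df //.
 by have := e1 U (@subset_refl _ U) Ux; rewrite res_id => <-.
Qed.

(** A map into [PS] is a family of linear maps indexed by the points, so the factorisation is made
    point by point: on families that agree near x with a section of the image of [d] the value is
    forced, and it extends linearly. *)
Lemma rel_inj : exists g : sheafHom B PS, forall U s, g U (d U s) = f U s.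
pose gx x := projT1 (cid (base_lin x)).
have gxE x b e : base x (b, e) -> gx x b = e by rewrite /gx; case: cid=> /= g; apply.
pose gU U (t : B U) : ps_sec U := fun x => gx (\val x) (germ t).
have gL U : linear (@gU U).
 by move=> c s t; apply/funext=> x; rewrite /gU germ_lin linearP.
have gR U V (h : V `<=` U) (s : B U) : mkLin (gL V) (res B h s) = res PS h (mkLin (gL U) s).
 apply/funext=> x; apply/eqP; rewrite -subr_eq0 /= -linearB; apply/eqP/gxE.
 exists V, (set_valP x), 0; split=> [W hW Wx|]; last by rewrite linear0.
 have hWU : W `<=` U by exact: subset_trans hW h.
 rewrite !linear0 /= -[LHS]/(germ (res B h s) W - germ s W) (germE _ hW) (germE _ hWU).
 by rewrite (res_res h hW hWU) subrr.
exists (@SheafHom k T B PS (fun U => mkLin (gL U)) gR) => U s; apply/funext=> x; apply: gxE.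
exists U, (set_valP x), s; split=> [W h Wx /=|/=]; first exact: germE.
by congr (f U s _); exact: ps_ptE.
Qed.
End RelInj.

Lemma PS_injective : sheaf_injective PS.
move=> F G m f mono; apply: rel_inj=> U s ms.
suff -> : s = 0 by rewrite linear0.
by apply: (mono U); rewrite ms linear0.
Qed.
End PS.
Section Embedding.
Context k (T : topologicalType) (G : sheaf k T) (K : subpre G).
Implicit Types U V W : opens T.

(** Coordinates are indexed by all functionals on families of sections. At a point only the
    functionals killing the families that lie in [K] near this point are evaluated; the other
    coordinates are 0. *)
Definition embM : lmodType k := ({linear dprod G -> k^o} -> k^o : lmodType k).

Let N (x : T) : set (dprod G) := [set v | exists U, (U : set T) x /\
 forall W, W `<=` U -> (W : set T) x -> @sp _ _ _ K W (v W)].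

Let N_sub x : sublin (N x).
split; first by exists (opens_full T); split=> // W _ _; exact: sp0.
move=> c u v [U [Ux hU]] [V [Vx hV]]; exists (capI U V); split=> // W h Wx.
rewrite dpL; apply: spL; [apply: hU|apply: hV] => //; apply: (subset_trans h); [exact: capIl|exact: capIr].
Qed.

Let eU U (s : G U) : @ps_sec k T embM U :=
 fun x l => if `[< forall v, N (\val x) v -> l v = 0 >] then l (germ s) else 0.

Let eL U : linear (@eU U).
move=> c s t; apply/funeq2P=> x l.
rewrite -[RHS]/(c *: eU s x l + eU t x l) /eU germ_lin; case: asboolP=> _; first by rewrite linearP.
by rewrite scaler0 addr0.
Qed.

Let eR U V (h : V `<=` U) (s : G U) :
 mkLin (@eL V) (res G h s) = res (PS T embM) h (mkLin (@eL U) s).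
apply/funeq2P=> x l; rewrite /= /eU; case: asboolP=> // lN.
apply/eqP; rewrite -subr_eq0 -linearB; apply/eqP; apply: lN.
exists V; split; first exact: set_valP.
move=> W hW Wx; have hWU : W `<=` U by exact: subset_trans hW h.
rewrite -[X in sp _ X]/(germ (res G h s) W - germ s W) (germE _ hW) (germE _ hWU).
by rewrite (res_res h hW hWU) subrr; exact: sp0.
Qed.

Definition emb : sheafHom G (PS T embM) :=
 @SheafHom k T G (PS T embM) (fun U => mkLin (@eL U)) eR.

(** Functionals separate a germ from the subspace of families lying in [K] near the point, so the
    kernel is exactly what lies locally in [K]. When [K] is the image of the previous map, this is
    exactness of a resolution. *)
Lemma emb0P U (s : G U) : emb U s = 0 <-> slocal K s.
split=> [e0 x Ux|loc].
 apply: contrapT=> nK.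
 have nN : ~ N x (germ s).
  move=> [V [Vx hV]]; apply: nK; exists (capI U V), (@capIl _ U V); split=> //.
  by rewrite -(germE _ (@capIl _ U V)); apply: hV=> //; exact: capIr.
 have [l lE] : exists l : {linear dprod G -> k^o}, forall b e,
   [set u : dprod G * k^o | N x (u.1 - (u.2 : k) *: (germ s : dprod G))] (b, e) -> l b = e.
  apply: lin_ext_rel=> /=.
  - by rewrite scale0r subr0; exact: sl0 (N_sub x).
  - move=> c u v Nu Nv /=.
   have -> : c *: u.1 + v.1 - (c * u.2 + v.2) *: (germ s : dprod G) =
     c *: (u.1 - (u.2 : k) *: (germ s : dprod G)) + (v.1 - (v.2 : k) *: (germ s : dprod G)).
    by rewrite scalerBr scalerDl opprD addrACA -scalerA.
   by case: (N_sub x) => _; apply.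
  - move=> e; rewrite sub0r => /(slN (N_sub x)); rewrite opprK => Ne.
   apply/eqP; apply: contraT=> e0'; case: nN.
   by have := slZ (N_sub x) (e : k)^-1 Ne; rewrite scalerA mulVf // scale1r.
 have := congr1 (fun F : ps_sec embM U => F (ps_pt Ux) l) e0.
 rewrite /= /eU; case: asboolP=> [_|[]]; last first.
  by move=> v Nv; apply: lE=> /=; rewrite scale0r subr0.
 rewrite (lE _ 1) /= ?scale1r ?subrr; first by move/eqP; rewrite -[X in _ == X]/(0 : k) oner_eq0.
 exact: sl0 (N_sub x).
apply/funeq2P=> x l; rewrite /= /eU; case: asboolP=> // lN.
apply: lN; have [V [h [Vx sK]]] := loc _ (set_valP x).
exists V; split=> // W hW Wx; have hWU : W `<=` U by exact: subset_trans hW h.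
by rewrite (germE _ hWU) -(res_res h hW hWU); exact: spR.
Qed.
End Embedding.

Lemma emb_mono k (T : topologicalType) (G : sheaf k T) :
 sheaf_mono (emb (sp_zero G)).
move=> U s t st; apply/eqP; rewrite -subr_eq0; apply/eqP/sheaf_sep.
apply: ((emb0P (sp_zero G) (s - t)).1 _).
by rewrite (linearB (emb (sp_zero G) U)) st subrr.
Qed.

Lemma injective_retract k (T : topologicalType) (J : sheaf k T) :
 sheaf_injective J -> exists r : sheafHom (PS T (embM J)) J,
  forall U s, r U (emb (sp_zero J) U s) = s.
move=> iJ; have id_hom : exists i : sheafHom J J, forall U s, i U s = s.
 by unshelve eexists (@SheafHom k T J J (fun U => idfun) _).
have [i iE] := id_hom; have [r rE] := iJ _ _ _ i (@emb_mono k T J).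
by exists r => U s; rewrite rE iE.
Qed.

(** Factorisation through a map whose kernel may be nonzero. An injective sheaf inherits it from
    [PS], of which it is a retract. *)
Lemma injective_rel k (T : topologicalType) (A B J : sheaf k T)
  (d : sheafHom A B) (f : sheafHom A J) : sheaf_injective J ->
 (forall U s, d U s = 0 -> f U s = 0) ->
 exists g : sheafHom B J, forall U s, g U (d U s) = f U s.
move=> iJ df; have [r rE] := injective_retract iJ.
have [|g gE] := @rel_inj _ _ _ A B d (hom_comp (emb (sp_zero J)) f).
 by move=> U s ds; rewrite -[LHS]/(emb (sp_zero J) U (f U s)) df // linear0.
by exists (hom_comp r g) => U s; rewrite /= gE /= rE.
Qed.

Lemma injective_resolution_ex k (T : topologicalType) (F : sheaf k T) :
 inhabited (injective_resolution F).
(* The state is a sheaf together with the image of the preceding map; the next map has this image as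
   its local kernel. *)
pose st := {G : sheaf k T & subpre G}.
pose nx (x : st) : st := existT _ _ (sp_im (emb (projT2 x))).
pose S j : st := iter j nx (nx (existT _ F (sp_zero F))).
constructor; unshelve refine (@InjectiveResolution k T F (fun j => projT1 (S j)) _ _ _ _ _ _).
- exact: (emb (sp_zero F)).
- exact: (fun j => emb (projT2 (S j))).
- by case=> [|j]; exact: PS_injective.
- exact: emb_mono.
- by move=> U y; exact: emb0P.
- by move=> j U y; exact: emb0P.
Qed.

(** * Cech acyclicity on a basis of quasi-compact opens *)

Definition finely_qc (T : topologicalType) (BB : set (opens T)) : Prop :=
 forall V, BB V -> forall N : T -> opens T,
 (forall x, (V : set T) x -> (N x : set T) x) ->
 exists r (U : 'I_r -> opens T) (xs : 'I_r -> T), [/\ forall i, BB (U i),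
  forall i, U i `<=` N (xs i), forall i, (V : set T) (xs i) &
  forall x, (V : set T) x -> exists i, (U i : set T) x].

Section Cech.
Context k (T : topologicalType).
Implicit Types (A B : sheaf k T) (V W : opens T).
Section Cochains.
Variables (r : nat) (U : 'I_r -> opens T).
Implicit Types (s t : seq 'I_r).

Fixpoint cap V s : opens T := if s is i :: s' then cap (capI V (U i)) s' else V.

Lemma capI_sub V V' i : V `<=` V' -> capI V (U i) `<=` capI V' (U i).
by move=> h x [Vx Ux]; split=> //; exact: h. Qed.
Lemma cap_sub s V V' : V `<=` V' -> cap V s `<=` cap V' s.
by elim: s V V' => //= i s IH V V' h; apply: IH; exact: capI_sub. Qed.
Lemma capS V i s : cap (capI V (U i)) s `<=` cap V s.
by apply: cap_sub; exact: capIl. Qed.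
Lemma capP V s x : (cap V s : set T) x <-> (V : set T) x /\ forall i, i \in s -> (U i : set T) x.
elim: s V => [|i s IH] V /=; first by split=> // [[]].
rewrite IH; split=> [[[Vx Ux] sx]|[Vx sx]].
 by split=> // j; rewrite inE => /orP[/eqP -> //|/sx].
split; first by split=> //; apply: sx; exact: mem_head.
by move=> j js; apply: sx; rewrite inE js orbT.
Qed.

Lemma cap_le V s : cap V s `<=` V.
by move=> x /capP[]. Qed.

(** Non-alternating cochains of all degrees at once. The empty sequence carries a section over [V],
    so the complex is the augmented one. *)
Definition coch A V : Type := forall s, A (cap V s).

(* the Cech differential, by recursion on the first index: *)
(* (dl c)_i = c - dl (c_i), where c_i s = c (i :: s) *)
Fixpoint dl A s : forall V, coch A V -> A (cap V s) :=
 match s return forall V, coch A V -> A (cap V s) with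
 | [::] => fun V c => 0
 | i :: s' => fun V c =>
   res A (@capS V i s') (c s') - @dl A s' (capI V (U i)) (fun t => c (i :: t))
 end.

Lemma dl_ext A s V (c c' : coch A V) : (forall t, c t = c' t) -> dl s c = dl s c'.
by move=> cc; congr dl; exact: functional_extensionality_dep. Qed.
Lemma dl_hom A B (f : sheafHom A B) s V (c : coch A V) :
 f _ (dl s c) = dl s (fun t => f _ (c t)).
elim: s V c => [|i s IH] V c /=; first by rewrite linear0.
by rewrite linearB -hom_res IH.
Qed.

Lemma dl_lin A s V (a : k) (c c' : coch A V) :
 dl s (fun t => a *: c t + c' t) = a *: dl s c + dl s c'.
elim: s V c c' => [|i s IH] V c c' /=; first by rewrite scaler0 addr0.
by rewrite linearP (IH _ (fun t => c (i :: t)) (fun t => c' (i :: t))) scalerBr opprD addrACA.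
Qed.

Lemma dlB A s V (c c' : coch A V) : dl s (fun t => c t - c' t) = dl s c - dl s c'.
rewrite -scaleN1r addrC -(dl_lin s (-1) c' c); apply: dl_ext=> t.
by rewrite scaleN1r addrC.
Qed.

Lemma dl0 A s V : dl s (fun t => 0 : A (cap V t)) = 0.
by elim: s V => //= i s IH V; rewrite linear0 IH subr0. Qed.
Lemma dl_res A s V V' (h : V' `<=` V) (c : coch A V) :
 res A (@cap_sub s _ _ h) (dl s c) = dl s (fun t => res A (@cap_sub t _ _ h) (c t)).
elim: s V V' h c => [|i s IH] V V' h c; first by rewrite /= linear0.
rewrite /= linearB; congr (_ - _).
 rewrite (res_res _ _ (subset_trans (@capS V' i s) (cap_sub h))).
 by rewrite (res_res _ _ (subset_trans (@capS V' i s) (cap_sub h))).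
rewrite (res_irr _ (cap_sub (capI_sub h))) IH; apply: dl_ext=> t; exact: res_irr.
Qed.

Lemma dldl A s V (c : coch A V) : dl s (fun t => dl t c) = 0.
elim: s V c => // i s IH V c.
rewrite /= (dlB s (fun t => res A (@capS V i t) (c t)) (fun t => dl t (fun u => c (i :: u)))) IH subr0.
rewrite [X in X - _](res_irr _ (@cap_sub s _ _ (@capIl _ V (U i)))) dl_res.
by apply/eqP; rewrite subr_eq0; apply/eqP/dl_ext=> t; exact: res_irr.
Qed.

Definition trunc A V m (c : coch A V) : coch A V := fun s => if size s == m then c s else 0.

Lemma dl_trunc A m s V (c : coch A V) :
 dl s (trunc m c) = if size s == m.+1 then dl s c else 0.
elim: s m V c => [|i s IH] m V c; first by rewrite /=.
rewrite /= eqSS; case: m=> [|m].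
 rewrite (@dl_ext _ _ _ _ (fun=> 0)) // dl0 subr0 /trunc.
 by case: s {IH} => [|j s] /=; rewrite ?subr0 // linear0.
rewrite (@dl_ext _ _ _ _ (trunc m (fun t => c (i :: t)))) // IH /trunc.
by case: (size s == m.+1) => //; rewrite linear0 subr0.
Qed.

Lemma dl_conc A m s V (c : coch A V) : (forall t, size t != m -> c t = 0) ->
 size s != m.+1 -> dl s c = 0.
move=> cm sm; rewrite (@dl_ext _ _ _ c (trunc m c)) ?dl_trunc ?(negPf sm) // => t.
by rewrite /trunc; case: eqP=> // /eqP /cm.
Qed.
End Cochains.

Variable BB : set (opens T).
Hypothesis BBI : forall V W, BB V -> BB W -> BB (capI V W).

Lemma BB_cap r (U : 'I_r -> opens T) V s : BB V -> (forall i, BB (U i)) -> BB (cap U V s).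
by move=> + bU; elim: s V => //= i s IH V bV; apply: IH; exact: BBI. Qed.

(** Exactness of the augmented Cech complex at sequences of length m + 1; the case m = 0 is gluing.
    Sub-presheaves are included because acyclicity is propagated along a resolution through the
    kernels of its differentials. *)
Definition cacyc A (K : subpre A) : Prop :=
 forall V r (U : 'I_r -> opens T), BB V -> (forall i, BB (U i)) ->
 (forall x, (V : set T) x -> exists i, (U i : set T) x) ->
 forall m (c : coch U A V), (forall s, @sp _ _ _ K _ (c s)) ->
 (forall s, size s != m.+1 -> c s = 0) -> (forall s, dl s c = 0) ->
 exists b : coch U A V, [/\ forall s, @sp _ _ _ K _ (b s),
  forall s, size s != m -> b s = 0 & forall s, dl s b = c s].

Lemma cacyc_trunc r (U : 'I_r -> opens T) A (K : subpre A) V m (c b : coch U A V) :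
 (forall s, size s != m.+1 -> c s = 0) -> (forall s, @sp _ _ _ K _ (b s)) ->
 (forall s, size s = m.+1 -> dl s b = c s) ->
 exists b : coch U A V, [/\ forall s, @sp _ _ _ K _ (b s),
  forall s, size s != m -> b s = 0 & forall s, dl s b = c s].
move=> cm Kb bc; exists (trunc m b); split=> s.
- by rewrite /trunc; case: ifP=> _; [exact: Kb|exact: sp0].
- by rewrite /trunc => /negPf ->.
- by rewrite dl_trunc; case: eqP=> [/bc //|/eqP/cm].
Qed.

Lemma cech_retract A B (e : sheafHom A B) (q : sheafHom B A) :
 (forall V (s : A V), q V (e V s) = s) -> cacyc (sp_full B) -> cacyc (sp_full A).
move=> qe cB V r U bV bU UV m c _ cm c0.
have [|s sm|s|b [_ bm bc]] := cB V r U bV bU UV m (fun s => e _ (c s)); first by [].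
- by rewrite cm // linear0.
- by rewrite -dl_hom c0 linear0.
exists (fun s => q _ (b s)); split=> // s; first by move=> sm; rewrite bm // linear0.
by rewrite -dl_hom bc qe.
Qed.

Section FunctionSheaf.
Variables (A : sheaf k T) (Y : Type) (pre : opens T -> set Y) (M : lmodType k).
Variable nu : forall V, A V -> Y -> M.
Hypothesis nuL : forall V a (s t : A V) y, nu (a *: s + t) y = a *: nu s y + nu t y.
Hypothesis nuR : forall V W (h : W `<=` V) (s : A V) y, pre W y -> nu (res A h s) y = nu s y.
Hypothesis nuI : forall V (s t : A V), (forall y, pre V y -> nu s y = nu t y) -> s = t.
Hypothesis preS : forall V W y, W `<=` V -> pre W y -> pre V y.
Hypothesis preI : forall V W y, pre V y -> pre W y -> pre (capI V W) y.

Section Cover.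
Variables (r : nat) (U : 'I_r -> opens T).
Notation cap := (cap U).
Notation coch := (coch U).

Fixpoint dls (s : seq 'I_r) (c : seq 'I_r -> M) : M :=
 if s is i :: s' then c s' - dls s' (fun t => c (i :: t)) else 0.

Lemma nu0 V y : nu (0 : A V) y = 0.
have := nuL (1 : k) (0 : A V) 0 y; rewrite scaler0 addr0 scale1r => e.
by apply: (addrI (nu (0 : A V) y)); rewrite addr0.
Qed.

Lemma nuB V (s t : A V) y : nu (s - t) y = nu s y - nu t y.
by rewrite addrC -scaleN1r nuL scaleN1r addrC. Qed.
Lemma nu_dl s V (c : coch A V) y : pre (cap V s) y ->
 nu (dl s c) y = dls s (fun t => nu (c t) y).
elim: s V c => [|i s IH] V c /= py; first exact: nu0.
by rewrite nuB nuR // IH.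
Qed.

Lemma dls_sum s (f : 'I_r -> seq 'I_r -> M) (w : 'I_r -> k) :
 dls s (fun t => \sum_i w i *: f i t) = \sum_i w i *: dls s (f i).
elim: s f => [|j s IH] f /=; first by rewrite big1 // => i _; rewrite scaler0.
rewrite (IH (fun i t => f i (j :: t))) -sumrB; apply: eq_bigr=> i _.
by rewrite scalerBr.
Qed.

Lemma dls_eq s (f g : seq 'I_r -> M) :
 (forall t, (size t).+1 = size s -> {subset t <= s} -> f t = g t) -> dls s f = dls s g.
elim: s f g => //= i s IH f g fg; rewrite fg // => [|j js]; last by rewrite inE js orbT.
congr (_ - _); apply: IH=> t ts st; apply: fg=> /=; first by rewrite ts.
by move=> j; rewrite !inE => /orP[->//|/st ->]; rewrite orbT.
Qed.

Lemma pre_cap V s y : pre (cap V s) y <-> pre V y /\ forall i, i \in s -> pre (U i) y.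
elim: s V => [|i s IH] V /=; first by split=> // [[]].
rewrite IH; split=> [[py ps]|[py ps]].
 split; first exact: preS (@capIl _ V (U i)) py.
 by move=> j; rewrite inE => /orP[/eqP -> |/ps //]; exact: preS (@capIr _ V (U i)) py.
split; first by apply: preI=> //; apply: ps; exact: mem_head.
by move=> j js; apply: ps; rewrite inE js orbT.
Qed.
End Cover.

(* Partitions of unity make the Cech complexes contractible. *)
Lemma cacyc_pu :
 (forall V r (U : 'I_r -> opens T), BB V -> (forall i, BB (U i)) ->
  (forall x, (V : set T) x -> exists i, (U i : set T) x) ->
  forall m (c : coch U A V), exists (b : coch U A V) (w : 'I_r -> Y -> k),
  [/\ forall y, pre V y -> \sum_i w i y = 1,
    forall i y, w i y != 0 -> pre V y -> pre (U i) y &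
    forall s y, size s = m -> pre (cap U V s) y ->
     nu (b s) y = \sum_i w i y *: nu (c (i :: s)) y]) ->
 cacyc (sp_full A).
move=> PU V r U bV bU UV m c _ cm c0.
have [b [w [w1 wU bE]]] := PU V r U bV bU UV m c.
apply: (@cacyc_trunc r U A (sp_full A) V m c b) => // s sm; apply: nuI=> y py.
have /pre_cap[pV pU] := py.
rewrite nu_dl // (@dls_eq r s _ (fun t => \sum_i w i y *: nu (c (i :: t)) y)); last first.
 move=> t ts st; apply: bE; first by move: ts; rewrite sm => -[].
 by apply/pre_cap; split=> // i /st /pU.
rewrite (@dls_sum r s (fun i t => nu (c (i :: t)) y)).
rewrite (eq_bigr (fun i => w i y *: nu (c s) y)).
 by rewrite -scaler_suml w1 // scale1r.
move=> i _; have [->|wi] := eqVneq (w i y) 0; first by rewrite !scale0r.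
have pis : pre (cap U V (i :: s)) y.
 by apply/pre_cap; split=> // j; rewrite inE => /orP[/eqP ->|/pU //]; exact: wU pV.
have := nu_dl c pis; rewrite c0 nu0 /= => e.
by congr (_ *: _); apply/eqP; rewrite eq_sym -subr_eq0 -e.
Qed.
End FunctionSheaf.

(** Arbitrary functions admit partitions of unity: the indicators of an index chosen at each
    point. *)
Lemma cech_PS (M : lmodType k) : cacyc (sp_full (PS T M)).
pose nu V (a : PS T M V) (x : T) : M := if pselect ((V : set T) x) is left h then a (ps_pt h) else 0.
have nuE V (a : PS T M V) x (h : (V : set T) x) : nu V a x = a (ps_pt h).
 by rewrite /nu; case: pselect=> // h'; congr (a _); exact: ps_ptE.
apply: (@cacyc_pu _ T (fun V => (V : set T)) M nu).
- move=> V a s t y; rewrite /nu; case: pselect=> // _.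
 by rewrite scaler0 addr0.
- move=> V W h s y Wy; rewrite (nuE _ _ _ Wy) (nuE _ _ _ (h _ Wy)); exact: ps_resE.
- move=> V s t st; apply/funext=> y; have := st _ (set_valP y).
 rewrite !(nuE _ _ _ (set_valP y)) => e.
 by have -> : y = ps_pt (set_valP y) by exact: ps_ptE.
- by move=> V W y h; exact: h.
- by move=> V W y.
move=> V r U bV bU UV m c.
pose ix (y : T) : option 'I_r := if pselect (exists i, (U i : set T) y) is left h then Some (projT1 (cid h)) else None.
have ixV y : (V : set T) y -> exists2 i, ix y = Some i & (U i : set T) y.
 move=> /UV ex; rewrite /ix; case: pselect=> // h; exists (projT1 (cid h)) => //.
 exact: projT2 (cid h).
have ixU y i : ix y = Some i -> (U i : set T) y.
 by rewrite /ix; case: pselect=> // h [<-]; exact: projT2 (cid h).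
exists (fun s (y : (cap U V s : set T)) => if ix (\val y) is Some i then nu _ (c (i :: s)) (\val y) else 0).
exists (fun i y => (ix y == Some i)%:R); split.
- move=> y /ixV[i -> _]; rewrite (bigD1 i) //= eqxx big1 ?addr0 // => j ji.
 by case: eqP=> // -[ij]; rewrite ij eqxx in ji.
- move=> i y; case E: (ix y == Some i); last by rewrite eqxx.
 by move=> _ _; exact (ixU y i (eqP E)).
move=> s y _ Vy; rewrite (nuE _ _ _ Vy) /=.
have /capP[/ixV[i -> _] _] := Vy.
rewrite (bigD1 i) //= eqxx scale1r big1 ?addr0 // => j ji.
by case: eqP=> [[ij]|]; [rewrite ij eqxx in ji|rewrite scale0r].
Qed.

Lemma cech_injective (J : sheaf k T) : sheaf_injective J -> cacyc (sp_full J).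
by move=> /injective_retract[q qe]; apply: (cech_retract qe); exact: cech_PS. Qed.

Section Pass.
Variables (A B C : sheaf k T) (d : sheafHom A B) (e : sheafHom B C).
Hypothesis de : sheaf_exact d e.
Hypothesis BBqc : finely_qc BB.
Hypotheses (cA : cacyc (sp_full A)) (cK : cacyc (sp_ker d)).

Lemma exact_comp V (s : A V) : e V (d V s) = 0.
apply/(de (d V s)).2 => x Vx; exists V, (@subset_refl _ V); split=> //.
by exists s; rewrite res_id.
Qed.

(** Preimages over a finite basic cover differ by a cocycle with values in the kernel of [d].
    Acyclicity of this kernel corrects them, and acyclicity of [A] glues the corrected ones. *)
Lemma cech_lift V (t : B V) : BB V -> e V t = 0 -> exists s, d V s = t.
move=> bV /(de t).1 loc.
have locN x : exists N : opens T, (V : set T) x -> exists h : N `<=` V, (N : set T) x /\ exists z, d N z = res B h t.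
 have [Vx|nVx] := pselect ((V : set T) x); last by exists V.
 by have [N [h [Nx z]]] := loc x Vx; exists N => _; exists h.
pose N x := projT1 (cid (locN x)).
have NP x : (V : set T) x -> exists h : N x `<=` V, (N x : set T) x /\ exists z, d (N x) z = res B h t.
 exact: projT2 (cid (locN x)).
have [|r [U [xs [bU UN xV UV]]]] := (BBqc bV (N := N)); first by move=> x /NP[h []].
have zi (i : 'I_r) : {z : A (cap U V [:: i]) | d _ z = res B (@cap_le _ U V [:: i]) t}.
 apply: cid; have [h [_ [z dz]]] := NP _ (xV i).
 have hN : cap U V [:: i] `<=` N (xs i) by move=> x /= [_ Ux]; exact: UN.
 exists (res A hN z); rewrite hom_res dz (res_res h hN (@cap_le _ U V [:: i])) //.
(* [t] is placed on the empty sequence, so that its differential is the family of restrictions of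
   [t] to the cover. *)
pose t0 : coch U B V := fun s => if s is [::] as s0 return B (cap U V s0) then t else 0.
pose c : coch U A V := fun s => match s return A (cap U V s) with
 | [:: i] => projT1 (zi i) | _ => 0 end.
have t0E s : dl s t0 = if s is [:: i] as s0 return B (cap U V s0) then res B (@cap_le _ U V [:: i]) t else 0.
 case: s=> [|i [|j s]] //=; first by rewrite subr0; exact: res_irr.
 by rewrite !linear0 dl0 !subr0.
have dc s : d _ (c s) = dl s t0.
 by rewrite t0E; case: s=> [|i [|j s]] /=; rewrite ?linear0 //; exact: projT2 (zi i).
have Kdc s : d _ (dl s c) = 0.
 rewrite dl_hom; have -> : (fun t => d _ (c t)) = (fun t => dl t t0) :> coch U B V.
  exact: functional_extensionality_dep.
 exact: dldl.
have cm s : size s != 1%N -> c s = 0 by case: s=> [|i [|j s]].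
have [||s|y [Ky ym yc]] := cK bV bU UV (m := 1) (c := fun s => dl s c).
- exact: Kdc.
- by move=> s sm; apply: (dl_conc cm).
- exact: dldl.
have [||s|a [_ am ac]] := cA bV bU UV (m := 0) (c := fun s => c s - y s).
- by [].
- by move=> s sm; rewrite cm // ym // subr0.
- by rewrite dlB yc subrr.
exists (a [::]); apply/eqP; rewrite -subr_eq0; apply/eqP/sheaf_sep=> x Vx.
have [i Ui] := UV x Vx; exists (cap U V [:: i]), (@cap_le _ U V [:: i]); split=> //.
rewrite linearB; apply/eqP; rewrite subr_eq0; apply/eqP.
have e1 : d (cap U V [:: i]) (c [:: i] - y [:: i]) = res B (@cap_le _ U V [:: i]) t.
 by rewrite linearB Ky subr0 dc t0E.
by rewrite -e1 -ac /= subr0 hom_res; exact: res_irr.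
Qed.

(** Lift the cocycle termwise through [d]. The differential of the lift is a cocycle of the next
    degree in the kernel of [d]; after its removal the lift is a cocycle of [A]. *)
Lemma cech_pass : cacyc (sp_ker e).
move=> V r U bV bU UV m c Kc cm c0.
have bC s := BB_cap s bV bU.
have lift s : {l : A (cap U V s) | d _ l = c s /\ (size s != m.+1 -> l = 0)}.
 apply: cid; have [sm|sm] := eqVneq (size s) m.+1.
  by have [l lE] := cech_lift (bC s) (Kc s); exists l.
 by exists 0; rewrite linear0 cm.
pose l s := projT1 (lift s); have lE s : d _ (l s) = c s by have [] := projT2 (lift s).
have lm s : size s != m.+1 -> l s = 0 by have [] := projT2 (lift s).
have [||s|y [Ky ym yc]] := cK bV bU UV (m := m.+1) (c := fun s => dl s (l : coch U A V)).
- move=> s; rewrite /= dl_hom.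
 have -> : (fun t => d _ (l t)) = (c : coch U B V) by exact: functional_extensionality_dep.
 exact: c0.
- by move=> s sm; apply: (dl_conc lm).
- exact: dldl.
have [||s|w [_ wm wc]] := cA bV bU UV (m := m) (c := fun s => l s - y s).
- by [].
- by move=> s sm; rewrite lm // ym // subr0.
- by rewrite dlB yc subrr.
exists (fun s => d _ (w s)); split=> s; first exact: exact_comp.
 by move=> sm; rewrite wm // linear0.
by rewrite -dl_hom wc linearB Ky subr0 lE.
Qed.
End Pass.
End Cech.
Section DirectSum.
Context k (T : topologicalType).
Implicit Types (U V W : opens T) (A B C : sheaf k T).
Section Dsum.
Variables A B : sheaf k T.
Definition ds_sec U : lmodType k := (A U * B U)%type.
Definition ds_res U V (h : V `<=` U) : {linear ds_sec U -> ds_sec V}.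
refine (@mkLin k (ds_sec U) (ds_sec V) (fun s => (res A h s.1, res B h s.2)) _).
by move=> c s t; congr (_, _); rewrite linearP.
Defined.

Lemma ds_glue U (C : set (opens T)) : U = \bigcup_(V in C) V :> set T ->
 forall s : (forall V, ds_sec V),
 (forall V1 V2 W (h1 : W `<=` V1) (h2 : W `<=` V2), C V1 -> C V2 ->
  ds_res h1 (s V1) = ds_res h2 (s V2)) ->
 exists! x : ds_sec U, forall V (hVU : V `<=` U), C V -> ds_res hVU x = s V.
move=> UC s compat.
have [V1 V2 W h1 h2 C1 C2|x [xE xu]] := @sheaf_glue _ _ A U C UC (fun V => (s V).1).
 by have [] := compat _ _ _ h1 h2 C1 C2.
have [V1 V2 W h1 h2 C1 C2|y [yE yu]] := @sheaf_glue _ _ B U C UC (fun V => (s V).2).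
 by have [] := compat _ _ _ h1 h2 C1 C2.
exists (x, y); split=> [V h CV|[x' y'] xyE].
 by rewrite /= xE // yE // -surjective_pairing.
congr (_, _); [apply: xu|apply: yu] => V h CV; by rewrite -(xyE _ h CV).
Qed.

Definition dsum : sheaf k T.
refine (@Sheaf k T ds_sec ds_res _ _ ds_glue).
- by move=> U h [a b]; rewrite /= !res_id.
- by move=> U V W h1 h2 h3 [a b]; rewrite /= !(res_res h1 h2 h3).
Defined.

Definition ds_fst : sheafHom dsum A.
by unshelve refine (@SheafHom k T dsum A (fun U => @mkLin k _ _ (fun s : dsum U => s.1) _) _).
Defined.
Definition ds_snd : sheafHom dsum B.
by unshelve refine (@SheafHom k T dsum B (fun U => @mkLin k _ _ (fun s : dsum U => s.2) _) _).
Defined.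

Lemma cech_dsum (BB : set (opens T)) : cacyc BB (sp_full A) ->
 cacyc BB (sp_full B) -> cacyc BB (sp_full dsum).
move=> cA cB V r U bV bU UV m c _ cm c0.
have [||s|a [_ am ac]] := cA V r U bV bU UV m (fun s => (c s).1).
- by [].
- by move=> s sm; rewrite cm.
- by rewrite -[LHS](dl_hom ds_fst s c) c0.
have [||s|b [_ bm bc]] := cB V r U bV bU UV m (fun s => (c s).2).
- by [].
- by move=> s sm; rewrite cm.
- by rewrite -[LHS](dl_hom ds_snd s c) c0.
exists (fun s => (a s, b s)); split=> // s; first by move=> sm; rewrite am // bm.
rewrite [LHS]surjective_pairing [RHS]surjective_pairing; congr (_, _).
 by rewrite -ac; exact: (dl_hom ds_fst).
by rewrite -bc; exact: (dl_hom ds_snd).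
Qed.
End Dsum.

Definition hom_pair A B C (f : sheafHom A B) (g : sheafHom A C) : sheafHom A (dsum B C).
unshelve refine (@SheafHom k T A (dsum B C)
 (fun U => @mkLin k _ _ (fun s : A U => (f U s, g U s) : dsum B C U) _) _).
- by move=> c s t; congr (_, _); rewrite linearP.
- by move=> U V h s; congr (_, _); rewrite /= hom_res.
Defined.

Definition hom_sub A B (f g : sheafHom A B) : sheafHom A B.
unshelve refine (@SheafHom k T A B (fun U => @mkLin k _ _ (fun s : A U => f U s - g U s) _) _).
- by move=> c s t; rewrite (linearP (f U)) (linearP (g U)) scalerBr opprD addrACA.
- by move=> U V h s; rewrite /= !hom_res linearB.
Defined.
End DirectSum.

(** * Acyclic resolutions compute cohomology *)

Section Comparison.
Context k (T : topologicalType).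
Implicit Types (U V W : opens T) (A B C : sheaf k T).
Variable BB : set (opens T).
Hypothesis BBI : forall V W, BB V -> BB W -> BB (capI V W).
Hypothesis BBqc : finely_qc BB.
Hypothesis BBT : BB (opens_full T).

Lemma exact_sections (C : nat -> sheaf k T) (d : forall j, sheafHom (C j) (C j.+1)) :
 (forall j, cacyc BB (sp_full (C j))) -> sheaf_mono (d 0%N) ->
 (forall j, sheaf_exact (d j) (d j.+1)) ->
 forall j V y, BB V -> d j.+1 V y = 0 -> exists z, d j V z = y.
move=> cC d0 de; have cK j : cacyc BB (sp_ker (d j)).
 elim: j=> [|j IH]; last exact: (cech_pass BBI (de j) BBqc (cC j) IH).
 move=> V r U bV bU UV m c Kc cm c0.
 have cE s : c s = 0 by apply: (d0 _); rewrite linear0; exact: Kc.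
 exists (fun=> 0); split=> // s; first by rewrite /= linear0.
 by rewrite dl0 cE.
by move=> j V y bV; exact: (cech_lift (de j) BBqc (cC j) (cK j) bV).
Qed.

Lemma dep_choice (S : nat -> Type) (R : forall j, S j -> S j.+1 -> Prop) (s0 : S 0%N) :
 (forall j x, exists y, R j x y) ->
 exists f : forall j, S j, f 0%N = s0 /\ forall j, R j (f j) (f j.+1).
move=> H; pose nx j x := projT1 (cid (H j x)).
exists (nat_rect S s0 nx); split=> // j; exact: projT2 (cid (H j _)).
Qed.

Variables (F : sheaf k T) (G : nat -> sheaf k T) (aug : sheafHom F (G 0%N)).
Variable dG : forall j, sheafHom (G j) (G j.+1).
Hypotheses (augM : sheaf_mono aug) (augE : sheaf_exact aug (dG 0%N)).
Hypothesis dGE : forall j, sheaf_exact (dG j) (dG j.+1).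
Hypothesis cG : forall j, cacyc BB (sp_full (G j)).

Definition sec_cyc j : set (G j (opens_full T)) := [set x | dG j (opens_full T) x = 0].
Definition sec_bnd j : set (G j (opens_full T)) :=
 match j with 0%N => [set 0] | i.+1 => [set x | exists z, x = dG i (opens_full T) z] end.

Lemma sec_bnd_sublin j : sublin (@sec_bnd j).
case: j=> [|j]; split=> //=.
- by move=> c _ _ -> ->; rewrite scaler0 addr0.
- by exists 0; rewrite linear0.
- by move=> c _ _ [s ->] [t ->]; exists (c *: s + t); rewrite linearP.
Qed.

Lemma sec_cyc_sublin j : sublin (@sec_cyc j).
split=> [|c u v]; rewrite /sec_cyc /= ?linear0 //.
by rewrite linearP => -> ->; rewrite scaler0 addr0.
Qed.

Lemma exact_comp0 A B C (f : sheafHom A B) (g : sheafHom B C) U s :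
 sheaf_exact f g -> g U (f U s) = 0 :> C U.
by move=> fg; exact: (@exact_comp k T A B C f g fg). Qed.

Section Resolution.
Variable J : injective_resolution F.
Notation dJ := (idiff J).

Lemma coboundaries_sublin j : sublin (@coboundaries k T F J j).
case: j=> [|j]; split=> //=.
- by move=> c _ _ -> ->; rewrite scaler0 addr0.
- by exists 0 => //; rewrite linear0.
- by move=> c _ _ [s _ <-] [t _ <-]; exists (c *: s + t) => //; rewrite linearP.
Qed.

Lemma comparison_map : exists phi : forall j, sheafHom (G j) (J j),
 (forall U s, phi 0%N U (aug U s) = iaug J U s) /\
 forall j U s, phi j.+1 U (dG j U s) = dJ j U (phi j U s).
have [f0 f0E] : exists f : sheafHom (G 0%N) (J 0%N), forall U s, f U (aug U s) = iaug J U s.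
 apply: injective_rel; first exact: ires_injective.
 move=> U s au; have -> : s = 0 by apply: (augM (U := U)); rewrite au linear0.
 by rewrite linear0.
pose S j := {f : sheafHom (G j) (J j) | forall U s, dG j U s = 0 -> dJ j U (f U s) = 0}.
have S0 : forall U s, dG 0%N U s = 0 -> dJ 0%N U (f0 U s) = 0.
 move=> U s /(augE s).1 loc; apply/(@iaug_exact _ _ _ J _ (f0 U s)).2 => x /loc[V [h [Vx [z zE]]]].
 by exists V, h; split=> //; exists z; rewrite -f0E zE hom_res.
have step j (f : S j) : exists g : S j.+1, forall U s, projT1 g U (dG j U s) = dJ j U (projT1 f U s).
 have [g gE] := @injective_rel k T _ _ _ (dG j) (hom_comp (dJ j) (projT1 f)) (@ires_injective _ _ _ J j.+1) (projT2 f).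
 unshelve eexists (exist _ g _); last exact: gE.
 move=> U s /(dGE s).1 loc; apply/(@idiff_exact _ _ _ J j _ (g U s)).2 => x /loc[V [h [Vx [z zE]]]].
 by exists V, h; split=> //; exists (projT1 f V z); rewrite -hom_res -zE; symmetry; exact: gE.
have [f [f0' fE]] := @dep_choice S (fun j a b => forall U s, projT1 b U (dG j U s) = dJ j U (projT1 a U s)) (exist _ f0 S0) step.
exists (fun j => projT1 (f j)); split; last exact: fE.
by rewrite f0'.
Qed.

Variable phi : forall j, sheafHom (G j) (J j).
Hypothesis phi0 : forall U s, phi 0%N U (aug U s) = iaug J U s.
Hypothesis phiS : forall j U s, phi j.+1 U (dG j U s) = dJ j U (phi j U s).

(** The mapping cone of [phi], starting at [G 0]. As both complexes resolve [F], it is an exact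
    complex of Cech-acyclic sheaves whose first map is mono, and [exact_sections] applies to it. *)
Definition cone j : sheaf k T := if j is i.+1 then dsum (G i.+1) (J i) else G 0%N.
Definition dcone j : sheafHom (cone j) (cone j.+1) :=
 match j with
 | 0%N => hom_pair (dG 0%N) (phi 0%N)
 | i.+1 => hom_pair (hom_comp (dG i.+1) (ds_fst _ _))
   (hom_sub (hom_comp (phi i.+1) (ds_fst _ _)) (hom_comp (dJ i) (ds_snd _ _)))
 end.

Lemma dconeE i U (s : cone i.+1 U) :
 dcone i.+1 U s = (dG i.+1 U s.1, phi i.+1 U s.1 - dJ i U s.2).
by []. Qed.
Lemma cone_mono : sheaf_mono (dcone 0%N).
move=> U s t [dst pst]; apply/eqP; rewrite -subr_eq0; apply/eqP/sheaf_sep=> x Ux.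
have /(augE (s - t)).1/(_ x Ux)[V [h [Vx [z zE]]]] : dG 0%N U (s - t) = 0.
 by rewrite linearB dst subrr.
exists V, h; split=> //; rewrite -zE.
suff -> : z = 0 by rewrite linear0.
apply: (iaug_mono (i := J)); rewrite linear0 -phi0 zE hom_res linearB pst subrr linear0 //.
Qed.

Lemma dcone_dcone j U s : dcone j.+1 U (dcone j U s) = 0.
rewrite dconeE; case: j s => [|j] s; congr (_, _).
- exact: (exact_comp0 _ (@dGE _)).
- by rewrite /= phiS subrr.
- exact: (exact_comp0 _ (@dGE _)).
- rewrite /= phiS linearB opprB addrCA subrr addr0.
 exact: (exact_comp0 _ (@idiff_exact _ _ _ J j)).
Qed.

Lemma cone_exact j : sheaf_exact (dcone j) (dcone j.+1).
move=> U y; split=> [|loc]; last first.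
 apply: sheaf_sep=> x /loc[V [h [Vx [z zE]]]]; exists V, h; split=> //.
 by rewrite -hom_res -zE dcone_dcone.
rewrite dconeE => -[/(dGE y.1).1 locg pd] x Ux.
have [V [h [Vx [z zE]]]] := locg x Ux.
have ph : dJ j V (phi j V z - res (J j) h y.2) = 0.
 move/eqP: pd; rewrite subr_eq0 => /eqP pd.
 by rewrite linearB -phiS zE !hom_res pd subrr.
case: j y locg pd z zE ph => [|j] y locg pd z zE ph.
 have [W [h' [Wx [u uE]]]] := (@iaug_exact _ _ _ J _ _).1 ph x Vx.
 have hW : W `<=` U by exact: subset_trans h' h.
 exists W, hW; split=> //; exists (res (G 0%N) h' z - aug W u).
 congr (_, _).
  rewrite linearB hom_res zE (res_res h h' hW) (exact_comp0 _ augE) subr0 //.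
 rewrite /= linearB phi0 uE linearB -hom_res opprB addrCA subrr addr0.
 by rewrite (res_res h h' hW).
have [W [h' [Wx [u uE]]]] := (@idiff_exact _ _ _ J j _ _).1 ph x Vx.
have hW : W `<=` U by exact: subset_trans h' h.
exists W, hW; split=> //; exists (res (G j.+1) h' z, u); rewrite dconeE.
congr (_, _); first by rewrite /= hom_res zE (res_res h h' hW).
rewrite /= uE linearB -hom_res opprB addrCA subrr addr0.
by rewrite (res_res h h' hW).
Qed.

Lemma cone_acyclic j : cacyc BB (sp_full (cone j)).
by case: j=> [|j] /=; [exact: cG|apply: cech_dsum; [exact: cG|exact/cech_injective/ires_injective]].
Qed.

(** Exactness of the cone on global sections is bijectivity of [phi] on cohomology. *)
Lemma comparison_dim j D : quotient_dim (@sec_cyc j) (@sec_bnd j) D ->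
 quotient_dim (@cocycles k T F J j) (@coboundaries k T F J j) D.
have ex i y := @exact_sections cone dcone cone_acyclic cone_mono cone_exact i _ y BBT.
pose X := opens_full T.
apply: (@qdim_iso k (G j X) (J j X) _ _ _ _ (fun u v => v = phi j X u) idfun).
- exact: sec_bnd_sublin.
- exact: coboundaries_sublin.
- exact: sec_cyc_sublin.
- split=> [|c u v]; rewrite /cocycles /= ?linear0 //.
 by rewrite linearP => -> ->; rewrite scaler0 addr0.
- by exists idfun.
- by rewrite linear0.
- by move=> c u v _ _ -> ->; rewrite linearP.
- move=> u du; exists (phi j X u); split=> //.
 by rewrite /cocycles /= -phiS du linear0.
- move=> x dx.
 have [|z zE] := ex j (0, x); first by rewrite dconeE /= !linear0 dx subrr.
 case: j x dx z zE => [|j] x dx z [dz pz].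
  exists z, x; split=> //; rewrite /coboundaries /= subrr //.
 exists z.1, (phi j.+1 X z.1); split=> //; first by rewrite /cocycles /= -phiS dz linear0.
 have {}pz : phi j.+1 X z.1 - dJ j X z.2 = x := pz.
 by exists (- z.2) => //; rewrite linearN -pz addrAC subrr add0r.
move=> u _ du _ ->; case: j u du => [|j] u du; split.
- by move=> ->; rewrite linear0.
- move=> pu; apply: (@cone_mono X); rewrite linear0.
 by congr (_, _); [exact: du|exact: pu].
- by move=> [z ->]; rewrite phiS; exists (phi j X z).
move=> [y _ yE]; have [|z zE] := ex j (u, y); first by rewrite dconeE /= du yE subrr.
by case: j u y du yE z zE => [|j] u y du yE z [zu _]; [exists z | exists z.1].
Qed.
End Resolution.

(** The second half covers every injective resolution, not just a chosen one; it is what later pins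
    down the value of [h_st]. *)
Lemma comparison_ex j D : quotient_dim (@sec_cyc j) (@sec_bnd j) D ->
 cohomology_dim F j D /\ forall d, cohomology_dim F j d -> d = D.
move=> qD; have H J : quotient_dim (@cocycles k T F J j) (@coboundaries k T F J j) D.
 by have [phi [p0 pS]] := comparison_map J; exact: (comparison_dim p0 pS).
split; first by have [J] := injective_resolution_ex F; exists J.
by move=> d [J qd]; apply: qdim_uniq (coboundaries_sublin J j) qd (H J).
Qed.
End Comparison.

(** * Group cohomology and its long exact sequence *)

Record rhom k (S : agr k) (N N' : rmod S) : Type := RHom {
 rh :> {linear N -> N'} ;
 rh_eq : forall g v, rh (ra g v) = ra g (rh v) }.

Section CosyzMap.
Context k (S : agr k) (N N' : rmod S) (f : rhom N N').

Lemma pm_subproof1 (h : csz N) : fsp agO (fun x => f (h x)).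
by apply: fsp_lin; [exact: linearP|exact: fmP]. Qed.
Lemma pm_subproof2 h : mkfm (pm_subproof1 h) \in @csz_pred _ _ N'.
by apply/eqP=> /=; rewrite pc1 linear0. Qed.

Definition pm_fun (h : csz N) : csz N' := CosyzCar (pm_subproof2 h).

Lemma pm_lin : linear pm_fun.
move=> c u v; apply: pc_ext=> x; rewrite pcED pcEZ.
by rewrite -[LHS]/(f (c *: u x + v x)) linearP.
Qed.

Lemma pm_eq g v : mkLin pm_lin (ra g v) = ra g (mkLin pm_lin v).
apply: pc_ext=> x.
rewrite -[LHS]/(f (pc_act g v x)) -[RHS]/(pc_act g (pm_fun v) x) !pc_actE.
by rewrite linearB rh_eq.
Qed.

Definition csz_map : rhom (csz N) (csz N') := RHom pm_eq.

Lemma csz_mapE h x : csz_map h x = f (h x). Proof. by []. Qed.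
Lemma csz_map_bd v : csz_map (bd v) = bd (f v).
by apply: pc_ext=> x; rewrite csz_mapE !bdE linearB rh_eq. Qed.
End CosyzMap.

Definition Pr k (S : agr k) (N : rmod S) (j : nat) : rmod S :=
 iter j (@csz k S) N.

Fixpoint Prm k (S : agr k) (N N' : rmod S) (f : rhom N N')
  (j : nat) : rhom (Pr N j) (Pr N' j) :=
 if j is i.+1 then csz_map (Prm f i) else f.

Definition bnd k (S : agr k) (N : rmod S) (j : nat) :
  set (Pr N j) :=
 match j return set (Pr N j) with
 | 0%N => [set 0]
 | i.+1 => [set v | exists w : Pr N i, v = bd w]
 end.

Definition cyc k (S : agr k) (N : rmod S) (j : nat) :
  set (Pr N j) := [set v | invt v].

Definition hdim k (S : agr k) (N : rmod S) (j d : nat) : Prop :=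
 quotient_dim (@cyc k S N j) (@bnd k S N j) d.

Definition hvan k (S : agr k) (N : rmod S) (j : nat) : Prop :=
 forall v : Pr N j, invt v -> @bnd k S N j v.

Lemma invt_sublin k (S : agr k) (N : rmod S) :
 sublin [set v : N | invt v].
split=> [g|c u v iu iv g]; first by rewrite ra0.
by rewrite raD raZ iu iv.
Qed.

Lemma bnd_sublin k (S : agr k) (N : rmod S) j :
 sublin (@bnd k S N j).
case: j=> [|j]; first by split=> // c u v -> ->; rewrite scaler0 addr0.
split; first by exists 0; apply/esym/(linear0 (mkLin (@bd_lin _ _ (Pr N j)))).
by move=> c _ _ [u ->] [v ->]; exists (c *: u + v); rewrite bd_lin.
Qed.
#[local] Hint Resolve bnd_sublin invt_sublin : core.

Lemma bnd_inv k (S : agr k) (N : rmod S) j (v : Pr N j) :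
 @bnd k S N j v -> invt v.
by case: j v => [v -> g|j v [w ->]]; [exact: ra0|exact: invt_bd].
Qed.

Lemma hdim_uniq k (S : agr k) (N : rmod S) j d d' :
 hdim N j d -> hdim N j d' -> d = d'.
by apply: qdim_uniq; exact: bnd_sublin. Qed.
Lemma hvanP k (S : agr k) (N : rmod S) j :
 hvan N j <-> hdim N j 0.
by rewrite /hdim qdim0P //; exact: bnd_sublin. Qed.

Record ses k (S : agr k) (A B C : rmod S) (f : rhom A B)
  (g : rhom B C) : Prop := Ses {
 ses_inj : injective f ;
 ses_surj : forall w, exists v, g v = w ;
 ses_zero : forall u, g (f u) = 0 ;
 ses_ker : forall v, g v = 0 -> exists u, f u = v }.

(** Surjectivity: lift the terms one by one, then project onto the functions vanishing at 1.
    Exactness in the middle: by [fsp_pts] a function is a combination of its own values, and these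
    lie in the image of [f]. *)
Lemma ses_csz k (S : agr k) (A B C : rmod S) (f : rhom A B)
  (g : rhom B C) : ses f g -> ses (csz_map f) (csz_map g).
move=> [fi gs gf gk]; split.
- by move=> u v /(congr1 (fun h : csz B => (h : S -> B))) E; apply: pc_ext=> x;
   apply: fi; exact: (congr1 (fun h => h x) E).
- move=> h.
 have [h' h'E] : exists h' : fmod agO B, forall x, g (h' x) = h x.
  elim/fmod_ind': (pc_fun h) => [|a w Pa F [F' F'E]].
   by exists 0 => x; rewrite !fmE0 linear0.
  have [v vw] := gs w.
  exists (mkfm (fsp1 v Pa) + F') => x.
  by rewrite !fmED linearD F'E /= linearZ_LR /= vw.
 exists (norm h' : csz B); apply: pc_ext=> x.
 by rewrite csz_mapE normE linearB rh_eq !h'E pc1 ra0 subr0.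
- by move=> u; apply: pc_ext=> x; rewrite csz_mapE csz_mapE gf.
- move=> h gh.
 have gh0 x : g (h x) = 0.
  by have := congr1 (fun u : csz C => u x) gh; rewrite csz_mapE.
 have [s [Ps sE]] := fsp_pts (agO_sub S) (fmP h).
 have [h' h'E] : exists h' : fmod agO A, forall x, f (h' x) = h x.
  suff [h' h'E] : exists h' : fmod agO A,
    forall x, f (h' x) = \sum_(u <- s) u.1 x *: h u.2.
   by exists h' => x; rewrite h'E -sE.
  elim: s Ps {sE} => [_|u s IH /= [Pu Ps]].
   by exists 0 => x; rewrite big_nil linear0.
  have [F FE] := IH Ps; have [a au] := gk _ (gh0 u.2).
  exists (mkfm (fsp1 a Pu) + F) => x.
  by rewrite big_cons fmED linearD FE /= linearZ_LR au.
 have h'1 : h' ag1 == 0.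
  by apply/eqP/fi; rewrite h'E pc1 linear0.
 exists (CosyzCar (h'1 : h' \in @csz_pred _ _ A) : csz A).
 by apply: pc_ext=> x; rewrite csz_mapE -h'E.
Qed.

Lemma ses_Pr k (S : agr k) (A B C : rmod S) (f : rhom A B)
  (g : rhom B C) j : ses f g -> ses (Prm f j) (Prm g j).
by move=> fg; elim: j=> //= j IH; exact: ses_csz. Qed.

Section LES.
Context k (S : agr k) (A B C : rmod S).
Variables (f : rhom A B) (g : rhom B C).
Hypothesis fg : ses f g.

Notation fj j := (Prm f j).
Notation gj j := (Prm g j).

Lemma rh_inv (M M' : rmod S) (h : rhom M M') v : invt v -> invt (h v).
by move=> iv x; rewrite -rh_eq iv. Qed.
Lemma Prm_bnd (M M' : rmod S) (h : rhom M M') j v :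
 @bnd k S M j v -> @bnd k S M' j (Prm h j v).
case: j v => [v ->|j v [w ->]]; first by rewrite linear0.
by exists (Prm h j w); rewrite [Prm h j.+1]/= csz_map_bd.
Qed.

(* the connecting homomorphism H^j(C) -> H^(j+1)(A), as a relation *)
Definition conn j (v : Pr C j) (p : Pr A j.+1) : Prop :=
 exists u : Pr B j, gj j u = v /\ fj j.+1 p = bd u.

Lemma conn0 j : @conn j 0 0.
exists 0; rewrite !linear0; split=> //.
exact/esym/(linear0 (mkLin (@bd_lin _ _ (Pr B j)))).
Qed.

Lemma conn_lin j c u v p q :
 @conn j u p -> @conn j v q -> @conn j (c *: u + v) (c *: p + q).
move=> [x [gx fp]] [y [gy fq]]; exists (c *: x + y).
by rewrite !linearP gx gy fp fq bd_lin.
Qed.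

Lemma conn_tot j (v : Pr C j) : invt v -> exists p, invt p /\ @conn j v p.
move=> iv; have [u uv] := ses_surj (ses_Pr j fg) v.
have [p pE] : exists p, fj j.+1 p = bd u.
 apply: (ses_ker (ses_Pr j.+1 fg)).
 by rewrite [Prm g j.+1]/= csz_map_bd uv; apply/bd0P.
exists p; split; last by exists u.
move=> x; apply: (ses_inj (ses_Pr j.+1 fg)).
by rewrite rh_eq pE; exact: invt_bd.
Qed.

Lemma conn_bnd j (v : Pr C j) p : @conn j v p -> bnd v -> @bnd k S A j.+1 p.
move=> [u [gu fp]] bv.
suff [a ua] : exists a, bd u = bd (fj j a).
 exists a; apply: (ses_inj (ses_Pr j.+1 fg)).
 by rewrite fp ua [Prm f j.+1]/= csz_map_bd.
case: j v p bv u gu {fp} => [|j] v p bv u gu.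
 have [|a <-] := ses_ker (ses_Pr 0 fg) (v := u); first by rewrite gu; exact: bv.
 by exists a.
have [w wE] := bv; have [w' w'E] := ses_surj (ses_Pr j fg) w.
have [|a aE] := ses_ker (ses_Pr j.+1 fg) (v := u - bd w').
 by rewrite linearB gu wE [Prm g j.+1]/= csz_map_bd w'E subrr.
exists a; rewrite aE.
have /bd0P bw : invt (bd w' : Pr B j.+1) by exact: invt_bd.
rewrite -[bd (u - _)]/(mkLin (@bd_lin _ _ (Pr B j.+1)) (u - bd w')) linearB /=.
by rewrite bw subr0.
Qed.

Lemma les_B j (u : Pr B j) : invt u -> bnd (gj j u) ->
 exists a, invt a /\ bnd (u - fj j a).
move=> iu bu.
suff [b bb [a aE]] : exists2 b, bnd b & exists a, fj j a = u - b.
 exists a; split; last by rewrite aE opprB addrC subrK.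
 move=> x; apply: (ses_inj (ses_Pr j fg)).
 by rewrite rh_eq aE raB iu (bnd_inv bb).
case: j u iu bu => [|j] u iu bu.
 exists 0 => //; have [|a aE] := ses_ker (ses_Pr 0 fg) (v := u); first exact: bu.
 by exists a; rewrite aE subr0.
have [w wE] := bu; have [w' w'E] := ses_surj (ses_Pr j fg) w.
exists (bd w'); first by exists w'.
apply: (ses_ker (ses_Pr j.+1 fg)).
by rewrite linearB wE [Prm g j.+1]/= csz_map_bd w'E subrr.
Qed.

Lemma les_C j (v : Pr C j) p : @conn j v p -> @bnd k S A j.+1 p ->
 exists u, invt u /\ gj j u = v.
move=> [u [gu fp]] [a aE]; exists (u - fj j a); split.
 apply/bd0P; rewrite -[bd _]/(mkLin (@bd_lin _ _ (Pr B j)) (u - fj j a)) linearB /=.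
 by rewrite -fp aE [Prm f j.+1]/= csz_map_bd subrr.
by rewrite linearB gu (ses_zero (ses_Pr j fg)) subr0.
Qed.

Lemma les_A j (p : Pr A j.+1) : invt p -> @bnd k S B j.+1 (fj j.+1 p) ->
 exists v, invt v /\ @conn j v p.
move=> ip [u uE]; exists (gj j u); split; last by exists u.
apply/bd0P; rewrite -csz_map_bd -uE -/(Prm g j.+1).
exact: (ses_zero (ses_Pr j.+1 fg)).
Qed.

Lemma hvan_mid j : hvan A j -> hvan C j -> hvan B j.
move=> vA vC u iu; have [a [ia ba]] := les_B iu (vC _ (rh_inv (gj j) iu)).
rewrite -(subrK (fj j a) u); apply: (slD (bnd_sublin B j)) => //.
exact/Prm_bnd/vA.
Qed.

Lemma hvan_quot j : hvan B j -> hvan A j.+1 -> hvan C j.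
move=> vB vA v iv; have [p [ip cp]] := conn_tot iv.
by have [u [iu <-]] := les_C cp (vA p ip); apply/Prm_bnd/vB.
Qed.

Lemma hvan_sub j : hvan C j -> hvan B j.+1 -> hvan A j.+1.
move=> vC vB p ip; have [v [iv cv]] := les_A ip (vB _ (rh_inv (fj j.+1) ip)).
exact: conn_bnd cv (vC v iv).
Qed.

Lemma hvan_sub0 : hvan B 0 -> hvan A 0.
move=> vB a ia; apply: (ses_inj fg).
by rewrite linear0; apply: vB; exact: (rh_inv (fj 0) ia).
Qed.

Lemma hdim_conn j d : hvan B j -> hvan B j.+1 -> hdim C j d -> hdim A j.+1 d.
move=> vB vB'; apply: (@qdim_iso _ _ _ _ _ _ _ (@conn j) idfun) => //.
- exact: conn0.
- by move=> c u v u' v'; exact: conn_lin.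
- exact: conn_tot.
- move=> p ip; have [v [iv cv]] := les_A ip (vB' _ (rh_inv (fj j.+1) ip)).
 by exists v, p; split=> //; rewrite subrr; exact: (sl0 (bnd_sublin A j.+1)).
- move=> v p iv ip c; split; first exact: conn_bnd.
 by move=> bp; have [u [iu <-]] := les_C c bp; apply/Prm_bnd/vB.
Qed.


(* H^j(A) is an extension of H^j(B) by H^(j-1)(C) when H(B) -> H(C) is zero *)
Lemma hdim_zero j d e :
 (forall u : Pr B j, invt u -> bnd (gj j u)) ->
 (forall u : Pr B j.+1, invt u -> bnd (gj j.+1 u)) ->
 hdim C j d -> hdim B j.+1 e -> hdim A j.+1 (d + e).
move=> z z'; apply: (@qdim_add _ _ _ _ _ _ _ _ _ _ (@conn j) (fj j.+1)) => //.
- exact: conn0.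
- by move=> c u v u' v'; exact: conn_lin.
- exact: conn_tot.
- move=> v p iv c; split.
  move=> x; apply: (ses_inj (ses_Pr j.+1 fg)).
  by have [u [_ E]] := c; rewrite rh_eq E; exact: invt_bd.
 split; first exact: conn_bnd.
 by move=> bp; have [u [iu <-]] := les_C c bp; exact: z.
- by move=> u iu; exact: rh_inv.
- by move=> u; exact: Prm_bnd.
- by move=> b ib; have [a [ia ba]] := les_B ib (z' b ib); exists a.
- by move=> v p iv [u [_ ->]]; exists u.
- move=> p ip bp; have [v [iv cv]] := les_A ip bp.
 by exists v, p; split=> //; rewrite subrr; exact: (sl0 (bnd_sublin A j.+1)).
Qed.

Lemma hdim_zero0 e : (forall u : B, invt u -> g u = 0) ->
 hdim B 0 e -> hdim A 0 e.
move=> z; apply: (@qdim_iso _ _ _ _ _ _ _ (fun u a => f a = u) idfun) => //.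
- exact: (bnd_sublin B 0).
- exact: (bnd_sublin A 0).
- exact: linear0.
- by move=> c u v u' v' <- <-; rewrite linearP.
- move=> u iu; have [a au] := ses_ker fg (z u iu); exists a; split=> // x.
 by apply: (ses_inj fg); rewrite rh_eq au; exact: iu.
- move=> a ia; exists (f a), a; split=> //; last by rewrite /= subrr.
 by move=> x; rewrite -rh_eq ia.
- move=> u a iu ia <-; split=> [fa|->]; last exact: linear0.
 by apply: (ses_inj fg); rewrite linear0.
Qed.
End LES.

Lemma fsp_dualP k X (P Q : set (X -> k))
  (W : lmodType k) (f : X -> W) :
 fsp P f -> (forall l : {linear W -> k^o}, Q (fun x => l (f x))) ->
 fsp Q f.
move=> Pf Qf; have [s sE] := fsp_dual Pf.
rewrite (_ : f = fun x => \sum_(lw <- s) lw.1 (f x) *: lw.2); last first.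
 by apply/funext=> x; exact: sE.
by apply: fsp_sum=> lw; apply: fsp1; exact: Qf.
Qed.

Lemma agV_uniq k (S : agr k) (x y : S) :
 agM x y = ag1 -> y = agV x.
by move=> xy; rewrite -[y]ag1M -(agVM x) -agMA xy agM1. Qed.
Lemma agV_M k (S : agr k) (x y : S) :
 agV (agM x y) = agM (agV y) (agV x).
by apply/esym/agV_uniq; rewrite agMA -[agM (agM x y) _]agMA agMV agM1 agMV.
Qed.

(** * Relative injectivity, twists and restriction *)

Section Maps.
Context k (S : agr k).
Implicit Types N M : rmod S.

Definition mkrh N M (f : N -> M) (lf : linear f)
 (ef : forall g v, f (ra g v) = ra g (f v)) : rhom N M := @RHom k S N M (mkLin lf) ef.

Lemma Prm_ret N M (i : rhom N M) (r : rhom M N) j :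
 (forall v, r (i v) = v) -> forall v, Prm r j (Prm i j v) = v.
move=> ri; elim: j=> //= j IH v.
by apply: pc_ext=> x; rewrite !csz_mapE IH.
Qed.

Lemma hvan_ret N M (i : rhom N M) (r : rhom M N) j :
 (forall v, r (i v) = v) -> hvan M j -> hvan N j.
move=> ri vM v iv; rewrite -(Prm_ret ri v).
by apply/Prm_bnd/vM; exact: rh_inv.
Qed.

Lemma orb_lin N : linear (@orb k S N).
by move=> c u v; apply: fm_ext=> x; rewrite fmED fmEZ /= raD raZ. Qed.
Lemma orb_eq N g (v : N) : orb (ra g v) = ra g (orb v).
by apply: fm_ext=> x /=; rewrite ra_M. Qed.

Definition orbh N : rhom N (ind S N) := mkrh (@orb_lin N) (@orb_eq N).

Lemma norm_orb N (v : N) : @norm k S N (orb v) = 0.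
by apply: pc_ext=> x; rewrite normE /= ra_1 subrr. Qed.
Lemma norm_pc N (f : csz N) : norm (f : fmod agO N) = f.
by apply: pc_ext=> x; rewrite normE pc1 ra0 subr0. Qed.
Lemma norm_eq N g (f : ind S N) :
 @norm k S N (ra g f) = ra g (@norm k S N f : csz N).
apply: pc_ext=> x; rewrite -[RHS]/(pc_act g (@norm k S N f) x) pc_actE !normE /=.
by rewrite !ag1M raB ra_M opprB addrA subrK.
Qed.

Definition normh N : rhom (ind S N) (csz N) := @mkrh (ind S N) (csz N) _ (@norm_lin k S N) (@norm_eq N).

Lemma ses_ind N : ses (orbh N) (normh N).
split.
- move=> u v /(congr1 (fun h : ind S N => (h : fmod agO N) ag1)) /=.
 by rewrite !ra_1.
- by move=> f; exists (f : fmod agO N); exact: norm_pc.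
- exact: norm_orb.
- move=> f nf; exists ((f : fmod agO N) ag1); apply: fm_ext=> x.
 have : @norm k S N f x = 0 by rewrite -[@norm k S N f]/(normh N f) nf.
 by rewrite normE => /eqP; rewrite subr_eq0 => /eqP.
Qed.

(** [N] is a direct summand, through the orbit maps, of k[S] tensor N; such modules have no
    cohomology in positive degrees. *)
Definition relinj N : Prop := exists r : rhom (ind S N) N, forall v, r (orb v) = v.

(** For a crossed homomorphism f, seen in k[S] tensor N, the difference g f - f is the orbit map of
    f(g). Applying the retraction r shows that f is the coboundary of r(f). *)
Lemma relinj_hvan1 N : relinj N -> hvan N 1.
move=> [r rE] f /invt_cszP fi; exists (r (f : fmod agO N)).
apply: pc_ext=> g; rewrite bdE -rh_eq -linearB.
rewrite -[LHS]rE; congr (r _); apply: fm_ext=> x.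
by rewrite fmEB /= fi addrC addKr.
Qed.

Lemma relinj_csz N : relinj N -> relinj (csz N).
move=> [r rE].
have Rs (F : ind S (csz N)) : fsp agO (fun y => r (fm_fun F y : fmod agO N)).
 apply: (@fsp_lin _ _ _ (csz N) N (fun f => r (f : fmod agO N))); last exact: fmP.
 by move=> c u v; rewrite -linearP.
(* On the orbit map of f the inner function is y |-> y r(f) - f(y), and [norm] kills the first
   summand; whence the sign. *)
pose R F : csz N := - norm (mkfm (Rs F)).
have lR : linear R.
 move=> c F G; rewrite /R scalerN -opprD -norm_lin; congr (- norm _).
 by apply: fm_ext=> x; rewrite fmED fmEZ /= -linearP.
have eR g F : R (ra g F) = ra g (R F).
 by rewrite /R raN -norm_eq; congr (- norm _); apply: fm_ext.
exists (mkrh lR eR) => f; apply: pc_ext=> x.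
rewrite -[LHS]/(- norm (mkfm (Rs (orb f))) x) normE /=.
have E g : mkfm (@norm_subproof1 k S N (@fm_act k S (greg S) (triv S N) g f)) =
  ra g (f : ind S N) - orb (f g) :> ind S N.
 by apply: fm_ext=> y; rewrite fmEB /= ag1M.
rewrite !E !linearB !rE !rh_eq ra_1 pc1 subr0.
by rewrite addrAC subrr sub0r opprK.
Qed.

Lemma relinj_hvan N j : relinj N -> hvan N j.+1.
move=> rN; have rj : relinj (Pr N j) by elim: j=> //= j; exact: relinj_csz.
exact: relinj_hvan1 rj.
Qed.

Lemma rhcomp_eq N M L (g : rhom M L) (f : rhom N M) x v :
 (g \o f) (ra x v) = ra x ((g \o f) v).
by rewrite /= !rh_eq. Qed.

Definition rhcomp N M L (g : rhom M L) (f : rhom N M) : rhom N L :=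
 @RHom k S N L (g \o f : {linear N -> L}) (rhcomp_eq g f).

(* A space with an equivariant regular map to the group is a trivial torsor;   *)
(* here the functions of interest are those supported on such an open set D.  *)
Lemma relinj_torsor (E : gspace S) (D : E -> bool) (th : E -> S) (W : lmodType k) :
 (forall x g, D (gact x g) = D x) ->
 (forall p x, gP E p -> ~~ D x -> p x = 0) ->
 (forall x g, D x -> th (gact x g) = agM (th x) g) ->
 (forall a p, agO a -> gP E p ->
   gP E (fun x => if D x then a (th x) * p (gact x (agV (th x))) else 0)) ->
 relinj (FM E (triv S W)).
move=> DM D0 thM Pth; set N := FM E (triv S W).
have F0 (F : N) x : ~~ D x -> fm_fun F x = 0.
 move=> Dx; elim/fmod_ind': F => [//|p w Pp F IH].
 by rewrite fmED IH addr0 /= (D0 p x) // scale0r.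
have Rs (F : ind S N) : fsp (gP E)
  (fun x => if D x then (F : fmod _ _) (th x) (gact x (agV (th x))) else 0 : W).
 elim/fmod_ind': F => [|a w Oa F IH].
  by apply: fsp_eq0=> x; case: ifP.
 rewrite (_ : (fun x => _) = fun x =>
  (if D x then a (th x) *: w (gact x (agV (th x))) else 0) +
  (if D x then F (th x) (gact x (agV (th x))) else 0)); last first.
  by apply/funext=> x; case: ifP=> _; rewrite ?addr0.
 apply: fsp_add=> //.
 elim/fmod_ind': w => [|p v Pp G IHG].
  by apply: fsp_eq0=> x; rewrite fmE0 scaler0 if_same.
 rewrite (_ : (fun x => _) = fun x =>
   (if D x then a (th x) * p (gact x (agV (th x))) else 0) *: v +
   (if D x then a (th x) *: G (gact x (agV (th x))) else 0)); last first.
  by apply/funext=> x; case: ifP=> _;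
    rewrite ?scale0r ?addr0 // fmED /= scalerDr scalerA.
 by apply: fsp_add=> //; apply: fsp1; exact: Pth.
pose R F : N := mkfm (Rs F).
have lR : linear R.
 by move=> c F G; apply: fm_ext=> x; rewrite fmED fmEZ /=; case: ifP;
   rewrite ?scaler0 ?addr0.
have eR g F : R (ra g F) = ra g (R F).
 apply: fm_ext=> x /=; rewrite DM; case: ifP=> // Dx.
 by rewrite thM // agV_M -gactM agMA agMV ag1M.
exists (mkrh lR eR) => F; apply: fm_ext=> x /=.
case: ifP=> [_|/negbT/F0 -> //]; by rewrite -gactM agVM gact1.
Qed.

Lemma relinj_ind (W : lmodType k) : relinj (ind S W).
apply: (@relinj_torsor (greg S) xpredT id) => //= a p Oa Op.
apply: agO_mul=> //.
rewrite (_ : (fun x => _) = fun=> p ag1); last first.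
 by apply/funext=> x; rewrite agMV.
rewrite (_ : (fun=> _) = fun x => p ag1 * (fun=> 1) x + (fun=> 0) x); last first.
 by apply/funext=> x; rewrite mulr1 addr0.
by case: (agO_sub S) => O0; apply => //; exact: agO_1.
Qed.
End Maps.

Record gchar k (S : agr k) : Type := GChar {
 gc :> S -> k ;
 gcO : agO gc ;
 gc1 : gc ag1 = 1 ;
 gcM : forall x y, gc (agM x y) = gc x * gc y }.

Section Twist.
Context k (S : agr k).
Implicit Types (N M : rmod S) (c d : gchar S).

Lemma gcVl c x : c (agV x) * c x = 1.
by rewrite -gcM agVM gc1. Qed.
Lemma gcVr c x : c x * c (agV x) = 1.
by rewrite -gcM agMV gc1. Qed.

Definition gc_mul c d : gchar S.
refine (@GChar k S (fun x => c x * d x) _ _ _).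
- by apply: agO_mul; exact: gcO.
- by rewrite !gc1 mulr1.
- by move=> x y; rewrite !gcM mulrACA.
Defined.

Definition gc_one : gchar S.
refine (@GChar k S (fun x => 1) _ _ _) => //; first exact: agO_1.
by move=> x y; rewrite mulr1.
Defined.

Definition gc_inv c : gchar S.
refine (@GChar k S (fun x => c (agV x)) _ _ _).
- by apply: agO_inv; exact: gcO.
- by rewrite -[LHS]mulr1 -{1}[1](gc1 c) gcVl.
- move=> x y; have cxy : c x * c y \is a GRing.unit.
  rewrite -gcM unitfE; apply/eqP=> c0.
  by have := gcVl c (agM x y); rewrite c0 mulr0 => /eqP; rewrite eq_sym oner_eq0.
 apply: (mulIr cxy); rewrite -{1}gcM gcVl.
 by rewrite mulrACA !gcVl mulr1.
Defined.

Definition tw c N : rmod S.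
refine (@RMod k S N (fun g v => c g *: ra g v) _ _ _ _).
- by move=> g a u v; rewrite raD raZ scalerDr !scalerA mulrC.
- by move=> v; rewrite gc1 ra_1 scale1r.
- by move=> g h v; rewrite gcM ra_M raZ scalerA.
- move=> v; apply: fsp_mul; last exact: ra_rat.
 by move=> b Ob; apply: agO_mul=> //; exact: gcO.
Defined.

Lemma twm_eq c N M (f : rhom N M) (g : S) (v : tw c N) :
 (f : {linear tw c N -> tw c M}) (ra g v) = ra g (f v : tw c M).
by rewrite /= linearZ_LR rh_eq. Qed.

Definition twm c N M (f : rhom N M) : rhom (tw c N) (tw c M) :=
 @RHom k S (tw c N) (tw c M) (f : {linear tw c N -> tw c M}) (@twm_eq c N M f).

Lemma ses_tw c N M L (f : rhom N M) (g : rhom M L) :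
 ses f g -> ses (twm c f) (twm c g).
by case=> *; split. Qed.
Lemma relinj_tw c N : relinj N -> relinj (tw c N).
move=> [r rE].
have Rs (F : ind S (tw c N)) : fsp agO (fun x => c (agV x) *: fm_fun F x : N).
 apply: fsp_mul; last exact: (fmP (F : fmod agO (tw c N))).
 by move=> b Ob; apply: agO_mul=> //; exact: (gcO (gc_inv c)).
pose R F : tw c N := r (mkfm (Rs F)).
have lR : linear R.
 move=> a F G; rewrite /R -linearP; congr (r _); apply: fm_ext=> x.
 by rewrite fmED fmEZ /= scalerDr !scalerA mulrC.
have eR g F : R (ra g F) = ra g (R F).
 rewrite -[RHS]/(c g *: ra g (r (mkfm (Rs F)))) -(rh_eq r) -linearZ_LR.
 congr (r _); apply: fm_ext=> x.
 rewrite fmEZ /= scalerA (gcM (gc_inv c) x g : c (agV _) = _) /=.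
 by rewrite mulrCA gcVr mulr1.
exists (mkrh lR eR) => v; rewrite /= /R -[RHS]rE; congr (r _).
by apply: fm_ext=> x /=; rewrite scalerA gcVl scale1r.
Qed.
End Twist.

Record ghom k (H G : agr k) : Type := GHom {
 gh :> H -> G ;
 gh1 : gh ag1 = ag1 ;
 ghM : forall x y, gh (agM x y) = agM (gh x) (gh y) ;
 ghO : forall f, agO f -> agO (fun x => f (gh x)) }.

Section Res.
Context k (H G : agr k) (h : ghom H G).
Implicit Types N M : rmod G.

Lemma fsp_pull (X Y : Type) (P : set (X -> k)) (Q : set (Y -> k)) (t : Y -> X)
  (W : lmodType k) (f : X -> W) :
 (forall a, P a -> Q (fun y => a (t y))) -> fsp P f -> fsp Q (fun y => f (t y)).
by move=> PQ; elim=> [|a w g Pa _ IH]; [exact: fsp0|apply: fspD; auto]. Qed.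

Definition rres N : rmod H.
refine (@RMod k H N (fun x v => ra (h x) v) _ _ _ _).
- by move=> g; exact: ra_lin.
- by move=> v; rewrite gh1 ra_1.
- by move=> x y v; rewrite ghM ra_M.
- by move=> v; apply: (fsp_pull _ (ra_rat v)); exact: ghO.
Defined.

Lemma resm_eq N M (f : rhom N M) (x : H) (v : rres N) :
 (f : {linear rres N -> rres M}) (ra x v) = ra x (f v : rres M).
by rewrite /= rh_eq. Qed.

Definition resm N M (f : rhom N M) : rhom (rres N) (rres M) :=
 @RHom k H (rres N) (rres M) (f : {linear rres N -> rres M}) (@resm_eq N M f).

Lemma ses_res N M L (f : rhom N M) (g : rhom M L) :
 ses f g -> ses (resm f) (resm g).
by case=> *; split. Qed.
(** Every module embeds into an induced one with a rational module as quotient, so vanishing spreads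
    from induced modules to all modules by dimension shifting. *)
Lemma hvan_res_ind (c : gchar H) :
 (forall W j, hvan (tw c (rres (ind G W))) j) ->
 forall j N, hvan (tw c (rres N)) j.
move=> vI; have S N := ses_tw c (ses_res (ses_ind N)).
elim=> [|j IH] N; first exact: (hvan_sub0 (S N)).
exact: (hvan_sub (S N)).
Qed.

Lemma hvan_res_relinj j N : (forall W, hvan (rres (ind G W)) j) ->
 relinj N -> hvan (rres N) j.
by move=> vI [r rE]; apply: (hvan_ret (i := resm (orbh N)) (r := resm r)). Qed.
End Res.

(** * Matrix groups and parabolic subgroups *)

Section PolyFun.
Context k (n : nat).
Implicit Types f g : 'M[k]_n -> k.

Definition mpf : set ('M[k]_n -> k) :=
 [set f | exists P : {mpoly k[n * n]}, forall x, f x = mxeval P x].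

Lemma mpf_mxeval P : mpf (@mxeval k n P).
by exists P. Qed.
Lemma mpfC c : mpf (fun=> c).
by exists c%:MP => x; rewrite mxevalC. Qed.
Lemma mpfD f g : mpf f -> mpf g -> mpf (fun x => f x + g x).
by move=> [P fP] [Q gQ]; exists (P + Q) => x; rewrite mxevalD fP gQ. Qed.
Lemma mpfM f g : mpf f -> mpf g -> mpf (fun x => f x * g x).
by move=> [P fP] [Q gQ]; exists (P * Q) => x; rewrite mxevalM fP gQ. Qed.
Lemma mpf_entry i j : mpf (fun x => x i j).
by exists 'X_(mxvec_index i j) => x; rewrite /mxeval mevalXU mxvecE.
Qed.
End PolyFun.
Arguments mpf {k n}.

Record falg k (X : Type) (A : set (X -> k)) : Prop := FAlg {
 fa_sub : fsub A ;
 fa_1 : A (fun=> 1) ;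
 fa_mul : forall f g, A f -> A g -> A (fun x => f x * g x) }.

Section FAlg.
Context k (X : Type) (A : set (X -> k)).
Hypothesis hA : falg A.

Lemma faC c : A (fun=> c).
rewrite (_ : (fun=> c) = fun x => c * (fun=> 1) x + (fun=> 0) x); last first.
 by apply/funext=> x; rewrite mulr1 addr0.
by case: (fa_sub hA) => A0 AD; apply: AD=> //; exact: fa_1.
Qed.

Lemma faD f g : A f -> A g -> A (fun x => f x + g x).
move=> Af Ag; rewrite (_ : (fun x => _) = fun x => 1 * f x + g x); last first.
 by apply/funext=> x; rewrite mul1r.
by case: (fa_sub hA) => A0 AD; exact: AD.
Qed.

Lemma faM f g : A f -> A g -> A (fun x => f x * g x).
exact: fa_mul. Qed.
Lemma faZ c f : A f -> A (fun x => c * f x).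
by apply: faM; exact: faC. Qed.
Lemma faN f : A f -> A (fun x => - f x).
move=> Af; rewrite (_ : (fun x => _) = fun x => -1 * f x); first exact: faZ.
by apply/funext=> x; rewrite mulN1r.
Qed.

Lemma faB f g : A f -> A g -> A (fun x => f x - g x).
by move=> Af Ag; apply: faD=> //; exact: faN. Qed.
Lemma faX f m : A f -> A (fun x => f x ^+ m).
move=> Af; elim: m=> [|m IH]; first exact: fa_1.
rewrite (_ : (fun x => _) = fun x => f x * f x ^+ m); first exact: faM.
by apply/funext=> x; rewrite exprS.
Qed.

Lemma fa_sum (I : Type) (r : seq I) (P : pred I) (f : I -> X -> k) :
 (forall i, P i -> A (f i)) -> A (fun x => \sum_(i <- r | P i) f i x).
move=> Af; elim: r=> [|i r IH].
 rewrite (_ : (fun x => _) = fun=> 0); first by case: (fa_sub hA).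
 by apply/funext=> x; rewrite big_nil.
have [Pi|Pi] := boolP (P i); last first.
 rewrite (_ : (fun x => _) = fun x => \sum_(i <- r | P i) f i x) //.
 by apply/funext=> x; rewrite big_cons (negPf Pi).
rewrite (_ : (fun x => _) = fun x => f i x + \sum_(i <- r | P i) f i x).
 by apply: faD=> //; exact: Af.
by apply/funext=> x; rewrite big_cons Pi.
Qed.

Lemma fa_prod (I : Type) (r : seq I) (P : pred I) (f : I -> X -> k) :
 (forall i, P i -> A (f i)) -> A (fun x => \prod_(i <- r | P i) f i x).
move=> Af; elim: r=> [|i r IH].
 rewrite (_ : (fun x => _) = fun=> 1); first exact: fa_1.
 by apply/funext=> x; rewrite big_nil.
have [Pi|Pi] := boolP (P i); last first.
 rewrite (_ : (fun x => _) = fun x => \prod_(i <- r | P i) f i x) //.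
 by apply/funext=> x; rewrite big_cons (negPf Pi).
rewrite (_ : (fun x => _) = fun x => f i x * \prod_(i <- r | P i) f i x).
 by apply: faM=> //; exact: Af.
by apply/funext=> x; rewrite big_cons Pi.
Qed.

Lemma fa_mulmx n (M N : X -> 'M[k]_n) :
 (forall i j, A (fun x => M x i j)) -> (forall i j, A (fun x => N x i j)) ->
 forall i j, A (fun x => (M x *m N x) i j).
move=> AM AN i j; rewrite (_ : (fun x => _) = fun x => \sum_r M x i r * N x r j).
 by apply: fa_sum=> r _; exact: faM.
by apply/funext=> x; rewrite mxE.
Qed.

Lemma fa_det n (M : X -> 'M[k]_n) :
 (forall i j, A (fun x => M x i j)) -> A (fun x => \det (M x)).
move=> AM; rewrite (_ : (fun x => _) = fun x => \sum_(s : 'S_n)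
  (-1) ^+ s * \prod_i M x i (s i)) //.
by apply: fa_sum=> s _; apply: faZ; apply: fa_prod.
Qed.

Lemma fa_comp n (M : X -> 'M[k]_n) f :
 (forall i j, A (fun x => M x i j)) -> mpf f -> A (fun x => f (M x)).
move=> AM [P fP].
rewrite (_ : (fun x => _) = fun x => \sum_(m <- msupp P) P@_m *
  \prod_i (mxvec (M x) 0 i) ^+ m i); last first.
 by apply/funext=> x; rewrite fP /mxeval mevalE.
apply: fa_sum=> m _; apply: faZ; apply: fa_prod=> i _; apply: faX.
case/mxvec_indexP: i => i j.
rewrite (_ : (fun x => _) = fun x => M x i j) //.
by apply/funext=> x; rewrite mxvecE.
Qed.
End FAlg.

Lemma mpf_alg k n : falg (@mpf k n).
split; last exact: mpfM.
 split; first exact: mpfC.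
 by move=> c f g Pf Pg; apply: mpfD=> //; apply: mpfM=> //; exact: mpfC.
exact: mpfC.
Qed.

Section DspanAlg.
Context k (X Y : Type) (P : set (X -> k)) (Q : set (Y -> k)).
Hypotheses (hP : falg P) (hQ : falg Q).

Lemma dspan_add f g :
 dspan P Q f -> dspan P Q g -> dspan P Q (fun x y => f x y + g x y).
elim=> [|a b h Pa Qb _ IH] dg.
 rewrite (_ : (fun x y => _) = g) //.
 by apply/funeq2P=> x y; rewrite add0r.
rewrite (_ : (fun x y => _) = fun x y => a x * b y + (h x y + g x y)).
 by apply: dspanD=> //; exact: IH.
by apply/funeq2P=> x y; rewrite addrA.
Qed.

Lemma dspan1 a b : P a -> Q b -> dspan P Q (fun x y => a x * b y).
move=> Pa Qb; rewrite (_ : (fun x y => _) = fun x y => a x * b y + 0).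
 by apply: dspanD=> //; exact: dspan0.
by apply/funeq2P=> x y; rewrite addr0.
Qed.

Lemma dspan_fst a : P a -> dspan P Q (fun x _ => a x).
move=> Pa; rewrite (_ : (fun x y => _) = fun x y => a x * (fun=> 1) y).
 by apply: dspan1=> //; exact: fa_1.
by apply/funeq2P=> x y; rewrite mulr1.
Qed.

Lemma dspan_snd b : Q b -> dspan P Q (fun _ y => b y).
move=> Qb; rewrite (_ : (fun x y => _) = fun x y => (fun=> 1) x * b y).
 by apply: dspan1=> //; exact: fa_1.
by apply/funeq2P=> x y; rewrite mul1r.
Qed.

Lemma dspan_mul1 a b f : P a -> Q b -> dspan P Q f ->
 dspan P Q (fun x y => a x * b y * f x y).
move=> Pa Qb; elim=> [|c d h Pc Qd _ IH].
 by apply: dspan_eq0=> x y; rewrite mulr0.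
rewrite (_ : (fun x y => _) =
  fun x y => (a x * c x) * (b y * d y) + a x * b y * h x y).
 by apply: dspanD=> //; exact: faM.
by apply/funeq2P=> x y; rewrite mulrDr mulrACA.
Qed.

Lemma dspan_alg :
 falg (fun f : X * Y -> k => dspan P Q (fun x y => f (x, y))).
split.
- split; first exact: dspan0.
 move=> c f g df dg; apply: dspan_add=> //.
 rewrite (_ : (fun x y => _) =
  fun x y => (fun=> c) x * (fun=> 1) y * f (x, y)); last first.
  by apply/funeq2P=> x y; rewrite mulr1.
 by apply: dspan_mul1=> //; [exact: faC|exact: fa_1].
- by apply: dspan_fst; exact: fa_1.
- move=> f g df dg.
 suff H F : dspan P Q F -> dspan P Q (fun x y => F x y * g (x, y)).
  exact: (H _ df).
 elim=> [|a b h Pa Qb _ IH].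
  by apply: dspan_eq0=> x y; rewrite mul0r.
 rewrite (_ : (fun x y => _) =
   fun x y => a x * b y * g (x, y) + h x y * g (x, y)).
  by apply: dspan_add=> //; exact: dspan_mul1.
 by apply/funeq2P=> x y; rewrite mulrDl.
Qed.
End DspanAlg.

Lemma dspan_sum k X Y (P : set (X -> k)) (Q : set (Y -> k))
  (I : finType) (F : I -> X -> Y -> k) :
 (forall i, dspan P Q (F i)) -> dspan P Q (fun x y => \sum_i F i x y).
move=> FP; rewrite (_ : (fun x y => _) = \sum_i F i); last first.
 by apply/funeq2P=> x y; rewrite !fct_sumE.
by elim/big_ind: _ => [|a b|i _]; [exact: dspan0|exact: dspan_add|exact: FP].
Qed.

(** There are points y_i such that f(x, y) is a combination of the slices f(x, y_i) with
    coefficients in [Q]; so only the slices have to be tested against [P']. *)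
Lemma dspan_sub k X Y (P P' : set (X -> k))
  (Q : set (Y -> k)) f : fsub Q -> dspan P Q f -> (forall y, P' (f^~ y)) ->
 dspan P' Q f.
move=> sQ df P'f.
have fQ : fsp Q (fun y => (f^~ y : X -> k^o)).
 elim: df {P'f} => [|a b h Pa Qb _ IH]; first exact: fsp0.
 rewrite (_ : (fun y => _) = fun y => b y *: (a : X -> k^o) + h^~ y).
  exact: fspD.
 by apply/funeq2P=> y x; rewrite mulrC.
have [s [Qs sE]] := fsp_pts sQ fQ.
rewrite (_ : f = fun x y => \sum_(u <- s) f x u.2 * u.1 y); last first.
 apply/funeq2P=> x y.
 have /(congr1 (fun h : X -> k^o => h x)) -> := sE y.
 elim: (s) => [|u r IH]; first by rewrite !big_nil.
 by rewrite !big_cons -IH [X in _ = X + _]mulrC.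
elim: s Qs {sE} => [_|u s IH /= [Qu Qs]].
 by apply: dspan_eq0=> x y; rewrite big_nil.
rewrite (_ : (fun x y => _) = fun x y => f x u.2 * u.1 y +
  \sum_(u <- s) f x u.2 * u.1 y).
 by apply: dspanD=> //; exact: IH.
by apply/funeq2P=> x y; rewrite big_cons.
Qed.

(** By Cayley-Hamilton the inverse of a matrix is a polynomial in it. *)
Lemma invmx_subalg k n (A : set 'M[k]_n) (x : 'M[k]_n) :
 A 1%:M -> (forall c y z, A y -> A z -> A (c *: y + z)) ->
 (forall y z, A y -> A z -> A (y *m z)) -> A x -> x \in unitmx -> A (invmx x).
case: n A x => [|n] A x A1 AD AM Ax ux.
 by rewrite (_ : invmx x = 1%:M) //; apply/matrixP=> - [].
have A0 : A 0 by have := AD (-1) _ _ A1 A1; rewrite scaleN1r addNr.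
have AZ c y : A y -> A (c *: y).
 by move=> Ay; rewrite -[_ *: _]addr0; exact: AD.
have Ah p : A (horner_mx x p).
 elim/poly_ind: p => [|p c IH]; first by rewrite rmorph0.
 rewrite rmorphD rmorphM /= horner_mx_X horner_mx_C -scalemx1 addrC.
 by apply: AD=> //; exact: AM.
have := Cayley_Hamilton x; rewrite -(poly_take_drop 1 (char_poly x)).
set q := drop_poly _ _.
have -> : take_poly 1 (char_poly x) = ((char_poly x)`_0)%:P.
 by rewrite /take_poly poly_def big_ord1 expr0 alg_polyC.
rewrite rmorphD rmorphM /= horner_mx_C expr1 horner_mx_X => /eqP.
rewrite addrC addr_eq0 => /eqP qx.
have dx : \det x != 0 by move: ux; rewrite unitmxE unitfE.
have p0 : (char_poly x)`_0 != 0.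
 by rewrite char_poly_det mulf_neq0 // signr_eq0.
suff -> : invmx x = - ((char_poly x)`_0)^-1 *: horner_mx x q by exact: AZ.
have : (- ((char_poly x)`_0)^-1 *: horner_mx x q) *m x = 1%:M.
 rewrite -scalemxAl -[_ *m x]/(horner_mx x q * x) qx scaleNr scalerN opprK.
 by rewrite scale_scalar_mx mulVf.
by move/(congr1 (fun y => y *m invmx x)); rewrite mulmxK // mul1mx.
Qed.

Lemma fracMr k (x y z : k) : z != 0 -> x * z / (y * z) = x / y.
by move=> z0; rewrite -mulf_div divff // mulr1. Qed.

Section RegFun.
Context k (n : nat) (T : Type) (v : T -> 'M[k]_n).
Variable F : 'M[k]_n -> k.

(* restrictions to T of rational functions with denominator a power of F *)
Definition regf : set (T -> k) :=
 [set f | exists p L, mpf p /\ forall t, f t = p (v t) / F (v t) ^+ L].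

Hypothesis pF : mpf F.
Hypothesis F0 : forall t, F (v t) != 0.

Lemma regf_alg : falg regf.
have pa := mpf_alg k n.
split.
- split; first by exists (fun=> 0), 0%N; split=> [|t]; [exact: mpfC|rewrite mul0r].
 move=> c f g [p [L [pp fE]]] [q [K [pq gE]]].
 exists (fun x => c * (p x * F x ^+ K) + q x * F x ^+ L), (L + K)%N; split.
  by apply: mpfD; [apply: (faZ pa)|]; apply: mpfM=> //; exact: (faX pa).
 move=> t; rewrite fE gE mulrDl exprD; congr (_ + _).
  by rewrite -[RHS]mulrA fracMr // expf_neq0.
 by rewrite [F _ ^+ L * _]mulrC fracMr // expf_neq0.
- by exists (fun=> 1), 0%N; split=> [|t]; [exact: mpfC|rewrite expr0 divr1].
- move=> f g [p [L [pp fE]]] [q [K [pq gE]]].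
 exists (fun x => p x * q x), (L + K)%N; split; first exact: mpfM.
 by move=> t; rewrite fE gE exprD mulf_div.
Qed.

Lemma regf_poly p : mpf p -> regf (fun t => p (v t)).
by exists p, 0%N; split=> // t; rewrite expr0 divr1. Qed.
Lemma regf_inv : regf (fun t => (F (v t))^-1).
by exists (fun=> 1), 1%N; split=> [|t]; [exact: mpfC|rewrite mul1r]. Qed.
End RegFun.

Record mgrp k (n : nat) : Type := MGrp {
 mgS :> set 'M[k]_n ;
 mg1 : mgS 1%:M ;
 mgM : forall x y, mgS x -> mgS y -> mgS (x *m y) ;
 mgV : forall x, mgS x -> mgS (invmx x) ;
 mgU : forall x, mgS x -> x \in unitmx }.

Section MGroup.
Context k (n : nat) (S : mgrp k n).

Definition mgE (x : 'M[k]_n) (Sx : mgS S x) : S := exist _ x (mem_set Sx).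

Lemma mgP (x : S) : mgS S (\val x). Proof. exact: set_valP. Qed.
Lemma mg_det (x : S) : \det (\val x) != 0.
by have := mgU (mgP x); rewrite unitmxE unitfE. Qed.

Definition mg_mul (x y : S) : S := mgE (mgM (mgP x) (mgP y)).
Definition mg_inv (x : S) : S := mgE (mgV (mgP x)).
Definition mg_one : S := mgE (mg1 S).

Definition mgO : set (S -> k) := regf (fun x : S => \val x) determinant.

Lemma mpf_det : mpf (@determinant k n).
by apply: (fa_det (mpf_alg k n)) => i j; exact: mpf_entry. Qed.
Lemma mgO_alg : falg mgO.
exact: (regf_alg mpf_det mg_det). Qed.
Lemma mgO_entry i j : mgO (fun x => \val x i j).
by apply: (@regf_poly _ _ _ _ _ (fun x => x i j)); exact: mpf_entry. Qed.
Lemma invmxE (x : 'M[k]_n) i j : x \in unitmx ->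
 invmx x i j = (\det x)^-1 * cofactor x j i.
by move=> ux; rewrite /invmx ux !mxE. Qed.
Lemma fa_cofactor (X : Type) (A : set (X -> k)) (M : X -> 'M[k]_n) i j : falg A ->
 (forall i j, A (fun x => M x i j)) -> A (fun x => cofactor (M x) i j).
move=> hA AM; rewrite (_ : (fun x => _) = fun x => (-1) ^+ (i + j) *
  \det (row' i (col' j (M x)))) //.
apply: (faZ hA); apply: (fa_det hA) => a b.
rewrite (_ : (fun x => _) = fun x => M x (lift i a) (lift j b)) //.
by apply/funext=> x; rewrite !mxE.
Qed.

Lemma mgO_inv_entry i j : mgO (fun x => invmx (\val x) i j).
rewrite (_ : (fun x => _) =
  fun x : S => (\det (\val x))^-1 * cofactor (\val x) j i); last first.
 by apply/funext=> x; rewrite invmxE //; exact: mgU (mgP x).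
apply: (faM mgO_alg); first exact: (regf_inv _ _).
by apply: (fa_cofactor _ _ mgO_alg); exact: mgO_entry.
Qed.

Lemma mgO_comp (X : Type) (A : set (X -> k)) (M : X -> S) f : falg A ->
 (forall i j, A (fun x => \val (M x) i j)) ->
 A (fun x => (\det (\val (M x)))^-1) -> mgO f -> A (fun x => f (M x)).
move=> hA AM Ad [p [L [pp fE]]].
rewrite (_ : (fun x => _) =
 fun x => p (\val (M x)) * (\det (\val (M x)))^-1 ^+ L); last first.
 by apply/funext=> x; rewrite fE exprVn.
by apply: (faM hA); [exact: (fa_comp hA)|exact: (faX hA)].
Qed.

(** [e] is the factor by which the denominator changes under translation. The coaction stays regular
    because 1 / e is a regular function on the group. *)
Lemma regf_co (T : Type) (v : T -> 'M[k]_n) (F : 'M[k]_n -> k) (e : S -> k)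
  (tr : T -> S -> T) f :
 mpf F -> (forall t, F (v t) != 0) ->
 (forall t s, v (tr t s) = v t *m \val s) ->
 (forall t s, F (v (tr t s)) = F (v t) * e s) ->
 mgO (fun s => (e s)^-1) ->
 regf v F f -> dspan (regf v F) mgO (fun t s => f (tr t s)).
move=> pF F0 vt Ft eO [p [L [pp fE]]].
have rA := regf_alg pF F0.
rewrite (_ : (fun t s => _) = fun t s => ((F (v t))^-1 ^+ L) * ((e s)^-1 ^+ L) *
  p (v t *m \val s)); last first.
 by apply/funeq2P=> t s; rewrite fE Ft vt exprMn invfM !exprVn mulrC.
apply: (dspan_mul1 rA mgO_alg); [|exact: (faX mgO_alg)|].
 by apply: (faX rA); exact: regf_inv.
pose A (h : T * S -> k) := dspan (regf v F) mgO (fun t s => h (t, s)).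
have dA : falg A := dspan_alg rA mgO_alg.
suff : A (fun ts => p (v ts.1 *m \val ts.2)) by [].
apply: (fa_comp dA) => // i j.
rewrite (_ : (fun x => _) = fun ts : T * S =>
  \sum_l v ts.1 i l * \val ts.2 l j); last first.
 by apply/funext=> ts; rewrite mxE.
apply: (fa_sum dA) => l _.
apply: (@dspan1 _ _ _ _ _ (fun t => v t i l) (fun s : S => \val s l j)).
 by apply: (@regf_poly _ _ _ _ _ (fun x => x i l)); exact: mpf_entry.
exact: mgO_entry.
Qed.

Definition mgr : agr k.
refine (@AGroup k S mg_mul mg_one mg_inv _ _ _ _ _ mgO (fa_sub mgO_alg)
 (fa_1 mgO_alg) (fa_mul mgO_alg) _ _).
- by move=> x y z; apply/val_inj; rewrite /= mulmxA.
- by move=> x; apply/val_inj; rewrite /= mul1mx.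
- by move=> x; apply/val_inj; rewrite /= mulmx1.
- by move=> x; apply/val_inj; rewrite /= mulVmx //; exact: mgU (mgP x).
- by move=> x; apply/val_inj; rewrite /= mulmxV //; exact: mgU (mgP x).
- move=> f fO; apply: (@mgO_comp _ _ mg_inv) => //; first exact: mgO_alg.
  exact: mgO_inv_entry.
 rewrite (_ : (fun x => _) = fun x : S => \det (\val x)); last first.
  by apply/funext=> x; rewrite /= det_inv invrK.
 exact: (regf_poly _ _ mpf_det).
- move=> f fO; apply: (regf_co (e := fun s : S => \det (\val s))) fO => //.
 + exact: mpf_det.
 + exact: mg_det.
 + by move=> x y; rewrite /= det_mulmx.
 + exact: (regf_inv _ _).
Defined.
End MGroup.

Lemma mg_sub_subproof k n (H G : mgrp k n) (HG : H `<=` G)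
  (x : H) : mgS G (\val x).
exact/HG/mgP. Qed.

Definition mg_sub k (n : nat) (H G : mgrp k n) (HG : H `<=` G) :
 ghom (mgr H) (mgr G).
refine (@GHom k (mgr H) (mgr G) (fun x => mgE (mg_sub_subproof HG x)) _ _ _).
- exact/val_inj.
- by move=> x y; exact/val_inj.
- move=> f [p [L [pp fE]]]; exists p, L; split=> // x; exact: fE.
Defined.

Section Parabolic.
Context k (n : nat).

(* the position (i, j) lies in the block of rows and columns l, ..., l+m-1, or *)
(* would if i <= j *)
Definition inblk (l m i j : nat) : bool := (l <= i)%N && (j < l + m)%N.

Definition parab_set (l m : nat) : set 'M[k]_n :=
 [set x | forall i j : 'I_n, (i < j)%N -> ~~ inblk l m i j -> x i j = 0].

Lemma parab_set1 l m : parab_set l m 1%:M.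
by move=> i j ij _; rewrite mxE -val_eqE ltn_eqF. Qed.
Lemma parab_setD l m c x y :
 parab_set l m x -> parab_set l m y -> parab_set l m (c *: x + y).
by move=> px py i j ij nb; rewrite !mxE px // py // mulr0 addr0. Qed.
Lemma parab_setM l m x y :
 parab_set l m x -> parab_set l m y -> parab_set l m (x *m y).
move=> px py i j ij nb; rewrite mxE big1 // => r _.
have [ri|ir] := leqP r i.
 rewrite [y r j]py ?mulr0 //; first exact: leq_ltn_trans ij.
 apply: contra nb => /andP[lr jl]; apply/andP; split=> //.
 exact: leq_trans lr ri.
have [bir|nbir] := boolP (inblk l m i r); last by rewrite px // mul0r.
have [li rl] := andP bir; have jl : (l + m <= j)%N.
 by move: nb; rewrite /inblk li /= -leqNgt.
rewrite [y r j]py ?mulr0 //; first exact: leq_trans rl jl.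
by rewrite /inblk negb_and -leqNgt jl orbT.
Qed.

Definition parab (l m : nat) : mgrp k n.
refine (@MGrp k n [set x | parab_set l m x /\ x \in unitmx] _ _ _ _).
- by split; [exact: parab_set1|exact: unitmx1].
- by move=> x y [px ux] [py uy]; split; [exact: parab_setM|rewrite unitmx_mul ux].
- move=> x [px ux]; split; last by rewrite unitmx_inv.
 by apply: (@invmx_subalg _ _ (parab_set l m)) => //;
   [exact: parab_set1|exact: parab_setD|exact: parab_setM].
- by move=> x [].
Defined.

Lemma parab_le l m l' m' : (l' <= l)%N -> (l + m <= l' + m')%N ->
 parab l m `<=` parab l' m'.
move=> ll lm x [px ux]; split=> // i j ij nb; apply: px=> //.
apply: contra nb => /andP[li jl]; apply/andP; split.
 exact: leq_trans li.
exact: leq_trans jl lm.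
Qed.
End Parabolic.

(** * The Cech complex of a parabolic over projective space *)

Section Signs.
Context k (r : nat) (W : lmodType k).
Implicit Types (S : {set 'I_r}) (c d : 'I_r) (F : {set 'I_r} -> W).

Definition eps c S : k := (-1) ^+ #|[set s in S | (s < c)%N]|.

Lemma eps2 c S : eps c S * eps c S = 1.
by rewrite -expr2 sqrr_sign. Qed.
Lemma epsU c d S : d \notin S -> eps c (d |: S) = (-1) ^+ (d < c)%N * eps c S.
move=> dS; rewrite /eps -exprD; congr (_ ^+ _).
have [dc|dc] := boolP (d < c)%N.
 rewrite (_ : [set s in d |: S | (s < c)%N] = d |: [set s in S | (s < c)%N]).
  by rewrite cardsU1 inE (negPf dS).
 by apply/setP=> s; rewrite !inE; case: eqP=> [->|]; rewrite ?dc.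
rewrite add0n; congr #|pred_of_set _|; apply/setP=> s; rewrite !inE.
by case: eqP=> [->|//]; rewrite (negPf dc) !andbF.
Qed.

Lemma epsD c d S : d \in S -> eps c (S :\ d) = (-1) ^+ (d < c)%N * eps c S.
move=> dS; rewrite -[in RHS](finset.setD1K dS) epsU ?mulrA ?finset.setD11 //.
by rewrite -expr2 sqrr_sign mul1r.
Qed.

Lemma eps_anti c d : c != d -> (-1) ^+ (d < c)%N + (-1) ^+ (c < d)%N = 0 :> k.
by rewrite -val_eqE neq_ltn => /orP[] h; rewrite h ltnNge (ltnW h) /= ?expr0 ?expr1
  ?addNr ?subrr.
Qed.

Definition dlt F S : W := \sum_(c in S) eps c S *: F (S :\ c).
Definition iot (w : 'I_r -> k) F S : W :=
 \sum_(c | c \notin S) (w c * eps c S) *: F (c |: S).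

Lemma dlt_dlt F S : dlt (dlt F) S = 0.
pose G c d := (eps c S * eps d (S :\ c)) *: F (S :\ c :\ d).
have anti c d : c \in S -> d \in S -> c != d -> G c d + G d c = 0.
 move=> cS dS cd; rewrite /G.
 have -> : S :\ d :\ c = S :\ c :\ d by rewrite !finset.setDDl finset.setUC.
 rewrite -scalerDl !epsD // mulrCA [X in _ + X]mulrCA [eps d S * eps c S]mulrC.
 by rewrite -mulrDl addrC eps_anti ?mul0r ?scale0r.
have -> : dlt (dlt F) S =
  \sum_(c in S) \sum_(d in S | c != d) G c d.
 apply: eq_bigr=> c cS; rewrite scaler_sumr.
 apply: eq_big=> [d|d _]; first by rewrite !inE andbC eq_sym.
 by rewrite scalerA.
have -> : \sum_(c in S) \sum_(d in S | c != d) G c d =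
  \sum_(c in S) \sum_(d in S | (c < d)%N) G c d +
  \sum_(c in S) \sum_(d in S | (d < c)%N) G c d.
 rewrite -big_split /=; apply: eq_bigr=> c cS.
 rewrite (bigID (fun d : 'I_r => (c < d)%N)) /=; congr (_ + _).
  by apply: eq_bigl=> d; rewrite -andbA -val_eqE neq_ltn; case: ltnP=> //;
    rewrite ?andbF ?andbT ?orbT.
 apply: eq_bigl=> d; rewrite -andbA -val_eqE neq_ltn; case: ltngtP=> //;
  by rewrite ?andbF ?andbT.
rewrite [X in _ + X](exchange_big_dep (mem S)) /=; last by move=> c d _ /andP[].
rewrite -big_split /= big1 // => c cS.
rewrite [X in _ + X](_ : _ = \sum_(d in S | (c < d)%N) G d c); last first.
 by apply: eq_bigl=> d; rewrite cS.
rewrite -big_split big1 // => d /andP[dS cd]; apply: anti=> //.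
by rewrite -val_eqE ltn_eqF.
Qed.

(* the Koszul contraction by w is a homotopy from the sum of w to zero *)
Lemma dlt_iot w F S :
 iot w (dlt F) S + dlt (iot w F) S = (\sum_c w c) *: F S.
have I1 : iot w (dlt F) S = \sum_(c | c \notin S) w c *: F S +
  \sum_(c | c \notin S) \sum_(d in S)
   (w c * eps c S * ((-1) ^+ (c < d)%N * eps d S)) *: F (c |: S :\ d).
 rewrite -big_split; apply: eq_bigr=> c cS /=.
 rewrite /dlt big_setU1 //= scalerDr; congr (_ + _).
  rewrite scalerA epsU // ltnn expr0 mul1r -mulrA eps2 mulr1.
  by rewrite setU1K.
 rewrite scaler_sumr; apply: eq_bigr=> d dS; rewrite scalerA epsU //.
 congr (_ *: F _); apply/setP=> s; rewrite !inE.
 by case: (s =P c) => [->|//]; rewrite /= andbT; apply/negP=> /eqP cd;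
   rewrite cd dS in cS.
have I2 : dlt (iot w F) S = \sum_(d in S) w d *: F S +
  \sum_(d in S) \sum_(c | c \notin S)
   (eps d S * (w c * ((-1) ^+ (d < c)%N * eps c S))) *: F (c |: S :\ d).
 rewrite -big_split; apply: eq_bigr=> d dS /=; rewrite /iot.
 rewrite (bigD1 d) ?finset.setD11 //= scalerDr; congr (_ + _).
  by rewrite scalerA epsD // ltnn expr0 mul1r mulrCA eps2 mulr1 finset.setD1K.
 rewrite scaler_sumr; apply: eq_big=> [c|c _].
  rewrite !inE negb_and negbK; case: (c =P d) => [->|]; rewrite ?dS //=.
  by rewrite andbT.
 by rewrite scalerA epsD.
rewrite I1 I2 addrACA [X in _ + X](_ : _ = 0); last first.
 rewrite [X in _ + X]exchange_big /= -big_split big1 //= => c cS.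
 rewrite -big_split big1 //= => d dS; rewrite -scalerDl.
 rewrite (_ : _ + _ = w c * eps c S * eps d S *
   ((-1) ^+ (c < d)%N + (-1) ^+ (d < c)%N)).
  rewrite eps_anti ?mulr0 ?scale0r //; apply: contraNneq cS => <-; exact: dS.
 by move: (eps c S) (eps d S) (_ ^+ _) (_ ^+ _) => *; ring.
rewrite addr0 addrC scaler_suml [RHS](bigID (mem S)) /=; congr (_ + _).
Qed.
End Signs.

Lemma dspan_pull k (X Y X' Y' : Type) (P : set (X -> k))
  (Q : set (Y -> k)) (P' : set (X' -> k)) (Q' : set (Y' -> k)) F
  (v : X' -> X) (v' : Y' -> Y) w u :
 (forall a, P a -> P' (fun x => w x * a (v x))) ->
 (forall b, Q b -> Q' (fun y => u y * b (v' y))) ->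
 dspan P Q F -> dspan P' Q' (fun x y => w x * u y * F (v x) (v' y)).
move=> hP hQ; elim=> [|a b h Pa Qb _ IH].
 by apply: dspan_eq0=> x y; rewrite mulr0.
rewrite (_ : (fun x y => _) = fun x y => (w x * a (v x)) * (u y * b (v' y)) +
  w x * u y * h (v x) (v' y)).
 by apply: dspanD=> //; [exact: hP|exact: hQ].
by apply/funeq2P=> x y; rewrite mulrDr mulrACA.
Qed.

Lemma mpf_comul k n (p : 'M[k]_n -> k) :
 mpf p -> dspan mpf mpf (fun x y : 'M[k]_n => p (x *m y)).
move=> pp; have pa := mpf_alg k n.
pose A (h : 'M[k]_n * 'M[k]_n -> k) := dspan mpf mpf (fun x y => h (x, y)).
have dA : falg A := dspan_alg pa pa.
suff : A (fun xy => p (xy.1 *m xy.2)) by [].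
apply: (fa_comp dA) => // i j.
rewrite (_ : (fun x => _) = fun xy : 'M[k]_n * 'M[k]_n =>
  \sum_l xy.1 i l * xy.2 l j); last by apply/funext=> xy; rewrite mxE.
apply: (fa_sum dA) => l _.
by apply: (@dspan1 _ _ _ _ _ (fun x : 'M[k]_n => x i l) (fun x : 'M[k]_n => x l j));
 exact: mpf_entry.
Qed.

Section Charts.
Context k (n l m : nat) (lm : (l + m < n)%N).
Variables (Q : mgrp k n).
Hypothesis QE : forall x, mgS Q x <-> mgS (parab k n l m) x.

Notation P := (parab k n l m.+1).
Notation I := 'I_m.+1.

Definition lcol : 'I_n := Ordinal lm.

Lemma lrow_subproof (c : I) : (l + c < n)%N.
by apply: leq_ltn_trans lm; rewrite leq_add2l -ltnS. Qed.

Definition lrow (c : I) : 'I_n := Ordinal (lrow_subproof c).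

(** The last column of the block gives homogeneous coordinates on P/Q, a projective space of
    dimension m: right multiplication by an element of [Q] rescales them by one diagonal entry. *)
Definition lX (c : I) (p : 'M[k]_n) : k := p (lrow c) lcol.

Lemma QP : mgS Q `<=` mgS P.
by move=> x /QE; apply: parab_le; rewrite ?leqnn // addnS leqnSn. Qed.
Lemma P_col (p : 'M[k]_n) (i : 'I_n) : mgS P p -> (i < l)%N -> p i lcol = 0.
move=> [pp _] il; apply: pp; first exact: leq_trans il (leq_addr _ _).
by rewrite /inblk leqNgt il.
Qed.

Lemma P_row (p : 'M[k]_n) (i j : 'I_n) : mgS P p -> (i <= l + m)%N ->
 (l + m < j)%N -> p i j = 0.
move=> [pp _] il jl; apply: pp; first exact: leq_ltn_trans jl.
by rewrite /inblk addnS ltnS [(j <= _)%N]leqNgt jl andbF.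
Qed.

Lemma Q_col (q : 'M[k]_n) (i : 'I_n) : mgS Q q -> (i < l + m)%N -> q i lcol = 0.
by move=> /QE[pq _] il; apply: pq=> //; rewrite /inblk ltnn andbF. Qed.
Lemma lX_semi c (p q : 'M[k]_n) : mgS P p -> mgS Q q ->
 lX c (p *m q) = lX c p * q lcol lcol.
move=> Pp Qq; rewrite /lX mxE (bigD1 lcol) //= big1 ?addr0 // => j.
rewrite -val_eqE neq_ltn => /orP[jl|lj]; first by rewrite (Q_col Qq) // mulr0.
by rewrite (P_row Pp) ?mul0r //= leq_add2l -ltnS.
Qed.

Lemma sum_block (f : 'I_n -> k) : (forall i : 'I_n, (i < l)%N -> f i = 0) ->
 (forall i : 'I_n, (l + m < i)%N -> f i = 0) -> \sum_i f i = \sum_c f (lrow c).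
move=> fl fm; rewrite (bigID (fun i : 'I_n => (l <= i <= l + m)%N)) /=.
rewrite [X in _ + X]big1 ?addr0 => [|i]; last first.
 by rewrite negb_and -!ltnNge => /orP[/fl|/fm].
rewrite (reindex_onto lrow (fun i : 'I_n => inord (i - l))) /=; last first.
 move=> i /andP[li ilm]; apply/val_inj=> /=; rewrite inordK; first by rewrite subnKC.
 by rewrite ltnS leq_subLR.
apply: eq_bigl=> c; rewrite leq_addr leq_add2l -ltnS ltn_ord /=.
by apply/eqP/val_inj; rewrite /= addKn inord_val.
Qed.

Lemma lX_unimod (p : 'M[k]_n) : mgS P p ->
 \sum_c invmx p lcol (lrow c) * lX c p = 1.
move=> Pp; have := mulVmx (mgU Pp) => /(congr1 (fun x : 'M_n => x lcol lcol)).
rewrite !mxE eqxx mulr1n => <-; apply/esym/sum_block=> i h.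
 by rewrite (P_col Pp) // mulr0.
by rewrite (P_row (mgV Pp)) // mul0r.
Qed.

(** The coordinates generate the unit ideal, hence so do their L-th powers. Exponents are raised one
    coordinate at a time: y + r = 1 implies y^L + r (1 + y + ... + y^(L-1)) = 1. *)
Lemma lX_unimodX (L : nat) : exists v : I -> P -> k,
 (forall c, mgO (v c)) /\ forall g : P, \sum_c v c g * lX c (\val g) ^+ L = 1.
have OA := mgO_alg P.
suff H : forall s : seq I, exists v : I -> P -> k, (forall c, mgO (v c)) /\
  forall g : P, \sum_c v c g * lX c (\val g) ^+ (if c \in s then L else 1%N) = 1.
 have [v [vO vE]] := H (enum I); exists v; split=> // g; rewrite -(vE g).
 by apply: eq_bigr=> c _; rewrite mem_enum.
elim=> [|d s [v [vO vE]]].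
 exists (fun c g => invmx (\val g) lcol (lrow c)); split=> [c|g].
  exact: mgO_inv_entry.
 by rewrite -[RHS](lX_unimod (mgP g)); apply: eq_bigr.
have [ds|ds] := boolP (d \in s).
 exists v; split=> // g; rewrite -(vE g); apply: eq_bigr=> c _.
 by rewrite inE; case: eqP=> // ->; rewrite ds.
pose y (g : P) := v d g * lX d (\val g).
pose w (g : P) := \sum_(i < L) y g ^+ i.
have yO : mgO y by apply: (faM OA) => //; exact: mgO_entry.
exists (fun c g => if c == d then v d g ^+ L else v c g * w g); split=> [c|g].
 case: eqP=> _; first exact: (faX OA).
 by apply: (faM OA) => //; apply: (fa_sum OA) => i _; exact: (faX OA).
rewrite (bigD1 d) //= eqxx inE eqxx /=.
have := vE g; rewrite (bigD1 d) //= (negPf ds) expr1 -/(y g).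
set r := (X in _ + X = 1) => yr.
rewrite (eq_bigr (fun c => v c g * lX c (\val g) ^+ (if c \in s then L else 1%N) * w g)).
 rewrite -mulr_suml -/r -exprMn -/(y g).
 have -> : r = 1 - y g by rewrite -yr addrC addKr.
 rewrite -opprB mulNr -subrX1 opprB addrC subrK //.
by move=> c /negPf cd; rewrite inE cd /= mulrAC.
Qed.

Definition lh (S : {set I}) (p : 'M[k]_n) : k := \prod_(c in S) lX c p.

Lemma mpf_lX c : mpf (lX c). Proof. exact: mpf_entry. Qed.
Lemma mpf_lh S : mpf (lh S).
by apply: (fa_prod (mpf_alg k n)) => c _; exact: mpf_lX. Qed.
Lemma lh_semi S (p q : 'M[k]_n) : mgS P p -> mgS Q q ->
 lh S (p *m q) = lh S p * q lcol lcol ^+ #|S|.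
move=> Pp Qq; rewrite /lh -prodr_const -big_split /=.
by apply: eq_bigr=> c _; exact: lX_semi.
Qed.

Lemma lhD (c : I) (S : {set I}) p : c \in S -> lh S p = lX c p * lh (S :\ c) p.
by move=> cS; rewrite /lh (big_setD1 c). Qed.
Lemma lhU (c : I) (S : {set I}) p : c \notin S -> lh (c |: S) p = lX c p * lh S p.
by move=> cS; rewrite /lh big_setU1. Qed.

Definition chart (S : {set I}) : Type := {g : P | lh S (\val g) != 0}.
Definition chv S (t : chart S) : 'M[k]_n := \val (sval t).
Definition chF S (x : 'M[k]_n) : k := lh S x * \det x.

Lemma mpf_chF S : mpf (chF S).
by apply: mpfM; [exact: mpf_lh|exact: mpf_det]. Qed.
Lemma chF0 S (t : chart S) : chF S (chv t) != 0.
by apply: mulf_neq0; [exact: (svalP t)|exact: mg_det]. Qed.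

Definition chO S : set (chart S -> k) := regf (@chv S) (chF S).

Lemma chO_alg S : falg (@chO S).
exact: (regf_alg (@mpf_chF S) (@chF0 S)). Qed.

(** Functions on a chart extended by zero, so that the cochains on all charts live on one set with
    one action. *)
Definition dreg S : set (P -> k) := [set f |
 (forall g : P, lh S (\val g) = 0 -> f g = 0) /\ chO (fun t : chart S => f (sval t))].

(** The exponent is kept positive so that the formula holds off the chart as well, where the
    denominator is 0 and division by 0 gives 0. *)
Lemma dregP S f L : dreg S f -> exists p M, [/\ mpf p, (L <= M)%N &
 forall g : P, f g = p (\val g) / chF S (\val g) ^+ M.+1].
move=> [f0 [p [M [pp fE]]]].
exists (fun x => p x * chF S x ^+ L.+1), (M + L)%N; split.
- apply: mpfM=> //; apply: (faX (mpf_alg k n)); exact: mpf_chF.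
- exact: leq_addl.
move=> g; have [h0|h0] := eqVneq (lh S (\val g)) 0.
 by rewrite f0 // /chF h0 mul0r exprS mul0r mulr0 mul0r.
have := fE (exist _ g h0); rewrite /= => ->.
rewrite -addnS exprD fracMr // expf_neq0 //; exact: (chF0 (exist _ g h0)).
Qed.

Lemma dregI S f p L : mpf p ->
 (forall g : P, f g = p (\val g) / chF S (\val g) ^+ L.+1) -> dreg S f.
move=> pp fE; split=> [g h0|].
 by rewrite fE /chF h0 mul0r exprS mul0r invr0 mulr0.
by exists p, L.+1; split=> // t; rewrite fE.
Qed.

Lemma dreg_sub S : fsub (dreg S).
have [[O0 OD] _ _] := chO_alg S.
split; first by split.
by move=> c f g [f0 fO] [g0 gO]; split=> [x hx|]; [rewrite f0 // g0 // mulr0 addr0|exact: OD].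
Qed.

Lemma chO_val S f : mgO f -> chO (fun t : chart S => f (sval t)).
move=> [p [L [pp fE]]].
rewrite (_ : (fun t => _) = fun t : chart S =>
  p (chv t) * (lh S (chv t) * (chF S (chv t))^-1) ^+ L).
 apply: (faM (chO_alg S)); first exact: regf_poly.
 apply: (faX (chO_alg S)); apply: (faM (chO_alg S)).
  by apply: regf_poly; exact: mpf_lh.
 exact: regf_inv.
apply/funext=> t; rewrite fE; congr (_ * _).
by rewrite /chF invfM mulrA divff ?mul1r ?exprVn //; exact: (svalP t).
Qed.

(* restriction from the chart of a smaller set, up to a power of h *)
Lemma dreg_chO S S' f h : mpf h -> (forall x, lh S x = h x * lh S' x) ->
 dreg S' f -> chO (fun t : chart S => f (sval t)).
move=> ph hE /(@dregP S' f 0)[p [L [pp _ fE]]].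
rewrite (_ : (fun t => _) = fun t : chart S =>
  p (chv t) * (h (chv t) * (chF S (chv t))^-1) ^+ L.+1).
 apply: (faM (chO_alg S)); first exact: regf_poly.
 apply: (faX (chO_alg S)); apply: (faM (chO_alg S)); first exact: regf_poly.
 exact: regf_inv.
apply/funext=> t; rewrite fE; congr (_ * _); rewrite -exprVn; congr (_ ^+ _).
have := svalP t; rewrite hE mulf_eq0 negb_or => /andP[h0 _].
by rewrite /chF hE -[h _ * _ * _]mulrA [in RHS]invfM [RHS]mulrA divff ?mul1r.
Qed.

Notation T := ({set I} * set_type (mgS P))%type.

(** The Cech cochains indexed by the subsets of size q. For q = 0 they are the functions on [P]
    itself, the augmentation of the complex. *)
Definition gPq (q : nat) : set (T -> k) := [set f : T -> k |
 (forall (S : {set I}) g, #|S| != q -> f (S, g) = 0) /\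
 forall S : {set I}, dreg S (fun g => f (S, g))].

Lemma gPq_sub q : fsub (gPq q).
split; first by split=> // S; case: (dreg_sub S).
move=> c f g [f0 fP] [g0 gP]; split=> [S x Sq|S].
 by rewrite f0 // g0 // mulr0 addr0.
by case: (dreg_sub S) => _; apply.
Qed.

Definition gactT (x : T) (q : Q) : T := (x.1, mg_mul x.2 (mgE (QP (mgP q)))).

Lemma gactT1 x : gactT x (mg_one Q) = x.
by case: x=> S g; congr (_, _); apply/val_inj; rewrite /= mulmx1.
Qed.

Lemma gactTM x q q' : gactT x (mg_mul q q') = gactT (gactT x q) q'.
by congr (_, _); apply/val_inj; rewrite /= mulmxA. Qed.
Lemma Q_diag (q : Q) : (\val q lcol lcol)^-1 = invmx (\val q) lcol lcol.
have Qq := mgP q; have : invmx (\val q) lcol lcol * \val q lcol lcol = 1.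
 have := mulVmx (mgU Qq) => /(congr1 (fun x : 'M_n => x lcol lcol)).
 rewrite !mxE eqxx mulr1n => <-; rewrite (bigD1 lcol) //= [X in _ = _ + X]big1 ?addr0 // => j.
 rewrite -val_eqE neq_ltn => /orP[jl|lj]; first by rewrite (Q_col Qq) // mulr0.
 by rewrite (P_row (QP (mgV Qq))) ?mul0r.
move=> h; have q0 : \val q lcol lcol != 0.
 by apply: contra_eq_neq h => ->; rewrite mulr0 eq_sym oner_eq0.
by rewrite -[RHS]mulr1 -(divff q0) mulrA h mul1r.
Qed.

Lemma Q_diag0 (q : Q) : \val q lcol lcol != 0.
apply/eqP=> q0; have := Q_diag q; rewrite q0 invr0 => i0.
have := mulVmx (mgU (mgP q)) => /(congr1 (fun x : 'M_n => x lcol lcol)).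
rewrite !mxE eqxx (bigD1 lcol) //= -i0 mul0r add0r big1 => [/eqP|j].
 by rewrite eq_sym oner_eq0.
rewrite -val_eqE neq_ltn => /orP[jl|lj]; first by rewrite (Q_col (mgP q)) // mulr0.
by rewrite (P_row (QP (mgV (mgP q)))) ?mul0r.
Qed.

Lemma gPq_co q f : gPq q f ->
 dspan (gPq q) (@mgO _ _ Q) (fun x s => f (gactT x s)).
move=> [f0 fP].
have QO := mgO_alg Q.
rewrite (_ : (fun x s => _) = fun x s =>
  \sum_S (x.1 == S)%:R * f (S, mg_mul x.2 (mgE (QP (mgP s))))); last first.
 apply/funeq2P=> x s; rewrite (bigD1 x.1) //= eqxx mul1r.
 by rewrite big1 ?addr0 // => S /negPf; rewrite eq_sym => ->; rewrite mul0r.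
elim: (index_enum _) => [|S r IH].
 by apply: dspan_eq0=> x s; rewrite big_nil.
rewrite (_ : (fun x s => _) = fun x s =>
  (x.1 == S)%:R * f (S, mg_mul x.2 (mgE (QP (mgP s)))) +
  \sum_(S <- r) (x.1 == S)%:R * f (S, mg_mul x.2 (mgE (QP (mgP s))))); last first.
 by apply/funeq2P=> x s; rewrite big_cons.
apply: dspan_add=> // {IH}.
have [Sq|Sq] := eqVneq #|S| q; last first.
 by apply: dspan_eq0=> x s; rewrite f0 // mulr0.
have [p [L [pp _ fE]]] := dregP 0 (fP S).
pose w (x : T) := (x.1 == S)%:R * (chF S (\val x.2))^-1 ^+ L.+1.
pose u (s : Q) := (\val s lcol lcol)^-1 ^+ (#|S| * L.+1) *
         (\det (\val s))^-1 ^+ L.+1.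
rewrite (_ : (fun x s => _) = fun x s => w x * u s * p (\val x.2 *m \val s)).
 apply: (@dspan_pull _ _ _ _ _ mpf mpf _ _ (fun x y => p (x *m y))
  (fun x : T => \val x.2) (fun s : Q => \val s)); last exact: mpf_comul.
  move=> a pa; split=> [S' g S'q|S'].
   rewrite /w /=; case: eqP=> [E|_]; last by rewrite !mul0r.
   by move: S'q; rewrite E Sq eqxx.
  rewrite /w /=; have [->|_] := eqVneq S' S; last first.
   rewrite (_ : (fun g => _) = fun=> 0); first by case: (dreg_sub S').
   by apply/funext=> g; rewrite !mul0r.
  by apply: (@dregI _ _ a L) => // g; rewrite mul1r exprVn mulrC.
 move=> b pb; apply: (faM QO); last exact: regf_poly.
 apply: (faM QO); last by apply: (faX QO); exact: (regf_inv _ _).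
 apply: (faX QO); rewrite (_ : (fun x => _) = fun s : Q => invmx (\val s) lcol lcol).
  exact: mgO_inv_entry.
 by apply/funext=> s; exact: Q_diag.
apply/funeq2P=> x s; rewrite fE /= /w /u /chF.
rewrite (lh_semi S (mgP x.2) (mgP s)) det_mulmx -!mulrA; congr (_ * _).
rewrite mulrC !mulrA; congr (_ * _).
rewrite exprM -!exprMn -exprVn; congr (_ ^+ _).
by rewrite !invfM exprVn; ring.
Qed.

Definition cspace q : gspace (mgr Q) :=
 @GSpace k (mgr Q) T gactT gactT1 gactTM (gPq q) (gPq_sub q) (@gPq_co q).
End Charts.
Section CechComplex.
Context k (n l m : nat) (lm : (l + m < n)%N).
Variables (Q : mgrp k n).
Hypothesis QE : forall x, mgS Q x <-> mgS (parab k n l m) x.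

Notation P := (parab k n l m.+1).
Notation I := 'I_m.+1.
Notation T := ({set I} * set_type (mgS P))%type.
Notation col := (lcol lm).
Notation X := (lX lm).
Notation h := (lh lm).

Definition dT (W : lmodType k) (F : T -> W) : T -> W := fun x =>
 if h x.1 (\val x.2) != 0 then dlt (fun S => F (S, x.2)) x.1 else 0.

Lemma dT_lin (W : lmodType k) c (F G : T -> W) x :
 dT (fun y => c *: F y + G y) x = c *: dT F x + dT G x.
rewrite /dT; case: ifP=> _; last by rewrite scaler0 addr0.
rewrite /dlt scaler_sumr -big_split; apply: eq_bigr=> d _ /=.
by rewrite scalerDr !scalerA mulrC.
Qed.

Lemma dT_map (V W : lmodType k) (f : {linear V -> W}) (F : T -> V) x :
 f (dT F x) = dT (fun y => f (F y)) x.
rewrite /dT; case: ifP=> _; last by rewrite linear0.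
by rewrite linear_sum; apply: eq_bigr=> d _; rewrite linearZ.
Qed.

Lemma h0D (S : {set I}) c (p : 'M[k]_n) : c \in S -> h S p != 0 -> h (S :\ c) p != 0.
by move=> cS; rewrite (lhD _ _ cS) mulf_eq0 negb_or => /andP[]. Qed.
Lemma dT_dT (W : lmodType k) (F : T -> W) x : dT (dT F) x = 0.
rewrite /dT; case: ifP=> // hx; rewrite -[RHS](dlt_dlt (fun S => F (S, x.2)) x.1).
by apply: eq_bigr=> c cS; rewrite /= h0D.
Qed.

Lemma dT_act (W : lmodType k) (F : T -> W) x q :
 dT (fun y => F (gactT QE y q)) x = dT F (gactT QE x q).
rewrite /dT /= (lh_semi lm QE _ (mgP x.2) (mgP q)) mulf_eq0 expf_eq0.
by rewrite (negPf (Q_diag0 lm QE q)) andbF orbF.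
Qed.

Lemma dT_gP q f : gPq lm q f -> gPq lm q.+1 (dT (f : T -> k^o)).
move=> [f0 fP]; split=> [S g Sq|S].
 rewrite /dT /=; case: ifP=> // _; rewrite /dlt big1 // => c cS.
 rewrite f0 ?scaler0 //; apply: contra Sq => /eqP <-.
 by rewrite (cardsD1 c S) cS.
split=> [g /eqP h0|]; first by rewrite /dT /= h0.
have OA := chO_alg k lm S.
rewrite (_ : (fun t => _) = fun t : chart k lm S => \sum_(c in S)
  eps k c S * f (S :\ c, sval t)); last first.
 by apply/funext=> t; rewrite /dT /= (svalP t).
apply: (fa_sum OA) => c cS; apply: (faZ OA).
by apply: (dreg_chO (@mpf_lX k n l m lm c) _ (fP (S :\ c))) => x; exact: lhD.
Qed.

(** Koszul contraction by a partition of unity. Regularity is preserved because the partition is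
    formed of multiples of powers of the X_c higher than the pole orders. *)
Lemma cech_exact q f : gPq lm q.+1 f -> (forall x, dT (f : T -> k^o) x = 0) ->
 exists2 g, gPq lm q g & dT (g : T -> k^o) = f.
move=> [f0 fP] df.
have [L LP] : exists L : nat, forall S : {set I}, exists p, mpf p /\
  forall g : P, f (S, g) = p (\val g) / chF lm S (\val g) ^+ L.+1.
 have /choice[M MP] S : exists M : nat, exists p, mpf p /\
   forall g : P, f (S, g) = p (\val g) / chF lm S (\val g) ^+ M.+1.
  by have [p [M [pp _ fE]]] := dregP 0 (fP S); exists M, p.
 exists (\max_S M S) => S.
 have [p [pp fE]] := MP S.
 have le : (M S <= \max_S M S)%N by exact: (leq_bigmax S).
 exists (fun x => p x * chF lm S x ^+ (\max_S M S - M S)); split.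
  apply: mpfM=> //; apply: (faX (mpf_alg k n)); exact: mpf_chF.
 move=> g; rewrite fE; have [c0|c0] := eqVneq (chF lm S (\val g)) 0.
  by rewrite c0 ![0 ^+ _.+1]exprS !mul0r invr0 !mulr0.
 by rewrite -{2}(subnKC le) -addSn exprD fracMr // expf_neq0.
have /choice[p pP] := LP.
(* One power more than the pole order L + 1: the product keeps a factor X_c, in agreement with the
   value 0 where X_c vanishes. *)
have [v [vO vE]] := lX_unimodX k lm L.+2.
pose w (g : P) c := v c g * X c (\val g) ^+ L.+2.
pose H (x : T) : k := if h x.1 (\val x.2) != 0
 then iot (w x.2) (fun S => f (S, x.2) : k^o) x.1 else 0.
exists H.
 split=> [S g Sq|S].
  rewrite /H /=; case: ifP=> // _; rewrite /iot big1 // => c cS.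
  by rewrite f0 ?scaler0 // cardsU1 cS add1n eqSS.
 split=> [g /eqP h0|]; first by rewrite /H /= h0.
 have OA := chO_alg k lm S.
 rewrite (_ : (fun t => _) = fun t : chart k lm S => \sum_(c | c \notin S)
   v c (sval t) * eps k c S * X c (chv t) * p (c |: S) (chv t) *
   (chF lm S (chv t))^-1 ^+ L.+1); last first.
  apply/funext=> t; rewrite /H /= (svalP t); apply: eq_bigr=> c cS.
  rewrite -[_ *: _]/(_ * _) (pP _).2 /w -/(chv t) /chF lhU //.
  have [X0|X0] := eqVneq (X c (chv t)) 0.
   by rewrite X0 exprS mul0r !(mulr0, mul0r).
  rewrite -[X c _ * _ * _]mulrA -[(_ ^+ L.+1)^-1]exprVn invfM exprMn (exprS _ L.+1).
  have E : X c (chv t) ^+ L.+1 * (X c (chv t))^-1 ^+ L.+1 = 1.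
   by rewrite -exprMn divff ?expr1n.
  rewrite -[RHS]mulr1 -E; ring.
 apply: (fa_sum OA) => c cS.
 apply: (faM OA); last by apply: (faX OA); exact: regf_inv.
 apply: (faM OA); last by apply: regf_poly; exact: (pP _).1.
 apply: (faM OA); last by apply: regf_poly; exact: mpf_lX.
 apply: (faM OA); last exact: (faC OA).
 exact: (chO_val lm S (vO c)).
apply/funext=> -[S g].
have [h0|h0] := eqVneq (h S (\val g)) 0.
 by rewrite /dT /= h0 eqxx; case: (fP S) => f00 _; rewrite f00.
rewrite {1}/dT /= h0.
have -> : dlt (fun S' => H (S', g) : k^o) S =
  dlt (iot (w g) (fun S' => f (S', g) : k^o)) S.
 by apply: eq_bigr=> c cS; rewrite /H /= (h0D cS h0).
have := dlt_iot (w g) (fun S' => f (S', g) : k^o) S.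
rewrite vE scale1r => <-; rewrite [X in _ = X + _](_ : _ = 0) ?add0r //.
rewrite /iot big1 // => c cS.
have [X0|X0] := eqVneq (X c (\val g)) 0.
 by rewrite /w X0 exprS mul0r mulr0 mul0r scale0r.
have := df (c |: S, g); rewrite /dT /= lhU // mulf_neq0 // => ->.
by rewrite scaler0.
Qed.

Definition gPk q : set (T -> k) := [set f | gPq lm q f /\ forall x, dT (f : T -> k^o) x = 0].

Lemma gPk_sub q : fsub (gPk q).
have [g0 gD] := gPq_sub k lm q.
split.
 split=> // x; rewrite /dT; case: ifP=> // _; rewrite /dlt big1 // => c _.
 by rewrite scaler0.
move=> c f g [fP f0] [gP g0']; split; first exact: gD.
move=> x; have := dT_lin c (f : T -> k^o) (g : T -> k^o) x.
by rewrite f0 g0' scaler0 addr0.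
Qed.

Lemma gPk_co q f : gPk q f ->
 dspan (gPk q) (@mgO _ _ Q) (fun x s => f (gactT QE x s)).
move=> [fP f0].
apply: (dspan_sub (fa_sub (mgO_alg Q)) (gPq_co QE fP)) => s; split.
 exact: (dspan_l s (gPq_sub k lm q) (gPq_co QE fP)).
by move=> x; have := dT_act (f : T -> k^o) x s; rewrite f0.
Qed.

Definition kspace q : gspace (mgr Q) :=
 @GSpace k (mgr Q) T (gactT QE) (gactT1 QE) (gactTM QE) (gPk q)
  (gPk_sub q) (@gPk_co q).

Variable W : lmodType k.
Notation Cq q := (FM (cspace lm QE q) (triv (mgr Q) W)).
Notation Kq q := (FM (kspace q) (triv (mgr Q) W)).

Lemma k2c_subproof q (F : Kq q) : fsp (gPq lm q) (fm_fun F).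
by elim: (fmP F) => [|a w f [Pa _] _ IH]; [exact: fsp0|exact: fspD]. Qed.

Definition k2c_fun q (F : Kq q) : Cq q := mkfm (k2c_subproof F).

Lemma k2c_lin q : linear (@k2c_fun q).
by move=> c F G; apply: fm_ext. Qed.
Lemma k2c_eq q g (F : Kq q) : k2c_fun (ra g F) = ra g (k2c_fun F).
exact: fm_ext. Qed.

Definition k2c q : rhom (Kq q) (Cq q) := mkrh (@k2c_lin q) (@k2c_eq q).

Lemma c2k_subproof q (F : Cq q) : fsp (gPk q.+1) (dT (fm_fun F)).
elim/fmod_ind': F => [|a w Pa F IH].
 rewrite (_ : dT _ = fun=> 0); first exact: fsp0.
 apply/funext=> x; rewrite /dT; case: ifP=> // _; rewrite /dlt big1 // => c _.
 exact: scaler0.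
rewrite (_ : dT _ = fun x => dT (a : T -> k^o) x *: w + dT (fm_fun F) x).
 apply: fspD=> //; split; first exact: dT_gP.
 by move=> x; exact: dT_dT.
apply/funext=> x; rewrite /dT; case: ifP=> _; last by rewrite scale0r addr0.
rewrite /dlt scaler_suml -big_split; apply: eq_bigr=> c _ /=.
by rewrite scalerDr scalerA.
Qed.

Definition c2k_fun q (F : Cq q) : Kq q.+1 := mkfm (c2k_subproof F).

Lemma c2k_lin q : linear (@c2k_fun q).
by move=> c F G; apply: fm_ext=> x; rewrite fmED fmEZ /= -dT_lin. Qed.
Lemma c2k_eq q g (F : Cq q) : c2k_fun (ra g F) = ra g (c2k_fun F).
by apply: fm_ext=> x /=; rewrite dT_act. Qed.

Definition c2k q : rhom (Cq q) (Kq q.+1) := mkrh (@c2k_lin q) (@c2k_eq q).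

Lemma kT0 q (F : Kq q) x : dT (fm_fun F) x = 0.
elim: (fmP F) x => [|a w f [_ da] _ IH] x.
 by rewrite /dT; case: ifP=> // _; rewrite /dlt big1 // => c _; exact: scaler0.
rewrite -[RHS](addr0 (0 : W)) -{2}(IH x) -(scale0r w) -(da x) /dT.
case: ifP=> _; last by rewrite scale0r addr0.
rewrite /dlt scaler_suml -big_split; apply: eq_bigr=> c _ /=.
by rewrite scalerDr scalerA.
Qed.

(** The exact Cech complex is cut into short exact sequences through its cocycles. That a function
    killed by the differential is a cocycle of finite rank is tested on linear coordinates. *)
Lemma ses_cech q : ses (k2c q) (c2k q).
split.
- move=> u v E; apply: fm_ext=> x.
 by have := congr1 (fun F : Cq q => fm_fun F x) E.
- move=> F; elim/fmod_ind': F => [|a w [Pa da] F [G GE]].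
  by exists 0; exact: linear0.
 have [b Pb bE] := cech_exact Pa da.
 exists (mkfm (fsp1 w Pb) + G); rewrite linearD GE; congr (_ + _).
 apply: fm_ext=> x /=; rewrite -bE /dT; case: ifP=> _; last by rewrite scale0r.
 rewrite /dlt scaler_suml; apply: eq_bigr=> c _.
 by rewrite scalerA.
- move=> F; apply: fm_ext=> x; exact: kT0.
- move=> F /(congr1 (fun G : Kq q.+1 => fm_fun G)) dF.
 have KF : fsp (gPk q) (fm_fun F).
  apply: (fsp_dualP (fmP F)) => f; split.
   apply: fsp_scalar; first exact: gPq_sub.
   by apply: fsp_lin; [exact: linearP|exact: fmP].
  move=> x; rewrite -dT_map.
  by rewrite (congr1 (fun G => G x) dF : dT (fm_fun F) x = 0) linear0.
 by exists (mkfm KF); apply: fm_ext.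
Qed.
End CechComplex.

(** * Triviality over the charts *)

Section ChartTorsor.
Context k (n l m : nat) (lm : (l + m < n)%N).
Variables (Q : mgrp k n).
Hypothesis QE : forall x, mgS Q x <-> mgS (parab k n l m) x.

Notation P := (parab k n l m.+1).
Notation I := 'I_m.+1.
Notation T := ({set I} * set_type (mgS P))%type.
Notation col := (lcol lm).
Notation row := (lrow lm).
Notation X := (lX lm).
Notation h := (lh lm).

Lemma row_inj : injective row.
by move=> a b /(congr1 val) /= /addnI /val_inj. Qed.
Lemma row_max : row ord_max = col. Proof. exact/val_inj. Qed.

(** Elimination in the last block column with pivot X_c: 1 - [rN] clears the other entries of the
    block, and its inverse is 1 + [rN] because [rN] has square zero. The transposition in [rA] then
    moves the pivot to the diagonal, so that [rA c p *m p] lies in [Q]. *)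
Definition rN (c : I) (p : 'M[k]_n) : 'M[k]_n :=
 \sum_(r | r != c) (X r p / X c p) *: delta_mx (row r) (row c).

Definition rA c p : 'M[k]_n := tperm_mx (row c) col *m (1%:M - rN c p).
Definition rZ c p : 'M[k]_n := (1%:M + rN c p) *m tperm_mx (row c) col.

Lemma rN2 c p : rN c p *m rN c p = 0.
rewrite /rN mulmx_suml big1 // => r rc; rewrite mulmx_sumr big1 // => s sc.
rewrite -scalemxAl -scalemxAr mul_delta_mx_cond.
by rewrite (inj_eq row_inj) eq_sym (negPf sc) mulr0n !scaler0.
Qed.

Lemma tperm2_mx (i j : 'I_n) : tperm_mx i j *m tperm_mx i j = 1%:M :> 'M[k]_n.
by rewrite /tperm_mx -perm_mxM tperm2 perm_mx1. Qed.
Lemma rAZ c p : rA c p *m rZ c p = 1%:M.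
have e : (1%:M - rN c p) *m (1%:M + rN c p) = 1%:M.
 by rewrite mulmxBl mul1mx mulmxDr mulmx1 rN2 addr0 addrK.
by rewrite /rA /rZ mulmxA -[X in X *m _]mulmxA e mulmx1 tperm2_mx.
Qed.

Lemma rA_unit c p : rA c p \in unitmx.
by have [] := mulmx1_unit (rAZ c p). Qed.
Lemma rZE c p : rZ c p = invmx (rA c p).
by rewrite -[LHS](mulKmx (rA_unit c p)) rAZ mulmx1. Qed.
Lemma rA_parab c p : parab_set l m.+1 (rA c p).
apply: parab_setM.
 move=> i j ij nb; rewrite !mxE; case: eqP=> // /eqP.
 case: tpermP=> [ic|icol|_ _]; rewrite eq_sym -val_eqE.
 - move=> /eqP jE; case/negP: nb; rewrite /inblk ic /= leq_addr /=.
  by rewrite -[nat_of_ord j]/(val j) jE /= addnS ltnS leqnn.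
 - move=> /eqP jE; case/negP: nb; rewrite /inblk icol /= leq_addr /=.
  by rewrite -[nat_of_ord j]/(val j) jE addnS ltnS leq_add2l -ltnS.
 - by rewrite (gtn_eqF ij).
move=> i j ij nb; rewrite mxE [(1%:M : 'M_n) i j]mxE -val_eqE (ltn_eqF ij) add0r mxE summxE big1 ?oppr0 //.
move=> r rc; rewrite !mxE; case: (i =P row r) => [ir|_]; last by rewrite mulr0.
case: (j =P row c) => [jc|_]; last by rewrite mulr0.
by case/negP: nb; rewrite /inblk ir jc /= leq_addr /= ltn_add2l ltn_ord.
Qed.

Lemma rNp c p r : X c p != 0 -> ((1%:M - rN c p) *m p) (row r) col =
 if r == c then X c p else 0.
move=> Xc; rewrite mulmxBl mul1mx mxE -/(X r p) /rN mulmx_suml mxE summxE.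
have E s : (((X s p / X c p) *: delta_mx (row s) (row c)) *m p) (row r) col =
  if s == r then X s p else 0.
 rewrite -scalemxAl mxE mxE (bigD1 (row c)) //= big1 ?addr0; last first.
  by move=> i ic; rewrite mxE (negPf ic) andbF mul0r.
 rewrite mxE eqxx andbT (inj_eq row_inj) eq_sym; case: eqP=> _.
  by rewrite mul1r -/(X c p) mulfVK.
 by rewrite mul0r mulr0.
under eq_bigr do rewrite E.
case: eqP=> [->|/eqP rc].
 rewrite big1 ?subr0 // => s /negPf sc; by rewrite sc.
rewrite (bigD1 r) //= eqxx big1 ?addr0 ?subrr // => s /andP[_ /negPf sr].
by rewrite sr.
Qed.

Lemma rAp c p r : X c p != 0 ->
 (rA c p *m p) (row r) col = if r == ord_max then X c p else 0.
move=> Xc; rewrite /rA -mulmxA /tperm_mx -row_permE mxE.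
case: tpermP=> [/row_inj ->|rc|nc ncol].
- by rewrite -{1}row_max rNp // eq_sym.
- by rewrite rNp // eqxx -(inj_eq row_inj) rc row_max eqxx.
- rewrite rNp // -!(inj_eq row_inj) row_max.
 by case: eqP=> // _; case: eqP.
Qed.

Lemma rA_Q c p : mgS P p -> X c p != 0 -> mgS Q (rA c p *m p).
move=> Pp Xc; apply/QE; split; last by rewrite unitmx_mul rA_unit (mgU Pp).
have [pp _] := Pp.
have pA := parab_setM (rA_parab c p) pp.
move=> i j ij nb; have [jc|jc] := eqVneq j col; last first.
 apply: pA=> //; apply: contra nb => /andP[li]; rewrite addnS ltnS /inblk li /=.
 by rewrite leq_eqVlt => /orP[/eqP jE|//]; case/eqP: jc; exact: val_inj.
have [li|il] := leqP l i; last first.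
 by apply: pA=> //; rewrite /inblk leqNgt il.
rewrite jc in ij *.
have im : (i - l < m.+1)%N by rewrite ltnS leq_subLR ltnW.
have -> : i = row (Ordinal im) by apply/val_inj; rewrite /= subnKC.
rewrite rAp // ifN // -val_eqE /= neq_ltn ltn_subLR //.
by rewrite ij.
Qed.

Lemma rN_semi c p q : mgS P p -> mgS Q q -> rN c (p *m q) = rN c p.
move=> Pp Qq; apply: eq_bigr=> r _; rewrite !(lX_semi lm QE) //.
by rewrite fracMr //; exact: (Q_diag0 lm QE (mgE Qq)).
Qed.

(** [rA] depends only on the coset of p. Hence p |-> [rA c p *m p] is an equivariant map from the
    chart to [Q], and [rZ] is a section of P -> P/Q over the chart. *)
Lemma rA_semi c p q : mgS P p -> mgS Q q -> rA c (p *m q) = rA c p.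
by move=> Pp Qq; rewrite /rA rN_semi. Qed.
Lemma chO_poly (S : {set I}) p : mpf p -> chO (fun t : chart k lm S => p (chv t)).
exact: regf_poly. Qed.

Section OnChart.
Variables (S : {set I}) (c : I).
Hypothesis cS : c \in S.
Let OA := chO_alg k lm S.

Lemma chO_Xinv : chO (fun t : chart k lm S => (X c (chv t))^-1).
rewrite (_ : (fun t => _) = fun t : chart k lm S =>
  (h (S :\ c) (chv t) * \det (chv t)) * (chF lm S (chv t))^-1).
 apply: (faM OA); last exact: regf_inv.
 have pp := mpfM (@mpf_lh k n l m lm (S :\ c)) (@mpf_det k n).
 exact: (chO_poly _ pp).
apply/funext=> t; have := svalP t; rewrite -/(chv t) (lhD lm _ cS) mulf_eq0 negb_or.
move=> /andP[X0 h0]; rewrite /chF (lhD lm _ cS) -[X c _ * _ * _]mulrA.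
rewrite [in RHS]invfM mulrCA divff ?mulr1 // mulf_neq0 //; exact: mg_det.
Qed.

Lemma chO_rN i j : chO (fun t : chart k lm S => rN c (chv t) i j).
rewrite (_ : (fun t => _) = fun t : chart k lm S => \sum_(r | r != c)
  X r (chv t) * (X c (chv t))^-1 * (delta_mx (row r) (row c) : 'M[k]_n) i j).
 apply: (fa_sum OA) => r _; apply: (faM OA); last exact: (faC OA).
 apply: (faM OA); last exact: chO_Xinv.
 exact: (chO_poly _ (@mpf_lX k n l m lm r)).
by apply/funext=> t; rewrite /rN summxE; apply: eq_bigr=> r _; rewrite mxE.
Qed.

Lemma chO_rA i j : chO (fun t : chart k lm S => rA c (chv t) i j).
apply: (fa_mulmx OA) => a b; first exact: (faC OA).
rewrite (_ : (fun y => _) = fun t : chart k lm S => (1%:M : 'M[k]_n) a b - rN c (chv t) a b).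
 by apply: (faB OA); [exact: (faC OA)|exact: chO_rN].
by apply/funext=> t; rewrite !mxE.
Qed.

Lemma chO_rZ i j : chO (fun t : chart k lm S => rZ c (chv t) i j).
apply: (fa_mulmx OA) => a b; last exact: (faC OA).
rewrite (_ : (fun y => _) = fun t : chart k lm S => (1%:M : 'M[k]_n) a b + rN c (chv t) a b).
 by apply: (faD OA); [exact: (faC OA)|exact: chO_rN].
by apply/funext=> t; rewrite !mxE.
Qed.

Lemma chO_chv i j : chO (fun t : chart k lm S => chv t i j).
exact: (chO_poly _ (@mpf_entry k n i j)). Qed.
Lemma chO_detV : chO (fun t : chart k lm S => (\det (chv t))^-1).
rewrite (_ : (fun t => _) = fun t : chart k lm S => h S (chv t) * (chF lm S (chv t))^-1).
 by apply: (faM OA); [exact: (chO_poly _ (@mpf_lh k n l m lm S))|exact: regf_inv].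
apply/funext=> t; rewrite /chF invfM mulrA divff ?mul1r //; exact: (svalP t).
Qed.
End OnChart.

Definition pk (S : {set I}) : I := odflt ord0 [pick c in S].

Lemma pk_in (S : {set I}) : (0 < #|S|)%N -> pk S \in S.
by rewrite /pk => /card_gt0P[x xS]; case: pickP=> //= /(_ x); rewrite xS.
Qed.

(** The equivariant map to [Q], with its pivot at an index of the subset; off the chart the value 1
    is a default. *)
Definition cth (x : T) : Q :=
 match pselect (mgS Q (rA (pk x.1) (\val x.2) *m \val x.2)) with
 | left p => mgE p
 | right _ => mg_one Q
 end.

Lemma cthE (x : T) : (0 < #|x.1|)%N -> h x.1 (\val x.2) != 0 ->
 \val (cth x) = rA (pk x.1) (\val x.2) *m \val x.2.
move=> x0 hx; rewrite /cth; case: pselect=> // nQ; case: nQ.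
apply: rA_Q; first exact: mgP.
by move: hx; rewrite (lhD lm _ (pk_in x0)) mulf_eq0 negb_or => /andP[].
Qed.

Lemma cth_act (x : T) q : (0 < #|x.1|)%N -> h x.1 (\val x.2) != 0 ->
 cth (gactT QE x q) = mg_mul (cth x) q.
move: x=> [S g] /= S0 hx; apply/val_inj; rewrite /= !cthE //=.
 by rewrite rA_semi ?mulmxA //; exact: mgP.
rewrite (lh_semi lm QE _ (mgP g) (mgP q)) mulf_neq0 // expf_neq0 //; exact: Q_diag0.
Qed.

Lemma cth_chartE (S : {set I}) (t : chart k lm S) : (0 < #|S|)%N ->
 \val (cth (S, sval t)) = rA (pk S) (chv t) *m chv t.
by move=> S0; rewrite cthE //; exact: (svalP t). Qed.
Lemma chO_cth (S : {set I}) a : (0 < #|S|)%N -> mgO a ->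
 chO (fun t : chart k lm S => a (cth (S, sval t))).
move=> S0; have cS := pk_in S0; have OA := chO_alg k lm S.
apply: (mgO_comp OA) => [i j|].
 rewrite (_ : (fun t => _) = fun t : chart k lm S => (rA (pk S) (chv t) *m chv t) i j).
  by apply: (fa_mulmx OA) => a' b'; [exact: chO_rA|exact: chO_chv].
 by apply/funext=> t; rewrite cth_chartE.
rewrite (_ : (fun t => _) = fun t : chart k lm S =>
  \det (rZ (pk S) (chv t)) * (\det (chv t))^-1).
 apply: (faM OA); last exact: chO_detV.
 by apply: (fa_det OA) => i j; exact: chO_rZ.
apply/funext=> t; rewrite cth_chartE // det_mulmx invfM; congr (_ * _).
by rewrite rZE det_inv.
Qed.

(** Elimination with a pivot in the subset makes each intersection of charts a trivial [Q]-torsor,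
    which is the situation of [relinj_torsor]. The translate of a cochain back to the section is its
    value at [rZ]. *)
Lemma relinj_chart q (W : lmodType k) :
 (0 < q)%N -> relinj (FM (cspace lm QE q) (triv (mgr Q) W)).
move=> q0.
pose D (x : cspace lm QE q) := (#|x.1| == q) && (h x.1 (\val x.2) != 0).
apply: (@relinj_torsor _ _ (cspace lm QE q) D cth).
- move=> x g; rewrite /D /= (lh_semi lm QE _ (mgP x.2) (mgP g)) mulf_eq0 expf_eq0.
 by rewrite (negPf (Q_diag0 lm QE g)) andbF orbF.
- move=> p [S g] [p0 pP]; rewrite /D negb_and negbK /= => /orP[/p0 //|/eqP h0].
 by case: (pP S) => + _; apply.
- by move=> x s /andP[/eqP Sq hx]; rewrite cth_act // Sq.
- move=> a p Oa [p0 pP]; split=> [S g Sq|S]; first by rewrite /D /= (negPf Sq).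
 split=> [g h0|]; first by rewrite /D /= h0 eqxx andbF.
 have OA := chO_alg k lm S.
 have [Sq|Sq] := eqVneq #|S| q; last first.
  rewrite (_ : (fun t => _) = fun=> 0); first exact: (faC OA).
  by apply/funext=> t; rewrite /D /= (negPf Sq).
 have S0 : (0 < #|S|)%N by rewrite Sq.
 have cS := pk_in S0; set c := pk S in cS.
 have thE (t : chart k lm S) := cth_chartE t S0.
 have ZE (t : chart k lm S) :
   \val (sval t) *m invmx (\val (cth (S, sval t))) = rZ c (chv t).
  have U : rA c (chv t) *m chv t \in unitmx.
   by rewrite unitmx_mul rA_unit; exact: mgU (mgP (sval t)).
  rewrite thE -[RHS](mulmxK U); congr (_ *m _).
  by rewrite mulmxA rZE mulVmx ?mul1mx ?rA_unit.
 rewrite (_ : (fun t => _) = fun t : chart k lm S => a (cth (S, sval t)) *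
   p (S, mg_mul (sval t) (mgE (QP QE (mgP (mg_inv (cth (S, sval t))))))) ); last first.
  by apply/funext=> t; rewrite /D /= Sq eqxx (svalP t).
 apply: (faM OA); first exact: chO_cth.
 have [f [L [pf _ fE]]] := dregP 0 (pP S).
 rewrite (_ : (fun t => _) = fun t : chart k lm S => f (rZ c (chv t)) *
   (X c (chv t) ^+ #|S| * \det (rA c (chv t)) * (h S (chv t))^-1) ^+ L.+1).
  apply: (faM OA); first by apply: (fa_comp OA) => // i j; exact: chO_rZ.
  apply: (faX OA); apply: (faM OA).
   apply: (faM OA); last by apply: (fa_det OA) => i j; exact: chO_rA.
   by apply: (faX OA); exact: (chO_poly _ (@mpf_lX k n l m lm c)).
  rewrite (_ : (fun t => _) = fun t : chart k lm S =>
    \det (chv t) * (chF lm S (chv t))^-1).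
   by apply: (faM OA); [exact: (chO_poly _ (@mpf_det k n))|exact: regf_inv].
  apply/funext=> t; rewrite /chF invfM mulrCA divff ?mulr1 //; exact: mg_det.
 apply/funext=> t; rewrite fE /= ZE; congr (_ * _); rewrite -exprVn; congr (_ ^+ _).
 have Xc : X c (chv t) != 0.
  by have := svalP t; rewrite -/(chv t) (lhD lm _ cS) mulf_eq0 negb_or => /andP[].
 have hE : h S (chv t) = h S (rZ c (chv t)) * X c (chv t) ^+ #|S|.
  have e : rZ c (chv t) *m (rA c (chv t) *m chv t) = chv t.
   by rewrite mulmxA rZE mulVmx ?mul1mx ?rA_unit.
  rewrite -{1}e (lh_semi lm QE).
  - by congr (_ * _ ^+ _); rewrite -{1}row_max rAp // eqxx.
  - rewrite -ZE; apply: mgM; first exact: mgP.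
   exact: (QP QE (mgV (mgP _))).
  - by apply: rA_Q=> //; exact: (mgP (sval t)).
 rewrite /chF hE invfM; have -> : \det (rZ c (chv t)) = (\det (rA c (chv t)))^-1.
  by rewrite rZE det_inv.
 by rewrite invrK [in RHS]invfM [RHS]mulrAC; congr (_ * _); rewrite [RHS]mulrC mulfVK ?expf_neq0.
Qed.
End ChartTorsor.

Lemma hvan_null k (S : agr k) (N : rmod S) j :
 (forall v : N, v = 0) -> hvan N j.
move=> N0; suff E : forall v : Pr N j, v = 0.
 by move=> v _; rewrite (E v); exact: sl0 (bnd_sublin _ _).
elim: j=> [|j IH] v; first exact: N0.
by apply: pc_ext=> x; apply: IH.
Qed.

(* for modules with the same underlying action but distinct proof components *)

Lemma fsp_extend0 k X Y (P : set (X -> k)) (Q : set (Y -> k))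
  (D : Y -> bool) (v : Y -> X) (W : lmodType k) (f : X -> W) :
 (forall a, P a -> Q (fun y => if D y then a (v y) else 0)) -> fsp P f ->
 fsp Q (fun y => if D y then f (v y) else 0).
move=> PQ; elim=> [|a w g Pa _ IH].
 by apply: fsp_eq0=> y; case: ifP.
rewrite (_ : (fun y => _) = fun y => (if D y then a (v y) else 0) *: w +
  (if D y then g (v y) else 0)); first by apply: fspD=> //; exact: PQ.
by apply/funext=> y; case: ifP; rewrite ?scale0r ?addr0.
Qed.

(** * Cohomological dimension of projective space *)

Section CohomologicalDimension.
Context k (n l m : nat) (lm : (l + m < n)%N).
Variables (Q : mgrp k n).
Hypothesis QE : forall x, mgS Q x <-> mgS (parab k n l m) x.
Variables (H : agr k) (h : ghom H (mgr Q)) (c : gchar (mgr Q)).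
Hypothesis acyc : forall (W : lmodType k) j, hvan (rres h (ind (mgr Q) W)) j.+1.
Variable W : lmodType k.

Notation P := (parab k n l m.+1).
Notation Cq q := (FM (cspace lm QE q) (triv (mgr Q) W)).
Notation Kq q := (FM (kspace lm QE q) (triv (mgr Q) W)).

Lemma fsp_null (X : Type) (A : set (X -> k)) (f : X -> W) :
 (forall a, A a -> a = fun=> 0) -> fsp A f -> f = fun=> 0.
move=> A0; elim=> // a w g Aa _ ->.
by rewrite (A0 _ Aa); apply/funext=> x; rewrite scale0r addr0.
Qed.

Lemma kspace0_null (F : Kq 0) : F = 0.
apply: fm_ext; suff : (fun x => F x) = fun=> 0 by move=> /(congr1 (@^~ _)) E x; exact: E.
apply: fsp_null (fmP F) => a [[a0 aP] da]; apply/funext=> -[S g].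
have [S0|/a0 //] := eqVneq #|S| 0%N; move/cards0_eq: S0 => ->{S}.
have [v [_ /(_ g) E]] := lX_unimodX k lm 1.
have [t Xt] : exists t, lX lm t (\val g) != 0.
 apply/existsP; apply: contraT; rewrite negb_exists => /forallP X0.
 move/eqP: E; rewrite big1 ?(eq_sym 0) ?oner_eq0 // => t _.
 by move: (X0 t); rewrite negbK expr1 => /eqP ->; rewrite mulr0.
have := da ([set t]%SET, g); rewrite /dT /= /lh big_set1 Xt /dlt big_set1.
by rewrite finset.setDv => /eqP; rewrite scaler_eq0 /eps expf_eq0 oppr_eq0 oner_eq0 andbF /= => /eqP.
Qed.

Lemma kspace_null (F : Kq m.+2) : F = 0.
apply: fm_ext; suff : (fun x => F x) = fun=> 0 by move=> /(congr1 (@^~ _)) E x; exact: E.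
apply: fsp_null (fmP F) => a [[a0 aP] da]; apply/funext=> -[S g].
by apply: a0; have := max_card (mem S); rewrite card_ord => /leq_ltn_trans; move/(_ _ (leqnn _)); rewrite ltn_neqAle => /andP[].
Qed.

Lemma hvan_cspace q j : (0 < q)%N -> hvan (rres h (tw c (Cq q))) j.+1.
move=> q0; apply: hvan_res_relinj=> [W'|]; first exact: acyc.
by apply: relinj_tw; exact: relinj_chart.
Qed.

(** Dimension shifting from the right end of the Cech complex: the cochains on nonempty subsets are
    acyclic, and there is no subset with m + 2 elements. *)
Lemma hvan_kspace d q j : (0 < q)%N -> (q + d = m.+2)%N -> (d <= j)%N ->
 hvan (rres h (tw c (Kq q))) j.
elim: d q j => [|d IH] q j q0 qd dj.
 by apply: hvan_null; rewrite addn0 in qd; rewrite qd; exact: kspace_null.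
case: j dj => // j dj.
apply: (hvan_sub (ses_res h (ses_tw c (ses_cech lm QE W q)))).
 by apply: IH=> //; rewrite addSnnS.
exact: hvan_cspace.
Qed.

Lemma hvan_cspace0 j : (m < j)%N -> hvan (rres h (tw c (Cq 0))) j.
move=> mj; apply: (hvan_mid (ses_res h (ses_tw c (ses_cech lm QE W 0)))).
 by apply: hvan_null; exact: kspace0_null.
exact: (@hvan_kspace m.+1).
Qed.

Notation A := (rres (mg_sub (QP QE)) (ind (mgr P) W)).

Lemma p2c_subproof (F : A) : fsp (gPq lm 0)
 (fun x : {set 'I_m.+1} * set_type (mgS P) => if x.1 == finset.set0 then (F : fmod _ _) x.2 else 0).
apply: (fsp_extend0 _ (fmP (F : fmod _ _))) => a Oa; split=> [S g|S].
 by rewrite cards_eq0 => /negPf /= ->.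
have [->|S0] /= := eqVneq S finset.set0; last by case: (@dreg_sub k n l m lm S).
split=> [g|]; last exact: chO_val.
by rewrite /lh big_set0 => /eqP; rewrite oner_eq0.
Qed.

Definition p2c_fun (F : A) : Cq 0 := mkfm (p2c_subproof F).

Lemma p2c_lin : linear p2c_fun.
by move=> a F G; apply: fm_ext=> x; rewrite fmED fmEZ /=; case: ifP; rewrite ?scaler0 ?addr0. Qed.
Lemma p2c_eq g (F : A) : p2c_fun (ra g F) = ra g (p2c_fun F).
apply: fm_ext=> x /=; case: ifP=> //= _.
by congr (fm_fun F _); apply/val_inj.
Qed.

Definition p2c : rhom A (Cq 0) := @mkrh _ _ A (Cq 0) _ p2c_lin p2c_eq.

Lemma c2p_subproof (F : Cq 0) : fsp (@mgO _ _ P) (fun g => F (finset.set0, g)).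
apply: (fsp_pull _ (fmP F)) => a [_ /(_ finset.set0) [_ [p [L [pp pE]]]]].
exists p, L; split=> // g.
have h0 : lh lm finset.set0 (\val g) != 0 by rewrite /lh big_set0 oner_eq0.
by rewrite (pE (exist _ g h0)) /chF /chv /= /lh big_set0 mul1r.
Qed.

Definition c2p_fun (F : Cq 0) : A := mkfm (c2p_subproof F).

Lemma c2p_lin : linear c2p_fun.
by move=> a F G; apply: fm_ext=> x; rewrite fmED fmEZ. Qed.
Lemma c2p_eq g (F : Cq 0) : c2p_fun (ra g F) = ra g (c2p_fun F).
by apply: fm_ext=> x /=; congr (F (_, _)); apply/val_inj. Qed.

Definition c2p : rhom (Cq 0) A := @mkrh _ _ (Cq 0) A _ c2p_lin c2p_eq.

(** Projective m-space has m + 1 charts, so the Cech complex bounds its cohomological dimension by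
    m. The twist by [c] plays the part of a line bundle on P/Q. *)
Lemma hvan_parab j : (m < j)%N -> hvan (rres h (tw c A)) j.
move=> mj.
apply: (@hvan_ret _ _ _ _ (resm h (twm c p2c)) (resm h (twm c c2p))); last exact: hvan_cspace0.
by move=> F; apply: fm_ext=> g /=; rewrite eqxx.
Qed.
End CohomologicalDimension.

(** When B and C are acyclic in positive degrees, the cohomology of A consists of the kernel and the
    cokernel of the map on invariants. *)
Lemma hvan_bij k (S : agr k) (A B C : rmod S) (f : rhom A B)
  (g : rhom B C) j : ses f g -> (forall i, hvan B i.+1) -> (forall i, hvan C i.+1) ->
 (forall b : B, invt b -> g b = 0 -> b = 0) ->
 (forall w : C, invt w -> exists2 b : B, invt b & g b = w) -> hvan A j.
move=> fg hB hC gi gs; case: j=> [a ia|[|j]].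
- apply: (ses_inj fg); rewrite linear0; apply: gi; first exact: rh_inv.
 exact: ses_zero fg _.
- move=> p ip; have [v [iv [u [/= gu fu]]]] := les_A fg ip (hB 0%N _ (rh_inv (Prm f 1) ip)).
 have [b ib gb] := gs _ iv; have [a fa] : exists a, f a = u - b.
  by apply: (ses_ker fg); rewrite linearB /= gu gb subrr.
 have {}fu : csz_map f p = bd u by [].
 exists a; apply: (ses_inj (ses_csz fg)); rewrite fu csz_map_bd fa.
 rewrite -[bd (u - b)]/(mkLin (@bd_lin k S B) (u - b)) linearB /=.
 by rewrite ((bd0P b).2 ib) subr0.
- by apply: (hvan_sub fg); [exact: hC|exact: hB].
Qed.

(** * Weights of degree -1 along a projective line *)

Definition inf_field k := forall p : {poly k}, (forall t, t != 0 -> p.[t] = 0) -> p = 0.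

Section PolyLine.
Context k.

Definition pline : set (k -> k) := [set f | exists P : {poly k}, forall t, f t = P.[t]].

Lemma pline_alg : falg pline.
split.
- split; first by exists 0 => t; rewrite horner0.
 by move=> c f g [P Pf] [Q Qg]; exists (c *: P + Q) => t; rewrite !hornerE Pf Qg.
- by exists 1 => t; rewrite hornerC.
- by move=> f g [P Pf] [Q Qg]; exists (P * Q) => t; rewrite hornerM Pf Qg.
Qed.

(** The bundle O(-1) on the projective line has no sections: comparing coefficients, nonnegative
    powers of t cannot match negative ones. *)
Lemma pline_meet (P Q : {poly k}) c :
 inf_field k -> c != 0 ->
 (forall t, t != 0 -> P.[t] = c * t^-1 * Q.[t^-1]) -> P = 0 /\ Q = 0.
move=> kinf c0 PQ.
pose R := \poly_(i < size Q) Q`_(size Q - i.+1).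
have ER : 'X^(size Q) * P - c *: R = 0.
 apply: kinf=> t t0; rewrite !hornerE PQ // horner_poly horner_coef.
 rewrite (reindex_inj rev_ord_inj) /= !mulr_sumr -sumrB big1 // => i _.
 rewrite exprVn.
 have -> : t ^+ size Q = t ^+ i * t * t ^+ (size Q - i.+1) by rewrite -exprSr -exprD subnKC.
 by field; rewrite t0 expf_neq0.
have P0 : P = 0.
 apply/polyP=> i; rewrite coef0; have := congr1 (fun p : {poly k} => p`_(size Q + i)) ER.
 rewrite coefB coefZ coef_poly coefXnM coef0 ltnNge leq_addr /= [(_ + i - _)%N]addKn.
 by rewrite mulr0 subr0.
split=> //; apply: kinf=> t t0; have := PQ _ (invr_neq0 t0); rewrite P0 hornerC invrK => /esym /eqP.
by rewrite mulf_eq0 mulf_eq0 (negPf c0) (negPf t0) => /eqP.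
Qed.
End PolyLine.
Arguments pline {k}.

Section Weights.
Context k (n : nat) (S : mgrp k n).

(** A diagonal entry that is multiplicative on the group; weights supported on such rows define
    characters. *)
Definition isolrow (i : 'I_n) : Prop := forall x y : 'M[k]_n, mgS S x -> mgS S y ->
 (x *m y) i i = x i i * y i i.

Lemma isolV i (x : 'M[k]_n) : isolrow i -> mgS S x -> x i i * invmx x i i = 1.
move=> iS Sx; rewrite -iS //; last exact: mgV.
by rewrite mulmxV ?mxE ?eqxx //; exact: mgU Sx.
Qed.

Lemma isol0 i (x : 'M[k]_n) : isolrow i -> mgS S x -> x i i != 0.
move=> iS Sx; apply/eqP=> x0; have /eqP := isolV iS Sx.
by rewrite x0 mul0r eq_sym oner_eq0.
Qed.

Variable e : 'I_n -> int.
Hypothesis eS : forall i, e i != 0 -> isolrow i.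

Definition wfun (x : mgr S) : k := \prod_i (\val x i i) ^ e i.

Lemma wfunO : agO wfun.
have OA := mgO_alg S; apply: (fa_prod OA) => i _; case E: (e i) => [d|d].
 by apply: (faX OA); exact: mgO_entry.
have iS : isolrow i by apply: eS; rewrite E.
rewrite (_ : (fun x => _) = fun x : S => invmx (\val x) i i ^+ d.+1).
 by apply: (faX OA); exact: mgO_inv_entry.
apply/funext=> x; rewrite /exprz -exprVn; congr (_ ^+ _).
have x0 := isol0 iS (mgP x).
by apply: (mulfI x0); rewrite (isolV iS (mgP x)) divff.
Qed.

Lemma wfun1 : wfun ag1 = 1.
by apply: big1=> i _; rewrite mxE eqxx exp1rz. Qed.
Lemma wfunM x y : wfun (agM x y) = wfun x * wfun y.
rewrite -big_split; apply: eq_bigr=> i _ /=.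
have [->|/eS iS] := eqVneq (e i) 0; first by rewrite !expr0z mulr1.
rewrite (iS _ _ (mgP x) (mgP y)) exprzMl // unitfE; apply: isol0=> //; exact: mgP.
Qed.

Definition wchar : gchar (mgr S) := GChar wfunO wfun1 wfunM.
End Weights.
Section Borel.
Context k (n : nat).

Definition borel : mgrp k n := parab k n 0 0.

Lemma borelE l x : mgS borel x <-> mgS (parab k n l 1) x.
split=> -[xp xU]; split=> // i j ij _; apply: xp=> //.
by rewrite /inblk addn1 ltnS; apply/negP=> /andP[li]; rewrite leqNgt (leq_ltn_trans li ij).
Qed.

Lemma borel_isol i : isolrow borel i.
move=> x y [xp _] [yp _]; rewrite mxE (bigD1 i) //= big1 ?addr0 // => j.
rewrite -val_eqE neq_ltn => /orP[ji|ij]; first by rewrite yp ?mulr0 // /inblk andbF.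
by rewrite xp ?mul0r // /inblk andbF.
Qed.

Definition bw (e : 'I_n -> int) : gchar (mgr borel) :=
 wchar (fun i (_ : e i != 0) => @borel_isol i).
End Borel.
Section P1Vanishing.
Context k (n l : nat) (lm : (l + 1 < n)%N).
Hypothesis kinf : inf_field k.
Variable e : 'I_n -> int.
Notation I := 'I_2.
Notation B := (borel k n).
Notation QE := (@borelE k n l).
Notation P := (parab k n l 2).
Notation col := (lcol lm).
Notation row := (lrow lm).
Notation X := (lX lm).
Notation h := (lh lm).
Notation T := ({set I} * set_type (mgS P))%type.
Notation cth := (@cth k n l 1 lm B).

(** A matrix that serves only through its coordinates, 1 at c and t at the other index. [yy] turns
    it into a point of [P], and t is the affine coordinate on the chart c of P/B. *)
Definition pt (c : I) (t : k) : 'M[k]_n :=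
 delta_mx (row c) col + t *: delta_mx (row (rev_ord c)) col.

Lemma rev2 (c d : I) : (d == rev_ord c) = (d != c).
by case: c d => [[|[|c]] hc] [[|[|d]] hd]. Qed.
Lemma X_pt c t d : X d (pt c t) = if d == c then 1 else t.
rewrite /lX !mxE eqxx !andbT !(inj_eq (@row_inj n l 1 lm)) rev2.
by case: eqP=> _ /=; rewrite ?mulr0 ?addr0 ?mulr1 ?add0r.
Qed.

Lemma rNE c (p : 'M[k]_n) : rN lm c p = (X (rev_ord c) p / X c p) *: delta_mx (row (rev_ord c)) (row c).
rewrite /rN (bigD1 (rev_ord c)) /=; last by rewrite -rev2.
by rewrite big1 ?addr0 // => d /andP[]; rewrite -rev2 => /eqP ->; rewrite eqxx.
Qed.

Lemma rN_pt c t : rN lm c (pt c t) = t *: delta_mx (row (rev_ord c)) (row c).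
by rewrite rNE !X_pt eqxx divr1 -[_ == c]negbK -rev2 eqxx. Qed.
Lemma yy_subproof c t : mgS P (rZ lm c (pt c t)).
by rewrite rZE; apply: mgV; split; [exact: rA_parab|exact: rA_unit]. Qed.

Definition yy c t : P := mgE (yy_subproof c t).

Lemma X_yy c t d : X d (\val (yy c t)) = if d == c then 1 else t.
rewrite /lX /= /rZ rN_pt -xcolE mxE tpermR !mxE !(inj_eq (@row_inj n l 1 lm)) eqxx andbT.
by rewrite rev2; case: eqP=> _ /=; rewrite ?mulr0 ?addr0 ?mulr1 ?add0r.
Qed.

Lemma rZ_yy c (p : P) : rZ lm c (\val p) = \val (yy c (X (rev_ord c) (\val p) / X c (\val p))).
by rewrite /= /rZ rN_pt rNE. Qed.
Lemma pk1 (c : I) : pk [set c]%SET = c.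
by have := @pk_in 1 [set c]%SET; rewrite cards1 => /(_ isT); rewrite inE => /eqP. Qed.
Lemma h1 (c : I) (p : 'M[k]_n) : h [set c]%SET p = X c p.
by rewrite /lh big_set1. Qed.
Lemma yy_cth c (p : P) : X c (\val p) != 0 ->
 p = mg_mul (yy c (X (rev_ord c) (\val p) / X c (\val p)))
    (mgE (QP QE (mgP (cth ([set c]%SET, p))))).
move=> Xc; apply/val_inj; rewrite /= -[rZ lm c _]/(\val (yy c _)) -rZ_yy (cthE QE) ?cards1 //=; last by rewrite h1.
by rewrite pk1 mulmxA rZE mulVmx ?mul1mx // rA_unit.
Qed.

Lemma cth_yy c t : t != 0 -> yy c t = mg_mul (yy (rev_ord c) t^-1)
 (mgE (QP QE (mgP (cth ([set rev_ord c]%SET, yy c t))))).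
have nc : (rev_ord c == c) = false by rewrite -[_ == c]negbK -rev2 eqxx.
move=> t0; have := @yy_cth (rev_ord c) (yy c t); rewrite !X_yy nc rev_ordK eqxx div1r.
by apply.
Qed.

Lemma plineX : pline (fun t : k => t).
by exists 'X => t; rewrite hornerX. Qed.
Lemma pline_rN c i j : pline (fun t => rN lm c (pt c t) i j).
rewrite (_ : (fun t => _) = fun t => t * (delta_mx (row (rev_ord c)) (row c) : 'M[k]_n) i j).
 by apply: (faM (pline_alg k)); [exact: plineX|exact: (faC (pline_alg k))].
by apply/funext=> t; rewrite rN_pt mxE.
Qed.

Lemma pline_rA c i j : pline (fun t => rA lm c (pt c t) i j).
have PA := pline_alg k; apply: (fa_mulmx PA) => a b; first exact: (faC PA).
rewrite (_ : (fun t => _) = fun t => (1%:M : 'M[k]_n) a b - rN lm c (pt c t) a b).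
 by apply: (faB PA); [exact: (faC PA)|exact: pline_rN].
by apply/funext=> t; rewrite !mxE.
Qed.

Lemma pline_rZ c i j : pline (fun t => rZ lm c (pt c t) i j).
have PA := pline_alg k; apply: (fa_mulmx PA) => a b; last exact: (faC PA).
rewrite (_ : (fun t => _) = fun t => (1%:M : 'M[k]_n) a b + rN lm c (pt c t) a b).
 by apply: (faD PA); [exact: (faC PA)|exact: pline_rN].
by apply/funext=> t; rewrite !mxE.
Qed.

Lemma dreg_yy (S : {set I}) c a : dreg lm S a ->
 exists (A : {poly k}) L, forall t, a (yy c t) = A.[t] / h S (\val (yy c t)) ^+ L.
move=> /(dregP 0)[p [M [pp _ pE]]]; have PA := pline_alg k.
have [A EA] : pline (fun t => p (rZ lm c (pt c t)) * \det (rA lm c (pt c t)) ^+ M.+1).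
 apply: (faM PA); first by apply: (fa_comp PA) => // i j; exact: pline_rZ.
 by apply: (faX PA); apply: (fa_det PA) => i j; exact: pline_rA.
exists A, M.+1 => t; rewrite pE -EA /chF exprMn invfM [RHS]mulrAC -mulrA; congr (_ * (_ * _)).
by rewrite /= rZE det_inv exprVn invrK.
Qed.

Lemma setD2 (c : I) : ([set: I] :\ c = [set rev_ord c])%SET.
by apply/setP=> d; rewrite !inE andbT rev2. Qed.
Lemma dT2 (W : lmodType k) (F : T -> W) (g : P) : h [set: I]%SET (\val g) != 0 ->
 dT lm F ([set: I]%SET, g) = F ([set ord_max]%SET, g) - F ([set ord0]%SET, g).
move=> h0; rewrite /dT /= h0 /dlt.
rewrite (eq_bigl xpredT); last by move=> c; rewrite inE.
rewrite big_ord_recl big_ord1 !setD2 /eps.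
have -> : [set s in [set: I] | (s < @ord0 1)%N]%SET = finset.set0.
 by apply/setP=> s; rewrite !inE.
have -> : [set s in [set: I] | (s < lift (@ord0 1) (@ord0 0))%N]%SET = [set ord0]%SET.
 by apply/setP=> -[[|[|s]] hs]; rewrite !inE.
rewrite cards0 cards1 expr0 expr1 scale1r scaleN1r.
by congr (F (_, _) - F (_, _)); congr [set _]%SET; apply/val_inj.
Qed.

Lemma hT (g : P) : h [set: I]%SET (\val g) = X ord0 (\val g) * X ord_max (\val g).
rewrite /lh (eq_bigl xpredT); last by move=> c; rewrite inE.
by rewrite big_ord_recl big_ord1; congr (_ * X _ _); apply/val_inj.
Qed.

Lemma gPq_supp q (W : lmodType k) (F : T -> W) (S : {set I}) (g : P) : fsp (gPq lm q) F ->
 (#|S| != q) || (h S (\val g) == 0) -> F (S, g) = 0.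
move=> FP Sh; elim: FP=> // a w f [a0 aP] _ ->; rewrite addr0.
suff -> : a (S, g) = 0 by rewrite scale0r.
by case/orP: Sh => [/a0 //|/eqP]; case: (aP S) => + _; apply.
Qed.

(** The transition cocycle between the two charts of the line. *)
Let beta (t : k) : B := cth ([set ord0]%SET, yy ord_max t).

Lemma beta_diag t i : t != 0 -> \val (beta t) i i =
 if i == row ord0 then - t^-1 else if i == col then t else 1.
move=> t0; have rm : row ord_max = col by apply/val_inj.
have rc : (col == row ord0) = false by rewrite -rm (inj_eq (@row_inj n l 1 lm)).
have e0 : rev_ord (@ord_max 1) = ord0 by apply/val_inj.
have e1 : rev_ord (@ord0 1) = ord_max by apply/val_inj.
have X0 := X_yy ord_max t ord0; have X1 := X_yy ord_max t ord_max.
have zE : \val (yy ord_max t) = 1%:M + t *: delta_mx (row ord0) col.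
 by rewrite /= /rZ rm /tperm_mx tperm1 perm_mx1 mulmx1 rN_pt e0 rm.
rewrite (cthE QE) ?cards1 ?h1 ?X0 //; move: (\val (yy _ _)) X0 X1 zE => /= z X0 X1 zE.
rewrite pk1 /rA -mulmxA /tperm_mx -row_permE mxE rNE e1 X0 X1 rm zE.
rewrite mulmxBl !mulmxDr !mul1mx mulmx1 -scalemxAl -scalemxAr mul_delta_mx.
rewrite scalerA div1r mulVf // scale1r !mxE.
case: tpermP=> [->|->|/eqP /negPf i0 /eqP /negPf ic].
- by rewrite !eqxx ?rc ?(eq_sym _ col) ?rc /= ?eqxx /=; ring.
- by rewrite !eqxx ?rc ?(eq_sym _ col) ?rc /= ?eqxx /=; ring.
- by rewrite i0 ic ?eqxx /=; ring.
Qed.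

Hypothesis ec : e col = e (row ord0) + 1.

(** The diagonal of [beta] contributes (-1/t)^e t^(e+1), where e is the weight of the upper row: by
    [ec] exactly one power of t is left, which is degree -1. *)
Lemma bw_beta (t : k) : t != 0 -> bw k e (beta t) = (-1) ^ e (row ord0) * t.
move=> t0; have rm : row ord_max = col by apply/val_inj.
have rc : (col == row ord0) = false by rewrite -rm (inj_eq (@row_inj n l 1 lm)).
have u : t \is a GRing.unit by rewrite unitfE.
rewrite /bw /= /wfun (bigD1 (row ord0)) //= (bigD1 col) ?rc //= big1 ?mulr1; last first.
 by move=> i /andP[/negPf i0 /negPf ic]; rewrite beta_diag // i0 ic exp1rz.
rewrite !beta_diag // eqxx rc eqxx ec exprzDr // expr1z mulrA; congr (_ * _).
by rewrite -exprzMl ?mulNr ?mulVf // unitfE oppr_eq0 invr_eq0.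
Qed.

(** The bundle O(-1) on the line has no H^1: nonnegative powers of t go to one chart, negative
    powers to the other. *)
Lemma laurent_split (A : {poly k}) L c : c != 0 -> exists B1 B2 : {poly k},
 forall t, t != 0 -> A.[t] / t ^+ L = B1.[t] + (c * t)^-1 * B2.[t^-1].
move=> c0; exists (drop_poly L A), (c *: \poly_(i < L) A`_(L - i.+1)) => t t0.
rewrite -{1}(poly_take_drop L A) hornerD hornerM hornerXn hornerZ mulrDl mulfK ?expf_neq0 //.
rewrite addrC invfM -mulrA mulrCA mulKf // /take_poly !horner_poly; congr (_ + _).
rewrite (reindex_inj rev_ord_inj) /= mulr_suml mulr_sumr; apply: eq_bigr=> i _.
have -> : t ^+ L = t ^+ (L - i.+1) * (t ^+ i * t) by rewrite -exprSr -exprD subnK.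
by rewrite exprVn; field; rewrite t0 !expf_neq0.
Qed.

Lemma fsp_wpull (Y Z : Type) (A : set (Y -> k)) (A' : set (Z -> k)) (w : Z -> k)
  (t : Z -> Y) (W : lmodType k) (f : Y -> W) :
 (forall a, A a -> A' (fun y => w y * a (t y))) -> fsp A f ->
 fsp A' (fun y => w y *: f (t y)).
move=> AA'; elim=> [|a v g Aa _ IH].
 by apply: fsp_eq0=> y; rewrite scaler0.
rewrite (_ : (fun y => _) = fun y => (w y * a (t y)) *: v + w y *: g (t y)).
 by apply: fspD=> //; exact: AA'.
by apply/funext=> y; rewrite scalerDr scalerA.
Qed.

(** An invariant frame of the twisted cochains over the chart c, extended by zero; [tt_] is the
    affine coordinate on that chart. *)
Definition wt (c : I) (x : T) : k :=
 if (x.1 == [set c]%SET) && (X c (\val x.2) != 0) then (bw k e (cth x))^-1 else 0.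
Definition tt_ (c : I) (x : T) : k := X (rev_ord c) (\val x.2) / X c (\val x.2).

Lemma bw0 q : bw k e q != 0.
by apply/eqP=> b0; have /eqP := gcVl (bw k e) q; rewrite b0 mulr0 eq_sym oner_eq0. Qed.
Lemma X_act c (x : T) (q : B) : X c (\val (gactT QE x q).2) = X c (\val x.2) * \val q col col.
by rewrite /= (lX_semi lm QE) //; exact: mgP. Qed.
Lemma tt_act c x q : tt_ c (gactT QE x q) = tt_ c x.
by rewrite /tt_ !X_act fracMr //; exact: (Q_diag0 lm QE). Qed.
Lemma wt_act c x q : bw k e q * wt c (gactT QE x q) = wt c x.
rewrite /wt X_act mulf_eq0 (negPf (Q_diag0 lm QE q)) orbF /=.
case: ifP=> [/andP[/eqP x1 x2]|]; last by rewrite mulr0.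
rewrite (cth_act QE) ?x1 ?cards1 ?h1 //.
have -> : wfun e (mg_mul (cth x) q) = wfun e (cth x) * wfun e q.
 exact: (@gcM _ (mgr B) (bw k e) (cth x) q).
by rewrite invfM mulrCA divff ?mulr1 //; exact: bw0.
Qed.

Lemma fsp_part c (W : lmodType k) (f : k -> W) : fsp pline f ->
 fsp (gPq lm 1) (fun x : T => wt c x *: f (tt_ c x)).
apply: fsp_wpull=> a [A aE]; split=> [S g S1|S].
 by rewrite /wt /=; case: eqP=> [S2|]; rewrite ?mul0r //; rewrite S2 cards1 in S1.
split=> [g h0|].
 by rewrite /wt /=; case: eqP=> [S2|]; rewrite ?mul0r //; rewrite S2 h1 in h0; rewrite h0 eqxx mul0r.
have OA := chO_alg k lm S.
have [S2|S2] := eqVneq S [set c]%SET; last first.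
 rewrite (_ : (fun t => _) = fun=> 0); first exact: (faC OA).
 by apply/funext=> t; rewrite /wt /= (negPf S2) mul0r.
have S0 : (0 < #|S|)%N by rewrite S2 cards1.
have cS : c \in S by rewrite S2 inE.
rewrite (_ : (fun t => _) = fun t : chart k lm S => gc_inv (bw k e) (cth (S, sval t)) *
  \sum_(i < size A) A`_i * (X (rev_ord c) (chv t) * (X c (chv t))^-1) ^+ i).
 apply: (faM OA); first exact: (@chO_cth k n l 1 lm B QE S (gc_inv (bw k e)) S0 (gcO (gc_inv (bw k e)))) .
 apply: (fa_sum OA) => i _; apply: (faM OA); first exact: (faC OA).
 apply: (faX OA); apply: (faM OA); last exact: (@chO_Xinv k n l 1 lm S c cS).
 exact: (@chO_poly k n l 1 lm S _ (@mpf_lX k n l 1 lm (rev_ord c))).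
apply/funext=> t; have := svalP t; rewrite {1}S2 h1 => X0.
rewrite /wt /= {1}S2 eqxx X0 /= aE horner_coef /tt_; congr (_ * _).
by apply: (mulfI (bw0 (cth (S, sval t)))); rewrite divff ?bw0 // gcVr.
Qed.

Lemma cth_own c t : cth ([set c]%SET, yy c t) = mg_one B.
apply/val_inj; rewrite (cthE QE) ?cards1 ?h1 ?X_yy ?eqxx ?oner_eq0 //= pk1.
by rewrite (_ : rA _ _ _ = rA lm c (pt c t)) ?rAZ // /rA -[rZ _ _ _]/(\val (yy c t)) !rNE !X_yy !X_pt.
Qed.

Section Ind.
Variable W : lmodType k.
Notation Cq q := (FM (cspace lm QE q) (triv (mgr B) W)).
Notation Kq q := (FM (kspace lm QE q) (triv (mgr B) W)).

(** By invariance the cochain is determined by two polynomials, its values along [yy] in the two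
    charts. Being killed by the differential relates them through the transition factor as in
    [pline_meet]. A functional reduces the question to scalar functions. *)
Lemma cech1_inj (F : tw (bw k e) (Cq 1)) : invt F -> twm (bw k e) (c2k lm QE W 1) F = 0 -> F = 0.
move=> iF dF; apply: fm_ext=> x; apply/eqP; apply: contraT=> /dual_sep [u u1].
have : u (fm_fun F x) = 0; last by move=> u0; move/eqP: u1; rewrite u0 eq_sym oner_eq0.
move=> {u1}; pose f y := u (fm_fun F y) : k.
have fP : gPq lm 1 f.
 apply: fsp_scalar; first exact: gPq_sub.
 by apply: (fsp_lin (l := u)); [exact: linearP|exact: fmP].
have fq y q : bw k e q * f (gactT QE y q) = f y.
 have := congr1 (fun G : fmod _ _ => u (G y)) (iF q).
 by rewrite /= linearZ.
have df y : dT lm (f : T -> k^o) y = 0.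
 rewrite /f -(dT_map lm u); have := congr1 (fun G : fmod _ _ => G y) dF.
 by move=> /= ->; rewrite linear0.
have [A [LA EA]] := dreg_yy ord_max (fP.2 [set ord_max]%SET).
have [C [LC EC]] := dreg_yy ord0 (fP.2 [set ord0]%SET).
have {}EA t : f ([set ord_max]%SET, yy ord_max t) = A.[t].
 by rewrite EA h1 X_yy eqxx expr1n divr1.
have {}EC t : f ([set ord0]%SET, yy ord0 t) = C.[t].
 by rewrite EC h1 X_yy eqxx expr1n divr1.
have e0 : rev_ord (@ord_max 1) = ord0 by apply/val_inj.
have k0 : (-1) ^ e (row ord0) != 0 :> k by rewrite expfz_neq0 // oppr_eq0 oner_eq0.
have [A0 C0] : A = 0 /\ C = 0.
 apply: (pline_meet kinf (invr_neq0 k0)) => t t0.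
 have hz : h [set: I]%SET (\val (yy ord_max t)) != 0 by rewrite hT !X_yy /= mulr1.
 have := df ([set: I]%SET, yy ord_max t); rewrite dT2 // => /subr0_eq; rewrite EA => ->.
 rewrite (cth_yy ord_max t0) e0 -[(_, _)]/(gactT QE ([set ord0]%SET, yy ord0 t^-1) (beta t)).
 apply: (mulfI (bw0 (beta t))); rewrite fq EC bw_beta //.
 by field; rewrite k0 t0.
have f0 c g : f ([set c]%SET, g) = 0.
 have [X0|X0] := eqVneq (X c (\val g)) 0.
  by case: (fP.2 [set c]%SET) => + _; apply; rewrite h1.
 rewrite (yy_cth X0); set q := cth _; set t := _ / _.
 apply: (mulfI (bw0 q)); rewrite mulr0 -[(_, _)]/(gactT QE ([set c]%SET, yy c t) q) fq.
 case: (unliftP ord0 c) => [j|] ->; last by rewrite EC C0 horner0.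
 by rewrite (_ : lift _ _ = ord_max) ?EA ?A0 ?horner0 //; apply/val_inj; case: j=> [[]].
case: x=> S g; rewrite -/(f (S, g)).
have [/eqP/cards1P[c ->]|/(fP.1 _ g) //] := eqVneq #|S| 1%N; exact: f0.
Qed.

(** Along [yy] an invariant cochain on the intersection is a Laurent polynomial in t.
    [laurent_split] distributes it between the charts, and [wt] spreads the two parts over the
    cosets. *)
Lemma cech1_surj (w : tw (bw k e) (Kq 2)) : invt w ->
 exists2 F : tw (bw k e) (Cq 1), invt F & twm (bw k e) (c2k lm QE W 1) F = w.
move=> iw; have k0 : (-1) ^ e (row ord0) != 0 :> k by rewrite expfz_neq0 // oppr_eq0 oner_eq0.
have wP : fsp (gPq lm 2) (w : fmod _ _).
 by elim: (fmP (w : fmod _ _)) => [|a v f [Pa _] _ IH]; [exact: fsp0|exact: fspD].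
have [al [be [Pal Pbe abE]]] : exists al be : k -> W, [/\ fsp pline al, fsp pline be &
  forall t, t != 0 -> fm_fun w ([set: I]%SET, yy ord_max t) =
   al t + ((-1) ^ e (row ord0) * t)^-1 *: be t^-1].
 elim: wP=> [|a v f Pa _ [al [be [Pal Pbe abE]]]].
  by exists (fun=> 0), (fun=> 0); split; try exact: fsp0; move=> t _; rewrite scaler0 addr0.
 have [A [L EA]] := dreg_yy ord_max (Pa.2 [set: I]%SET).
 have [B1 [B2 BE]] := laurent_split A L k0.
 exists (fun t => B1.[t] *: v + al t), (fun t => B2.[t] *: v + be t).
 split; [by apply: fspD=> //; exists B1|by apply: fspD=> //; exists B2|].
 move=> t t0; rewrite abE // EA hT !X_yy /= mulr1 BE //.
 by rewrite scalerDl scalerDr scalerA addrACA.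
have FP : fsp (gPq lm 1) (fun x : T => wt ord_max x *: al (tt_ ord_max x) -
  wt ord0 x *: be (tt_ ord0 x)).
 apply: fsp_add; first exact: fsp_part.
 rewrite (_ : (fun x => _) = fun x : T => (-1) *: (wt ord0 x *: be (tt_ ord0 x))).
  by apply: fsp_scale; exact: fsp_part.
 by apply/funext=> x; rewrite scaleN1r.
pose F : tw (bw k e) (Cq 1) := (mkfm FP : Cq 1).
have FE x q : bw k e q *: fm_fun F (gactT QE x q) = fm_fun F x.
 by rewrite /= scalerBr !scalerA !wt_act !tt_act.
have Fx x : fm_fun F x = wt ord_max x *: al (tt_ ord_max x) - wt ord0 x *: be (tt_ ord0 x) by [].
clearbody F; exists F; first by move=> q; apply: fm_ext=> x; rewrite fmEZ; exact: FE.
apply: fm_ext=> -[S g].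
have wq x q : bw k e q *: fm_fun w (gactT QE x q) = fm_fun w x.
 exact: (congr1 (fun G : fmod _ _ => G x) (iw q)).
have dP : fsp (gPq lm 2) (dT lm (F : fmod _ _)).
 by elim: (c2k_subproof (F : Cq 1)) => [|a v f [Pa _] _ IH]; [exact: fsp0|exact: fspD].
have -> : (twm (bw k e) (c2k lm QE W 1) F : fmod _ _) (S, g) = dT lm (F : fmod _ _) (S, g) by [].
have [Sh|] := boolP ((#|S| != 2) || (h S (\val g) == 0)); first by rewrite (gPq_supp dP Sh) (gPq_supp wP Sh).
rewrite negb_or negbK => /andP[/eqP S2 hS].
have {S2} ST : S = [set: I]%SET by apply/eqP; rewrite eqEcard finset.subsetT S2 cardsT card_ord.
rewrite ST in hS *; rewrite dT2 //; have X0 : X ord_max (\val g) != 0.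
 by move: hS; rewrite hT mulf_eq0 negb_or => /andP[].
rewrite (yy_cth X0); set q := cth _; set t := _ / _.
have t0 : t != 0.
 move: hS; rewrite hT mulf_eq0 negb_or => /andP[hS0 hS1].
 by rewrite /t mulf_neq0 ?invr_eq0 // (_ : rev_ord _ = ord0) //; apply/val_inj.
have F1 c := FE ([set c]%SET, yy ord_max t) q.
have W1 := wq ([set: I]%SET, yy ord_max t) q.
rewrite /gactT /= in F1 W1.
apply: (scalerI (bw0 q)); rewrite scalerBr [bw k e q]/= !F1 W1 abE // !Fx.
have e0 : rev_ord (@ord_max 1) = ord0 by apply/val_inj.
have e1 : rev_ord (@ord0 1) = ord_max by apply/val_inj.
have n01 (c d : I) : c != d -> (@finset.set1 I c == [set d]%SET) = false.
 by move=> cd; apply/eqP=> /setP /(_ c); rewrite !inE eqxx (negPf cd).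
rewrite /wt /tt_ /= !eqxx !n01 // e0 e1 -[rZ _ _ _]/(\val (yy ord_max t)) !X_yy /=.
rewrite oner_eq0 t0 /= !scale0r subr0 sub0r opprK divr1 div1r.
have -> : wfun e (cth ([set ord_max]%SET, yy ord_max t)) = 1.
 by rewrite (cth_own ord_max t); exact: (gc1 (bw k e)).
have -> : wfun e (cth ([set ord0]%SET, yy ord_max t)) = (-1) ^ e (row ord0) * t.
 exact: bw_beta.
by rewrite invr1 scale1r.
Qed.

(** There are only two charts, so after the augmentation a complex with two acyclic terms remains,
    and comparing their invariants suffices. *)
Lemma hvan_P1_ind j : hvan (tw (bw k e) (rres (mg_sub (QP QE)) (ind (mgr P) W))) j.
have hC q i : (0 < q)%N -> hvan (tw (bw k e) (Cq q)) i.+1.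
 by move=> q0; apply: relinj_hvan; apply: relinj_tw; exact: relinj_chart.
have hK2 i : hvan (tw (bw k e) (Kq 2)) i.+1.
 apply: (hvan_sub (ses_tw (bw k e) (ses_cech lm QE W 2))); last exact: hC.
 by apply: hvan_null; exact: kspace_null.
have hK1 i : hvan (tw (bw k e) (Kq 1)) i.
 apply: (hvan_bij (ses_tw (bw k e) (ses_cech lm QE W 1))) => //; first by move=> i'; exact: hC.
  exact: cech1_inj.
 exact: cech1_surj.
apply: (@hvan_ret _ _ _ _ (twm (bw k e) (p2c lm QE W)) (twm (bw k e) (c2p lm QE W))).
 by move=> F; apply: fm_ext=> g /=; rewrite eqxx.
apply: (hvan_mid (ses_tw (bw k e) (ses_cech lm QE W 0))) => //.
by apply: hvan_null; exact: kspace0_null.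
Qed.
End Ind.

(* The weight e has degree -1 on the fibres P / B, which are projective lines. *)
Lemma hvan_P1 (N : rmod (mgr P)) j : hvan (tw (bw k e) (rres (mg_sub (QP QE)) N)) j.
by apply: hvan_res_ind=> W i; exact: hvan_P1_ind. Qed.
End P1Vanishing.

(** * Isomorphisms of modules *)

Section Isomorphism.
Context k (S : agr k).
Implicit Types N M L : rmod S.

Definition riso N M : Prop := exists (f : rhom N M) (g : rhom M N),
 (forall v, g (f v) = v) /\ (forall v, f (g v) = v).

Lemma riso_sym N M : riso N M -> riso M N.
by move=> [f [g [fg gf]]]; exists g, f. Qed.
Lemma riso_trans N M L : riso N M -> riso M L -> riso N L.
move=> [f [g [fg gf]]] [f' [g' [fg' gf']]]; exists (rhcomp f' f), (rhcomp g g').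
by split=> v /=; rewrite ?fg' ?gf.
Qed.

Lemma riso_hv N M j : riso N M -> hvan M j -> hvan N j.
by move=> [f [g [fg _]]]; exact: hvan_ret fg. Qed.
Lemma riso_hdim N M j d : riso N M -> hdim N j d -> hdim M j d.
move=> [f [g [fg gf]]].
apply: (@qdim_iso _ _ _ _ _ _ _ (fun u v => v = Prm f j u) idfun) => //.
- by rewrite linear0.
- by move=> c u v u' v' -> ->; rewrite linearP.
- by move=> u iu; exists (Prm f j u); split=> //; exact: rh_inv.
- move=> u' iu'; exists (Prm g j u'), u'; split=> //; first exact: rh_inv.
  by rewrite (Prm_ret gf).
 by rewrite subrr; exact: sl0 (bnd_sublin _ _).
- move=> u u' _ _ ->; split=> [|bu]; first exact: Prm_bnd.
 by rewrite -(Prm_ret fg u); exact: Prm_bnd.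
Qed.

Lemma riso_same (V : lmodType k) (a b : S -> V -> V) l1 l2 l3 l4 l1' l2' l3' l4' :
 (forall g v, a g v = b g v) ->
 riso (@RMod k S V a l1 l2 l3 l4) (@RMod k S V b l1' l2' l3' l4').
move=> ab; have e : a = b by apply/funext=> g; apply/funext.
subst b; rewrite (rmod_eq l1 l1' l2 l2' l3 l3' l4 l4').
have lid : linear (id : V -> V) by [].
pose i := @mkrh _ _ (RMod l1' l2' l3' l4') (RMod l1' l2' l3' l4') id lid (fun _ _ => erefl).
by exists i, i.
Qed.

Lemma riso_tw c N M : riso N M -> riso (tw c N) (tw c M).
by move=> [f [g fg]]; exists (twm c f), (twm c g). Qed.
Lemma tw_tw (c d e : gchar S) N : (forall g, e g = c g * d g) -> riso (tw c (tw d N)) (tw e N).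
by move=> E; apply: riso_same=> g v /=; rewrite E scalerA. Qed.
Lemma tw_eq (c d : gchar S) N : (forall g, c g = d g) -> riso (tw c N) (tw d N).
by move=> E; apply: riso_same=> g v /=; rewrite E. Qed.
Lemma tw_1 (c : gchar S) N : (forall g, c g = 1) -> riso (tw c N) N.
by move=> E; case: N=> V a *; apply: riso_same=> g v /=; rewrite E scale1r. Qed.
(** Multiplication by a character is invertible on regular functions and absorbs the twist. *)
Lemma ind_tw (c : gchar S) W : riso (ind S W) (tw c (ind S W)).
have mulP (d : gchar S) (F : ind S W) : fsp (@agO k S) (fun x => d x *: fm_fun F x).
 by apply: fsp_mul (fmP (F : fmod _ _)) => b Ob; apply: agO_mul=> //; exact: gcO.
have lin d : linear (fun F : ind S W => mkfm (mulP d F) : ind S W).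
 by move=> a F G; apply: fm_ext=> x; rewrite fmED fmEZ /= scalerDr !scalerA mulrC.
have e1 g (F : ind S W) : (mkfm (mulP (gc_inv c) (ra g F)) : tw c (ind S W)) =
  ra g (mkfm (mulP (gc_inv c) F) : tw c (ind S W)).
 apply: fm_ext=> x; rewrite fmEZ /= scalerA; congr (_ *: _).
 by rewrite agV_M gcM mulrA gcVr mul1r.
have e2 g (F : tw c (ind S W)) : (mkfm (mulP c (ra g F)) : ind S W) = ra g (mkfm (mulP c F) : ind S W).
 by apply: fm_ext=> x /=; rewrite scalerA gcM.
exists (@mkrh _ _ (ind S W) (tw c (ind S W)) _ (lin (gc_inv c)) e1).
exists (@mkrh _ _ (tw c (ind S W)) (ind S W) _ (lin c) e2).
by split=> F; apply: fm_ext=> x /=; rewrite scalerA ?gcVr ?gcVl scale1r.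
Qed.
End Isomorphism.

Lemma riso_res k (H G : agr k) (h : ghom H G) (N M : rmod G) :
 riso N M -> riso (rres h N) (rres h M).
by move=> [f [g fg]]; exists (resm h f), (resm h g). Qed.

(** * Homogeneous polynomials and symmetric powers *)

Section Homogeneous.
Context k.

(** Homogeneous polynomial functions by recursion on the degree: linear substitution, splitting off
    a coordinate and restriction to lines become inductions. *)
Fixpoint hpoly (d r : nat) : set ('rV[k]_d -> k) :=
 match r with
 | 0%N => [set f | exists c, forall y, f y = c]
 | s.+1 => [set f | exists g : 'I_d -> 'rV[k]_d -> k,
   (forall i, @hpoly d s (g i)) /\ forall y : 'rV[k]_d, f y = \sum_i y 0 i * g i y]
 end.
Arguments hpoly : clear implicits.

Lemma hpoly_sub d r : fsub (hpoly d r).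
elim: r=> [|r [h0 hL]]; split.
- by exists 0.
- by move=> c f g [a fa] [b gb]; exists (c * a + b) => y; rewrite fa gb.
- by exists (fun _ _ => 0); split=> // y; rewrite big1 // => i _; rewrite mulr0.
- move=> c f g [f' [hf fE]] [g' [hg gE]]; exists (fun i y => c * f' i y + g' i y).
 split=> [i|y]; first exact: (hL c _ _ (hf i) (hg i)).
 rewrite fE gE mulr_sumr -big_split; apply: eq_bigr=> i _ /=.
 by rewrite mulrDr mulrCA.
Qed.

Lemma hpoly_mul d r i f : hpoly d r f -> hpoly d r.+1 (fun y => y 0 i * f y).
move=> hf; exists (fun j => if j == i then f else fun=> 0); split=> [j|y].
 by case: eqP=> // _; case: (hpoly_sub d r).
rewrite (bigD1 i) //= eqxx big1 ?addr0 // => j /negPf ->.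
by rewrite mulr0.
Qed.

Lemma hpolyD d r f g : hpoly d r f -> hpoly d r g -> hpoly d r (fun y => f y + g y).
move=> hf hg; have [_ H] := hpoly_sub d r.
by have := H 1 f g hf hg; congr hpoly; apply/funext=> y; rewrite mul1r.
Qed.

Lemma hpoly_sum d r (I : finType) (P : pred I) (f : I -> 'rV[k]_d -> k) :
 (forall i, hpoly d r (f i)) -> hpoly d r (fun y => \sum_(i | P i) f i y).
move=> hf; rewrite (_ : (fun y => _) = \sum_(i | P i) f i); last first.
 by apply/funext=> y; rewrite fct_sumE.
elim/big_ind: _ => [|a b|i _]; [by case: (hpoly_sub d r)|exact: hpolyD|exact: hf].
Qed.

Lemma hpoly_lin d d' r (J : 'M[k]_(d', d)) f :
 hpoly d r f -> hpoly d' r (fun y => f (y *m J)).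
elim: r f => [|r IH] f; first by move=> [c E]; exists c => y; rewrite E.
move=> [g [hg E]]; rewrite (_ : (fun y => _) = fun y : 'rV_d' =>
  \sum_i \sum_j y 0 j * (J j i * g i (y *m J))); last first.
 by apply/funext=> y; rewrite E; apply: eq_bigr=> i _; rewrite mxE mulr_suml; apply: eq_bigr=> j _; rewrite mulrA.
apply: hpoly_sum=> i; apply: hpoly_sum=> j; apply: hpoly_mul.
have [h0 hL] := hpoly_sub d' r; have := hL (J j i) _ _ (IH _ (hg i)) h0.
by congr hpoly; apply/funext=> y; rewrite addr0.
Qed.

Definition zc d (i : 'I_d) (y : 'rV[k]_d) : 'rV[k]_d := \row_j (if j == i then 0 else y 0 j).

Lemma zcE d (i : 'I_d) y : y = zc i y + y 0 i *: delta_mx 0 i.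
apply/rowP=> j; rewrite !mxE eqxx /=; case: eqP=> [->|_]; last by rewrite mulr0 addr0.
by rewrite mulr1 add0r.
Qed.

Lemma hpoly_split d r i f : hpoly d r.+1 f ->
 exists2 g, hpoly d r g & forall y, f y = f (zc i y) + y 0 i * g y.
elim: r f => [|r IH] f [g [hg fE]].
 exists (g i) => [|y]; first exact: hg.
 rewrite !fE (bigD1 i) // addrC [in RHS](bigD1 i) //= mxE eqxx mul0r add0r.
 congr (_ + _); apply: eq_bigr=> j /negPf ji; rewrite mxE ji.
 by have [c E] := hg j; rewrite !E.
have /choice[g' hg'] : forall j, exists g', hpoly d r g' /\ forall y, g j y = g j (zc i y) + y 0 i * g' y.
 by move=> j; have [g' h' E] := IH _ (hg j); exists g'.
exists (fun y => g i y + \sum_(j | j != i) y 0 j * g' j y).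
 apply: hpolyD; first exact: hg.
 apply: hpoly_sum=> j; apply: hpoly_mul; exact: (hg' j).1.
move=> y; rewrite !fE (bigD1 i) // [in RHS](bigD1 i) //= mxE eqxx mul0r add0r.
rewrite mulrDr addrCA mulr_sumr -big_split; congr (_ + _); apply: eq_bigr=> j /negPf ji /=.
by rewrite mxE ji (hg' j).2 mulrDr mulrCA.
Qed.

Lemma hpoly_scale d r f t y : hpoly d r f -> f (t *: y) = t ^+ r * f y.
elim: r f => [|r IH] f; first by move=> [c E]; rewrite !E mul1r.
move=> [g [hg E]]; rewrite !E mulr_sumr; apply: eq_bigr=> i _.
by rewrite mxE (IH _ (hg i)) exprS mulrACA.
Qed.

Lemma hpoly_line d r f y z : hpoly d r f -> pline (fun t => f (y + t *: z)).
have PA := pline_alg k; elim: r f => [|r IH] f.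
 by move=> [c E]; rewrite (_ : (fun t => _) = fun=> c); [exact: (faC PA)|apply/funext=> t].
move=> [g [hg E]]; rewrite (_ : (fun t => _) = fun t =>
 \sum_i (y 0 i + t * z 0 i) * g i (y + t *: z)).
 apply: (fa_sum PA) => i _; apply: (faM PA); last exact: (IH _ (hg i)).
 apply: (faD PA); first exact: (faC PA).
 by apply: (faM PA); [exact: plineX|exact: (faC PA)].
by apply/funext=> t; rewrite E; apply: eq_bigr=> i _; rewrite !mxE.
Qed.
End Homogeneous.
Arguments hpoly {k} d r.

Record mrep k (S : agr k) (d : nat) : Type := MRep {
 mr :> S -> 'M[k]_d ;
 mr1 : mr ag1 = 1%:M ;
 mrM : forall x y, mr (agM x y) = mr x *m mr y ;
 mrO : forall i j, agO (fun x => mr x i j) }.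

Section SymmetricPowers.
Context k (S : agr k).

Section Def.
Variables (d r : nat) (rho : mrep S d).

Lemma sym_act1 (y : 'rV[k]_d) : y *m rho ag1 = y.
by rewrite mr1 mulmx1. Qed.
Lemma sym_actM (y : 'rV[k]_d) g h : y *m rho (agM g h) = (y *m rho g) *m rho h.
by rewrite mrM mulmxA. Qed.
Lemma sym_co f : hpoly d r f -> dspan (hpoly d r) (@agO k S) (fun y g => f (y *m rho g)).
elim: r f => [|s IH] f.
 move=> [c E]; rewrite (_ : (fun y g => _) = fun _ _ => c * 1 + 0).
  by apply: dspanD; [exists c|exact: agO_1|exact: dspan0].
 by apply/funeq2P=> y g; rewrite E mulr1 addr0.
move=> [g [hg E]]; rewrite (_ : (fun y x => _) = fun (y : 'rV[k]_d) (x : S) =>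
  \sum_i \sum_j y 0 j * rho x j i * g i (y *m rho x)); last first.
 apply/funeq2P=> y x; rewrite E; apply: eq_bigr=> i _.
 by rewrite mxE mulr_suml.
apply: (dspan_sum (F := fun i y x => _)) => i; apply: (dspan_sum (F := fun j y x => _)) => j.
apply: (@dspan_pull _ _ _ _ _ (hpoly d s) (@agO k S) _ _ (fun y x => g i (y *m rho x)) id id
 (fun y => y 0 j) (fun x => rho x j i)); last exact: (IH _ (hg i)).
 by move=> a; exact: hpoly_mul.
by move=> b Ob; apply: agO_mul=> //; exact: mrO.
Qed.

Definition symsp : gspace S :=
 @GSpace k S 'rV[k]_d (fun y g => y *m rho g) sym_act1 sym_actM (hpoly d r) (@hpoly_sub k d r) sym_co.
End Def.

Definition SymP d r (rho : mrep S d) (N : rmod S) : rmod S := FM (symsp r rho) N.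

Section SymSes.
Variables (d d' r : nat) (rho : mrep S d) (rho' : mrep S d') (i : 'I_d) (c : gchar S).
Variables (J : 'M[k]_(d', d)) (K : 'M[k]_(d, d')).
Hypothesis kinf : inf_field k.
Hypothesis rhoi : forall g j, rho g j i = if j == i then c g else 0.
Hypothesis JK : J *m K = 1%:M.
Hypothesis KJ : forall y : 'rV[k]_d, y *m K *m J = zc i y.
Hypothesis Jrho : forall g, J *m rho g = rho' g *m J.
Variable N : rmod S.

Lemma sym_mul_subproof (F : SymP r rho N) :
 fsp (hpoly d r.+1) (fun y => y 0 i *: fm_fun F y).
elim: (fmP (F : fmod _ _)) => [|a v f Pa _ IH].
 by apply: fsp_eq0=> y; rewrite scaler0.
rewrite (_ : (fun y => _) = fun y : 'rV[k]_d => (y 0 i * a y) *: v + y 0 i *: f y).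
 by apply: fspD=> //; exact: hpoly_mul.
by apply/funext=> y; rewrite scalerDr scalerA.
Qed.

Definition sym_mul_fun (F : tw c (SymP r rho N)) : SymP r.+1 rho N := mkfm (sym_mul_subproof F).

Lemma sym_mul_lin : linear sym_mul_fun.
by move=> a F G; apply: fm_ext=> y; rewrite fmED fmEZ /= scalerDr !scalerA mulrC. Qed.
Lemma sym_mul_eq g F : sym_mul_fun (ra g F) = ra g (sym_mul_fun F).
apply: fm_ext=> y.
have e : (y *m rho g) 0 i = y 0 i * c g.
 rewrite mxE (bigD1 i) //= rhoi eqxx big1 ?addr0 // => j /negPf ji.
 by rewrite rhoi ji mulr0.
have -> : (ra g (sym_mul_fun F) : fmod _ _) y =
  ra g ((y *m rho g) 0 i *: fm_fun F (y *m rho g)) by [].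
by rewrite e raZ -scalerA.
Qed.

Definition sym_mul : rhom (tw c (SymP r rho N)) (SymP r.+1 rho N) := mkrh sym_mul_lin sym_mul_eq.

Lemma sym_res_subproof (F : SymP r.+1 rho N) :
 fsp (hpoly d' r.+1) (fun y => fm_fun F (y *m J)).
by apply: (fsp_pull _ (fmP (F : fmod _ _))) => a; exact: hpoly_lin. Qed.

Definition sym_res_fun (F : SymP r.+1 rho N) : SymP r.+1 rho' N := mkfm (sym_res_subproof F).

Lemma sym_res_lin : linear sym_res_fun.
by move=> a F G; apply: fm_ext=> y; rewrite fmED fmEZ. Qed.
Lemma sym_res_eq g F : sym_res_fun (ra g F) = ra g (sym_res_fun F).
by apply: fm_ext=> y /=; rewrite -!mulmxA Jrho. Qed.

Definition sym_res : rhom (SymP r.+1 rho N) (SymP r.+1 rho' N) := mkrh sym_res_lin sym_res_eq.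

(** Multiplication by an eigencoordinate y_i, followed by restriction to the hyperplane y_i = 0.
    Injectivity is tested on lines in the direction i, where a polynomial vanishing at all nonzero t
    is zero; [K] extends functions off the hyperplane. *)
Lemma ses_sym : ses sym_mul sym_res.
split.
- move=> F G FG; apply/eqP; rewrite -subr_eq0; apply/eqP; apply: fm_ext=> y.
 apply/eqP; apply: contraT=> /dual_sep[u u1].
 pose f (z : 'rV[k]_d) := u ((F - G : fmod _ _) z) : k.
 have fP : hpoly d r f.
  apply: fsp_scalar; first exact: hpoly_sub.
  by apply: (fsp_lin (l := u)); [exact: linearP|exact: fmP].
 have f0 (z : 'rV[k]_d) : z 0 i != 0 -> f z = 0.
  move=> z0; have := congr1 (fun H : fmod _ _ => u (H z)) FG; rewrite /= !linearZ /f fmEB linearB /=.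
  by move/(mulfI z0) => ->; rewrite subrr.
 have [p pE] := hpoly_line (zc i y) (delta_mx 0 i) fP.
 have p0 : p = 0.
  apply: kinf=> t t0; rewrite -pE; apply: f0.
  by rewrite !mxE !eqxx add0r mulr1.
 by move: u1; rewrite -/(f y) {1}(zcE i y) pE p0 horner0 => /eqP; rewrite eq_sym oner_eq0.
- move=> G; have FP : fsp (hpoly d r.+1) (fun y => fm_fun G (y *m K)).
  by apply: (fsp_pull _ (fmP (G : fmod _ _))) => a; exact: hpoly_lin.
 by exists (mkfm FP); apply: fm_ext=> y /=; rewrite -mulmxA JK mulmx1.
- move=> F; apply: fm_ext=> y /=; have := KJ (y *m J); rewrite -[y *m J *m K]mulmxA JK mulmx1 => ->.
 by rewrite mxE eqxx scale0r.
- move=> F F0; have [G GP GE] : exists2 G : 'rV[k]_d -> N, fsp (hpoly d r) G &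
   forall y, fm_fun F y = fm_fun F (zc i y) + y 0 i *: G y.
  elim: (fmP (F : fmod _ _)) => [|a v f Pa _ [G GP GE]].
   by exists (fun=> 0); [exact: fsp0|move=> y; rewrite scaler0 addr0].
  have [g gP gE] := hpoly_split i Pa.
  exists (fun y => g y *: v + G y); first exact: fspD.
  by move=> y; rewrite GE {1}gE scalerDl scalerDr scalerA addrACA.
 exists (mkfm GP); apply: fm_ext=> y; rewrite [RHS]GE /= -KJ.
 by have := congr1 (fun H : fmod _ _ => H (y *m K)) F0 => /= ->; rewrite add0r.
Qed.
End SymSes.

Lemma sym0_riso d (rho : mrep S d) N : riso (SymP 0 rho N) N.
have FP (v : N) : fsp (hpoly d 0) (fun=> v).
 rewrite (_ : (fun=> v) = fun=> 1 *: v + 0); last by apply/funext=> y; rewrite scale1r addr0.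
 by apply: fspD; [exists 1|exact: fsp0].
have l1 : linear (fun F : SymP 0 rho N => fm_fun F 0) by move=> a F G; rewrite fmED fmEZ.
have l2 : linear (fun v : N => mkfm (FP v) : SymP 0 rho N).
 by move=> a u v; apply: fm_ext=> y; rewrite fmED fmEZ.
have e1 g (F : SymP 0 rho N) : (ra g F : fmod _ _) 0 = ra g (fm_fun F 0).
 by rewrite /= mul0mx.
have e2 g (v : N) : (mkfm (FP (ra g v)) : SymP 0 rho N) = ra g (mkfm (FP v) : SymP 0 rho N) by apply: fm_ext.
exists (mkrh l1 e1), (mkrh l2 e2); split=> [F|v] //=; apply: fm_ext=> y /=.
elim: (fmP (F : fmod _ _)) => // a v f [c aE] _ ->; by rewrite !aE.
Qed.

Lemma sym1_riso r (rho : mrep S 1) (c : gchar S) N : (forall g, c g = rho g 0 0 ^+ r) ->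
 riso (SymP r rho N) (tw c N).
move=> cE; have hr : hpoly 1 r (fun y : 'rV[k]_1 => y 0 0 ^+ r).
 elim: r {cE} => [|r IH]; first by exists 1.
 by have := hpoly_mul 0 IH; congr hpoly; apply/funext=> y; rewrite exprS.
have yE (y : 'rV[k]_1) : y = y 0 0 *: const_mx 1 by apply/rowP=> i; rewrite !mxE mulr1 (ord1 i).
have FE (F : SymP r rho N) t y : fm_fun F (t *: y) = t ^+ r *: fm_fun F y.
 elim: (fmP (F : fmod _ _)) => [|a v f Pa _ IH]; first by rewrite scaler0.
 by rewrite (hpoly_scale _ _ Pa) IH scalerDr scalerA.
have FP (v : N) : fsp (hpoly 1 r) (fun y => y 0 0 ^+ r *: v) by exact: fsp1.
have l1 : linear (fun F : SymP r rho N => fm_fun F (const_mx 1) : tw c N).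
 by move=> a F G; rewrite fmED fmEZ.
have l2 : linear (fun v : tw c N => mkfm (FP v) : SymP r rho N).
 by move=> a u v; apply: fm_ext=> y; rewrite fmED fmEZ /= scalerDr !scalerA mulrC.
have e1 g (F : SymP r rho N) : ((ra g F : fmod _ _) (const_mx 1) : tw c N) = ra g (fm_fun F (const_mx 1) : tw c N).
 rewrite /= (yE (const_mx 1 *m rho g)) FE raZ cE; congr (_ ^+ _ *: _).
 by rewrite mxE big_ord1 mxE mul1r.
have e2 g (v : tw c N) : (mkfm (FP (ra g v)) : SymP r rho N) = ra g (mkfm (FP v) : SymP r rho N).
 apply: fm_ext=> y.
 have e : (y *m rho g) 0 0 ^+ r = y 0 0 ^+ r * c g by rewrite mxE big_ord1 exprMn cE.
 have -> : (ra g (mkfm (FP v) : SymP r rho N) : fmod _ _) y = ra g ((y *m rho g) 0 0 ^+ r *: (v : N)) by [].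
 by rewrite e raZ -scalerA.
exists (@mkrh _ _ _ (tw c N) _ l1 e1), (@mkrh _ _ (tw c N) _ _ l2 e2); split=> [F|v] /=.
 by apply: fm_ext=> y /=; rewrite [in RHS](yE y) FE.
by rewrite mxE expr1n scale1r.
Qed.
End SymmetricPowers.

(** * Block representations and Borel weights *)

Section BlockReps.
Context k (n l m : nat) (lm : (l + m < n)%N) (S : mgrp k n).
Hypothesis SP : mgS S `<=` mgS (parab k n l m.+1).
Notation row := (lrow lm).

Definition blk (x : 'M[k]_n) : 'M[k]_m.+1 := \matrix_(a, b) x (row a) (row b).

Lemma parab_low (x : 'M[k]_n) (i : 'I_n) b : mgS (parab k n l m.+1) x -> (i < l)%N -> x i (row b) = 0.
case=> xp _ il; apply: xp; first by rewrite /= (leq_trans il) // leq_addr.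
by rewrite /inblk leqNgt il.
Qed.

Lemma parab_high (x : 'M[k]_n) a (j : 'I_n) : mgS (parab k n l m.+1) x -> (l + m < j)%N -> x (row a) j = 0.
case=> xp _ mj; apply: xp; first by rewrite /= (leq_ltn_trans _ mj) // leq_add2l -ltnS ltn_ord.
by rewrite /inblk addnS ltnS [(j <= _)%N]leqNgt mj andbF.
Qed.

Lemma blkM (x y : 'M[k]_n) : mgS S x -> mgS S y -> blk (x *m y) = blk x *m blk y.
move=> /SP Px /SP Py; apply/matrixP=> a b; rewrite !mxE.
rewrite (sum_block lm); [by apply: eq_bigr=> c _; rewrite !mxE| |].
 by move=> i il; rewrite (parab_low _ Py) // mulr0.
by move=> i il; rewrite (parab_high _ Px) // mul0r.
Qed.

Lemma blk1 : blk 1%:M = 1%:M.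
by apply/matrixP=> a b; rewrite !mxE (inj_eq (@row_inj n l m lm)). Qed.
Lemma blkrep_M (x y : mgr S) : blk (\val (agM x y)) = blk (\val x) *m blk (\val y).
by apply: blkM; exact: mgP. Qed.
Lemma blkrep_O i j : @agO k (mgr S) (fun x => blk (\val x) i j).
rewrite (_ : (fun x => _) = fun x : S => \val x (row i) (row j)); first exact: mgO_entry.
by apply/funext=> x; rewrite mxE.
Qed.

Definition blkrep : mrep (mgr S) m.+1 := MRep blk1 blkrep_M blkrep_O.

Lemma dualrep_1 : (blk (invmx (1%:M : 'M[k]_n)))^T = 1%:M.
by rewrite invmx1 blk1 trmx1. Qed.
Lemma dualrep_M (x y : mgr S) :
 (blk (invmx (\val (agM x y))))^T = (blk (invmx (\val x)))^T *m (blk (invmx (\val y)))^T.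
rewrite -trmx_mul -blkM; [|exact: mgV (mgP y)|exact: mgV (mgP x)].
congr (blk _)^T; have := congr1 (fun z : mgr S => \val (z : S)) (agV_M x y); exact.
Qed.

Lemma dualrep_O i j : @agO k (mgr S) (fun x => (blk (invmx (\val x)))^T i j).
rewrite (_ : (fun x => _) = fun x : S => invmx (\val x) (row j) (row i)); first exact: mgO_inv_entry.
by apply/funext=> x; rewrite !mxE.
Qed.

Definition dualrep : mrep (mgr S) m.+1 := MRep dualrep_1 dualrep_M dualrep_O.
End BlockReps.
Section LiftMatrix.
Context k (d : nat) (i : 'I_d.+1).

Definition liftmx : 'M[k]_(d, d.+1) := \matrix_(a, b) (b == lift i a)%:R.

Lemma liftmxE p (y : 'M[k]_(p, d.+1)) r a : (y *m liftmx^T) r a = y r (lift i a).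
rewrite mxE (bigD1 (lift i a)) //= big1 ?addr0; last first.
 by move=> j /negPf ji; rewrite !mxE ji mulr0.
by rewrite !mxE eqxx mulr1.
Qed.

Lemma liftmxK : liftmx *m liftmx^T = 1%:M.
by apply/matrixP=> a b; rewrite liftmxE !mxE (inj_eq lift_inj) eq_sym. Qed.
Lemma liftmx_lift p (y : 'M[k]_(p, d)) r a : (y *m liftmx) r (lift i a) = y r a.
rewrite mxE (bigD1 a) //= big1 ?addr0; last first.
 by move=> j /negPf ji; rewrite !mxE (inj_eq lift_inj) eq_sym ji mulr0.
by rewrite !mxE eqxx mulr1.
Qed.

Lemma liftmx_own p (y : 'M[k]_(p, d)) r : (y *m liftmx) r i = 0.
by rewrite mxE big1 // => j _; rewrite !mxE (negPf (neq_lift i j)) mulr0. Qed.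
Lemma liftmx_zc (y : 'rV[k]_d.+1) : y *m liftmx^T *m liftmx = zc i y.
apply/rowP=> b; rewrite [RHS]mxE; case: (unliftP i b) => [a ->|->].
 by rewrite liftmx_lift liftmxE eq_sym (negPf (neq_lift i a)).
by rewrite liftmx_own eqxx.
Qed.

Lemma liftmx_rho (x : 'M[k]_d.+1) (x' : 'M[k]_d) : (forall a, x (lift i a) i = 0) ->
 (forall a b, x (lift i a) (lift i b) = x' a b) -> liftmx *m x = x' *m liftmx.
move=> xi xx; apply/matrixP=> a b.
have -> : (liftmx *m x) a b = x (lift i a) b.
 rewrite mxE (bigD1 (lift i a)) //= big1 ?addr0; last first.
  by move=> j /negPf ji; rewrite !mxE ji mul0r.
 by rewrite !mxE eqxx mul1r.
case: (unliftP i b) => [c ->|->]; first by rewrite liftmx_lift xx.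
by rewrite liftmx_own xi.
Qed.
End LiftMatrix.

Lemma sym_ses k (S : agr k) d r (rho : mrep S d.+1) (rho' : mrep S d)
  (i : 'I_d.+1) (c : gchar S) (N : rmod S) :
 inf_field k ->
 (forall g j, rho g j i = if j == i then c g else 0) ->
 (forall g a b, rho g (lift i a) (lift i b) = rho' g a b) ->
 exists (f : rhom (tw c (SymP r rho N)) (SymP r.+1 rho N))
     (h : rhom (SymP r.+1 rho N) (SymP r.+1 rho' N)), ses f h.
move=> kinf rhoi rr; have Jr g : liftmx k i *m rho g = rho' g *m liftmx k i.
 by apply: liftmx_rho=> [a|//]; rewrite rhoi eq_sym (negPf (neq_lift i a)).
exists (sym_mul r rhoi N), (sym_res r Jr N).
by apply: ses_sym=> //; [exact: liftmxK|exact: liftmx_zc].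
Qed.

Section BorelWeights.
Context k (n : nat).
Notation B := (borel k n).

(** Weights are functions on nat so that one formula serves for every n and for arithmetic on
    positions. *)
Definition bwt (E : nat -> int) : gchar (mgr B) := bw k (fun i : 'I_n => E i).

Lemma bwt_eq E E' q : (forall i, (i < n)%N -> E i = E' i) -> bwt E q = bwt E' q.
by move=> EE; apply: eq_bigr=> i _; rewrite EE. Qed.
Lemma bwtD E E' F q : (forall i, (i < n)%N -> F i = E i + E' i) -> bwt F q = bwt E q * bwt E' q.
move=> FE; rewrite /bwt /= /wfun -big_split; apply: eq_bigr=> i _ /=.
by rewrite FE // expfzDr // (isol0 (@borel_isol k n i) (mgP q)).
Qed.

Lemma bwt0 E q : (forall i, (i < n)%N -> E i = 0) -> bwt E q = 1.
by move=> E0; apply: big1=> i _; rewrite E0 // expr0z. Qed.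

Definition at1 (l : nat) (c : int) : nat -> int := fun i => if i == l then c else 0.

Lemma bwt_at1 (i : 'I_n) c q : bwt (at1 i c) q = \val q i i ^ c.
rewrite /bwt /= /wfun (bigD1 i) //= /at1 eqxx big1 ?mulr1 // => j ji.
by have /negPf -> : (j : nat) != i by []; rewrite expr0z.
Qed.
End BorelWeights.

(** * Vanishing and duality on projective spaces *)

Section VChain.
Context k (n : nat) (R : mgrp k n) (M : rmod (mgr R)).
Notation B := (borel k n).
Hypothesis kinf : inf_field k.
Hypothesis BR : mgS B `<=` mgS R.
Notation Mb := (rres (mg_sub BR) M).
Notation bwt := (@bwt k n).
Notation at1 := at1.

Lemma borel_sub l m : mgS B `<=` mgS (parab k n l m).
by move=> x /(borelE l) [xp xU]; split=> // i j ij _; apply: xp=> //; rewrite /inblk addn1 ltnS; apply/negP=> /andP[li]; rewrite leqNgt (leq_ltn_trans li ij). Qed.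
(** The block contains the rows l and l + 1, so its representation extends from B to the parabolic
    of the line and can serve as coefficients in [hvan_P1]. *)
Lemma hvan_V1sym l bl bm (blm : (bl + bm < n)%N) E r j (BP : mgS B `<=` mgS (parab k n bl bm.+1)) :
 (l + 1 < n)%N -> mgS (parab k n l 2) `<=` mgS R -> E l.+1 = E l + 1 ->
 (bl <= l)%N -> (l < bl + bm)%N ->
 hvan (tw (bwt E) (SymP r (blkrep blm BP) Mb)) j /\ hvan (tw (bwt E) (SymP r (dualrep blm BP) Mb)) j.
move=> lm PR El bll lbl.
have PP : mgS (parab k n l 2) `<=` mgS (parab k n bl bm.+1).
 by apply: parab_le=> //; rewrite addn2 addnS ltnS.
pose N := rres (mg_sub PR) M.
have ec : E (lcol lm) = E (lrow lm ord0) + 1 by rewrite /= addn1 addn0.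
split.
 have := @hvan_P1 k n l lm kinf (fun i : 'I_n => E i) ec (SymP r (blkrep blm PP) N) j.
 apply: riso_hv; apply: riso_same=> g v; congr (_ *: _).
 by apply: fm_ext=> y /=; congr (@ra _ _ M _ _); exact/val_inj.
have := @hvan_P1 k n l lm kinf (fun i : 'I_n => E i) ec (SymP r (dualrep blm PP) N) j.
apply: riso_hv; apply: riso_same=> g v; congr (_ *: _).
by apply: fm_ext=> y /=; congr (@ra _ _ M _ _); exact/val_inj.
Qed.

Section Step.
Variables (l : nat) (lm : (l + 1 < n)%N).
Notation TT E r := (tw (bwt E) (SymP r (blkrep lm (@borel_sub l 2)) Mb)).

(** In the rank 2 block of the rows l and l + 1, the coordinate of the row l + 1 is an eigenvector
    of B and the quotient is a line. *)
Lemma TT_ses E E1 E2 r : (forall i, (i < n)%N -> E1 i = E i + at1 l.+1 1 i) ->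
 (forall i, (i < n)%N -> E2 i = E i + at1 l r.+1 i) ->
 exists (A C : rmod (mgr B)) (f : rhom A (TT E r.+1)) (h : rhom (TT E r.+1) C),
  [/\ ses f h, riso A (TT E1 r) & riso C (tw (bwt E2) Mb)].
move=> E1E E2E; have lm0 : (l + 0 < n)%N by rewrite addn0 (leq_trans _ lm) // ltnS leq_addr.
have := @sym_ses k (mgr B) 1 r (blkrep lm (@borel_sub l 2)) (blkrep lm0 (@borel_sub l 1))
  ord_max (bwt (at1 l.+1 1)) Mb kinf.
case.
- move=> g j; rewrite mxE; have -> : lrow lm ord_max = lcol lm by exact/val_inj.
 case: eqP=> [->|/eqP jm].
  have -> : l.+1 = lcol lm :> nat by rewrite /= addn1.
  by rewrite bwt_at1 expr1z; congr (\val g _ _); exact/val_inj.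
 have [gp _] := mgP g; apply: gp; last by rewrite /inblk andbF.
 by rewrite /= ltn_add2l; case: j jm => [[|[|j]] hj].
- by move=> g a b; rewrite !mxE; congr (\val g _ _); apply/val_inj; rewrite /= ?(ord1 a) ?(ord1 b).
move=> f [h fh]; exists _, _, (twm (bwt E) f), (twm (bwt E) h); split; first exact: ses_tw.
 by apply: tw_tw=> q; exact: bwtD.
apply: riso_trans (tw_tw _ (c := bwt E) (d := bwt (at1 l r.+1)) _).
 apply: riso_tw; apply: sym1_riso=> q; rewrite mxE.
 have e : l = lrow lm0 ord0 :> nat by rewrite /= addn0.
 by rewrite [X in at1 X _]e bwt_at1 -exprnP.
by move=> q; exact: bwtD.
Qed.

Lemma TT0 E : riso (TT E 0) (tw (bwt E) Mb).
by apply: riso_tw; exact: sym0_riso. Qed.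
Lemma TT_V1 E r j : mgS (parab k n l 2) `<=` mgS R -> E l.+1 = E l + 1 -> hvan (TT E r) j.
by move=> PR El; apply: (hvan_V1sym _ _ _ _ lm PR El _ _).1 => //; rewrite addn1. Qed.
End Step.

Lemma parab_in i : mgS (parab k n 0 i.+2) `<=` mgS R ->
 mgS (parab k n 0 i.+1) `<=` mgS R /\ mgS (parab k n i 2) `<=` mgS R.
by move=> PR; split; apply: subset_trans PR; apply: parab_le=> //; rewrite ?add0n ?addn2. Qed.
(** These are the bundles O(-y) with 1 <= y <= i on projective i-space. A weight in position l + 1
    is lowered to 1 by passing to symmetric powers of the rank 2 block, where degree -1 along a line
    applies; the remaining terms are instances of the claim for projective l-space. *)
Lemma vchain i y E j : (i < n)%N -> mgS (parab k n 0 i.+1) `<=` mgS R ->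
 (forall l, (l < i)%N -> E l = 0) -> E i = y%:Z -> (0 < y <= i)%N -> hvan (tw (bwt E) Mb) j.
elim: i y E j => [|l IH] y E j ln PR E0 Ey; first by case: y Ey.
have lm : (l + 1 < n)%N by rewrite addn1.
have [PR0 PR2] := parab_in PR.
(* The bound a + r <= l keeps the weight of the quotient terms in the range of the induction
   hypothesis. *)
suff H a r F : (forall x, (x <= l)%N -> F x = 0) -> F l.+1 = a.+1%:Z -> (a + r <= l)%N ->
  forall i, hvan (tw (bwt F) (SymP r (blkrep lm (@borel_sub l 2)) Mb)) i.
 move=> /andP[y0 yl]; apply: riso_hv (riso_sym (TT0 lm E)) _.
 by apply: (H y.-1) => //; [rewrite prednK|rewrite addn0 -ltnS prednK].
elim: a r F => [|a IHa] r F F0 Fl ar i'.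
 by apply: TT_V1=> //; rewrite Fl F0.
pose F0' := fun x => if x == l.+1 then a.+1%:Z else F x.
have [A [C [f [h [fh rA rC]]]]] := @TT_ses l lm F0' F (fun x => F0' x + at1 l r.+1 x) r
 (fun x _ => ltac:(rewrite /F0' /at1; case: eqP=> [->|]; rewrite ?addr0 // Fl; lia)) (fun _ _ => erefl).
have hB q : hvan (tw (bwt F0') (SymP r.+1 (blkrep lm (@borel_sub l 2)) Mb)) q.
 apply: IHa; rewrite /F0' ?eqxx // ?addnS // => x xl.
 by rewrite ltn_eqF // F0.
have hC q : hvan C q.
 apply: riso_hv rC _; apply: (IH r.+1); [exact: ltnW|exact: PR0 | | |].
 - by move=> x xl; rewrite /F0' /at1 (ltn_eqF xl) (ltn_eqF (leqW xl)) F0 ?addr0 // ltnW.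
 - by rewrite /F0' /at1 (ltn_eqF (ltnSn l)) eqxx F0 // add0r.
 - by rewrite /= (leq_trans _ ar) // addSn ltnS leq_addl.
apply: riso_hv (riso_sym rA) _.
by case: i'=> [|i']; [apply: (hvan_sub0 fh)|apply: (hvan_sub fh)].
Qed.

(** The canonical weight of projective i-space on the positions 0, ..., i, normalised to have the
    same total as (1, ..., 1). *)
Definition vtop (i : nat) (E : nat -> int) : nat -> int :=
 fun x => if (x < i)%N then 0 else if x == i then i.+1%:Z else E x.

(* Serre duality on projective i-space, in the direction needed here *)
Lemma vshift i E j : (i < n)%N -> mgS (parab k n 0 i.+1) `<=` mgS R ->
 (forall l, (l <= i)%N -> E l = 1) -> hvan (tw (bwt (vtop i E)) Mb) (j + i) ->
 hvan (tw (bwt E) Mb) j.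
elim: i E j => [|l IH] E j ln PR E1 hv.
 rewrite addn0 in hv; apply: riso_hv hv; apply: tw_eq=> q; apply: bwt_eq=> x _.
 by rewrite /vtop ltn0; case: eqP=> // ->; rewrite E1.
have lm : (l + 1 < n)%N by rewrite addn1.
have [PR0 PR2] := parab_in PR.
pose F a : nat -> int := fun x => if (x <= l)%N then 0 else if x == l.+1 then a.+1%:Z else E x.
have FS a x : F a.+1 x = F a x + at1 l.+1 1 x.
 rewrite /F /at1; case: leqP=> [xl|lx]; first by rewrite ltn_eqF ?addr0.
 by case: eqP=> _; rewrite ?addr0 //; lia.
have step a r := @TT_ses l lm (F a) (F a.+1) (fun x => F a x + at1 l r.+1 x) r
 (fun x _ => FS a x) (fun _ _ => erefl).
(* For r = 0 the weight [F l.+1] is that of [vtop]. Each unit of weight given up adds one symmetric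
   power, and the third terms vanish by [vchain]. *)
have H r a : (a + r = l)%N -> hvan (tw (bwt (F a.+1)) (SymP r (blkrep lm (@borel_sub l 2)) Mb)) (j + l.+1).
 elim: r a => [|r IHr] a ar.
  apply: riso_hv (TT0 lm _) _; apply: riso_hv hv; apply: tw_eq=> q; apply: bwt_eq=> x _.
  by rewrite /F /vtop ltnS -ar addn0; case: leqP.
 have [A [C [f [h [fh rA rC]]]]] := step a.+1 r.
 apply: (hvan_mid fh); first by apply: riso_hv rA _; apply: IHr; rewrite addSnnS.
 apply: riso_hv rC _; apply: (vchain (i := l) (y := r.+1)) => //.
 - exact: ltnW.
 - by move=> x xl; rewrite /F /at1 (ltnW xl) (ltn_eqF xl) addr0.
 - by rewrite /F /at1 leqnn eqxx add0r.
 - by rewrite -ar ltn_addl.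
have [A [C [f [h [fh rA rC]]]]] := step 0%N l.
apply: (IH E j) => //; [exact: ltnW|by move=> x xl; apply: E1; exact: leqW |].
have hC : hvan C (j + l).
 apply: (hvan_quot fh); first by apply: TT_V1=> //; rewrite /F leqnn ltnn eqxx.
 by apply: riso_hv rA _; rewrite -addnS; apply: H.
apply: riso_hv hC; apply: riso_trans (riso_sym rC); apply: tw_eq=> q; apply: bwt_eq=> x _.
rewrite /vtop /F /at1; have [xl|lx|xl] := ltngtP x l; rewrite ?addr0 ?add0r //.
by case: eqP=> // ->; rewrite E1.
Qed.
End VChain.

(** * Acyclicity of the coordinate ring over the Borel subgroup *)

Section Acyclicity.
Context k (n : nat).
Notation B := (borel k n).
Notation bwt := (@bwt k n).
Hypothesis kinf : inf_field k.

Lemma detO (S : mgrp k n) : @agO k (mgr S) (fun x => \det (\val x)).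
by apply: (fa_det (mgO_alg S)) => i j; exact: mgO_entry. Qed.

Definition detchar (S : mgrp k n) : gchar (mgr S).
by exists (fun x => \det (\val x)); [exact: detO|exact: det1|move=> x y; exact: det_mulmx].
Defined.

Lemma borel_det (q : mgr B) : \det (\val (q : B)) = bwt (fun=> 1) q.
rewrite det_trig; first by apply: eq_bigr=> i _; rewrite expr1z.
by apply/is_trig_mxP=> i j ij; have [qp _] := mgP q; apply: qp=> //; rewrite /inblk andbF.
Qed.

Lemma parab_isol m (i : 'I_n) : (m <= i)%N -> isolrow (parab k n 0 m) i.
move=> mi x y [xp _] [yp _]; rewrite mxE (bigD1 i) //= big1 ?addr0 // => j.
rewrite -val_eqE neq_ltn => /orP[ji|ij].
 by rewrite yp ?mulr0 // /inblk add0n -leqNgt.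
by rewrite xp ?mul0r // /inblk add0n -leqNgt (leq_trans mi) // ltnW.
Qed.

Lemma vtop_isol m (i : 'I_n) : vtop m (fun=> 1) i != 0 -> isolrow (parab k n 0 m) i.
by rewrite /vtop; case: ltnP=> // mi _; exact: parab_isol. Qed.

(* Regular functions on a block parabolic, by induction on the size of the    *)
(* block: vanishing above the dimension m of projective m-space is moved down *)
(* to degree 1 by duality.                                                    *)
Lemma hvan_parab_ind m (HG : mgS B `<=` mgS (parab k n 0 m)) (W : lmodType k) j : (m <= n)%N ->
 hvan (rres (mg_sub HG) (ind (mgr (parab k n 0 m)) W)) j.+1.
elim: m HG W j => [|m IH] HG W j mn.
 apply: (@riso_hv _ _ _ (ind (mgr B) W)); last by apply: relinj_hvan; exact: relinj_ind.
 by apply: riso_same=> g F; apply: fm_ext=> x /=; congr (fm_fun F _); exact/val_inj.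
pose P := parab k n 0 m.+1; pose N := ind (mgr P) W.
(* Twisting k[P] by the determinant changes nothing, and on B the determinant has the weight (1,
   ..., 1) to which [vshift] applies. *)
suff H : hvan (tw (bwt (fun=> 1)) (rres (mg_sub HG) N)) j.+1.
 apply: riso_hv H; apply: riso_trans (riso_res (mg_sub HG) (ind_tw (detchar P) W)) _.
 by apply: riso_same=> g F; congr (_ *: _); exact: (borel_det g).
apply: (@vshift _ _ P N kinf HG m) => //.
have lm : (0 + m < n)%N by rewrite add0n.
pose Q := parab k n 0 m; have QE x : mgS Q x <-> mgS (parab k n 0 m) x by [].
have BQ : mgS B `<=` mgS Q by exact: borel_sub.
(* The weight produced by duality extends to a character of [Q], so [hvan_parab] applies in degree j
   + 1 + m, which exceeds m. *)
pose c : gchar (mgr Q) := wchar (@vtop_isol m).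
have hA i W' : hvan (rres (mg_sub BQ) (ind (mgr Q) W')) i.+1 by apply: IH; exact: ltnW.
have := @hvan_parab k n 0 m lm Q QE (mgr B) (mg_sub BQ) c (fun W' i => hA i W') W (j.+1 + m).
rewrite addSn ltnS leq_addl => /(_ isT); apply: riso_hv; apply: riso_same=> g v.
by congr (_ *: _); apply: fm_ext=> x /=; congr (fm_fun v _); exact/val_inj.
Qed.

Definition gl : mgrp k n := parab k n 0 n.

Lemma glE x : mgS gl x <-> x \in unitmx.
split=> [[] //|xU]; split=> // i j ij; by rewrite /inblk leq0n add0n ltn_ord.
Qed.

Lemma borel_gl : mgS B `<=` mgS gl.
exact: borel_sub. Qed.
Lemma hvan_gl_ind (W : lmodType k) j : hvan (rres (mg_sub borel_gl) (ind (mgr gl) W)) j.+1.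
exact: hvan_parab_ind. Qed.
End Acyclicity.

Lemma riso_bij k (S : agr k) (N M : rmod S) (f : rhom N M) :
 injective f -> (forall w, exists v, f v = w) -> riso N M.
move=> fi /choice[g gf]; have fg v : g (f v) = v by apply: fi; rewrite gf.
have lg : linear g by move=> c u v; apply: fi; rewrite linearP !gf.
have eg x v : g (ra x v) = ra x (g v) by apply: fi; rewrite rh_eq !gf.
by exists f, (mkrh lg eg).
Qed.

(** * Global functions on the flag variety are constant *)

Section Constants.
Context k (n : nat).
Hypothesis kinf : inf_field k.
Variables (p : 'M[k]_n -> k) (L : nat).
Hypothesis pp : mpf p.
Let F (x : 'M[k]_n) : k := p x / \det x ^+ L.
Hypothesis FB : forall x b, x \in unitmx -> mgS (borel k n) b -> F (x *m b) = F x.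

(** A regular function on the projective line is constant, so it takes the same value at its two
    ends. *)
Lemma poly_ends (P Q : {poly k}) : (forall t, t != 0 -> P.[t] = Q.[t^-1]) -> P.[0] = Q.[0].
move=> PQ; have : root (P - P.[0]%:P) 0 by rewrite rootE hornerD hornerN hornerC subrr.
move=> /factor_theorem[P1 P1E]; rewrite subr0 in P1E.
have [|_ Q0] := @pline_meet k P1 (Q - P.[0]%:P) 1 kinf (oner_neq0 _).
 move=> t t0; have := congr1 (fun q : {poly k} => q.[t]) P1E.
 rewrite !(hornerD, hornerN, hornerC, hornerM, hornerX) PQ // => ->.
 by rewrite mul1r mulrC mulfK.
by apply/eqP; rewrite eq_sym -subr_eq0 -[P.[0]](hornerC _ 0) -hornerN -hornerD Q0 horner0.
Qed.

Lemma pline_F (x : 'M[k]_n) (V W : k -> 'M[k]_n) :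
 (forall i j, pline (fun t => V t i j)) -> (forall i j, pline (fun t => W t i j)) ->
 (forall t, V t *m W t = 1%:M) -> pline (fun t => F (x *m V t)).
move=> PV PW VW; have PA := pline_alg k.
rewrite (_ : (fun t => _) = fun t => p (x *m V t) * ((\det x)^-1 * \det (W t)) ^+ L).
 apply: (faM PA).
  apply: (fa_comp PA) => // i j; apply: (fa_mulmx PA) => // a b; exact: (faC PA).
 by apply: (faX PA); apply: (faM PA); [exact: (faC PA)|exact: (fa_det PA)].
apply/funext=> t; rewrite /F -exprVn det_mulmx invfM; congr (_ * (_ * _) ^+ _).
have := congr1 determinant (VW t); rewrite det_mulmx det1 => e.
have d0 : \det (V t) != 0 by apply/eqP=> d0; move/eqP: e; rewrite d0 mul0r eq_sym oner_eq0.
by apply: (mulfI d0); rewrite divff.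
Qed.

(** The cosets of x and of its product with the transposition are the two ends of a projective line
    in GL_n/B, covered by the affine lines [u] and [y]: [u t] and [y t^-1] lie in the same coset. *)
Lemma F_tperm (x : 'M[k]_n) (i j : 'I_n) : (i < j)%N -> x \in unitmx ->
 F (x *m tperm_mx i j) = F x.
move=> ij xU; have PA := pline_alg k.
have ji : (j == i) = false by rewrite eq_sym -val_eqE (ltn_eqF ij).
have line a b (c : k) : forall u v, pline (fun t => (1%:M + (c * t) *: delta_mx a b : 'M[k]_n) u v).
 move=> u v; rewrite (_ : (fun t => _) = fun t => (1%:M : 'M[k]_n) u v + c * t * (delta_mx a b : 'M[k]_n) u v).
  apply: (faD PA); first exact: (faC PA).
  by apply: (faM PA); [apply: (faM PA); [exact: (faC PA)|exact: plineX]|exact: (faC PA)].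
 by apply/funext=> t; rewrite !mxE.
have inv a b (t : k) : (b == a) = false ->
  (1%:M + (1 * t) *: delta_mx a b) *m (1%:M + (-1 * t) *: delta_mx a b) = 1%:M :> 'M[k]_n.
 move=> ba; rewrite mulmxDl !mulmxDr !mul1mx mulmx1 -scalemxAl -scalemxAr mul_delta_mx_cond ba.
 by rewrite mulr0n !scaler0 addr0 -addrA -scalerDl mul1r mulN1r addNr scale0r addr0.
pose u t : 'M[k]_n := 1%:M + (1 * t) *: delta_mx i j.
pose y t : 'M[k]_n := (1%:M + (1 * t) *: delta_mx j i) *m tperm_mx i j.
have [P PE] : pline (fun t => F (x *m u t)).
 by apply: (@pline_F x u (fun t => 1%:M + (-1 * t) *: delta_mx i j)) => [||t]; [exact: line|exact: line|exact: inv].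
have [Q QE] : pline (fun t => F (x *m y t)).
 apply: (@pline_F x y (fun t => tperm_mx i j *m (1%:M + (-1 * t) *: delta_mx j i))).
 - by apply: (fa_mulmx PA) => [|a b]; [exact: line|exact: (faC PA)].
 - by apply: (fa_mulmx PA) => [a b|]; [exact: (faC PA)|exact: line].
 - by move=> t; rewrite /y mulmxA -[_ *m tperm_mx i j *m _]mulmxA tperm2_mx mulmx1 inv // -val_eqE (ltn_eqF ij).
have u0 : u 0 = 1%:M by rewrite /u mulr0 scale0r addr0.
have y0 : y 0 = tperm_mx i j by rewrite /y mulr0 scale0r addr0 mul1mx.
rewrite -y0 -[in RHS](mulmx1 x) -u0 QE PE; apply/esym/poly_ends=> t t0.
rewrite -PE -QE; pose b := tperm_mx i j *m ((1%:M + (-1 * t^-1) *: delta_mx j i) *m u t).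
have ub : u t = y t^-1 *m b.
 rewrite /y /b [RHS]mulmxA -[X in _ = X *m _]mulmxA tperm2_mx mulmx1 mulmxA inv ?mul1mx //.
 by rewrite -val_eqE (ltn_eqF ij).
have uU : u t \in unitmx by have [] := mulmx1_unit (inv i j t ji).
have : y t^-1 *m b \in unitmx by rewrite -ub.
rewrite unitmx_mul => /andP[yU bU].
have xyU : x *m y t^-1 \in unitmx by rewrite unitmx_mul xU.
rewrite ub mulmxA FB //; split=> // a c ac _.
rewrite /b /tperm_mx -row_permE mxE /u mulmxDl !mulmxDr !mul1mx mulmx1 -scalemxAl -scalemxAr mul_delta_mx.
rewrite scalerA mul1r mulN1r mulNr mulVf // scaleN1r !mxE.
case: tpermP=> [ai|aj|/eqP /negPf ai /eqP /negPf aj].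
- have ci : (c == i) = false by rewrite -val_eqE -ai gtn_eqF.
 by rewrite eqxx ci ji /= (eq_sym j c); ring.
- have cj : (c == j) = false by rewrite -val_eqE -aj gtn_eqF.
 have ic : (i == c) = false by rewrite -val_eqE ltn_eqF // (ltn_trans ij) // -aj.
 by rewrite !eqxx cj ic eq_sym ji /=; ring.
- by rewrite ai aj -val_eqE (ltn_eqF ac) /=; ring.
Qed.

Lemma F_perm (x : 'M[k]_n) (s : 'S_n) : x \in unitmx -> F (x *m perm_mx s) = F x.
have [ts -> _] := prod_tpermP s; elim: ts x => [|[i j] ts IH] x xU.
 by rewrite big_nil perm_mx1 mulmx1.
rewrite big_cons perm_mxM mulmxA IH /=; last by rewrite unitmx_mul xU unitmx_perm.
case: (ltngtP i j) => [ij|ij|/val_inj ->].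
- exact: F_tperm.
- by rewrite tpermC; exact: F_tperm.
- by rewrite tperm1 perm_mx1 mulmx1.
Qed.
End Constants.

(** From transpositions one passes to all permutation matrices, hence to the opposite Borel
    subgroup, which is conjugate to B by the reversal. An LUP factorisation then reaches every
    invertible matrix. *)
Lemma borel_invariant_const k n (p : 'M[k]_n -> k) L :
 inf_field k -> mpf p ->
 (forall x b, x \in unitmx -> mgS (borel k n) b ->
   p (x *m b) / \det (x *m b) ^+ L = p x / \det x ^+ L) ->
 forall x, x \in unitmx -> p x / \det x ^+ L = p 1%:M / \det (1%:M : 'M[k]_n) ^+ L.
case: n p => [|n] p kinf pp FB x xU.
 by rewrite (_ : x = 1%:M) //; apply/matrixP=> -[].
pose F (y : 'M[k]_n.+1) := p y / \det y ^+ L; rewrite -!/(F _).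
have FP y (s : 'S_n.+1) : y \in unitmx -> F (y *m perm_mx s) = F y by exact: F_perm.
have := cormen_lup_correct x; case E: (cormen_lup x) => [[P A] U] /= e.
have [s Ps] : exists s, P = perm_mx s.
 by have := cormen_lup_perm x; rewrite E /= => /is_perm_mxP[s ->]; exists s.
have lA (i j : 'I_n.+1) : (i < j)%N -> A i j = 0.
 move=> ij; have := cormen_lup_lower x (ltnW ij); rewrite E /= => ->.
 by rewrite -val_eqE (ltn_eqF ij).
have lU (i j : 'I_n.+1) : (j < i)%N -> U i j = 0.
 by move=> ij; have := cormen_lup_upper x ij; rewrite E.
have PxU : P *m x \in unitmx by rewrite unitmx_mul Ps unitmx_perm.
move: (PxU); rewrite [P *m x]e unitmx_mul => /andP[AU UU].
pose r : 'S_n.+1 := perm rev_ord_inj.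
have rr : (r * r)%g = 1%g by apply/permP=> i; rewrite permM !permE /= rev_ordK.
have rV : (r^-1)%g = r by apply/eqP; rewrite eq_invg_mul rr.
have r2 : perm_mx r *m perm_mx r = 1%:M :> 'M[k]_n.+1 by rewrite -perm_mxM rr perm_mx1.
have FU y : y \in unitmx -> F (y *m U) = F y.
 move=> yU; pose b := perm_mx r *m U *m perm_mx r.
 have -> : y *m U = y *m perm_mx r *m b *m perm_mx r.
  by rewrite /b !mulmxA -[y *m perm_mx r *m _]mulmxA r2 mulmx1 -!mulmxA r2 mulmx1.
 have bU : b \in unitmx by rewrite !unitmx_mul UU unitmx_perm.
 have yrU : y *m perm_mx r \in unitmx by rewrite unitmx_mul yU unitmx_perm.
 rewrite FP; last by rewrite unitmx_mul yrU.
 rewrite /F FB // -/(F _); first exact: FP.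
 split=> // i j ij _; rewrite /b -{2}rV -col_permE -row_permE !mxE !permE lU //=.
 by have := ltn_ord j; have := ltn_ord i; lia.
have -> : x = 1%:M *m perm_mx s^-1%g *m A *m U.
 rewrite -[_ *m A *m U]mulmxA -[A *m U]e Ps mul1mx mulmxA -perm_mxM mulVg perm_mx1.
 exact/esym/mul1mx.
have sU : 1%:M *m perm_mx s^-1%g \in (unitmx : {pred 'M[k]_n.+1}).
 by rewrite mul1mx unitmx_perm.
rewrite FU; last by rewrite unitmx_mul sU.
rewrite /F FB // -/(F _); last by split=> // i j ij _; exact: lA.
by apply: FP; exact: unitmx1.
Qed.

Section GlobalConstants.
Context k (n : nat).
Hypothesis kinf : inf_field k.
Notation B := (borel k n).
Notation G := (gl k n).
Notation O := (ind (mgr G) (k^o : lmodType k)).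
Notation Ob := (rres (mg_sub (@borel_gl k n)) O).

Lemma fmk_const (X : Type) (A : set (X -> k)) (c : k) : A (fun=> 1) ->
 fsp A (fun=> c : k^o).
move=> A1; rewrite (_ : (fun=> _) = fun=> 1 *: (c : k^o) + 0).
 by apply: fspD=> //; exact: fsp0.
by apply/funext=> x; rewrite scale1r addr0.
Qed.

Lemma invt_O (f : Ob) : invt f -> forall x, fm_fun f x = fm_fun f ag1.
move=> fi; have [p [L [pp pE]]] : @mgO k n G (f : fmod _ _).
 by apply: fsp_scalar (fmP (f : fmod _ _)); exact: (agO_sub (mgr G)).
move=> x; rewrite !pE; apply: borel_invariant_const=> //; last exact: mgU (mgP x).
move=> y b yU Bb; have Gy : mgS G y by apply/glE.
have := congr1 (fun h : fmod _ _ => h (mgE Gy)) (fi (mgE Bb)).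
by rewrite /= !pE.
Qed.
End GlobalConstants.

(** * Symmetric powers of the quotient bundles *)

Section DualChain.
Context k (n : nat).
Hypothesis kinf : inf_field k.
Notation B := (borel k n).
Notation G := (gl k n).
Notation bwt := (@bwt k n).
Notation Mb M := (rres (mg_sub (@borel_gl k n)) M).

Lemma parab_gl l m : mgS (parab k n l m) `<=` mgS G.
by move=> x [_ xU]; apply/glE. Qed.

(* Sym^r of the quotient by the subspace of the flag of dimension s, with the *)
(* weight E; the quotient has dimension m + 1 = n - s *)
Definition Dmod s m (sm : (s + m < n)%N) r (E : nat -> int) (M : rmod (mgr G)) : rmod (mgr B) :=
 tw (bwt E) (SymP r (dualrep sm (@borel_sub k n s m.+1)) (Mb M)).

Lemma Dmod_ses s m (sm : (s + m.+1 < n)%N) (sm' : (s.+1 + m < n)%N) r E E' M :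
 (forall i, (i < n)%N -> E' i = E i + at1 s (-1) i) -> (s + m.+1 = n.-1)%N ->
 exists (A : rmod (mgr B)) (f : rhom A (Dmod sm r.+1 E M))
   (h : rhom (Dmod sm r.+1 E M) (Dmod sm' r.+1 E M)),
  ses f h /\ riso A (Dmod sm r E' M).
move=> EE smn; have s0 : s = lrow sm ord0 :> nat by rewrite /= addn0.
have := @sym_ses k (mgr B) m.+1 r (dualrep sm (@borel_sub k n s m.+2))
 (dualrep sm' (@borel_sub k n s.+1 m.+1)) ord0 (bwt (at1 s (-1))) (Mb M) kinf.
case.
- move=> g j; rewrite !mxE; have [gp gU] := mgV (mgP g); case: eqP=> [->|/eqP j0].
  rewrite [X in at1 X _]s0 bwt_at1; have iB := @borel_isol k n (lrow sm ord0).
  have x0 := isol0 iB (mgP g).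
  by apply: (mulfI x0); rewrite (isolV iB (mgP g)) exprN1 divff.
 apply: gp; last by rewrite /inblk andbF.
 by rewrite /= ltn_add2l lt0n.
- move=> g a b; rewrite !mxE; congr (invmx (\val g) _ _); apply/val_inj=> /=.
  by rewrite /bump /= add1n addnS addSn.
 by rewrite /bump /= add1n addnS addSn.
move=> f [h fh]; exists _, (twm (bwt E) f), (twm (bwt E) h).
split; first exact: ses_tw.
by apply: tw_tw=> q; exact: bwtD.
Qed.

Lemma Dmod_0 s m (sm : (s + m < n)%N) E M : riso (Dmod sm 0 E M) (tw (bwt E) (Mb M)).
by apply: riso_tw; exact: sym0_riso. Qed.
Lemma Dmod_line s (sm : (s + 0 < n)%N) r E E' M :
 (forall i, (i < n)%N -> E' i = E i + at1 s (- r%:Z) i) ->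
 riso (Dmod sm r E M) (tw (bwt E') (Mb M)).
move=> EE; have s0 : s = lrow sm ord0 :> nat by rewrite /= addn0.
apply: riso_trans (tw_tw _ (c := bwt E) (d := bwt (at1 s (- r%:Z))) _); last by move=> q; exact: bwtD.
apply: riso_tw; apply: sym1_riso=> q; rewrite !mxE [X in at1 X _]s0 bwt_at1.
have iB := @borel_isol k n (lrow sm ord0); have x0 := isol0 iB (mgP q).
rewrite -exprz_inv -exprnP; congr (_ ^+ _).
by apply: (mulfI x0); rewrite (isolV iB (mgP q)) divff.
Qed.

(* Over the full flag variety, Sym^r of the trivial bundle of rank n *)
Lemma Dmod_full m (sm : (0 + m < n)%N) r E M : (m.+1 = n)%N ->
 exists M' : rmod (mgr G), riso (Dmod sm r E M) (tw (bwt E) (Mb M')).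
move=> mn; have GP : mgS G `<=` mgS (parab k n 0 m.+1) by rewrite mn.
exists (SymP r (dualrep sm GP) M); apply: riso_same=> g v; congr (_ *: _).
exact: fm_ext.
Qed.

(** Induction on s, starting from the symmetric power of the trivial bundle, a GL_n-module. From s
    to s + 1, the kernel of the restriction has weights -1 and 0 in positions s and s + 1 and dies
    along a projective line. *)
Lemma hvan_Dmod s m (sm : (s + m < n)%N) r E M : (s + m.+1 = n)%N -> (0 < m)%N ->
 (forall i, (i <= s)%N -> E i = 0) ->
 (forall M' j, hvan (tw (bwt E) (Mb M')) j) -> forall j, hvan (Dmod sm r E M) j.
elim: s m sm r => [|s IH] m sm r smn m0 E0 hM j.
 by have [|M' i] := @Dmod_full m sm r E M; [by []|exact: riso_hv i (hM _ _)].
have sm1 : (s + m.+1 < n)%N by rewrite addnS -addSn.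
have V0 r' i : hvan (Dmod sm1 r' E M) i.
 by apply: IH=> //; [rewrite addnS -addSn|move=> x xs; apply: E0; exact: leqW].
case: r=> [|r].
 by apply: riso_hv (riso_trans (Dmod_0 sm E M) (riso_sym (Dmod_0 sm1 E M))) _.
have [|A [f [h [fh rA]]]] := @Dmod_ses s m sm1 sm r E (fun i => E i + at1 s (-1) i) M (fun _ _ => erefl).
 by lia.
apply: (hvan_quot fh) => //; apply: riso_hv rA _.
have s2 : (s + 1 < n)%N by rewrite addn1 (leq_ltn_trans _ sm) // leq_addr.
have [|||_ H] := @hvan_V1sym k n G M kinf (@borel_gl k n) s s m.+1 sm1 (fun i => E i + at1 s (-1) i) r j.+1
 (@borel_sub k n s m.+2) s2 (@parab_gl s 2) => //.
- by rewrite /at1 eqxx !E0 // ?(gtn_eqF (ltnSn s)) // addr0 add0r addNr.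
- by rewrite addnS ltnS leq_addr.
Qed.
End DualChain.
Section HvanAll.
Context k (S : agr k) (A B C : rmod S) (f : rhom A B) (g : rhom B C).
Hypothesis fg : ses f g.

Lemma hvan_sub_all : (forall j, hvan B j) -> (forall j, hvan C j) -> forall j, hvan A j.
by move=> hB hC [|j]; [apply: (hvan_sub0 fg)|apply: (hvan_sub fg)]. Qed.
End HvanAll.

(** * Reduction of hooks to a quotient of rank two *)

Section HookReduction.
Context k (q : nat).
Hypothesis kinf : inf_field k.
Notation n := q.+2.
Notation B := (borel k n).
Notation G := (gl k n).
Notation bwt := (@bwt k n).
Notation Mb M := (rres (mg_sub (@borel_gl k n)) M).

(* the row weights of (-d, a, 1^b), where s = q - b *)
Definition wH (d a s : nat) : nat -> int := fun i =>
 if i == q.+1 then d%:Z else if i == q then - a%:Z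
 else if (s <= i)%N && (i < q)%N then -1 else 0.

Lemma wH_low d a s i : (i < s)%N -> (s <= q)%N -> wH d a s i = 0.
move=> si sq; rewrite /wH !ltn_eqF ?(leq_trans si) //; last exact: leqW.
by rewrite leqNgt si.
Qed.

Lemma q1 : (q + 1 < n)%N. Proof. by rewrite addn1. Qed.
Lemma q0 : (q.+1 + 0 < n)%N. Proof. by rewrite addn0. Qed.
(** Induction on c. The Koszul sequence relates the pair (c + 1, N) to (c, N + 1) and to a line
    where x is lowered by N + 1; the case c = 0 is [hvan_Dmod] combined with [vchain]. *)
Lemma hvan_hook0 c N x (M : rmod (mgr G)) j : (c + N < x < n)%N -> hvan (Dmod q1 N (wH x c q) M) j.
elim: c N x M j => [|c IH] N x M j.
 move=> /andP[Nx xn]; apply: (hvan_Dmod kinf) => //; first by rewrite addn2.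
  move=> i iq; rewrite /wH ltn_eqF ?ltnS //; case: eqP=> // _.
  by rewrite andbC; case: ltnP.
 move=> M' i; apply: (@vchain k n G M' kinf (@borel_gl k n) q.+1 x) => //.
 - move=> l lq; rewrite /wH ltn_eqF //; case: eqP=> // _.
  by rewrite andbC; case: ltnP.
 - by rewrite /wH eqxx.
 - by rewrite (leq_ltn_trans _ Nx) // -ltnS.
move=> /andP[cNx xn].
have [|//|A [f [h [fh rA]]]] := @Dmod_ses k n kinf q 0 q1 q0 N (wH x c q) (wH x c.+1 q) M.
- move=> i _; rewrite /wH /at1; case: (i =P q.+1) => [->|_].
  by rewrite gtn_eqF // addr0.
 by case: eqP=> [_|_]; [lia|rewrite addr0].
- by rewrite addn1.
apply: riso_hv (riso_sym rA) _; apply: (hvan_sub_all fh) => {}j.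
 by apply: IH; rewrite addnS -addSn cNx.
have lE i : (i < n)%N -> wH (x - N.+1) c q i = wH x c q i + at1 q.+1 (- N.+1%:Z) i.
 move=> _; rewrite /wH /at1; case: eqP=> [_|]; last by rewrite addr0.
 by have := cNx; lia.
apply: riso_hv (Dmod_line q0 M lE) _.
apply: riso_hv (riso_sym (Dmod_0 q1 _ _)) _; apply: IH.
by have := cNx; lia.
Qed.

(** The weight -1 in position s is traded for one more symmetric power, and the middle term of the
    exchange is acyclic by [hvan_Dmod]. *)
Lemma hook_ses s b (sm : (s + b.+2 < n)%N) (sm' : (s.+1 + b.+1 < n)%N) i d a (M : rmod (mgr G)) :
 (s.+1 + b = q)%N ->
 (forall M' j, hvan (tw (bwt (wH d a s.+1)) (Mb M')) j) ->
 exists (A X : rmod (mgr B)) (f : rhom A X) (h : rhom X (Dmod sm' i.+1 (wH d a s.+1) M)),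
  [/\ ses f h, riso A (Dmod sm i (wH d a s) M) & forall j, hvan X j].
move=> sb hM.
have [||A [f [h [fh rA]]]] := @Dmod_ses k n kinf s b.+1 sm sm' i (wH d a s.+1) (wH d a s) M.
- move=> x _; rewrite /wH /at1; case: (x =P q.+1) => [->|_]; first by rewrite gtn_eqF ?addr0 // -sb addSn -addnS leq_addr.
 case: (x =P q) => [->|_]; first by rewrite gtn_eqF ?addr0 // -sb addSn ltnS leq_addr.
 case: (ltngtP x s) => [xs|sx|->]; rewrite ?addr0 // ?leqnn /= ?add0r //.
 by rewrite -sb addSn ltnS leq_addr.
- by rewrite -sb !addnS addSn.
exists A, _, f, h; split=> // j; apply: (hvan_Dmod kinf) => //.
- by rewrite !addnS -sb addSn.
- by move=> x xs; apply: wH_low; rewrite ?ltnS // -sb leq_addr.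
Qed.

Lemma hvan_hook b s (sm : (s + b.+1 < n)%N) d a i (M : rmod (mgr G)) j : (s + b = q)%N ->
 (a + b + i < d < n)%N -> hvan (Dmod sm i (wH d a s) M) j.
elim: b s sm i M j => [|b IH] s sm i M j sb.
 rewrite !addn0 in sb *; move: sm; rewrite sb => sm abd.
 by rewrite (Prop_irrelevance sm q1); exact: hvan_hook0.
move=> /andP[abd dn].
have sb' : (s.+1 + b = q)%N by rewrite addSn -addnS.
have sm' : (s.+1 + b.+1 < n)%N by rewrite addSn -addnS.
have [|A [X [f [h [fh rA hX]]]]] := @hook_ses s b sm sm' i d a M sb'.
 move=> M' i'; apply: riso_hv (riso_sym (Dmod_0 sm' _ _)) _; apply: IH=> //.
 by rewrite addn0 dn andbT (leq_ltn_trans _ abd) // addnS addSn -addnS leq_addr.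
apply: riso_hv (riso_sym rA) _; apply: (hvan_sub_all fh) => // {}j.
by apply: IH=> //; rewrite dn andbT; lia.
Qed.

(** Each of the b entries 1 is exchanged by [hook_ses] for one symmetric power and one cohomological
    degree, until the quotient has rank 2. *)
Lemma hdim_hook b s (sm : (s + b.+1 < n)%N) d a i (M : rmod (mgr G)) : (s + b = q)%N ->
 d = (a + b + i)%N -> (d < n)%N ->
 (forall j D, hdim (Dmod q1 (b + i) (wH d a q) M) j D -> hdim (Dmod sm i (wH d a s) M) (j + b) D) /\
 (forall j, (j < b)%N -> hvan (Dmod sm i (wH d a s) M) j).
elim: b s sm i => [|b IH] s sm i sb de dn.
 split=> // j D; rewrite !addn0 in sb *; move: sm; rewrite sb => sm.
 by rewrite (Prop_irrelevance sm q1).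
have sb' : (s.+1 + b = q)%N by rewrite addSn -addnS.
have sm' : (s.+1 + b.+1 < n)%N by rewrite addSn -addnS.
have [|A [X [f [h [fh rA hX]]]]] := @hook_ses s b sm sm' i d a M sb'.
 move=> M' j; apply: riso_hv (riso_sym (Dmod_0 sm' _ _)) _; apply: hvan_hook=> //.
 by rewrite addn0 dn andbT de addnS addSn ltnS leq_addr.
have [] := IH s.+1 sm' i.+1 sb' _ dn; first by rewrite de addnS -addSn addnS.
move=> H1 H2; split=> [j D hD|j jb].
 apply: (riso_hdim rA); rewrite addnS; apply: (hdim_conn fh) => //.
 by apply: H1; rewrite addnS -addSn.
apply: riso_hv (riso_sym rA) _; case: j jb => [_|j jb]; first exact: (hvan_sub0 fh).
by apply: (hvan_sub fh) => //; exact: H2.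
Qed.
End HookReduction.

(** * Polynomial functions and divided derivatives *)

Section PolynomialFunctions.
Context k.
Hypothesis kinf : inf_field k.
Variable W : lmodType k.
Implicit Types (f g : k -> W) (c : nat -> W).

Definition pfun L c : k -> W := fun h => \sum_(i < L) h ^+ i *: c i.

Lemma pfun_inj L L' c c' : (forall h, pfun L c h = pfun L' c' h) ->
 (forall j, (L <= j)%N -> c j = 0) -> (forall j, (L' <= j)%N -> c' j = 0) ->
 forall j, c j = c' j.
move=> e cL cL' j; apply/eqP; rewrite -subr_eq0; apply: contraT=> /dual_sep[u u1].
pose P := \poly_(i < L) (u (c i) : k) - \poly_(i < L') (u (c' i) : k).
have P0 : P = 0.
 apply: kinf=> t _; rewrite hornerD hornerN !horner_poly.
 have := congr1 u (e t); rewrite /pfun !linear_sum => E.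
 have {}E : \sum_(i < L) t ^+ i * (u (c i) : k) = \sum_(i < L') t ^+ i * (u (c' i) : k).
  by transitivity (\sum_(i < L) u (t ^+ i *: c i) : k); [|rewrite E]; apply: eq_bigr=> i _; rewrite linearZ.
 apply/eqP; rewrite subr_eq0; apply/eqP.
 under eq_bigr do rewrite mulrC; rewrite E.
 by apply: eq_bigr=> i _; rewrite mulrC.
have := congr1 (fun p : {poly k} => p`_j) P0; rewrite coefB !coef_poly coef0.
have E1 : (if (j < L)%N then (u (c j) : k) else 0) = u (c j).
 by case: ltnP=> // /cL ->; rewrite linear0.
have E2 : (if (j < L')%N then (u (c' j) : k) else 0) = u (c' j).
 by case: ltnP=> // /cL' ->; rewrite linear0.
rewrite E1 E2 => /eqP; move: u1; rewrite linearB /= => -> /eqP.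
by move=> /eqP; rewrite (oner_eq0 k).
Qed.

(** Coefficients are unique because the field is infinite; the default 0 is met only when [f] is not
    polynomial. *)
Definition pcoef f (i : nat) : W :=
 xget 0 [set w | exists c L, [/\ forall h, f h = pfun L c h, forall j, (L <= j)%N -> c j = 0 & c i = w]].

Lemma pcoefE f L c i : (forall h, f h = pfun L c h) -> (forall j, (L <= j)%N -> c j = 0) ->
 pcoef f i = c i.
move=> fE cL; rewrite /pcoef; case: xgetP=> [w _ [c' [L' [fE' cL' <-]]]|/(_ (c i))].
 by apply: (pfun_inj _ cL' cL) => h; rewrite -fE' fE.
by case; exists c, L.
Qed.

(** The Hasse derivative, which keeps its meaning in characteristic p, where dividing the iterated
    derivative by q! does not. *)
Definition hasse (q : nat) f : k -> W := fun x => pcoef (fun h => f (x + h)) q.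

Lemma pfun_shift L c x h : pfun L c (x + h) =
 pfun L (fun i => \sum_(m < L) (x ^+ (m - i) *+ 'C(m, i)) *: c m) h.
rewrite /pfun; under eq_bigr do rewrite exprDn scaler_suml.
under [RHS]eq_bigr do rewrite scaler_sumr.
rewrite exchange_big /=; apply: eq_bigr=> m _.
rewrite (big_ord_widen L (fun i => (x ^+ (m - i) * h ^+ i *+ 'C(m, i)) *: c m)) //.
rewrite big_mkcond; apply: eq_bigr=> i _; rewrite ltnS scalerA mulrnAr [h ^+ i * _]mulrC.
by case: leqP=> // mi; rewrite bin_small // mulr0n scale0r.
Qed.

Lemma hasse_pfun q L c x : (forall j, (L <= j)%N -> c j = 0) ->
 hasse q (pfun L c) x = \sum_(m < L) (x ^+ (m - q) *+ 'C(m, q)) *: c m.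
move=> cL; rewrite /hasse (pcoefE (L := L) (c := fun i => \sum_(m < L) (x ^+ (m - i) *+ 'C(m, i)) *: c m)) //.
 by move=> h; rewrite pfun_shift.
by move=> j Lj; apply: big1=> m _; rewrite bin_small ?mulr0n ?scale0r // (leq_trans _ Lj).
Qed.

Definition polyle N : set (k -> k) := [set f | exists P : {poly k}, (size P <= N)%N /\ forall x, f x = P.[x]].

Lemma polyle_sub N : fsub (polyle N).
split; first by exists 0; rewrite size_poly0; split=> // x; rewrite horner0.
move=> c f g [P [sP Pf]] [Q [sQ Qg]]; exists (c *: P + Q); split=> [|x].
 by rewrite (leq_trans (size_polyD _ _)) // geq_max sQ (leq_trans (size_scale_leq _ _)).
by rewrite hornerD hornerZ Pf Qg.
Qed.

Lemma polyleP N f : fsp (polyle N) f <->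
 exists c, (forall j, (N <= j)%N -> c j = 0) /\ forall x, f x = pfun N c x.
split=> [|[c [cN fE]]].
 elim=> [|a w g [P [sP Pa]] _ [c [cN gE]]].
  by exists (fun=> 0); split=> // x; rewrite /pfun big1 // => i _; rewrite scaler0.
 exists (fun j => P`_j *: w + c j); split=> [j Nj|x].
  by rewrite cN // addr0 nth_default ?scale0r // (leq_trans sP).
 rewrite gE Pa /pfun (horner_coef_wide _ sP) scaler_suml -big_split; apply: eq_bigr=> i _ /=.
 by rewrite scalerDr scalerA mulrC.
rewrite (_ : f = fun x => \sum_(i < N) x ^+ i *: c i); last by apply/funext.
apply: fsp_sum=> i; apply: fsp1; exists 'X^i; rewrite size_polyXn; split=> // x.
by rewrite hornerXn.
Qed.

Lemma fsp_hasse N q f : fsp (polyle (q + N)) f -> fsp (polyle N) (hasse q f).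
move=> /polyleP[c [cN fE]]; apply/polyleP; exists (fun j => c (q + j)%N *+ 'C(q + j, q)).
split=> [j Nj|x]; first by rewrite cN ?mul0rn // leq_add2l.
rewrite (_ : f = pfun (q + N) c); last by apply/funext.
rewrite hasse_pfun // big_split_ord /= big1 ?add0r; last first.
 by move=> i _; rewrite bin_small // mulr0n scale0r.
by apply: eq_bigr=> i _; rewrite addKn -scalerMnl scalerMnr.
Qed.

Lemma hasse_affine q f a b x : fsp pline f ->
 hasse q (fun y => f (b + y * a)) x = a ^+ q *: hasse q f (b + x * a).
move=> Pf; have [L [c [cL fE]]] : exists L c, (forall j, (L <= j)%N -> c j = 0) /\ forall h, f (b + x * a + h) = pfun L c h.
 elim: Pf=> [|p w g [P Pp] _ [L [c [cL gE]]]].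
  by exists 0%N, (fun=> 0); split=> // h; rewrite /pfun big_ord0.
 pose R := P \Po ('X + (b + x * a)%:P).
 have [M [RM LM]] : exists M, (size R <= M)%N /\ (L <= M)%N.
  by exists (maxn (size R) L); rewrite leq_maxl leq_maxr.
 exists M, (fun j => R`_j *: w + c j); split=> [j Mj|h].
  by rewrite cL ?nth_default ?scale0r ?addr0 // (leq_trans _ Mj).
 rewrite gE Pp /pfun.
 have -> : P.[b + x * a + h] = R.[h] by rewrite /R horner_comp hornerD hornerX hornerC [in RHS]addrC.
 rewrite (horner_coef_wide _ RM) scaler_suml.
 rewrite (big_ord_widen M (fun i => h ^+ i *: c i)) // [X in _ + X = _]big_mkcond -big_split.
 apply: eq_bigr=> i _ /=; rewrite scalerDr scalerA mulrC; congr (_ + _).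
 by case: ltnP=> // Li; rewrite cL // scaler0.
rewrite /hasse (pcoefE q fE cL).
apply: (pcoefE (L := L) (c := fun i => a ^+ i *: c i)) => [h|j Lj]; last by rewrite cL ?scaler0.
rewrite mulrDl addrA fE /pfun; apply: eq_bigr=> i _.
by rewrite exprMn scalerA.
Qed.
End PolynomialFunctions.
Section HasseLinear.
Context k.
Hypothesis kinf : inf_field k.

Lemma fsp_polyle_line (W : lmodType k) N (f : k -> W) : fsp (polyle N) f -> fsp pline f.
elim=> [|a w g [P [_ Pa]] _ IH]; first exact: fsp0.
by apply: fspD=> //; exists P.
Qed.

Lemma hasse_map (V W : lmodType k) (u : {linear V -> W}) N q (f : k -> V) x :
 fsp (polyle N) f -> hasse q (fun y => u (f y)) x = u (hasse q f x).
move=> /polyleP[c [cN fE]].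
have Ef : f = pfun N c by apply/funext.
have -> : (fun y => u (f y)) = pfun N (fun j => u (c j)).
 by apply/funext=> y; rewrite Ef /pfun linear_sum; apply: eq_bigr=> i _; rewrite linearZ.
have cc j : (N <= j)%N -> u (c j) = 0 by move=> Nj; rewrite cN ?linear0.
rewrite Ef (hasse_pfun kinf q x cN) (hasse_pfun kinf q x cc) linear_sum.
by apply: eq_bigr=> i _; rewrite linearZ.
Qed.

Lemma hasse_linear (W : lmodType k) N q a (f g : k -> W) x :
 fsp (polyle N) f -> fsp (polyle N) g ->
 hasse q (fun y => a *: f y + g y) x = a *: hasse q f x + hasse q g x.
move=> /polyleP[c [cN fE]] /polyleP[c' [cN' gE]].
have Ef : f = pfun N c by apply/funext.
have Eg : g = pfun N c' by apply/funext.
have -> : (fun y => a *: f y + g y) = pfun N (fun j => a *: c j + c' j).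
 apply/funext=> y; rewrite Ef Eg /pfun scaler_sumr -big_split; apply: eq_bigr=> i _ /=.
 by rewrite scalerDr !scalerA mulrC.
rewrite Ef Eg (hasse_pfun kinf q x cN) (hasse_pfun kinf q x cN').
have cc j : (N <= j)%N -> a *: c j + c' j = 0 by move=> Nj; rewrite cN // cN' // scaler0 addr0.
rewrite (hasse_pfun kinf q x cc) scaler_sumr -big_split; apply: eq_bigr=> i _ /=.
by rewrite scalerDr !scalerA mulrC.
Qed.
End HasseLinear.

(** * Polynomials of bounded degree as modules over the Borel subgroup *)

Section AffineLine.
Context k (q : nat).
Hypothesis kinf : inf_field k.
Notation n := q.+2.
Notation B := (borel k n).
Notation G := (gl k n).
Notation bwt := (@bwt k n).
Notation Mb M := (rres (mg_sub (@borel_gl k n)) M).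
Notation U := (dualrep (q1 q) (@borel_sub k n q 2)).

Lemma rE (i : 'I_n) g : \val (g : B) i i * invmx (\val g) i i = 1.
exact: (isolV (@borel_isol k n i) (mgP g)). Qed.
Lemma U00 g : U g ord0 ord0 = bwt (at1 q (-1)) g.
have e : q = lrow (q1 q) ord0 :> nat by rewrite /= addn0.
rewrite !mxE [X in at1 X _]e bwt_at1; have x0 := isol0 (@borel_isol k n (lrow (q1 q) ord0)) (mgP g).
by apply: (mulfI x0); rewrite rE exprN1 divff.
Qed.

Lemma U11 g : U g ord_max ord_max = bwt (at1 q.+1 (-1)) g.
have e : q.+1 = lrow (q1 q) ord_max :> nat by rewrite /= addn1.
rewrite !mxE [X in at1 X _]e bwt_at1; have x0 := isol0 (@borel_isol k n (lrow (q1 q) ord_max)) (mgP g).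
by apply: (mulfI x0); rewrite rE exprN1 divff.
Qed.

Lemma U10 g : U g ord_max ord0 = 0.
rewrite !mxE; have [gp _] := mgV (mgP g); apply: gp; last by rewrite /inblk andbF.
by rewrite /= ltn_add2l.
Qed.

(** A row (1, x) is sent by [U] to a multiple of (1, be + x al); so B acts by affine maps on the
    line of slopes. *)
Definition al : gchar (mgr B) := gc_mul (bwt (at1 q 1)) (bwt (at1 q.+1 (-1))).
Definition be (g : B) : k := U g ord0 ord_max * bwt (at1 q 1) g.

Lemma at1V c g : bwt (at1 q c) g * bwt (at1 q (- c)) g = 1.
rewrite -(@bwtD k n _ _ (fun=> 0)); first exact: bwt0.
by move=> i _; rewrite /at1; case: eqP; rewrite ?addr0 ?subrr.
Qed.

Lemma alE g : al g * U g ord0 ord0 = U g ord_max ord_max.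
by rewrite U00 U11 -[al g]/(bwt (at1 q 1) g * bwt (at1 q.+1 (-1)) g) mulrAC at1V mul1r. Qed.
Lemma beE g : be g * U g ord0 ord0 = U g ord0 ord_max.
by rewrite U00 /be -mulrA at1V mulr1. Qed.
Lemma U000 g : U g ord0 ord0 != 0.
rewrite U00; apply/eqP=> u0; have /eqP := at1V (-1) g; rewrite opprK u0 mul0r.
by rewrite eq_sym oner_eq0.
Qed.

Definition aact (x : k) (g : B) : k := be g + x * al g.

Lemma UM g h i j : U (agM g h) i j = U g i ord0 * U h ord0 j + U g i ord_max * U h ord_max j.
rewrite mrM mxE big_ord_recl big_ord1; congr (_ + U g _ _ * U h _ _); exact/val_inj.
Qed.

Lemma aact1 x : aact x (mg_one B) = x.
have U1 i j : U (mg_one B) i j = (i == j)%:R by rewrite -[mg_one B]/(@ag1 _ (mgr B)) mr1 mxE.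
rewrite /aact; apply: (mulIf (U000 (mg_one B))).
by rewrite mulrDl beE mulrAC -mulrA [U _ _ _ * _]mulrC alE !U1 /= add0r !mulr1.
Qed.

Lemma aactM x g h : aact x (mg_mul g h) = aact (aact x g) h.
apply: (mulIf (U000 (mg_mul g h))); rewrite -[mg_mul g h]/(@agM _ (mgr B) g h).
have E y g' : aact y g' * U g' ord0 ord0 = U g' ord0 ord_max + y * U g' ord_max ord_max.
 by rewrite /aact mulrDl beE -mulrA alE.
rewrite E !UM !U10 mul0r add0r mulr0 addr0.
have -> : aact (aact x g) h * (U g ord0 ord0 * U h ord0 ord0) =
  (aact (aact x g) h * U h ord0 ord0) * U g ord0 ord0 by rewrite mulrAC mulrA.
have e1 := E x g; have e2 := E (aact x g) h.
by rewrite e2 mulrDl [X in _ = _ + X]mulrAC e1; ring.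
Qed.

Lemma aff_co N f : polyle N f -> dspan (polyle N) (@agO k (mgr B)) (fun x g => f (aact x g)).
move=> [P [sP fE]]; rewrite (_ : (fun x g => _) = fun (x : k) (g : B) =>
 \sum_(j < size P) \sum_(i < N) (if (i <= j)%N then x ^+ i else 0) *
   (P`_j * (be g ^+ (j - i) * (al g ^+ i *+ 'C(j, i))))); last first.
 apply/funeq2P=> x g; rewrite fE horner_coef; apply: eq_bigr=> j _.
 rewrite /aact exprDn mulr_sumr; have jN : (j < N)%N by apply: leq_trans sP.
 rewrite (big_ord_widen N (fun i => P`_j * (be g ^+ (j - i) * (x * al g) ^+ i *+ 'C(j, i)))) //.
 rewrite big_mkcond; apply: eq_bigr=> i _; rewrite ltnS.
 case: ifP=> _; last by rewrite mul0r.
 rewrite [(x * _) ^+ i]exprMn !mulrnAr; congr (_ *+ _). by rewrite [RHS]mulrCA; congr (_ * _); rewrite [RHS]mulrCA.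
apply: dspan_sum=> j; apply: dspan_sum=> i; apply: dspan1.
 case: leqP=> ij; last exact: (polyle_sub k N).1.
 exists 'X^i; rewrite size_polyXn; split=> [|x]; last by rewrite hornerXn.
 by apply: leq_trans sP; apply: leq_ltn_trans (ltn_ord j).
have OA := mgO_alg B; apply: (faM OA); first exact: (faC OA).
apply: (faM OA).
 apply: (faX OA); apply: (faM OA); [exact: (mrO U ord0 ord_max)|exact: (gcO (bwt (at1 q 1)))].
rewrite (_ : (fun g => _) = fun g : B => 'C(j, i)%:R * al g ^+ i).
 by apply: (faM OA); [exact: (faC OA)|apply: (faX OA); exact: (gcO al)].
by apply/funext=> g; rewrite mulr_natl.
Qed.

Definition aff N : gspace (mgr B) :=
 @GSpace k (mgr B) k aact aact1 aactM (polyle N) (polyle_sub k N) (@aff_co N).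

Definition wA (d : int) : nat -> int := fun i => if i == q.+1 then d else if i == q then - d else 0.

(** Dehomogenised form of the rank 2 symmetric power of degree N - 1: polynomials of degree < N on
    the affine line. *)
Definition Qm N (d : int) (M : rmod (mgr G)) : rmod (mgr B) :=
 tw (bwt (wA d)) (FM (aff N) (Mb M)).

Lemma wA_al d c g : bwt (wA (d - c%:Z)) g = bwt (wA d) g * al g ^+ c.
elim: c d => [|c IH] d; first by rewrite subr0 expr0 mulr1.
rewrite exprS mulrA.
have -> : bwt (wA d) g * al g = bwt (wA (d - 1)) g.
 rewrite -[al g]/(bwt (at1 q 1) g * bwt (at1 q.+1 (-1)) g) mulrA.
 rewrite -(@bwtD k n _ _ (fun i => wA d i + at1 q 1 i)) // -(@bwtD k n _ _ (wA (d - 1))) //.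
 move=> i _; rewrite /wA /at1; case: (i =P q.+1) => [->|_]; first by rewrite gtn_eqF // addr0.
 by case: eqP=> _; rewrite addr0 // opprB addrC.
by rewrite -IH; congr (bwt (wA _) g); lia.
Qed.

Section Maps.
Variable M : rmod (mgr G).
Implicit Types N c : nat.

Lemma QmE N d (F : Qm N d M) g x : (ra g F : fmod _ _) x =
 bwt (wA d) g *: (ra g ((fm_fun F (aact x g)) : Mb M)).
by []. Qed.
Lemma inc_subproof N N' (NN : (N <= N')%N) d (F : Qm N d M) : fsp (polyle N') (F : fmod _ _).
elim: (fmP (F : fmod _ _)) => [|a w g [P [sP Pa]] _ IH]; first exact: fsp0.
by apply: fspD=> //; exists P; rewrite (leq_trans sP).
Qed.

Definition inc_fun N N' (NN : (N <= N')%N) d (F : Qm N d M) : Qm N' d M := mkfm (inc_subproof NN F).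

Lemma inc_lin N N' (NN : (N <= N')%N) d : linear (@inc_fun N N' NN d).
by move=> a F F'; apply: fm_ext. Qed.
Lemma inc_eq N N' (NN : (N <= N')%N) d g (F : Qm N d M) : inc_fun NN (ra g F) = ra g (inc_fun NN F).
by apply: fm_ext. Qed.

Definition inc N N' (NN : (N <= N')%N) d : rhom (Qm N d M) (Qm N' d M) :=
 @mkrh _ _ (Qm N d M) (Qm N' d M) _ (@inc_lin N N' NN d) (@inc_eq N N' NN d).

Definition hs_fun c N d (F : Qm (c + N) d M) : Qm N (d - c%:Z) M :=
 mkfm (fsp_hasse kinf (fmP (F : fmod (polyle (c + N)) (Mb M)))).

Lemma hs_lin c N d : linear (@hs_fun c N d).
move=> a F F'; apply: fm_ext=> x; rewrite fmED fmEZ.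
exact: (hasse_linear kinf c a x (fmP (F : fmod (polyle (c + N)) (Mb M))) (fmP (F' : fmod (polyle (c + N)) (Mb M)))).
Qed.

Lemma hs_eq c N d g (F : Qm (c + N) d M) : hs_fun (ra g F) = ra g (hs_fun F).
apply: fm_ext=> x; rewrite QmE wA_al -scalerA.
pose f : k -> Mb M := (F : fmod _ _); have Pf : fsp (polyle (c + N)) f by exact: fmP.
pose f' y : Mb M := bwt (wA d) g *: ra g (f y).
have Pf' : fsp (polyle (c + N)) f'.
 by apply: (fsp_scale (bwt (wA d) g)); apply: (fsp_lin (l := ra g)); [exact: ra_lin |].
have -> : (hs_fun (ra g F) : fmod _ _) x = hasse c (fun y => f' (be g + y * al g)) x by [].
rewrite (hasse_affine kinf); last exact: fsp_polyle_line Pf'.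
have lu : linear (fun v : Mb M => bwt (wA d) g *: (ra g v : Mb M)).
 by move=> a u v; rewrite ra_lin scalerDr !scalerA mulrC.
rewrite -[f']/(fun y => mkLin lu (f y)) (hasse_map kinf (mkLin lu) c _ Pf) /=.
by rewrite !scalerA mulrC.
Qed.

Definition hs c N d : rhom (Qm (c + N) d M) (Qm N (d - c%:Z) M) :=
 @mkrh _ _ (Qm (c + N) d M) (Qm N (d - c%:Z) M) _ (@hs_lin c N d) (@hs_eq c N d).

Lemma hs0 c N d (F : Qm c d M) : hs c N d (inc (leq_addr N c) d F) = 0.
apply: fm_ext=> x; have /polyleP[w [wN wE]] := fmP (F : fmod (polyle c) (Mb M)).
have -> : (hs c N d (inc (leq_addr N c) d F) : fmod _ _) x = hasse c (F : fmod _ _) x by [].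
rewrite (_ : (F : fmod _ _) = pfun c w :> (_ -> _)); last by apply/funext.
rewrite (hasse_pfun kinf c x wN) big1 // => m _.
by rewrite bin_small // mulr0n scale0r.
Qed.

(** The derivative sends x^m to C(m, c) x^(m-c), so nonvanishing binomials make it onto, with the
    degrees below c as kernel. *)
Lemma ses_hasse c N d : (forall m, (c <= m < c + N)%N -> 'C(m, c)%:R != 0 :> k) ->
 ses (inc (leq_addr N c) d) (hs c N d).
move=> hC; split.
- by move=> F F' /(congr1 (fun H : fmod _ _ => H : k -> _)) E; apply: fm_ext=> x; rewrite -[LHS]/((inc (leq_addr N c) d F : fmod _ _) x) E.
- move=> H; have /polyleP[v [vN vE]] := fmP (H : fmod (polyle N) (Mb M)).
 pose w m := if (m < c)%N then 0 else ('C(m, c)%:R : k)^-1 *: v (m - c)%N.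
 have wN j : (c + N <= j)%N -> w j = 0.
  by move=> cj; rewrite /w vN ?scaler0 ?if_same // leq_subRL // (leq_trans _ cj) // leq_addr.
 have Pw : fsp (polyle (c + N)) (pfun (c + N) w) by apply/polyleP; exists w.
 exists (mkfm Pw); apply: fm_ext=> x; rewrite vE.
 have -> : (hs c N d (mkfm Pw) : fmod _ _) x = hasse c (pfun (c + N) w) x by [].
 rewrite (hasse_pfun kinf c x wN) big_split_ord /= big1 ?add0r; last first.
  by move=> i _; rewrite bin_small // mulr0n scale0r.
 apply: eq_bigr=> i _; rewrite addKn /w ltnNge leq_addr /= addKn scalerA -mulr_natr -mulrA divff ?mulr1 //.
 by apply: hC; rewrite leq_addr ltn_add2l /=.
- exact: hs0.
- move=> F F0; have /polyleP[w [wN wE]] := fmP (F : fmod (polyle (c + N)) (Mb M)).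
 have FE : (F : fmod _ _) = pfun (c + N) w :> (_ -> _) by apply/funext.
 have F0' x : hasse c (pfun (c + N) w) x = 0.
  by rewrite -FE; exact: (congr1 (fun H : fmod _ _ => H x) F0).
 have w0 m : (c <= m)%N -> w m = 0.
  move=> cm; have [mN|/wN //] := ltnP m (c + N).
  have := @pfun_inj k kinf (Mb M) N 0 (fun j => w (c + j)%N *+ 'C(c + j, c)) (fun=> 0).
  move=> /(_ _ _ _ (m - c)%N) E; have {}E : w (c + (m - c))%N *+ 'C(c + (m - c), c) = 0.
   apply: E=> // [x|j Nj]; last by rewrite wN ?mul0rn // leq_add2l.
   rewrite [RHS]/pfun big_ord0 -(F0' x) (hasse_pfun kinf c x wN) [RHS]big_split_ord /= big1 ?add0r.
    by apply: eq_bigr=> i _; rewrite addKn -scalerMnl scalerMnr.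
   by move=> i _; rewrite bin_small // mulr0n scale0r.
  rewrite subnKC // in E; apply/eqP; move/eqP: E; rewrite -scaler_nat scaler_eq0.
  by rewrite (negPf (hC m _)) // cm.
 have Pw : fsp (polyle c) (pfun c w) by apply/polyleP; exists w.
 exists (mkfm Pw); apply: fm_ext=> x; rewrite wE /pfun [RHS]big_split_ord /= [X in _ + X]big1 ?addr0 //.
 by move=> i _; rewrite w0 ?scaler0 // leq_addr.
Qed.

Lemma Qm_1 d : riso (Qm 1 d M) (tw (bwt (wA d)) (Mb M)).
have FP (v : Mb M) : fsp (polyle 1) (fun=> v).
 rewrite (_ : (fun=> v) = fun=> 1 *: v + 0); last by apply/funext=> y; rewrite scale1r addr0.
 by apply: fspD; [exists 1; rewrite size_poly1; split=> // x; rewrite hornerC|exact: fsp0].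
apply: riso_tw; pose A := FM (aff 1) (Mb M).
have l1 : linear (fun F : A => fm_fun F 0) by move=> a F F'; rewrite fmED fmEZ.
have F1 (F : A) x : fm_fun F x = fm_fun F 0.
 have /polyleP[w [wN wE]] := fmP (F : fmod (polyle 1) (Mb M)).
 by rewrite !wE /pfun !big_ord1 !expr0.
have e1 g (F : A) : (ra g F : fmod _ _) 0 = ra g (fm_fun F 0 : Mb M).
 by rewrite -[LHS]/(ra g (fm_fun F (aact 0 g) : Mb M)) F1.
apply: (@riso_bij _ _ _ _ (@mkrh _ _ A (Mb M) _ l1 e1)) => [F F' /= FF|v].
 by apply: fm_ext=> x; rewrite F1 [RHS]F1.
by exists (mkfm (FP v)).
Qed.

(** Dehomogenisation at y_0 = 1. By homogeneity N factors [U g ord0 ord0] come out, and they turn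
    the weight -a in position q into -a - N = -d. *)
Lemma hook_riso N a d : d = (a + N)%N -> riso (Dmod (q1 q) N (wH q d a q) M) (Qm N.+1 d%:Z M).
move=> de; pose V := SymP N U (Mb M).
pose e x : 'rV[k]_2 := \row_i (if i == ord0 then 1 else x).
have eU x g : e x *m U g = U g ord0 ord0 *: e (aact x g).
 have e0 z : e z ord0 ord0 = 1 by rewrite mxE.
 have e1 z : e z ord0 ord_max = z by rewrite mxE.
 apply/rowP=> j; rewrite mxE big_ord_recl big_ord1 e0 mul1r [RHS]mxE.
 have -> : lift ord0 ord0 = @ord_max 1 by exact/val_inj.
 rewrite e1; case: (unliftP ord0 j) => [i ->|->] /=; last by rewrite U10 mulr0 addr0 e0 mulr1.
 have -> : lift ord0 i = @ord_max 1 by rewrite (ord1 i); exact/val_inj.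
 by rewrite e1 [RHS]mulrC /aact mulrDl beE -mulrA alE.
have Pe f : hpoly 2 N f -> polyle N.+1 (fun x => f (e x)).
 elim: N {de V} f => [|N IH] f.
  by move=> [c fE]; exists c%:P; rewrite size_polyC; split=> [|x]; [case: eqP|rewrite hornerC fE].
 move=> [g [hg fE]]; have [P [sP PE]] := IH _ (hg ord0); have [Q [sQ QE]] := IH _ (hg ord_max).
 exists (P + 'X * Q); split=> [|x].
  rewrite (leq_trans (size_polyD _ _)) // geq_max (leq_trans sP) //=.
  by rewrite (leq_trans (size_polyMleq _ _)) // size_polyX add2n /= ltnS.
 rewrite fE big_ord_recl big_ord1 !mxE /= mul1r !hornerE -PE -QE.
 by have -> : lift ord0 ord0 = @ord_max 1 by exact/val_inj.
have PF (F : V) : fsp (polyle N.+1) (fun x => fm_fun F (e x)).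
 by apply: (fsp_pull _ (fmP (F : fmod _ _))) => f; exact: Pe.
pose phi (F : Dmod (q1 q) N (wH q d a q) M) : Qm N.+1 d%:Z M := mkfm (PF F).
have lphi : linear phi by move=> c F F'; apply: fm_ext=> x; rewrite fmED fmEZ.
have FE (F : V) t y : fm_fun F (t *: y) = t ^+ N *: fm_fun F y.
 elim: (fmP (F : fmod _ _)) => [|c v f Pa _ IH]; first by rewrite scaler0.
 by rewrite (hpoly_scale _ _ Pa) IH scalerDr scalerA.
have wE g : bwt (wH q d a q) g * U g ord0 ord0 ^+ N = bwt (wA d%:Z) g.
 have -> : U g ord0 ord0 ^+ N = bwt (at1 q (- N%:Z)) g.
  rewrite U00; elim: N {de V Pe PF phi lphi FE} => [|N IH].
   by rewrite expr0 oppr0 [RHS]bwt0 // => i _; rewrite /at1; case: eqP.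
  rewrite exprS IH -(@bwtD k n _ _ (at1 q (- N.+1%:Z))) // => i _.
  by rewrite /at1; case: eqP=> _; [lia|rewrite addr0].
 rewrite -(@bwtD k n _ _ (wA d%:Z)) // => i _; rewrite /wH /wA /at1.
 case: (i =P q.+1) => [->|_]; first by rewrite gtn_eqF // addr0.
 case: (i =P q) => [_|_]; first by rewrite de; lia.
 by rewrite andbC; case: ltnP; rewrite addr0.
have ephi g F : phi (ra g F) = ra g (phi F).
 apply: fm_ext=> x; rewrite QmE -wE -scalerA -[LHS]/(bwt (wH q d a q) g *: ra g (fm_fun F (e x *m U g) : Mb M)).
 by rewrite eU FE raZ.
apply: (@riso_bij _ _ _ _ (@mkrh _ _ (Dmod (q1 q) N (wH q d a q) M) (Qm N.+1 d%:Z M) _ lphi ephi)).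
- move=> F F' /(congr1 (fun H : fmod _ _ => H : k -> _)) FF; apply: fm_ext=> y.
 have Fe x : fm_fun F (e x) = fm_fun F' (e x) by exact: (congr1 (@^~ x) FF).
 have nz (y' : 'rV_2) : y' ord0 ord0 != 0 -> fm_fun F y' = fm_fun F' y'.
  move=> y0; have -> : y' = y' ord0 ord0 *: e (y' ord0 ord_max / y' ord0 ord0).
   apply/rowP=> j; rewrite !mxE; case: eqP=> [->|/eqP j0]; first by rewrite mulr1.
   by rewrite mulrC divfK //; congr (y' _ _); apply/val_inj; case: j j0 => [[|[|j]] hj].
  by rewrite !FE Fe.
 apply/eqP; rewrite -subr_eq0 -fmEB; apply: contraT=> /dual_sep[u u1].
 pose f z := u ((F - F' : fmod (hpoly 2 N) (Mb M)) z) : k.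
 have fP : hpoly 2 N f.
  apply: fsp_scalar; first exact: hpoly_sub.
  by apply: (fsp_lin (l := u)); [exact: linearP|exact: fmP].
 have [p pE] := hpoly_line (zc ord0 y) (delta_mx 0 ord0) fP.
 have p0 : p = 0.
  apply: kinf=> t t0; rewrite -pE /f fmEB nz ?subrr ?linear0 //.
  by rewrite !mxE !eqxx add0r mulr1.
 by move: u1; rewrite -/(f y) {1}(zcE ord0 y) pE p0 horner0 => /eqP; rewrite eq_sym oner_eq0.
- move=> H; have /polyleP[w [wN wE']] := fmP (H : fmod (polyle N.+1) (Mb M)).
 have hm i : (i <= N)%N -> hpoly 2 N (fun y : 'rV[k]_2 => y 0 ord_max ^+ i * y 0 ord0 ^+ (N - i)).
  elim: N i {de V Pe PF phi lphi FE wE ephi H wN wE'} => [|N IH] i.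
   by rewrite leqn0 => /eqP ->; exists 1 => y; rewrite mulr1.
  rewrite leq_eqVlt => /orP[/eqP ->|]; last first.
   rewrite ltnS => iN; have := hpoly_mul ord0 (IH _ iN); congr hpoly; apply/funext=> y.
   by rewrite subSn // exprS mulrCA.
  have := hpoly_mul ord_max (IH _ (leqnn N)); congr hpoly; apply/funext=> y.
  by rewrite !subnn !mulr1 exprS.
 have Pw : fsp (hpoly 2 N) (fun y => \sum_(i < N.+1) (y 0 ord_max ^+ i * y 0 ord0 ^+ (N - i)) *: w i).
  by apply: fsp_sum=> i; apply: fsp1; apply: hm; rewrite -ltnS.
 exists (mkfm Pw); apply: fm_ext=> x; rewrite wE' -[LHS]/(\sum_(i < N.+1) (e x 0 ord_max ^+ i * e x 0 ord0 ^+ (N - i)) *: w i).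
 by apply: eq_bigr=> i _; rewrite !mxE /= expr1n mulr1.
Qed.
End Maps.
End AffineLine.

(** * Binomials and p-linear maps in characteristic p *)

Section CharP.
Context k (p : nat).
Hypothesis hp : p \in [pchar k].

Lemma ppr : prime p. Proof. by case/andP: hp. Qed.
Lemma pgt0 : (0 < p)%N. Proof. exact: prime_gt0 ppr. Qed.
Lemma powpD (a b : k) : (a + b) ^+ p = a ^+ p + b ^+ p.
by rewrite -!(pFrobenius_autE hp) rmorphD. Qed.
(** Vandermonde's identity, in which C(p, i) vanishes mod p except for i = 0 and i = p. *)
Lemma bin_pchar m j : 'C(m + p, j + p)%:R = 'C(m, j + p)%:R + 'C(m, j)%:R :> k.
rewrite addnC -binomial.Vandermonde natr_sum (bigID (fun i : 'I_(j + p).+1 => (i == 0%N :> nat) || (i == p :> nat))) /=.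
rewrite [X in _ + X]big1 ?addr0 => [|i]; last first.
 rewrite negb_or => /andP[i0 ip]; apply/eqP; rewrite -(dvdn_pcharf hp); apply: dvdn_mulr.
 have [ilp|pli] := ltnP i p; first by apply: prime_dvd_bin ppr _; rewrite lt0n i0.
 by rewrite bin_small ?dvdn0 // ltn_neqAle eq_sym ip.
have p0 : (p == 0%N) = false by rewrite gtn_eqF // pgt0.
have ord_p : (p < (j + p).+1)%N by rewrite ltnS leq_addl.
rewrite (bigD1 ord0) //= (bigD1 (Ordinal ord_p)) /=; last by rewrite eqxx orbT -val_eqE /= p0.
rewrite big1 => [|i /andP[/andP[/orP[/eqP i0|/eqP ip] n0] np]].
- by rewrite bin0 mul1n subn0 binn mul1n addnK addr0.
- by case/eqP: n0; exact/val_inj.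
- by case/eqP: np; exact/val_inj.
Qed.

Lemma bin_block b r s : (r < p)%N -> 'C(p * b + r, p * b + s)%:R = 'C(r, s)%:R :> k.
move=> rp; elim: b=> [|b IH]; first by rewrite muln0.
rewrite mulnS -!addnA !(addnC p) bin_pchar IH bin_small ?add0r //.
by rewrite -addnA ltn_add2l ltn_addl.
Qed.

Lemma fact_pchar r : (r < p)%N -> r`!%:R != 0 :> k.
elim: r=> [|r IH] rp; first by rewrite fact0 oner_eq0.
rewrite factS natrM mulf_neq0 ?IH ?(ltnW rp) // -(dvdn_pcharf hp).
by rewrite gtnNdvd.
Qed.

Lemma bin_neq0 r s : (s <= r)%N -> (r < p)%N -> 'C(r, s)%:R != 0 :> k.
move=> sr /fact_pchar; rewrite -(bin_fact sr) natrM mulf_eq0 negb_or => /andP[//].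
Qed.

(** Both m and c lie in one block pb, ..., pb + p - 1, so Lucas's congruence leaves a binomial of
    numbers below p. *)
Lemma bin_block_neq0 b c N m : (c + N = p * b.+1)%N -> (p * b <= c)%N -> (c <= m < c + N)%N ->
 'C(m, c)%:R != 0 :> k.
move=> cN pbc /andP[cm mN].
have -> : m = (p * b + (m - p * b))%N by rewrite subnKC // (leq_trans pbc).
rewrite -[X in 'C(_, X)](subnKC pbc) bin_block; last by rewrite ltn_subLR ?(leq_trans pbc) // -mulnSr -cN.
by apply: bin_neq0; rewrite ?leq_sub2r // ltn_subLR ?(leq_trans pbc) // -mulnSr -cN.
Qed.

Section Semilinear.
Variable S : agr k.

(** p-linear, yet equivariant without a twist of the group: Frobenius raises weights to the p-th
    power, and the weight of the target is chosen accordingly. *)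
Record shom (N N' : rmod S) : Type := SHom {
 sh :> N -> N' ;
 shD : forall u v, sh (u + v) = sh u + sh v ;
 shZ : forall c u, sh (c *: u) = c ^+ p *: sh u ;
 sh_eq : forall g v, sh (ra g v) = ra g (sh v) }.

Lemma sh0 N N' (f : shom N N') : f 0 = 0.
by rewrite -(scale0r 0) shZ expr0n gtn_eqF ?pgt0 // scale0r. Qed.
Lemma shB N N' (f : shom N N') u v : f (u - v) = f u - f v.
by apply/eqP; rewrite eq_sym subr_eq -shD subrK. Qed.
Lemma sh_fsp N N' (f : shom N N') (F : S -> N) :
 fsp (@agO k S) F -> fsp (@agO k S) (fun x => f (F x)).
elim=> [|a w g Oa _ IH].
 by apply: fsp_eq0=> x; rewrite sh0.
rewrite (_ : (fun x => _) = fun x => a x ^+ p *: f w + f (g x)).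
 apply: fspD=> //; elim: p=> [|r IHr]; first exact: agO_1.
 rewrite (_ : (fun x => _) = fun x => a x * a x ^+ r); first exact: agO_mul.
 by apply/funext=> x; rewrite exprS.
by apply/funext=> x; rewrite shD shZ.
Qed.

Section CosyzSmap.
Variables (N N' : rmod S) (f : shom N N').

Lemma sm_subproof (h : csz N) :
 mkfm (sh_fsp f (fmP (h : fmod (@agO k S) N))) \in @csz_pred _ _ N'.
by apply/eqP; rewrite /= (pc1 h) sh0. Qed.

Definition sm_fun (h : csz N) : csz N' := CosyzCar (sm_subproof h).

Lemma sm_D u v : sm_fun (u + v) = sm_fun u + sm_fun v.
by apply: pc_ext=> x; rewrite pcED -shD. Qed.
Lemma sm_Z c u : sm_fun (c *: u) = c ^+ p *: sm_fun u.
by apply: pc_ext=> x; rewrite pcEZ -shZ. Qed.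
Lemma sm_eq g v : sm_fun (ra g v) = ra g (sm_fun v).
apply: pc_ext=> x; rewrite -[LHS]/(f (pc_act g v x)) pc_actE shB sh_eq.
by rewrite -[RHS]/(pc_act g (sm_fun v) x) pc_actE.
Qed.
Definition csz_smap : shom (csz N) (csz N') := @SHom (csz N) (csz N') sm_fun sm_D sm_Z sm_eq.

Lemma csz_smap_bd v : csz_smap (bd v) = bd (f v).
by apply: pc_ext=> x; rewrite bdE -sh_eq -shB. Qed.
End CosyzSmap.

Fixpoint sPrm N N' (f : shom N N') j : shom (Pr N j) (Pr N' j) :=
 if j is i.+1 then csz_smap (sPrm f i) else f.

Lemma sh_inv N N' (f : shom N N') v : invt v -> invt (f v).
by move=> iv g; rewrite -sh_eq iv. Qed.
Lemma sPrm_bnd N N' (f : shom N N') j v : @bnd k S N j v -> @bnd k S N' j (sPrm f j v).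
case: j v => [|j] v; first by move=> ->; exact: sh0.
by move=> [w ->]; exists (sPrm f j w); exact: csz_smap_bd.
Qed.

Lemma sPrm_comm N N' M M' (f : shom N N') (g : shom M M') (a : rhom N M) (b : rhom N' M') j :
 (forall v, g (a v) = b (f v)) -> forall v, sPrm g j (Prm a j v) = Prm b j (sPrm f j v).
by move=> ab; elim: j=> [|j IH] v; [exact: ab|apply: pc_ext=> x; exact: IH].
Qed.

Definition qiso N N' (f : shom N N') j : Prop :=
 (forall v : Pr N j, invt v -> @bnd k S N' j (sPrm f j v) -> @bnd k S N j v) /\
 (forall w : Pr N' j, invt w -> exists v, invt v /\ @bnd k S N' j (w - sPrm f j v)).

Lemma qiso_van N N' (f : shom N N') j : hvan N j -> hvan N' j -> qiso f j.
move=> hN hN'; split=> [v iv _|w iw]; first exact: hN.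
exists 0; split; first by move=> g; rewrite ra0.
by rewrite sh0 subr0; exact: hN'.
Qed.

Section Five.
Variables (A B C A' B' C' : rmod S) (f : rhom A B) (g : rhom B C) (f' : rhom A' B') (g' : rhom B' C').
Hypotheses (fg : ses f g) (fg' : ses f' g').
Variables (a : shom A A') (b : shom B B') (c : shom C C').
Hypotheses (fab : forall v, b (f v) = f' (a v)) (gbc : forall v, c (g v) = g' (b v)).
Hypotheses (qB : forall j, qiso b j) (qC : forall j, qiso c j).

Lemma conn_smap j v q : @conn _ _ _ _ _ f g j v q -> @conn _ _ _ _ _ f' g' j (sPrm c j v) (sPrm a j.+1 q).
move=> [u [gu fq]]; exists (sPrm b j u); split; first by rewrite -(sPrm_comm gbc) gu.
by rewrite -(sPrm_comm fab) fq; exact: csz_smap_bd.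
Qed.

(** The chase of the five lemma, where [conn_smap] is the compatibility of p-linear maps with the
    connecting homomorphisms. *)
Lemma qiso_five j : qiso a j.
case: j=> [|j]; split.
- move=> v iv /= av; apply: (ses_inj fg); rewrite linear0.
 apply: (qB 0).1; [exact: rh_inv|by rewrite /= fab av linear0].
- move=> w iw; have [u [iu /= bu]] := (qB 0).2 _ (rh_inv f' iw).
 move/subr0_eq in bu.
 have [v fv] : exists v, f v = u.
  apply: (ses_ker fg); apply: (qC 0).1; first exact: rh_inv.
  by rewrite /= gbc -bu (ses_zero fg').
 exists v; split.
  by move=> x; apply: (ses_inj fg); rewrite rh_eq fv iu.
 by apply/eqP; rewrite subr_eq0; apply/eqP/(ses_inj fg'); rewrite bu -fv fab.
- move=> v iv av.
 have bf : @bnd k S B j.+1 (Prm f j.+1 v).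
  apply: (qB j.+1).1; first exact: rh_inv.
  by rewrite (sPrm_comm fab); exact: Prm_bnd.
 have [w [iw cw]] := les_A fg iv bf.
 have [u' [iu' gu']] := les_C fg' (conn_smap cw) av.
 have [u [iu bu]] := (qB j).2 _ iu'.
 have wb : @bnd k S C j (w - Prm g j u).
  apply: (qC j).1.
   by move=> x; rewrite raB iw (rh_inv _ iu).
  by rewrite shB (sPrm_comm gbc) -gu' -linearB; exact: Prm_bnd.
 have c0 : @conn _ _ _ _ _ f g j (Prm g j u) 0.
  by exists u; split=> //; rewrite linear0; exact/esym/bd0P.
 have := conn_lin (-1) c0 cw; rewrite scaler0 add0r scaleN1r addrC => cc.
 exact: (conn_bnd fg cc wb).
- move=> w iw; have [u [iu bu]] := (qB j.+1).2 _ (rh_inv (Prm f' j.+1) iw).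
 have gu : @bnd k S C j.+1 (Prm g j.+1 u).
  apply: (qC j.+1).1; first exact: rh_inv.
  rewrite (sPrm_comm gbc).
  have := Prm_bnd g' bu; rewrite linearB.
  have -> : Prm g' j.+1 (Prm f' j.+1 w) = 0 by exact: (ses_zero (ses_Pr j.+1 fg')).
  by rewrite sub0r => /(slN (bnd_sublin _ _)); rewrite opprK.
 have [v [iv fv]] := les_B fg iu gu.
 have fa : @bnd k S B' j.+1 (Prm f' j.+1 (w - sPrm a j.+1 v)).
  have := slD (bnd_sublin _ _) bu (sPrm_bnd b fv).
  rewrite shB addrA subrK linearB (sPrm_comm fab).
  by [].
 have iwv : invt (w - sPrm a j.+1 v) by move=> x; rewrite raB iw (sh_inv _ iv).
 have [w' [iw' cw']] := les_A fg' iwv fa.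
 have [x [ix cx]] := (qC j).2 _ iw'.
 have [y [iy cy]] := conn_tot fg ix.
 have := conn_lin (-1) (conn_smap cy) cw'; rewrite !scaleN1r => cc.
 exists (v + y); split; first by move=> z; rewrite raD iv iy.
 rewrite shD opprD addrA addrC; apply: (conn_bnd fg' cc).
 by rewrite addrC.
Qed.
End Five.
End Semilinear.

(** * Frobenius on polynomials of bounded degree *)

Section FrobeniusLine.
Variable q : nat.
Hypothesis kinf : inf_field k.
Hypothesis kroot : forall c : k, exists d, d ^+ p = c.
Notation n := q.+2.
Notation B := (borel k n).
Notation G := (gl k n).
Notation bwt := (@bwt k n).
Notation O := (ind (mgr G) (k^o : lmodType k)).
Notation Ob := (rres (mg_sub (@borel_gl k n)) O).
Notation Q N d := (@Qm k q N d O).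

Lemma ind_mgO (f : O) : @mgO k n G (f : fmod _ _).
by apply: fsp_scalar (fmP (f : fmod _ _)); exact: (agO_sub (mgr G)). Qed.
Lemma froO_subproof (f : Ob) : fsp (@agO k (mgr G)) (fun x => fm_fun f x ^+ p : k^o).
rewrite (_ : (fun x => _) = fun x => (fm_fun f x ^+ p : k) *: (1 : k^o)).
 by apply: fsp1; apply: (faX (mgO_alg G)); exact: ind_mgO.
by apply/funext=> x; rewrite -[_ *: _]/(_ * _) mulr1.
Qed.

(** The p-th power on k[GL_n]. It commutes with B, which acts on functions through translations. *)
Definition froO (f : Ob) : Ob := mkfm (froO_subproof f).

Lemma froO_E f x : (froO f : fmod _ _) x = fm_fun f x ^+ p. Proof. by []. Qed.
Lemma froO_D u v : froO (u + v) = froO u + froO v.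
by apply: fm_ext=> x; rewrite fmED !froO_E fmED; exact: powpD. Qed.
Lemma froO_Z c u : froO (c *: u) = c ^+ p *: froO u.
by apply: fm_ext=> x; rewrite fmEZ !froO_E fmEZ; exact: exprMn. Qed.
Lemma froO_eq (g : mgr B) (v : Ob) : froO (ra g v) = ra g (froO v).
by apply: fm_ext. Qed.
Lemma froO_0 : froO 0 = 0.
by apply: fm_ext=> x; rewrite froO_E !fmE0 expr0n gtn_eqF // pgt0. Qed.
Lemma froO_pfun L c : (forall j, (L <= j)%N -> c j = 0) -> forall x, froO (pfun L c x) =
 pfun (p * L) (fun i => if (p %| i)%N then froO (c (i %/ p)%N) else 0) x.
move=> cL x; pose c' i := if (p %| i)%N then froO (c (i %/ p)%N) else 0; rewrite -/c'.
elim: L {cL} => [|L IH]; first by rewrite muln0 /pfun !big_ord0 froO_0.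
have -> : pfun L.+1 c x = pfun L c x + x ^+ L *: c L by rewrite /pfun big_ord_recr.
rewrite froO_D froO_Z IH mulnS addnC /pfun [RHS]big_split_ord /=; congr (_ + _).
rewrite (bigD1 (Ordinal pgt0)) //= addn0 /c' dvdn_mulr // mulKn ?pgt0 // -exprM mulnC big1 ?addr0 //.
move=> i; rewrite -val_eqE /= => i0; rewrite dvdn_addr ?dvdn_mulr ?dvdn_mull // gtnNdvd ?scaler0 ?ltn_ord //.
by rewrite lt0n.
Qed.

(** The p-th power of f(x + h) contains only powers of h^p, and their coefficients are the p-th
    powers of the coefficients of f(x + h). *)
Lemma hasse_fro N c x (f : k -> Ob) : fsp (polyle N) f ->
 hasse (p * c) (fun y => froO (f y)) x = froO (hasse c f x) /\
 forall i, ~~ (p %| i)%N -> hasse i (fun y => froO (f y)) x = 0.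
move=> /polyleP[w [wN wE]].
pose v i := \sum_(m < N) (x ^+ (m - i) *+ 'C(m, i)) *: w m.
have vN j : (N <= j)%N -> v j = 0.
 by move=> Nj; apply: big1=> m _; rewrite bin_small ?mulr0n ?scale0r // (leq_trans _ Nj).
have fE h : f (x + h) = pfun N v h by rewrite wE pfun_shift.
pose v' i := if (p %| i)%N then froO (v (i %/ p)%N) else 0.
have ffE h : froO (f (x + h)) = pfun (p * N) v' h by rewrite fE froO_pfun.
have v'N j : (p * N <= j)%N -> v' j = 0.
 move=> Nj; rewrite /v'; case: ifP=> // pj; rewrite vN ?froO_0 //.
 by rewrite leq_divRL ?pgt0 // mulnC.
split=> [|i pi]; rewrite /hasse (pcoefE kinf _ ffE v'N) /v'.
 by rewrite dvdn_mulr // mulKn ?pgt0 // (pcoefE kinf _ fE vN).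
by rewrite (negPf pi).
Qed.

Section Fro.
Variables (N N' : nat) (d d' : int).
Hypothesis NN : (p * N <= N' + p.-1)%N.
Hypothesis dd : d' = d * p%:Z.

(** Degrees at most N - 1 become degrees at most p(N - 1), and [NN] says that this is below N'. *)
Lemma fro_subproof (F : Q N d) : fsp (polyle N') (fun x => froO (fm_fun F x)).
have /polyleP[w [wN wE]] := fmP (F : fmod (polyle N) Ob).
apply/polyleP; exists (fun i => if (p %| i)%N then froO (w (i %/ p)%N) else 0); split=> [j Nj|x].
 case: ifP=> // /dvdnP[i ji]; rewrite ji mulnK ?pgt0 // wN ?froO_0 //.
 rewrite leqNgt; apply/negP=> iN; have := pgt0; move: NN Nj; rewrite ji; nia.
rewrite wE froO_pfun //.
have H L L' (u : nat -> Ob) : (L <= L')%N -> (forall j, (L <= j)%N -> u j = 0) -> pfun L' u x = pfun L u x.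
 move=> LL uL; rewrite /pfun [RHS](big_ord_widen L' (fun i => x ^+ i *: u i)) // [RHS]big_mkcond.
 by apply: eq_bigr=> i _; case: ltnP=> // /uL ->; rewrite scaler0.
set u := fun i => _; have uN j : (p * N <= j + p.-1)%N -> u j = 0.
 rewrite /u; case: ifP=> // /dvdnP[i ->]; rewrite mulnK ?pgt0 // => Nj; rewrite wN ?froO_0 //.
 rewrite leqNgt; apply/negP=> iN; have := pgt0; move: Nj; nia.
have [NL|LN] := leqP N' (p * N).
 by apply: H=> // j Nj; apply: uN; rewrite (leq_trans NN) // leq_add2r.
by apply/esym; apply: H=> [|j Nj]; [exact: ltnW|apply: uN; rewrite (leq_trans Nj) // leq_addr].
Qed.

Definition fro_fun (F : Q N d) : Q N' d' := mkfm (fro_subproof F).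

Lemma fro_D u v : fro_fun (u + v) = fro_fun u + fro_fun v.
by apply: fm_ext=> x; rewrite fmED -[RHS]froO_D. Qed.
Lemma fro_Z c u : fro_fun (c *: u) = c ^+ p *: fro_fun u.
by apply: fm_ext=> x; rewrite fmEZ -[RHS]froO_Z. Qed.
Lemma bwt_pow E E' g : (forall i, (i < n)%N -> E' i = E i * p%:Z) -> bwt E' g = bwt E g ^+ p.
move=> EE; rewrite /bwt /= /wfun -prodrXl; apply: eq_bigr=> i _.
by rewrite EE // exprnP exprz_exp.
Qed.

Lemma fro_eq g v : fro_fun (ra g v) = ra g (fro_fun v).
apply: fm_ext=> x; rewrite QmE.
have -> : (fro_fun (ra g v) : fmod _ _) x =
  froO (bwt (wA q d) g *: (ra g (fm_fun v (aact x g) : Ob))) by [].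
rewrite froO_Z froO_eq; congr (_ *: _); apply/esym/bwt_pow=> i _.
rewrite /wA dd; case: ifP=> // _; case: ifP=> _; first by rewrite mulNr.
by rewrite mul0r.
Qed.

Definition fro : shom (Q N d) (Q N' d') := @SHom _ (Q N d) (Q N' d') fro_fun fro_D fro_Z fro_eq.
End Fro.

(** The top piece of the filtration by degree is O(d - N) on projective q-space, and [vchain] kills
    it in this range; this is one origin of the lower bounds on q. *)
Lemma Qm_top N d M j : (0 < N%:Z - d)%R -> (N%:Z - d <= q%:Z)%R ->
 hvan (tw (bwt (wA q (d - N%:Z))) (rres (mg_sub (@borel_gl k n)) M)) j.
move=> Nd Ndq; have [y yE] : exists y : nat, N%:Z - d = y%:Z by exists `|N%:Z - d|%N; rewrite gtz0_abs.
apply: (@vchain k n G M kinf (@borel_gl k n) q y) => //; first exact: parab_gl.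
- by move=> l lq; rewrite /wA !ltn_eqF // ltnW.
- by rewrite /wA (ltn_eqF (ltnSn q)) eqxx -yE opprB.
- by move: Nd Ndq; rewrite yE; lia.
Qed.

Lemma Qm_step N d : ses (inc O (leq_addr 1 N) d) (hs kinf O N 1 d).
apply: ses_hasse=> m /andP[Nm mN]; have -> : m = N by move: mN; rewrite addn1 ltnS => mN; apply/eqP; rewrite eqn_leq mN.
by rewrite binn oner_neq0.
Qed.

Lemma Qm_neg N (d : int) j : (d < 0)%R -> (N%:Z - d <= q%:Z + 1)%R -> hvan (Q N d) j.
elim: N j => [|N IH] j d0 Nd.
 apply: hvan_null=> F; apply: fm_ext=> x; have /polyleP[w [_ ->]] := fmP (F : fmod (polyle 0) Ob).
 by rewrite /pfun big_ord0.
rewrite -[N.+1]addn1; apply: (hvan_mid (Qm_step N d)); first by apply: IH=> //; lia.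
by apply: riso_hv (Qm_1 _ _) _; apply: Qm_top; lia.
Qed.

Lemma hvan_L1 N x (M : rmod (mgr G)) j : (0 < x < n)%N -> hvan (Dmod (q1 q) N (wH q x 0 q) M) j.
move=> /andP[x0 xn]; apply: (hvan_Dmod kinf) => //; first by rewrite addn2.
 move=> i iq; rewrite /wH ltn_eqF ?ltnS //; case: eqP=> // _.
 by rewrite andbC; case: ltnP.
move=> M' i; apply: (@vchain k n G M' kinf (@borel_gl k n) q.+1 x) => //.
- move=> l lq; rewrite /wH ltn_eqF //; case: eqP=> // _.
 by rewrite andbC; case: ltnP.
- by rewrite /wH eqxx.
- by rewrite x0 -ltnS.
Qed.

(** For N = d + 1 this is the case a = 0 of the hook weight, treated in [hvan_L1]; each further
    degree adds a piece covered by [Qm_top]. *)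
Lemma Qm_van N (d : nat) j : (0 < d < n)%N -> (d < N)%N -> (N <= d + q.+1)%N -> hvan (Q N d) j.
move=> dn; elim: N j => // N IH j; rewrite ltnS leq_eqVlt => /orP[/eqP <- _|dN Nq].
 by apply: riso_hv (riso_sym (hook_riso kinf O (esym (add0n d)))) _; exact: hvan_L1.
rewrite -[N.+1]addn1; apply: (hvan_mid (Qm_step N d)); first by apply: IH=> //; exact: ltnW.
by apply: riso_hv (Qm_1 _ _) _; apply: Qm_top; lia.
Qed.

Lemma Qm1_0 : riso (Q 1 0) Ob.
apply: riso_trans (Qm_1 O 0) _; apply: tw_1=> g; apply: bwt0=> i _.
by rewrite /wA oppr0; case: ifP=> // _; case: ifP.
Qed.

(** For d = 0 the constant polynomials form k[GL_n], which is acyclic over B, and the pieces of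
    higher degree vanish by [Qm_top]. *)
Lemma Qm0_van N j : (N <= q)%N -> hvan (Q N.+1 0) j.+1.
elim: N j => [|N IH] j Nq; first by apply: riso_hv Qm1_0 _; exact: hvan_gl_ind.
rewrite -[N.+2]addn1; apply: (hvan_mid (Qm_step N.+1 0)); first by apply: IH; exact: ltnW.
by apply: riso_hv (Qm_1 _ _) _; apply: Qm_top; lia.
Qed.

Lemma Qm0_inv N (F : Q N.+1 0) : (N <= q)%N -> invt F ->
 exists c, forall x g, (fm_fun F x : fmod _ _) g = c.
elim: N F => [|N IH] F Nq iF.
 have [f [g [fg gf]]] := Qm1_0.
 have F1 x : fm_fun F x = fm_fun F 0.
  have /polyleP[w [wN wE]] := fmP (F : fmod (polyle 1) Ob).
  by rewrite !wE /pfun !big_ord1 !expr0.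
 have iv : invt (fm_fun F 0 : Ob).
  move=> h; have := congr1 (fun H : fmod _ _ => H 0) (iF h).
  rewrite QmE F1 bwt0 ?scale1r // => i _.
  by rewrite /wA oppr0; case: ifP=> // _; case: ifP.
 exists ((fm_fun F 0 : fmod _ _) ag1) => x h; rewrite F1.
 exact: (invt_O kinf iv).
have e2 : (N.+2 = N.+1 + 1)%N by rewrite addn1.
move: F iF; rewrite e2 => F iF.
have F0 : hs kinf O N.+1 1 0 F = 0.
 have hv : hvan (Q 1 (0 - N.+1%:Z)) 0 by apply: riso_hv (Qm_1 _ _) _; apply: Qm_top; lia.
 by apply: hv; exact: rh_inv.
have [F' FE] := ses_ker (Qm_step N.+1 0) F0.
have iF' : invt F' by move=> g; apply: (ses_inj (Qm_step N.+1 0)); rewrite rh_eq FE iF.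
have [c cE] := IH F' (ltnW Nq) iF'; exists c => x g; rewrite -FE; exact: cE.
Qed.

Lemma Qm0_one N : fsp (polyle N.+1) (fun=> mkfm (@fmk_const k _ (@agO k (mgr G)) 1 (agO_1 _)) : Ob).
set v : Ob := mkfm _; rewrite (_ : (fun=> v) = fun=> 1 *: v + 0); last first.
 by apply/funext=> y; rewrite scale1r addr0.
apply: fspD; last exact: fsp0.
by exists 1; rewrite size_poly1; split=> // x; rewrite hornerC.
Qed.

Lemma Qm0_one_inv N : invt (mkfm (Qm0_one N) : Q N.+1 0).
move=> g; apply: fm_ext=> x; rewrite QmE bwt0 ?scale1r; first exact: fm_ext.
by move=> i _; rewrite /wA oppr0; case: ifP=> // _; case: ifP.
Qed.

Lemma Qm0_hdim N : (N <= q)%N -> hdim (Q N.+1 0) 0 1.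
move=> Nq; apply/(qdimP _ _ (bnd_sublin (Q N.+1 0) 0)).
exists (fun=> mkfm (Qm0_one N)); split; first by move=> _; exact: Qm0_one_inv.
- move=> F iF; have [c cE] := Qm0_inv Nq iF; exists (fun=> c); rewrite big_ord1.
 apply: fm_ext=> x; rewrite fmEB fmEZ; apply: fm_ext=> g; rewrite fmEB fmEZ /= cE.
 by rewrite -[_ *: _]/(_ * _) mulr1 subrr.
- move=> c; rewrite big_ord1 => /(congr1 (fun H : fmod _ _ => (H 0 : fmod _ _) ag1)).
 by rewrite !fmEZ /= -[_ *: _]/(_ * _) mulr1 => c0 i; rewrite (ord1 i).
Qed.

(** Only constants in degree 0 remain: injectivity is reducedness of k, surjectivity the existence
    of p-th roots. *)
Lemma qiso0 N N' d d' (NN : (p * N.+1 <= N'.+1 + p.-1)%N) (dd : d' = d * p%:Z) j :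
 d = 0 -> (N <= q)%N -> (N' <= q)%N -> qiso (fro NN dd) j.
move=> d0 Nq Nq'; subst d; have d'0 : d' = 0 by rewrite dd mul0r.
subst d'; case: j=> [|j]; last by apply: qiso_van; exact: Qm0_van.
split=> [v iv /= fv|w iw].
 have [c cE] := Qm0_inv Nq iv; have c0 : c = 0.
  have := congr1 (fun H : Q N'.+1 0 => (fm_fun H 0 : fmod _ _) ag1) fv.
  rewrite -[LHS]/((fm_fun v 0 : fmod _ _) ag1 ^+ p) cE !fmE0 => /eqP.
  by rewrite expf_eq0 => /andP[_ /eqP].
 by apply: fm_ext=> x; apply: fm_ext=> g; rewrite cE c0 !fmE0.
have [c cE] := Qm0_inv Nq' iw; have [r rE] := kroot c.
exists (r *: (mkfm (Qm0_one N) : Q N.+1 0)); split.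
 by move=> g; rewrite raZ Qm0_one_inv.
apply/eqP; rewrite subr_eq0; apply/eqP; apply: fm_ext=> x; apply: fm_ext=> g; rewrite cE.
rewrite -[RHS]/(((r *: (mkfm (Qm0_one N) : Q N.+1 0) : fmod _ _) x : fmod _ _) g ^+ p).
by rewrite !fmEZ -[_ *: _]/(r * 1) mulr1 rE.
Qed.

(* Downward induction on N, starting from the vanishing for N > d, the        *)
(* quotients of consecutive steps having smaller d. *)
Lemma qiso_fro K : (p * (2 * K + 5) <= q)%N -> forall d N N' di dj (NN : (p * N <= N' + p.-1)%N) dd,
 di = d%:Z -> (d <= K)%N -> (0 < N <= K.+1)%N -> (N' = p * N)%N ->
 forall j, qiso (@fro N N' di dj NN dd) j.
move=> Kq; elim/ltn_ind=> d IHd; have p0 := pgt0.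
have [->|d0] := posnP d.
 move=> N N' di dj NN dd di0 _ /andP[N0 NK] N'E j.
 case: N N0 NK N'E NN => // N _ NK N'E NN.
 case: N' N'E NN => [|r] N'E NN; first by exfalso; nia.
 by apply: qiso0=> //; nia.
move=> N N' di dj NN dd diE dK /andP[N0 NK] N'E; subst N' di.
have djE : dj = (d * p)%N%:Z by rewrite dd PoszM.
have vanish N1 : (d < N1)%N -> (N1 <= K.+1)%N ->
  forall NN1 dd1 j, qiso (@fro N1 (p * N1) d%:Z dj NN1 dd1) j.
 by move=> dN1 N1K NN1 dd1 j; apply: qiso_van; rewrite ?djE; apply: Qm_van; nia.
have [m mE] : exists m, (N + m)%N = maxn N d.+1 by exists (maxn N d.+1 - N)%N; rewrite subnKC // leq_maxl.
elim: m N N0 NK NN mE => [|m IHm] N N0 NK NN mE.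
 by apply: vanish=> //; rewrite -(addn0 N) mE leq_maxr.
have [dN|Nd] := ltnP d N; first exact: vanish.
have pE : (p * (N + 1) = p * N + p)%N by rewrite mulnDr muln1.
have NN1 : (p * (N + 1) <= p * N + p + p.-1)%N by rewrite pE leq_addr.
have H1 j : qiso (@fro (N + 1) (p * N + p) d%:Z dj NN1 dd) j.
 move: NN1; rewrite -pE addn1 => NN1; apply: IHm=> //; first by lia.
 have e1 : maxn N d.+1 = d.+1 by apply/maxn_idPr; lia.
 have e2 : maxn N.+1 d.+1 = d.+1 by apply/maxn_idPr; lia.
 by rewrite e2; move: mE; rewrite e1; lia.
have NN2 : (p * 1 <= p + p.-1)%N by rewrite muln1 leq_addr.
have dd2 : dj - (p * N)%N%:Z = (d%:Z - N%:Z) * p%:Z :> int by rewrite dd mulrBl PoszM [p%:Z * _]mulrC.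
have H2 j : qiso (fro NN2 dd2) j by apply: (IHd (d - N)%N) => //; rewrite ?muln1 //; lia.
(* Frobenius carries the step from N to N + 1 to the step from pN to pN + p, the derivative of order
   N turning into that of order pN. The five lemma then descends from N + 1 to N. *)
have sB : ses (inc O (leq_addr p (p * N)) dj) (hs kinf O (p * N) p dj).
 by apply: ses_hasse=> mm mN; apply: (@bin_block_neq0 N (p * N) p) => //; rewrite mulnSr.
move=> j; apply: (qiso_five (Qm_step N d%:Z) sB (b := fro NN1 dd) (c := fro NN2 dd2)) => // v.
 by apply: fm_ext.
apply: fm_ext=> x.
exact/esym/(hasse_fro N x (fmP (v : fmod (polyle (N + 1)) Ob))).1.
Qed.

(** The same filtration, in steps of p. The residue of d mod p is unchanged in the quotients, so the
    induction never meets d = 0, and everything vanishes once the allowed degrees exceed d. *)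
Lemma Qm_ndvd K : (p * (2 * K + 5) <= q)%N -> forall d N, ~~ (p %| d)%N -> (d <= p * K)%N ->
 (0 < N <= K.+1)%N -> forall j, hvan (Q (p * N) d%:Z) j.
move=> Kq; elim/ltn_ind=> d IHd N pd dK /andP[N0 NK]; have p0 := pgt0.
have d0 : (0 < d)%N by case: d pd {IHd dK} => //; rewrite dvdn0.
have vanish N1 : (d < p * N1)%N -> (N1 <= K.+1)%N -> forall j, hvan (Q (p * N1) d%:Z) j.
 by move=> dN1 N1K j; apply: Qm_van=> //; nia.
have [m mE] : exists m, (N + m)%N = maxn N K.+1 by exists (maxn N K.+1 - N)%N; rewrite subnKC // leq_maxl.
elim: m N N0 NK mE => [|m IHm] N N0 NK mE.
 apply: vanish=> //; rewrite -(addn0 N) mE; apply: (@leq_trans (p * K.+1)); first by nia.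
 by rewrite leq_mul2l leq_maxr orbT.
have [dN|Nd] := ltnP d (p * N); first exact: vanish.
have sB : ses (inc O (leq_addr p (p * N)) d%:Z) (hs kinf O (p * N) p d%:Z).
 by apply: ses_hasse=> mm mN; apply: (@bin_block_neq0 N (p * N) p) => //; rewrite mulnSr.
apply: (hvan_sub_all sB) => j.
 have -> : (p * N + p = p * N.+1)%N by rewrite mulnSr.
 by apply: IHm=> //; move: mE; rewrite maxnE; nia.
have -> : d%:Z - (p * N)%N%:Z = (d - p * N)%N%:Z by lia.
rewrite -[X in Q X _]muln1; apply: IHd=> //; try lia.
by rewrite dvdn_subl // dvdn_mulr.
Qed.

(* The residues i <> p - 1: the map to the quotient kills the Frobenius image. *)
Lemma Qm_residue K b i d D E j : (p * (2 * K + 5) <= q)%N -> (b <= K)%N -> (d <= K)%N -> (i.+1 < p)%N ->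
 let c := (p * b + i).+1 in
 (forall j, hdim (Q (p * b.+1) d%:Z) j (E j)) ->
 (forall j, hdim (Q (p - i.+1) (d%:Z - c%:Z)) j (D j)) ->
 hdim (Q c d%:Z) j (if j is j'.+1 then (D j' + E j)%N else E 0%N).
move=> Kq bK dK ip c hE hD; have p0 := pgt0.
have cE : (c + (p - i.+1) = p * b.+1)%N by rewrite /c; nia.
have sB : ses (inc O (leq_addr (p - i.+1) c) d%:Z) (hs kinf O c (p - i.+1) d%:Z).
 by apply: ses_hasse=> mm; apply: (@bin_block_neq0 b) => //; rewrite /c; lia.
(* If p does not divide d, the middle cohomology vanishes. Otherwise it is the image of Frobenius,
   which the derivative of order c kills because p does not divide c. *)
have zero j' : forall u : Pr (Q (c + (p - i.+1)) d%:Z) j', invt u ->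
  @bnd _ _ (Q (p - i.+1) (d%:Z - c%:Z)) j' (Prm (hs kinf O c (p - i.+1) d%:Z) j' u).
 have pc : ~~ (p %| c)%N by rewrite /c -addnS dvdn_addr ?dvdn_mulr // gtnNdvd.
 have [pd|pd] := boolP (p %| d)%N; last first.
  move=> u iu; apply: Prm_bnd; move: u iu; rewrite cE.
  by move=> u iu; apply: (@Qm_ndvd K) => //; nia.
 have NN1 : (p * b.+1 <= c + (p - i.+1) + p.-1)%N by rewrite cE leq_addr.
 have dd1 : d%:Z = (d %/ p)%N%:Z * p%:Z by rewrite -PoszM divnK.
 have Q1 : qiso (fro NN1 dd1) j'.
  apply: (qiso_fro Kq (d := (d %/ p)%N)) => //; first by rewrite (leq_trans (leq_div _ _)).
 move=> u iu; have [v [iv bv]] := Q1.2 u iu.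
 have := Prm_bnd (hs kinf O c (p - i.+1) d%:Z) bv; rewrite linearB.
 have z w : hs kinf O c (p - i.+1) d%:Z (fro NN1 dd1 w) = 0.
  apply: fm_ext=> x; have [_ H] := hasse_fro c x (fmP (w : fmod (polyle b.+1) Ob)).
  exact: H.
 have -> : forall j'' (w : Pr (Q b.+1 (d %/ p)%N%:Z) j''), Prm (hs kinf O c (p - i.+1) d%:Z) j'' (sPrm (fro NN1 dd1) j'' w) = 0.
  by elim=> [|j'' IH] w; [exact: z|apply: pc_ext=> x; exact: IH].
 by rewrite subr0.
rewrite -cE in hE; case: j=> [|j].
 apply: (hdim_zero0 sB) => // u iu; exact: (zero 0%N u iu).
by apply: (hdim_zero sB) => //; exact: zero.
Qed.
End FrobeniusLine.
Section QisoDim.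
Variable S : agr k.
Hypothesis kroot : forall c : k, exists d, d ^+ p = c.

Lemma pFrobenius_bij : bijective (pFrobenius_aut hp).
have /choice[g gE] := kroot; exists g => x; last exact: gE.
by apply: (fmorph_inj (pFrobenius_aut hp)); exact: gE.
Qed.

Lemma qiso_hdim (N N' : rmod S) (f : shom N N') j d : qiso f j -> hdim N j d -> hdim N' j d.
move=> [qi qs]; apply: (@qdim_iso _ _ _ _ _ _ _ (fun u v => v = sPrm f j u) (pFrobenius_aut hp)) => //.
- exact: pFrobenius_bij.
- by rewrite sh0.
- by move=> c u v u' v' -> ->; rewrite shD shZ.
- by move=> u iu; exists (sPrm f j u); split=> //; exact: sh_inv.
- move=> u' iu'; have [v [iv bv]] := qs u' iu'.
 by exists v, (sPrm f j v); split=> //; exact: sh_inv.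
- by move=> u u' iu _ ->; split=> [|bu]; [exact: sPrm_bnd|exact: qi].
Qed.
End QisoDim.

(** * Stable dimensions for hooks *)

Section HookDimensions.
Hypothesis kinf : inf_field k.
Hypothesis kroot : forall c : k, exists d, d ^+ p = c.
Notation O q := (ind (mgr (gl k q.+2)) (k^o : lmodType k)).

(* f gives the stable dimensions of the cohomology of the hook (a, 1^b) of    *)
(* degree d = a + b, shifted down by b *)
Definition hookdim (b d : nat) (f : nat -> nat) : Prop :=
 exists q0, forall q, (q0 <= q)%N -> forall j, hdim (Qm b.+1 d%:Z (O q)) j (f j).

Lemma hookdim_uniq b d f f' : hookdim b d f -> hookdim b d f' -> f =1 f'.
move=> [q1 H1] [q2 H2] j; apply: (hdim_uniq (H1 (maxn q1 q2) _ j) (H2 _ _ j)).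
 exact: leq_maxl.
exact: leq_maxr.
Qed.

Lemma hookdim0 b : hookdim b 0 (fun j => (j == 0%N) : nat).
exists b => q bq [|j]; first exact: Qm0_hdim.
by apply/hvanP; exact: Qm0_van.
Qed.

Lemma hookdim_top b d f : hookdim b d f -> hookdim (p * b + p.-1) (p * d) f.
move=> [q0 H]; exists (q0 + p * (2 * (b + d) + 5))%N => q qq j.
have p0 := pgt0.
have NN : (p * b.+1 <= (p * b + p.-1).+1 + p.-1)%N by rewrite -addnS prednK // mulnSr leq_addr.
have dd : (p * d)%N%:Z = d%:Z * p%:Z by rewrite mulnC PoszM.
apply: (@qiso_hdim _ kroot _ _ (fro q NN dd)).
 have Kq : (p * (2 * (b + d) + 5) <= q)%N by lia.
 by apply: (qiso_fro kinf kroot Kq (d := d)) => //; lia.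
by apply: H; lia.
Qed.

Lemma hookdim_ndvd b d : ~~ (p %| d)%N -> hookdim (p * b + p.-1) d (fun=> 0%N).
move=> pd; exists (p * (2 * (b + d) + 5))%N => q qq j; apply/hvanP; have p0 := pgt0.
rewrite -addnS prednK // -mulnSr; apply: (Qm_ndvd kinf (K := (b + d)%N)) => //; nia.
Qed.

(** When d < pb + i + 1 the quotient term has negative weight and is acyclic by [Qm_neg]; this is
    the alternative D = 0. *)
Lemma hookdim_residue b i d E D : (i.+1 < p)%N -> hookdim (p * b + p.-1) d E ->
 (if (p * b + i < d)%N then hookdim (p - i.+2) (d - (p * b + i).+1) D else forall j, D j = 0%N) ->
 hookdim (p * b + i) d (fun j => if j is j'.+1 then (D j' + E j)%N else E 0%N).
move=> ip [q0 H] HD; have p0 := pgt0; pose K := (b + d)%N.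
have [q1 H1] : exists q1, forall q, (q1 <= q)%N -> forall j,
  hdim (Qm (p - i.+1) (d%:Z - (p * b + i).+1%:Z) (O q)) j (D j).
 move: HD; case: ltnP=> [bd [q1 H1]|db D0].
  exists q1 => q qq j; have := H1 q qq j.
  have -> : (d - (p * b + i).+1)%N%:Z = d%:Z - (p * b + i).+1%:Z by lia.
  by have -> : (p - i.+2).+1 = (p - i.+1)%N by lia.
 exists (p + (p * b + i).+1)%N => q qq j; rewrite D0; apply/hvanP; apply: Qm_neg=> //; lia.
exists (q0 + q1 + p * (2 * K + 5))%N => q qq j.
apply: (Qm_residue kinf kroot (K := K) (E := E) (D := D)) => //; try (rewrite /K; lia).
 move=> j'; have := H q _ j'; rewrite -addnS prednK // -mulnSr; apply; lia.
by move=> j'; apply: H1; lia.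
Qed.

(** Strong induction on d with b varying: division by p and subtraction of pb + i + 1 both lower a
    positive d. The bound j <= d makes the Poincare series polynomials. *)
Lemma hookdim_ex d b : exists f, hookdim b d f /\ forall j, (d < j)%N -> f j = 0%N.
elim/ltn_ind: d b => d IH b; have p0 := pgt0; have p1 := prime_gt1 ppr.
have [->|d0] := posnP d; first by exists (fun j => (j == 0%N) : nat); split; [exact: hookdim0|case].
pose c := (b %/ p)%N; pose i := (b %% p)%N; have bE : b = (p * c + i)%N by rewrite mulnC -divn_eq.
have ip : (i < p)%N by rewrite ltn_mod.
have [E [HE E0]] : exists E, hookdim (p * c + p.-1) d E /\ forall j, (d < j)%N -> E j = 0%N.
 have [pd|pd] := boolP (p %| d)%N; last by exists (fun=> 0%N); split=> //; exact: hookdim_ndvd.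
 have [|f [Hf f0]] := IH (d %/ p)%N _ c; first by rewrite ltn_Pdiv.
 exists f; split; last by move=> j dj; apply: f0; rewrite (leq_ltn_trans (leq_div _ _)).
 have dE : d = (p * (d %/ p))%N by rewrite mulnC divnK.
 by rewrite [X in hookdim _ X _]dE; exact: hookdim_top.
have [ip1|ip1] := eqVneq i.+1 p; first by exists E; rewrite bE -ip1 /= in HE *.
have {}ip1 : (i.+1 < p)%N by rewrite ltn_neqAle ip1.
have [D [HD D0]] : exists D, (if (p * c + i < d)%N then hookdim (p - i.+2) (d - (p * c + i).+1) D else forall j, D j = 0%N) /\
  forall j, (d < j.+1)%N -> D j = 0%N.
 case: ltnP=> cd; last by exists (fun=> 0%N).
 have [|D [HD D0]] := IH (d - (p * c + i).+1)%N _ (p - i.+2)%N; first by lia.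
 by exists D; split=> // j dj; apply: D0; lia.
exists (fun j => if j is j'.+1 then (D j' + E j)%N else E 0%N); split; last first.
 by case=> // j dj; rewrite D0 // E0.
by rewrite bE; exact: hookdim_residue.
Qed.

(** Undoes the reduction to rank two: the b degrees removed by [hdim_hook] come back as the
    shift. *)
Lemma hookdim_weight a b f j : (0 < a)%N -> hookdim b (a + b) f -> exists q0, forall q, (q0 <= q)%N ->
 hdim (tw (@bwt k q.+2 (wH q (a + b) a (q - b))) (rres (mg_sub (@borel_gl k q.+2)) (O q))) j
  (if (b <= j)%N then f (j - b)%N else 0%N).
move=> a0 [q0 H]; exists (q0 + a + b)%N => q qq.
have sb : (q - b + b = q)%N by rewrite subnK; lia.
have sm : (q - b + b.+1 < q.+2)%N by rewrite addnS sb.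
have [||H1 H2] := @hdim_hook k q kinf b (q - b) sm (a + b) a 0 (O q) sb; [by rewrite addn0|by lia |].
apply: (riso_hdim (Dmod_0 sm _ _)); case: leqP=> [bj|jb]; last by apply/hvanP; exact: H2.
rewrite -{1}(subnK bj); apply: H1; rewrite addn0.
apply: (riso_hdim (riso_sym (hook_riso kinf (O q) (erefl _)))).
by apply: H; lia.
Qed.
End HookDimensions.
End CharP.

(** * Hilbert's Nullstellensatz *)

Record ideal (R : comNzRingType) (J : set R) : Prop := Ideal {
 id_0 : J 0 ;
 id_D : forall x y, J x -> J y -> J (x + y) ;
 id_M : forall x y, J y -> J (x * y) }.

Record prime_ideal (R : comNzRingType) (J : set R) : Prop := PrimeIdeal {
 pi_id : ideal J ;
 pi_M : forall x y, J (x * y) -> J x \/ J y }.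

Section Ideals.
Variable R : comNzRingType.
Implicit Types J : set R.

Lemma id_N J x : ideal J -> J x -> J (- x).
by move=> iJ Jx; rewrite -mulN1r; exact: id_M. Qed.
Lemma id_sum J (I : Type) (r : seq I) (f : I -> R) : ideal J -> (forall i, J (f i)) ->
 J (\sum_(i <- r) f i).
by move=> iJ fJ; elim/big_ind: _ => //; [exact: id_0 iJ|exact: id_D iJ]. Qed.
Lemma pi_X J x m : prime_ideal J -> ~ J x -> ~ J 1 -> ~ J (x ^+ m).
move=> pJ nx n1; elim: m=> [|m IH]; first by rewrite expr0.
by rewrite exprS => /(pi_M pJ)[].
Qed.

(** An ideal maximal among those avoiding the powers of G is prime: if x and y are outside,
    adjoining either one reaches a power of G, and the product of the two powers lies in the ideal
    as soon as x y does. *)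
Lemma prime_ideal_ex J G : ideal J -> (forall L, ~ J (G ^+ L)) ->
 exists P, [/\ J `<=` P, prime_ideal P & ~ P G].
move=> iJ JG; pose good X := [/\ J `<=` X, ideal X & forall L, ~ X (G ^+ L)].
have chain (F : set (set R)) : F `<=` [set X | X = set0 \/ good X] ->
  total_on F subset -> (\bigcup_(X in F) X = set0 \/ good (\bigcup_(X in F) X)).
 move=> FP Ft; have [->|] := pselect (\bigcup_(X in F) X = set0); first by left.
 move=> /eqP/set0P[u [X FX Xu]]; right.
 have gX Y v : F Y -> Y v -> good Y.
  by move=> FY Yv; case: (FP Y FY) => // Y0; rewrite Y0 in Yv.
 have [JX iX _] := gX _ _ FX Xu; split.
 - by move=> v Jv; exists X => //; exact: JX.
 - split; first by exists X => //; exact: id_0 iX.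
   move=> v w [Y FY Yv] [Z FZ Zw]; have [_ iY _] := gX _ _ FY Yv; have [_ iZ _] := gX _ _ FZ Zw.
   by have [YZ|ZY] := Ft _ _ FY FZ; [exists Z => //; apply: (id_D iZ) => //; exact: YZ
    | exists Y => //; apply: (id_D iY) => //; exact: ZY].
  move=> v w [Y FY Yw]; have [_ iY _] := gX _ _ FY Yw; exists Y => //; exact: id_M.
 - by move=> L [Y FY YL]; have [_ _] := gX _ _ FY YL; apply; exact: YL.
have [P [gP maxP]] := Zorn_bigcup chain.
have {gP}[JP iP PG] : good P.
 case: gP=> // P0; case: (maxP J); last by right; split=> //; exact: subset_refl.
 by split=> [u|/(_ 0)]; rewrite P0 //; apply; exact: id_0 iJ.
exists P; split=> //; last by move=> PG1; apply: (PG 1%N); rewrite expr1.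
have ext x : ~ P x -> exists L y, P (G ^+ L - y * x).
 move=> nx; pose P' : set R := [set z | exists y, P (z - y * x)].
 have gP' : ~ good P'.
  move=> gP'; apply: (maxP P'); last by right.
  split=> [z Pz|/(_ x) h]; first by exists 0; rewrite mul0r subr0.
  by apply: nx; apply: h; exists 1; rewrite mul1r subrr; exact: id_0 iP.
 have iP' : ideal P'.
  split; first by exists 0; rewrite mul0r subr0; exact: id_0 iP.
   move=> z w [y Py] [y' Py']; exists (y + y').
   by rewrite mulrDl opprD addrACA; exact: id_D iP _ _ Py Py'.
  by move=> z w [y Py]; exists (z * y); rewrite -mulrA -mulrBr; exact: id_M.
 have : exists L, P' (G ^+ L).
  apply: contrapT=> h; apply: gP'; split=> //; last by move=> L P'L; apply: h; exists L.
  by move=> z Jz; exists 0; rewrite mul0r subr0; exact: JP.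
 by move=> [L [y h]]; exists L, y.
split=> // x y Pxy; apply: contrapT=> /not_orP[/ext[L [a Pa]] /ext[M [b Pb]]].
apply: (PG (L + M)%N).
have -> : G ^+ (L + M) = G ^+ M * (G ^+ L - a * x) + (a * x) * (G ^+ M - b * y) + (a * b) * (x * y).
 by rewrite exprD; ring.
by apply: (id_D iP); [apply: (id_D iP)|]; exact: (id_M iP).
Qed.
End Ideals.
Section Nullstellensatz.
Variable k : closedFieldType.

(** Iterated univariate polynomials, so that the induction on the number of variables is a
    pseudo-division in the last one. *)
Fixpoint ip (N : nat) : idomainType := if N is m.+1 then ({poly ip m} : idomainType) else k.

Fixpoint ev (N : nat) (v : nat -> k) : {rmorphism ip N -> k} :=
 match N return {rmorphism ip N -> k} with
 | 0%N => idfun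
 | m.+1 => (horner_eval (v m) \o map_poly (ev m v) : {rmorphism {poly ip m} -> k})
 end.

Lemma evS m v (P : ip m.+1) : ev m.+1 v P = (map_poly (ev m v) (P : {poly ip m})).[v m].
by []. Qed.
Lemma ev_ext N v v' (P : ip N) : (forall i, (i < N)%N -> v i = v' i) -> ev N v P = ev N v' P.
elim: N P => [|m IH] P vv //; rewrite !evS vv //; congr (_.[_]).
by apply/polyP=> i; rewrite !coef_map; apply: IH=> j jm; apply: vv; exact: leqW.
Qed.

Definition upd (v : nat -> k) N t : nat -> k := fun i => if i == N then t else v i.

Lemma ev_upd N v t (P : ip N.+1) :
 ev N.+1 (upd v N t) P = (map_poly (ev N v) (P : {poly ip N})).[t].
rewrite evS {2}/upd eqxx; congr (_.[_]); apply/polyP=> i; rewrite !coef_map.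
by apply: ev_ext=> j jN; rewrite /upd ltn_eqF.
Qed.

Section Step.
Variables (N : nat) (p : set (ip N.+1)).
Hypotheses (pp : prime_ideal p) (p1 : ~ p 1).
Notation toP := (fun c : ip N => c%:P : ip N.+1).
Definition contr : set (ip N) := [set c | p (toP c)].

Lemma contr_prime : prime_ideal contr.
have ip_ := pi_id pp; split; first split.
- by rewrite /contr /= polyC0; exact: id_0 ip_.
- by move=> x y cx cy; rewrite /contr /= polyCD; exact: id_D ip_ _ _ cx cy.
- by move=> x y cy; rewrite /contr /= polyCM; exact: id_M ip_ _ _ cy.
- by move=> x y; rewrite /contr /= polyCM => /(pi_M pp).
Qed.

(** The leading term of a member is itself in [p] when its coefficient is in the contraction;
    subtract it and continue. *)
Lemma coefs_contr s : (forall P : {poly ip N}, p P -> (size P < s)%N -> contr (lead_coef P)) ->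
 forall P : {poly ip N}, p P -> (size P < s)%N -> forall i, contr P`_i.
move=> H P pP; move: {2}(size P) (leqnn (size P)) => n; elim: n P pP => [|n IH] P pP Pn Ps i.
 by move: Pn; rewrite leqn0 size_poly_eq0 => /eqP ->; rewrite coef0; exact: id_0 (pi_id contr_prime).
have [P0|P0] := eqVneq P 0; first by rewrite P0 coef0; exact: id_0 (pi_id contr_prime).
have cl := H _ pP Ps; pose Q := P - lead_coef P *: 'X^((size P).-1).
have pQ : p Q.
 rewrite /Q; apply: (id_D (pi_id pp)) => //; apply: id_N; first exact: pi_id pp.
 by rewrite -mul_polyC mulrC; exact: id_M (pi_id pp) _ _ cl.
have sQ : (size Q < size P)%N.
 rewrite -[X in (_ < X)%N]prednK ?size_poly_gt0 // ltnS; apply/leq_sizeP=> j.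
 rewrite leq_eqVlt => /orP[/eqP <-|Pj]; rewrite coefB coefZ coefXn.
  by rewrite eqxx mulr1 lead_coefE subrr.
 have sj : (size P <= j)%N by rewrite -[size P]prednK ?size_poly_gt0.
 by rewrite nth_default // (gtn_eqF Pj) mulr0 subr0.
have := IH Q pQ _ (ltn_trans sQ Ps) i; rewrite -ltnS (leq_trans sQ Pn) => /(_ isT).
rewrite coefB coefZ coefXn => h.
rewrite -(subrK (lead_coef P * (i == (size P).-1)%:R) P`_i).
apply: (id_D (pi_id contr_prime)) => //.
by rewrite mulrC; exact: (id_M (pi_id contr_prime)).
Qed.

Lemma from_coefs (P : {poly ip N}) : (forall i, contr P`_i) -> p P.
move=> cP; rewrite -(coefK P) poly_def.
apply: id_sum (pi_id pp) _ => i.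
by rewrite -mul_polyC mulrC; exact: id_M (pi_id pp) _ _ (cP i).
Qed.

Lemma map0_contr v (P : {poly ip N}) : (forall c, contr c -> ev N v c = 0) ->
 (forall i, contr P`_i) -> map_poly (ev N v) P = 0.
by move=> h cP; apply/polyP=> i; rewrite coef_map coef0; exact: h. Qed.

Hypothesis IH : forall G, ~ contr G -> exists v, (forall c, contr c -> ev N v c = 0) /\ ev N v G != 0.

(** A zero of the contraction is extended to a zero of [p] that is not one of G. Either all
    coefficients of members lie in the contraction, and a free value of the last variable is chosen,
    or one uses the roots of a member of least degree among those with leading coefficient outside
    the contraction. *)
Lemma zero_step (G : {poly ip N}) : ~ p G ->
 exists v, (forall P, p P -> ev N.+1 v P = 0) /\ ev N.+1 v G != 0.
have fZ v c (q : {poly ip N}) : map_poly (ev N v) (c *: q) = ev N v c *: map_poly (ev N v) q.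
 by rewrite -!mul_polyC rmorphM /= map_polyC.
move=> nG; have nocoef (H : {poly ip N}) : ~ p H -> exists i, ~ contr H`_i.
 by move=> nH; apply: contrapT=> h; apply: nH; apply: from_coefs=> i; apply: contrapT=> ni; apply: h; exists i.
have [[P [pP cP]]|noP] := pselect (exists P : {poly ip N}, p P /\ ~ contr (lead_coef P)); last first.
 have cc (P : {poly ip N}) : p P -> forall i, contr P`_i.
  move=> pP; apply: (@coefs_contr (size P).+1) => // Q pQ _.
  by apply: contrapT=> nQ; apply: noP; exists Q.
 have [i ni] := nocoef _ nG; have [v [v0 vG]] := IH ni.
 have Gv : map_poly (ev N v) G != 0.
  by apply/eqP=> /(congr1 (fun q : {poly k} => q`_i)); rewrite coef_map coef0 => /eqP; rewrite (negPf vG).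
 have [t rt] := closed_nonrootP _ Gv.
 exists (upd v N t); split=> [P pP|]; rewrite ev_upd //.
 by rewrite (map0_contr v0 (cc P pP)) horner0.
have {P pP cP}[P [pP cP minP]] : exists P : {poly ip N}, [/\ p P, ~ contr (lead_coef P) &
  forall Q : {poly ip N}, p Q -> (size Q < size P)%N -> contr (lead_coef Q)].
 move: {2}(size P) (leqnn (size P)) => n; elim: n P pP cP => [|n IHn] P pP cP Pn.
  by case: cP; move: Pn; rewrite leqn0 size_poly_eq0 => /eqP ->; rewrite lead_coef0; exact: id_0 (pi_id contr_prime).
 have [[Q [pQ cQ QP]]|no] := pselect (exists Q : {poly ip N}, [/\ p Q, ~ contr (lead_coef Q) & (size Q < size P)%N]).
  by apply: (IHn Q) => //; rewrite -ltnS (leq_trans QP).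
 by exists P; split=> // Q pQ QP; apply: contrapT=> nQ; apply: no; exists Q.
set a := lead_coef P in cP; pose D := (size P).-1.
have P0 : P != 0.
 by apply/eqP=> P0; apply: cP; rewrite /a P0 lead_coef0; exact: id_0 (pi_id contr_prime).
have E (H : {poly ip N}) := Pdiv.Idomain.divp_eq H P.
have sR (H : {poly ip N}) : (size (H %% P)%R < size P)%N by rewrite Pdiv.Idomain.ltn_modp.
(* D is the degree of P. If every root of P over the chosen point were a root of G, then P would
   divide G^D over that point and R would vanish there, whereas the point keeps a coefficient of R
   nonzero. *)
pose R := (G ^+ D %% P)%R.
have nR : ~ p R.
 move=> pR; have : p (a%:P ^+ scalp (G ^+ D) P * G ^+ D).
  rewrite -polyC_exp mul_polyC E; apply: (id_D (pi_id pp)) => //.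
  exact: (id_M (pi_id pp)).
 by move=> /(pi_M pp)[]; exact: pi_X.
have [i ni] := nocoef _ nR.
have nar : ~ contr (a * R`_i) by move=> /(pi_M contr_prime)[].
have [v [v0]] := IH nar; rewrite rmorphM mulf_eq0 negb_or => /andP[va vr].
pose f := map_poly (ev N v).
have sP : size (f P) = size P by rewrite size_map_poly_id0.
have [t [rt nt]] : exists t, root (f P) t /\ ~~ root (f G) t.
 apply: contrapT=> h; have rr t : root (f P) t -> root (f G) t.
  by move=> rt; apply: contrapT=> /negP nt; apply: h; exists t.
 have [rs fE] := closed_field_poly_normal (f P).
 have lP : lead_coef (f P) != 0 by rewrite lead_coef_eq0 -size_poly_eq0 sP size_poly_eq0.
 have dvd : (f P %| f G ^+ D)%R.
  rewrite fE dvdpZl //; have -> : D = size rs.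
   by rewrite /D -sP fE size_scale // size_prod_XsubC.
  have : all (root (f G)) rs.
   apply/allP=> z zrs; apply: rr; rewrite fE rootZ // root_prod_XsubC; exact: zrs.
  elim: (rs) => [|z s IHs] /=; first by rewrite big_nil dvd1p.
  move=> /andP[rz /IHs ds]; rewrite big_cons exprS dvdp_mul //.
  by rewrite dvdp_XsubCl.
 have fEq : (ev N v a) ^+ scalp (G ^+ D) P *: f G ^+ D = f (G ^+ D %/ P)%R * f P + f R.
  have := congr1 f (E (G ^+ D)); rewrite /f fZ !rmorphXn /= => ->.
  by rewrite rmorphD /= rmorphM.
 have : (f P %| f R)%R.
  by rewrite -(dvdp_addr _ (dvdp_mull (f (G ^+ D %/ P)%R) (dvdpp (f P)))) -fEq dvdpZr ?expf_neq0.
 move=> /dvdp_leq; have [fR0|fR0] := eqVneq (f R) 0.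
  by move=> _; move/eqP: vr; case; have := congr1 (fun q : {poly k} => q`_i) fR0; rewrite coef_map coef0.
 move=> /(_ isT); rewrite sP leqNgt (leq_ltn_trans _ (sR (G ^+ D))) //.
 exact: size_poly.
exists (upd v N t); split=> [H pH|]; rewrite ev_upd //.
have pR : p (H %% P)%R.
 have -> : (H %% P)%R = lead_coef P ^+ scalp H P *: H - (H %/ P)%R * P by rewrite E addrC addKr.
 apply: (id_D (pi_id pp)); first by rewrite -mul_polyC; exact: (id_M (pi_id pp)).
 by apply: id_N; [exact: pi_id pp|exact: (id_M (pi_id pp))].
have fR0 : f (H %% P)%R = 0 by apply: map0_contr=> //; apply: (coefs_contr minP).
have fEq : (ev N v a) ^+ scalp H P *: f H = f (H %/ P)%R * f P.
 have := congr1 f (E H); rewrite {1}/f fZ rmorphXn /= -/a => ->.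
 by rewrite /f rmorphD /= rmorphM -/f fR0 addr0.
have := congr1 (fun q : {poly k} => q.[t]) fEq; rewrite hornerZ hornerM (eqP rt) mulr0.
by move/eqP; rewrite mulf_eq0 expf_eq0 (negPf va) andbF => /eqP.
Qed.
End Step.

Lemma prime_zero N (p : set (ip N)) G : prime_ideal p -> ~ p 1 -> ~ p G ->
 exists v, (forall P, p P -> ev N v P = 0) /\ ev N v G != 0.
elim: N p G => [|N IH] p G pp p1 nG.
 exists (fun=> 0); split=> [P pP|].
  apply/eqP; apply: contraT=> P0; case: p1; rewrite -(mulVf (P0 : (P : k) != 0)).
  exact: (id_M (pi_id pp)).
 by apply/eqP=> G0; apply: nG; rewrite (G0 : G = 0); exact: id_0 (pi_id pp).
apply: zero_step=> // H nH; apply: IH=> //; exact: contr_prime.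
Qed.

(** [J] is an ideal of functions on matrices. It is pulled back to the iterated polynomial ring and
    enlarged to a prime ideal avoiding the powers of G; a zero of that prime outside the zeros of G
    contradicts the assumption. *)
Lemma nullstellensatz n (J : set ('M[k]_n -> k)) G : mpf G ->
 J (fun=> 0) -> (forall f g, J f -> J g -> J (fun x => f x + g x)) ->
 (forall f g, mpf f -> J g -> J (fun x => f x * g x)) ->
 (forall x, (forall f, J f -> mpf f -> f x = 0) -> G x = 0) ->
 exists L, J (fun x => G x ^+ L).
move=> PG J0 JD JM zG; pose N := (n * n)%N.
pose vx (x : 'M[k]_n) : nat -> k := fun i => nth 0 [seq mxvec x 0 j | j <- enum 'I_N] i.
pose xv (v : nat -> k) : 'M[k]_n := vec_mx (\row_(j < N) v j).
pose fn (P : ip N) : 'M[k]_n -> k := fun x => ev N (vx x) P.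
have vxE x (j : 'I_N) : vx x j = mxvec x 0 j by rewrite /vx (nth_map j) ?size_enum_ord // nth_ord_enum.
have xvK v P : fn P (xv v) = ev N v P.
 apply: ev_ext=> i iN; rewrite -[i]/(nat_of_ord (Ordinal iN)) vxE /xv vec_mxK mxE //.
have coord m (j : nat) : (j < m)%N -> exists P : ip m, forall v, ev m v P = v j.
 elim: m=> // m IH; rewrite ltnS leq_eqVlt => /orP[/eqP ->|/IH[P PE]].
  by exists ('X : {poly ip m}) => v; rewrite evS map_polyX hornerX.
 by exists (P%:P : {poly ip m}) => v; rewrite evS map_polyC hornerC; exact: PE.
have cst m c : exists P : ip m, forall v, ev m v P = c.
 elim: m=> [|m [P PE]]; first by exists c.
 by exists (P%:P : {poly ip m}) => v; rewrite evS map_polyC hornerC; exact: PE.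
have FA : falg (fun f : 'M[k]_n -> k => exists P, f = fn P).
 split; first split.
 - by exists 0; apply/funext=> x; rewrite /fn rmorph0.
 - move=> c f g [P ->] [Q ->]; have [C CE] := cst N c; exists (C * P + Q).
  by apply/funext=> x; rewrite /fn rmorphD rmorphM CE.
 - by exists 1; apply/funext=> x; rewrite /fn rmorph1.
 - by move=> f g [P ->] [Q ->]; exists (P * Q); apply/funext=> x; rewrite /fn rmorphM.
have fnP m (P : ip m) : (m <= N)%N -> mpf (fun x : 'M[k]_n => ev m (vx x) P).
 elim: m P => [|m IH] P mN; first by exact: (faC (mpf_alg k n)).
 rewrite (_ : (fun x => _) = fun x => \sum_(i < size (P : {poly ip m})) ev m (vx x) ((P : {poly ip m})`_i) * vx x m ^+ i).
  apply: (fa_sum (mpf_alg k n)) => i _; apply: (faM (mpf_alg k n)); first exact: IH (ltnW mN).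
  apply: (faX (mpf_alg k n)); pose j := Ordinal mN.
  have [a [b jE]] : exists a b, j = mxvec_index a b.
   by case: (mxvec_indexP j) => a b; exists a, b.
  rewrite (_ : (fun x => _) = fun x : 'M[k]_n => x a b); first exact: mpf_entry.
  by apply/funext=> x; rewrite -[m]/(nat_of_ord j) vxE jE mxvecE.
 apply/funext=> x; rewrite evS (@horner_coef_wide _ (size (P : {poly ip m}))) ?size_poly //.
 by apply: eq_bigr=> i _; rewrite coef_map.
have pfn f : mpf f -> exists P, f = fn P.
 move=> [Q QE]; rewrite (_ : f = fun x => \sum_(m <- msupp Q) Q@_m * \prod_(i < N) mxvec x 0 i ^+ m i); last first.
  by apply/funext=> x; rewrite QE /mxeval mevalE.
 apply: (fa_sum FA) => m _; apply: (faM FA); first exact: (faC FA).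
 apply: (fa_prod FA) => i _; apply: (faX FA).
 by have [P PE] := coord N i (ltn_ord i); exists P; apply/funext=> x; rewrite /fn PE vxE.
have [G' GE] := pfn _ PG.
pose J' : set (ip N) := [set P | J (fn P)].
have fnD P Q : fn (P + Q) = fun x => fn P x + fn Q x by apply/funext=> x; rewrite /fn rmorphD.
have fnM P Q : fn (P * Q) = fun x => fn P x * fn Q x by apply/funext=> x; rewrite /fn rmorphM.
have iJ : ideal J'.
 split; first by rewrite /J' /= (_ : fn 0 = fun=> 0) //; apply/funext=> x; rewrite /fn rmorph0.
  by move=> P Q JP JQ; rewrite /J' /= fnD; exact: JD.
 by move=> P Q JQ; rewrite /J' /= fnM; apply: JM=> //; exact: fnP.
apply: contrapT=> nL.
have [p [Jp pp pG]] : exists P, [/\ J' `<=` P, prime_ideal P & ~ P G'].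
 apply: prime_ideal_ex=> // L J'L; apply: nL; exists L.
 by rewrite (_ : (fun x => _) = fn (G' ^+ L)) //; apply/funext=> x; rewrite GE /fn rmorphXn.
have p1 : ~ p 1 by move=> p1; apply: pG; rewrite -[G']mulr1; exact: (id_M (pi_id pp)).
have [v [v0 /eqP]] := prime_zero pp p1 pG; apply.
rewrite -xvK -GE; apply: zG=> f Jf pf.
by have [P fE] := pfn _ pf; rewrite fE xvK; apply: v0; apply: Jp; rewrite /J' /= -fE.
Qed.
End Nullstellensatz.

(** * Frames of flags and triangular decomposition *)

Section Frames.
Context k (n : nat).
Implicit Types (g h : 'M[k]_n) (V W : flag k n).

Lemma sum_rowsP (P : pred 'I_n) g (u : 'rV[k]_n) :
 (u \in \sum_(j < n | P j) <[row j g]>)%VS <->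
 exists c : 'rV[k]_n, (forall j, ~~ P j -> c 0 j = 0) /\ u = c *m g.
split=> [/memv_sumP[v vP ->]|[c [c0 ->]]].
 pose a j := if P j then (if pselect (exists x : k, v j = x *: row j g) is left h then projT1 (cid h) else 0) else 0.
 exists (\row_j a j); split=> [j nPj|]; first by rewrite mxE /a (negPf nPj).
 rewrite mulmx_sum_row big_mkcond; apply: eq_bigr=> j _; rewrite mxE /a.
 case: ifP=> Pj; last by rewrite scale0r.
 case: pselect=> [h|[]]; first exact: projT2 (cid h).
 by have /vlineP[x ->] := vP j Pj; exists x.
rewrite mulmx_sum_row; apply: memv_suml=> j _; have [Pj|nPj] := boolP (P j).
 by apply: memvZ; apply: (subvP (sumv_sup j Pj (subvv _))); exact: memv_line.
by rewrite c0 // scale0r mem0v.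
Qed.

Lemma adapted_unit V g : adapted V g -> g \in unitmx.
move=> /(_ ord_max) Vg; have VT : V ord_max = fullv.
 by apply/eqP; rewrite eqEdim subvf dimvf flag_dim /dim /= mul1n leqnn.
have rep (u : 'rV[k]_n) : exists c : 'rV[k]_n, u = c *m g.
 have := memvf u; rewrite -VT Vg => /sum_rowsP[c [_ ->]]; by exists c.
pose h := \matrix_i projT1 (cid (rep (row i 1%:M))).
suff : h *m g = 1%:M by case/mulmx1_unit.
by apply/row_matrixP=> i; rewrite row_mul rowK; rewrite -(projT2 (cid (rep (row i 1%:M)))).
Qed.

Lemma dim_sum_rows g (i : 'I_n.+1) : g \in unitmx ->
 \dim (\sum_(j < n | (j < i)%N) <[row j g]>)%VS = i.
move=> ug; set A := (\sum_(j < n | (j < i)%N) _)%VS.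
pose B := (\sum_(j < n | ~~ (j < i)%N) <[row j g]>)%VS.
have le1 (P : pred 'I_n) : (\dim (\sum_(j < n | P j) <[row j g]>)%VS <= #|P|)%N.
 apply: leq_trans (dimv_leq_sum _ _ _) _; rewrite -sum1_card.
 by apply: leq_sum=> j _; rewrite dim_vline leq_b1.
have cP : #|[pred j : 'I_n | (j < i)%N]| = i.
 have -> : #|[pred j : 'I_n | (j < i)%N]| = (\sum_(j < n | (j < i)%N) 1)%N.
  by rewrite -sum1_card; exact: eq_bigl.
 by rewrite -(big_ord_widen n (fun=> 1%N)) ?sum1_card ?card_ord // -ltnS.
have AB : (A + B)%VS = fullv.
 apply/eqP; rewrite eqEsubv subvf /=; apply/subvP=> u _.
 suff : (u \in \sum_(j < n) <[row j g]>)%VS by rewrite (bigID (fun j : 'I_n => (j < i)%N)).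
 by apply/(sum_rowsP predT); exists (u *m invmx g); rewrite mulmxKV.
apply/eqP; rewrite eqn_leq; apply/andP; split; first by rewrite -[X in (_ <= X)%N]cP; exact: le1.
have lB : (\dim B <= n - i)%N.
 apply: leq_trans (le1 _) _; have e := cardC [pred j : 'I_n | (j < i)%N].
 rewrite cP card_ord in e; rewrite -[X in (_ <= X - _)%N]e addKn.
 by apply: eq_leq; exact: eq_card.
have : (n <= \dim A + \dim B)%N.
 apply: leq_trans (dimv_add_leqif A B).1; by rewrite AB dimvf /dim /= mul1n.
have := ltn_ord i; lia.
Qed.

Definition flag_of g (ug : g \in unitmx) : flag k n.
refine (@Flag k n (fun i => \sum_(j < n | (j < i)%N) <[row j g]>)%VS (fun i => dim_sum_rows i ug) _).
move=> i i' ii'; apply/subv_sumP=> j ji.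
by apply: (sumv_sup j); rewrite ?subvv // (leq_trans ji).
Defined.

Lemma flag_ofP g (ug : g \in unitmx) : adapted (flag_of ug) g.
by []. Qed.
Lemma framesTP g : frames setT g <-> g \in unitmx.
by split=> [[V _ /adapted_unit]|ug] //; exists (flag_of ug). Qed.
Lemma frames_unit A g : frames A g -> g \in unitmx.
by move=> [V _ /adapted_unit]. Qed.
Lemma framesP A V g : adapted V g -> frames A g <-> A V.
by move=> aV; split=> [[W AW aW]|AV]; [rewrite (flag_ext aV aW) | exists V]. Qed.
Lemma adapted_trans V g h : adapted V g -> adapted V h -> exists2 b, is_trig_mx b & h = b *m g.
move=> ag ah; have ug := adapted_unit ag.
exists (h *m invmx g); last by rewrite mulmxKV.
apply/is_trig_mxP=> i j ij.
have : row i h \in V (lift ord0 i).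
 by rewrite (ah (lift ord0 i)); apply: (subvP (sumv_sup i _ (subvv _))); rewrite ?memv_line.
rewrite (ag (lift ord0 i)) => /sum_rowsP[c [c0 hc]].
have -> : (h *m invmx g) i j = (row i (h *m invmx g)) 0 j by rewrite [RHS]mxE.
by rewrite row_mul hc mulmxK // c0 // lift0 -leqNgt.
Qed.

Lemma adapted_mul V b g : is_trig_mx b -> b \in unitmx -> adapted V g -> adapted V (b *m g).
move=> tb ub ag; have ubg : b *m g \in unitmx by rewrite unitmx_mul ub (adapted_unit ag).
by rewrite (adapted_trig tb ag (flag_ofP ubg)).
Qed.

Lemma adapted_ex V : exists g, adapted V g.
have new (i : 'I_n) : exists x, x \in V (lift ord0 i) /\ x \notin V (widen_ord (leqnSn n) i).
 apply: contrapT=> h; have /dimvS : (V (lift ord0 i) <= V (widen_ord (leqnSn n) i))%VS.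
  apply/subvP=> x xV; apply: contrapT=> /negP nx; apply: h; by exists x.
 by rewrite !flag_dim lift0 /= ltnn.
pose x i := projT1 (cid (new i)); pose g := \matrix_i x i.
have xP i : x i \in V (lift ord0 i) /\ x i \notin V (widen_ord (leqnSn n) i) by exact: projT2 (cid (new i)).
exists g; suff H m (hm : (m < n.+1)%N) : V (Ordinal hm) = (\sum_(j < n | (j < m)%N) <[row j g]>)%VS.
 by move=> [m hm]; rewrite H.
elim: m hm => [|m IH] hm.
 by apply/eqP; rewrite big_pred0 // -dimv_eq0 flag_dim.
have hm' : (m < n)%N by [].
pose i := Ordinal hm'; have [xi nxi] := xP i.
have e1 : Ordinal hm = lift ord0 i by apply: val_inj; rewrite /= /bump leq0n.
have e0 : widen_ord (leqnSn n) i = Ordinal (leqW hm') by exact: val_inj.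
rewrite (bigD1 i) //= rowK (eq_bigl (fun j : 'I_n => (j < m)%N)); last first.
 by move=> j; rewrite ltnS (ltn_neqAle j m) andbC.
rewrite -(IH (leqW hm')) -e0 e1; apply/eqP; rewrite eq_sym eqEdim.
apply/andP; split.
 by rewrite subv_add -memvE xi /=; apply: flag_mono; rewrite lift0 /=.
rewrite flag_dim lift0 -[X in (X < _)%N]/(nat_of_ord (widen_ord (leqnSn n) i)) -(flag_dim V).
rewrite ltnNge; apply/negP=> le; case/negP: nxi.
have /eqP e : (V (widen_ord (leqnSn n) i) == <[x i]> + V (widen_ord (leqnSn n) i))%VS.
 by rewrite eqEdim le addvSr.
by rewrite e; exact: (subvP (addvSl _ _) _ (memv_line _)).
Qed.
End Frames.

(* LU decomposition: on the open set where all leading minors lm h i of h are  *)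
(* invertible, lub h *m h is the unitriangular representative of the coset B h *)
Section LU.
Context k (n : nat).
Implicit Types (h b : 'M[k]_n) (i : 'I_n).

(** The leading block of size i + 1, completed by the identity so that all blocks keep the size
    n. *)
Definition lead h i : 'M[k]_n := \matrix_(a, c) if (a <= i)%N then h a c else (a == c)%:R.
Definition lub h : 'M[k]_n := \matrix_(i, a) if (a <= i)%N then invmx (lead h i) i a else 0.
Definition lmin h : k := \prod_i \det (lead h i).

Lemma lead_mul b h i : is_trig_mx b -> lead (b *m h) i = lead b i *m lead h i.
move=> /is_trig_mxP tb; apply/matrixP=> a c; rewrite !mxE.
have [ai|ia] := leqP a i.
 apply: eq_bigr=> e _; rewrite !mxE ai; have [ei|ie] := leqP e i => //.
 by rewrite tb ?mul0r // (leq_ltn_trans ai).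
rewrite (bigD1 a) //= big1 => [|e ea]; rewrite !mxE leqNgt ia /=.
 by rewrite eqxx mul1r addr0.
by rewrite eq_sym (negPf ea) mul0r.
Qed.

Lemma lead1 i : lead 1%:M i = 1%:M.
by apply/matrixP=> a c; rewrite !mxE if_same. Qed.
Lemma lmin_mul b h : is_trig_mx b -> lmin (b *m h) = lmin b * lmin h.
by move=> tb; rewrite -big_split; apply: eq_bigr=> i _; rewrite lead_mul // det_mulmx. Qed.
Lemma lmin1 : lmin 1%:M = 1.
by rewrite /lmin big1 // => i _; rewrite lead1 det1. Qed.
Lemma lub1 : lub 1%:M = 1%:M.
apply/matrixP=> i a; rewrite !mxE lead1 invmx1 mxE; case: leqP=> // ia.
by case: eqP=> // ia'; rewrite ia' ltnn in ia.
Qed.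

Lemma lead_unit h i : lmin h != 0 -> lead h i \in unitmx.
by move=> /prodf_neq0/(_ i isT); rewrite unitmxE unitfE. Qed.
Lemma lub_trig h : is_trig_mx (lub h).
by apply/is_trig_mxP=> i a ia; rewrite mxE leqNgt ia. Qed.
Lemma lub_unitri h i (c : 'I_n) : lmin h != 0 -> (c <= i)%N -> (lub h *m h) i c = (i == c)%:R.
move=> /(lead_unit i) ul ci.
have := congr1 (fun M : 'M[k]_n => M i c) (mulVmx ul); rewrite [RHS]mxE => <-.
rewrite !mxE; apply: eq_bigr=> a _; rewrite !mxE; have [ai|ia] := leqP a i => //.
by rewrite mul0r; case: eqP=> [ac|]; [rewrite ac leqNgt ltnS ci in ia|rewrite mulr0].
Qed.

Lemma det_lub h : lmin h != 0 -> \det (lub h) * \det h = 1.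
move=> dh; rewrite -det_mulmx -det_tr det_trig; last first.
 apply/is_trig_mxP=> a c ac; rewrite mxE lub_unitri //; last exact: ltnW.
 by case: eqP=> // ca; rewrite ca ltnn in ac.
by rewrite big1 // => i _; rewrite mxE lub_unitri // eqxx.
Qed.

Lemma lub_unit h : lmin h != 0 -> lub h \in unitmx.
by move=> /det_lub e; rewrite unitmxE; apply/unitrP; exists (\det h); rewrite [_ * \det (lub h)]mulrC e. Qed.
(** Leading blocks are multiplicative for a triangular left factor, so the normalising matrix
    absorbs the inverse of b and the representative of the coset is unchanged. *)
Lemma lub_mul b h : is_trig_mx b -> b \in unitmx -> is_trig_mx (invmx b) ->
 lmin h != 0 -> lub (b *m h) = lub h *m invmx b.
move=> tb ub tb' dh; apply/matrixP=> i a; rewrite [LHS]mxE.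
have /is_trig_mxP tbi := tb'.
have [ai|ia] := leqP a i; last first.
 rewrite mxE big1 // => c _; rewrite mxE; have [ci|] := leqP c i; last by rewrite mul0r.
 by rewrite tbi ?mulr0 // (leq_ltn_trans ci).
have ulb : lead b i *m lead (invmx b) i = 1%:M by rewrite -lead_mul // mulmxV // lead1.
have [u1 u2] := mulmx1_unit ulb; have ul := lead_unit i dh.
have -> : invmx (lead (b *m h) i) = invmx (lead h i) *m lead (invmx b) i.
 rewrite lead_mul //; apply: (can_inj (mulKmx (_ : lead b i *m lead h i \in unitmx))).
  by rewrite unitmx_mul u1.
 by rewrite mulmxV ?unitmx_mul ?u1 // mulmxA -(mulmxA (lead b i)) mulmxV // mulmx1.
rewrite !mxE; apply: eq_bigr=> c _; rewrite !mxE; have [ci|ic] := leqP c i => //.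
by rewrite mul0r; case: eqP=> [ca|]; [rewrite ca ltnNge ai in ic|rewrite mulr0].
Qed.
End LU.

(** * Regular functions with semi-invariant denominators *)

Section RegularFunctions.
Context k (n : nat).
Implicit Types (F : 'M[k]_n -> k) (W : lmodType k).

Definition TF F : Type := {h : 'M[k]_n | F h != 0}.
Definition regF F : set (TF F -> k) := regf (fun t : TF F => sval t) F.
Arguments regF : clear implicits.
Definition reg F W (f : 'M[k]_n -> W) : Prop := fsp (regF F) (fun t : TF F => f (sval t)).

Lemma regF_alg F : mpf F -> falg (regF F).
by move=> pF; apply: regf_alg=> // -[]. Qed.
Lemma regF_entry F i j : mpf F -> regF F (fun t : TF F => sval t i j).
by move=> pF; apply: (@regf_poly k n (TF F) _ F (fun x => x i j)); exact: mpf_entry. Qed.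
Lemma regF_inv F : mpf F -> regF F (fun t : TF F => (F (sval t))^-1).
by move=> pF; apply: regf_inv. Qed.
Lemma regF_comp F (X : Type) (A : set (X -> k)) (u : X -> TF F) a : falg A ->
 (forall i j, A (fun x => sval (u x) i j)) -> A (fun x => (F (sval (u x)))^-1) ->
 regF F a -> A (fun x => a (u x)).
move=> hA uA FA [p [L [pp aE]]].
rewrite (_ : (fun x => _) = fun x => p (sval (u x)) * (F (sval (u x)))^-1 ^+ L).
 by apply: (faM hA); [exact: (fa_comp hA uA pp)|exact: faX].
by apply/funext=> x; rewrite aE exprVn.
Qed.

Lemma reg_ext F W (f f' : 'M[k]_n -> W) : (forall h, F h != 0 -> f h = f' h) -> reg F f -> reg F f'.
move=> ff; have E : (fun t : TF F => f (sval t)) = (fun t : TF F => f' (sval t)).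
 by apply/funext=> -[h Fh]; exact: ff.
by rewrite /reg E.
Qed.

Lemma reg_poly F W (f : 'M[k]_n -> W) : mpf F -> reg F f ->
 exists L m, fsp mpf m /\ forall h, F h != 0 -> F h ^+ L *: f h = m h.
move=> pF rf; suff H (f0 : TF F -> W) : fsp (regF F) f0 -> exists L m, fsp mpf m /\
  forall t : TF F, F (sval t) ^+ L *: f0 t = m (sval t).
 have [L [m [pm mE]]] := H _ rf.
 by exists L, m; split=> // h Fh; exact: (mE (exist _ h Fh)).
elim=> [|a w g [p [L1 [pp aE]]] _ [L2 [m [pm mE]]]].
 by exists 0%N, (fun=> 0); split=> [|t]; [exact: fsp0|rewrite scaler0].
have PA := mpf_alg k n.
exists (L1 + L2)%N, (fun h => (p h * F h ^+ L2) *: w + F h ^+ L1 *: m h); split.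
 apply: fspD; first by apply: (faM PA) => //; exact: faX.
 by apply: fsp_mul pm => b pb; apply: (faM PA) => //; exact: faX.
move=> t; have Ft : F (sval t) != 0 := proj2_sig t.
rewrite scalerDr scalerA aE -(mE t) scalerA exprD; congr (_ *: w + _).
by field; rewrite expf_neq0.
Qed.

Lemma reg_of_poly F W (f m : 'M[k]_n -> W) L : mpf F -> fsp mpf m ->
 (forall h, F h != 0 -> F h ^+ L *: f h = m h) -> reg F f.
move=> pF pm fm; rewrite /reg (_ : (fun t => _) = fun t : TF F => (F (sval t))^-1 ^+ L *: m (sval t)).
 apply: fsp_mul.
  by move=> b rb; apply: (faM (regF_alg pF)) => //; apply: (faX (regF_alg pF)); exact: regF_inv.
 by apply: fsp_pull pm => a pa; exact: regf_poly.
apply/funext=> -[h Fh] /=; rewrite -fm // scalerA exprVn mulVf ?scale1r // expf_neq0 //.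
Qed.

Lemma reg_mulr F F' W (f : 'M[k]_n -> W) : mpf F -> mpf F' -> reg F f ->
 reg (fun h => F h * F' h) f.
move=> pF pF' rf; pose FF h := F h * F' h.
have pFF : mpf FF by exact: mpfM.
have F0 (t : TF FF) : F (sval t) != 0 by case: t=> h /=; rewrite mulf_eq0 negb_or => /andP[].
suff FP a : regF F a -> regF FF (fun t => a (exist (fun h => F h != 0) _ (F0 t))) by exact: (fsp_pull FP rf).
move=> ra; apply: (@regF_comp F (TF FF) (regF FF) (fun t => exist (fun h => F h != 0) _ (F0 t))) ra.
- exact: regF_alg.
- by move=> i j; exact: regF_entry.
rewrite (_ : (fun x => _) = fun t : TF FF => F' (sval t) * (FF (sval t))^-1).
 by apply: (faM (regF_alg pFF)); [exact: regf_poly|exact: regF_inv].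
apply/funext=> -[h Fh] /=; rewrite /FF in Fh *; move: Fh; rewrite mulf_eq0 negb_or => /andP[F1 F2].
by rewrite invfM mulrCA mulfV ?mulr1.
Qed.

Lemma reg_mull F F' W (f : 'M[k]_n -> W) : mpf F -> mpf F' -> reg F' f ->
 reg (fun h => F h * F' h) f.
move=> pF pF' /(reg_mulr pF' pF); rewrite (_ : (fun h => F' h * _) = fun h => F h * F' h) //.
by apply/funext=> h; rewrite mulrC.
Qed.

Lemma regL F W c (f f' : 'M[k]_n -> W) : reg F f -> reg F f' -> reg F (fun h => c *: f h + f' h).
by move=> rf rf'; apply: (fsp_add (fsp_scale c rf)). Qed.
Lemma fa_lead (X : Type) (A : set (X -> k)) (M : X -> 'M[k]_n) : falg A ->
 (forall i j, A (fun x => M x i j)) -> forall j c d, A (fun x => lead (M x) j c d).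
move=> hA MA j c d.
rewrite (_ : (fun x => _) = fun x => if (c <= j)%N then M x c d else (c == d)%:R); last first.
 by apply/funext=> x; rewrite mxE.
by case: (c <= j)%N; [exact: MA|exact: faC].
Qed.

Lemma fa_lead_inv (X : Type) (A : set (X -> k)) (M : X -> 'M[k]_n) : falg A ->
 (forall i j, A (fun x => M x i j)) -> (forall x, lmin (M x) != 0) ->
 A (fun x => (lmin (M x))^-1) -> forall i a, A (fun x => lub (M x) i a).
move=> hA MA M0 IA i a; rewrite (_ : (fun x => _) = fun x => if (a <= i)%N then invmx (lead (M x) i) i a else 0); last first.
 by apply/funext=> x; rewrite mxE.
case: (a <= i)%N; last exact: faC.
have lA j := fa_lead hA MA j.
rewrite (_ : (fun x => _) = fun x => ((\prod_(j | j != i) \det (lead (M x) j)) * (lmin (M x))^-1) * cofactor (lead (M x) i) a i).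
 apply: (faM hA); last by apply: fa_cofactor.
 apply: (faM hA) => //; apply: (fa_prod hA) => j _; exact: (fa_det hA).
apply/funext=> x; rewrite invmxE ?lead_unit //; congr (_ * _).
have := M0 x; rewrite /lmin (bigD1 i) //= mulf_eq0 negb_or => /andP[d1 d2].
by rewrite invfM mulrCA mulfV ?mulr1.
Qed.
End RegularFunctions.
Arguments regF {k n} F.

Section SemiInvariants.
Context k (n : nat).
Implicit Types (F : 'M[k]_n -> k) (g h : 'M[k]_n) (V : opens (flag k n)).
Notation B := (borel k n).
Notation Bg := (mgr B).

Lemma borelP b : mgS B b <-> is_trig_mx b /\ b \in unitmx.
split=> [[pb ub]|[/is_trig_mxP tb ub]]; split=> //; last by move=> i j ij _; exact: tb.
by apply/is_trig_mxP=> i j ij; apply: pb=> //; rewrite /inblk addn0 ltn0 andbF.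
Qed.

Lemma borel_trig (b : B) : is_trig_mx (\val b). Proof. by have /borelP[] := mgP b. Qed.
Lemma borel_unit (b : B) : \val b \in unitmx. Proof. by have /borelP[] := mgP b. Qed.
Lemma frames_borel (A : set (flag k n)) (b : B) g : frames A (\val b *m g) <-> frames A g.
split=> [fbg|[V AV aV]]; last by exists V => //; apply: adapted_mul=> //; [exact: borel_trig|exact: borel_unit].
have ug : g \in unitmx by move: (frames_unit fbg); rewrite unitmx_mul => /andP[].
apply/(framesP _ (flag_ofP ug)).
exact: (framesP A (adapted_mul (borel_trig b) (borel_unit b) (flag_ofP ug))).1 fbg.
Qed.

(** The nonvanishing locus of such a polynomial is stable under B, so within GL_n it is the preimage
    of a subset of the flag variety. *)
Definition semi F : Prop := mpf F /\ exists c : gchar Bg, forall (b : B) g, F (\val b *m g) = c b * F g.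

Lemma gc_neq0 (c : gchar Bg) b : c b != 0.
by apply/eqP=> c0; have := gcVr c b; rewrite c0 mul0r => /eqP; rewrite eq_sym oner_eq0. Qed.
Lemma semi0 F (b : B) g : semi F -> (F (\val b *m g) != 0) = (F g != 0).
by move=> [_ [c cE]]; rewrite cE mulf_eq0 (negPf (gc_neq0 c b)). Qed.
Lemma semiM F F' : semi F -> semi F' -> semi (fun h => F h * F' h).
move=> [pF [c cE]] [pF' [d dE]]; split; first exact: mpfM.
by exists (gc_mul c d) => b g; rewrite cE dE mulrACA.
Qed.

Lemma semi_det : semi determinant.
split; first exact: mpf_det.
have O : @agO k Bg (fun b : B => \det (\val b)).
 by apply: (fa_det (mgO_alg B)) => i j; exact: mgO_entry.
have M1 : (fun b : B => \det (\val b)) (@ag1 k Bg) = 1 by exact: det1.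
have MM (x y : Bg) : (fun b : B => \det (\val b)) (agM x y) = \det (\val x) * \det (\val y) by exact: det_mulmx.
by exists (GChar O M1 MM) => b g; exact: det_mulmx.
Qed.

Lemma semi_lmin (c : 'M[k]_n) : semi (fun h => lmin (h *m c)).
have PA := mpf_alg k n.
have lA (X : Type) (A : set (X -> k)) (M : X -> 'M[k]_n) : falg A ->
  (forall i j, A (fun x => M x i j)) -> A (fun x => lmin (M x)).
 by move=> hA MA; apply: (fa_prod hA) => i _; apply: (fa_det hA); exact: fa_lead.
split.
 by apply: lA=> //; apply: (fa_mulmx PA) => a b; [exact: mpf_entry|exact: (faC PA)].
have O : @agO k Bg (fun b : B => lmin (\val b)) by apply: (lA _ _ _ (mgO_alg B)) => i j; exact: mgO_entry.
have M1 : (fun b : B => lmin (\val b)) (@ag1 k Bg) = 1 by exact: lmin1.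
have MM (x y : Bg) : (fun b : B => lmin (\val b)) (agM x y) = lmin (\val x) * lmin (\val y).
 by apply: lmin_mul; exact: borel_trig.
by exists (GChar O M1 MM) => b g; rewrite -mulmxA lmin_mul // borel_trig.
Qed.

(* the representative of the coset B h in the chart centred at invmx c *)
Definition urep (c h : 'M[k]_n) : 'M[k]_n := lub (h *m c) *m h.

Lemma lub_borel h : lmin h != 0 -> mgS B (lub h).
by move=> h0; apply/borelP; split; [exact: lub_trig|exact: lub_unit]. Qed.
Lemma lub_borelM (b : B) h : lmin h != 0 -> lub (\val b *m h) = lub h *m invmx (\val b).
move=> h0; apply: lub_mul=> //; [exact: borel_trig|exact: borel_unit|].
by have /borelP[] := mgV (mgP b).
Qed.

Lemma urep_borel c (b : B) h : lmin (h *m c) != 0 -> urep c (\val b *m h) = urep c h.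
move=> h0; rewrite /urep -mulmxA lub_borelM // -mulmxA mulKmx //; exact: borel_unit.
Qed.

(** Q is not semi-invariant, but Q at the representative [urep] is constant on cosets. Clearing the
    powers of the leading minors and of the determinant turns it into a semi-invariant
    polynomial. *)
Lemma chart_ex g0 (Q : 'M[k]_n -> k) : g0 \in unitmx -> mpf Q -> Q g0 != 0 ->
 exists F, [/\ semi F, F g0 != 0,
  forall h, F h != 0 -> [/\ h \in unitmx, lmin (h *m invmx g0) != 0 & Q (urep (invmx g0) h) != 0] &
  regF F (fun t => (lmin (sval t *m invmx g0))^-1) /\
   regF F (fun t => (Q (urep (invmx g0) (sval t)))^-1)].
move=> ug pQ Q0; set c := invmx g0; have PA := mpf_alg k n.
have [pD [cD cDE]] := semi_lmin c; have sdet := semi_det.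
pose D0 h := lmin (h *m c) * \det h.
have [pD0 [x xE]] : semi D0 by apply: semiM=> //; exact: semi_lmin.
have D0P h : D0 h != 0 -> lmin (h *m c) != 0 /\ \det h != 0.
 by rewrite mulf_eq0 negb_or => /andP[].
have A0 := regF_alg pD0.
have Li : regF D0 (fun t => (lmin (sval t *m c))^-1).
 rewrite (_ : (fun t => _) = fun t : TF D0 => \det (sval t) * (D0 (sval t))^-1).
  by apply: (faM A0); [apply: regf_poly=> //; exact: mpf_det|exact: regF_inv].
 by apply/funext=> -[h h0] /=; have [l0 d0] := D0P h h0; rewrite /D0 invfM mulrCA mulfV ?mulr1.
have eC (i j : 'I_n) : regF D0 (fun t => (sval t *m c) i j).
 by apply: (fa_mulmx A0) => a b; [exact: regF_entry|exact: (faC A0)].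
have eL (i j : 'I_n) : regF D0 (fun t => lub (sval t *m c) i j).
 by apply: fa_lead_inv=> // -[h h0] /=; have [] := D0P h h0.
have eS (i j : 'I_n) : regF D0 (fun t => urep c (sval t) i j).
 by apply: (fa_mulmx A0) => a b; [exact: eL|exact: regF_entry].
have [P [L [pP PE]]] := fa_comp A0 eS pQ.
have {}PE h : D0 h != 0 -> Q (urep c h) = P h / D0 h ^+ L by move=> h0; exact: (PE (exist _ h h0)).
pose F h := P h * D0 h.
have FP h : F h != 0 -> P h != 0 /\ D0 h != 0 by rewrite mulf_eq0 negb_or => /andP[].
have pF : mpf F by exact: mpfM.
have c1 : g0 *m c = 1%:M by exact: mulmxV.
have D00 : D0 g0 != 0 by rewrite /D0 c1 lmin1 mul1r -unitfE -unitmxE.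
have A := regF_alg pF.
exists F; split.
- split=> //; pose xL := iter L (gc_mul x) (gc_one Bg).
 have xLE b : xL b = x b ^+ L.
  by rewrite /xL; elim: (L) => [|l IH]; rewrite ?expr0 // exprS /= IH.
 exists (gc_mul xL x) => b g; rewrite -[gc_mul xL x b]/(xL b * x b) /F xE xLE.
 have [->|Dg] := eqVneq (D0 g) 0; first by rewrite !mulr0.
 have [l0 _] := D0P g Dg.
 have Dbg : D0 (\val b *m g) != 0 by rewrite xE mulf_neq0 // gc_neq0.
 have := PE _ Dbg; rewrite urep_borel // PE // xE => /(congr1 (fun z => z * (x b * D0 g) ^+ L)).
 rewrite divfK; last by rewrite expf_neq0 // mulf_neq0 // gc_neq0.
 have -> : P g / D0 g ^+ L * (x b * D0 g) ^+ L = x b ^+ L * P g.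
  by rewrite (exprMn L (x b) (D0 g)) mulrCA divfK ?expf_neq0.
 by move=> <-; ring.
- have := PE _ D00; rewrite /urep c1 lub1 mul1mx => e; rewrite mulf_neq0 //.
 by move: Q0; rewrite e mulf_eq0 negb_or => /andP[].
- move=> h /FP[Ph Dh]; have [l0 d0] := D0P h Dh; split=> //; first by rewrite unitmxE unitfE.
 by rewrite PE // mulf_neq0 // invr_neq0 // expf_neq0.
split.
- rewrite (_ : (fun t => _) = fun t : TF F => P (sval t) * \det (sval t) * (F (sval t))^-1).
  apply: (faM A); last exact: regF_inv.
  by apply: (@regf_poly k n (TF F) _ F (fun h => P h * \det h)) => //; apply: mpfM=> //; exact: mpf_det.
 apply/funext=> -[h h0] /=; have [P0 Dh] := FP h h0; have [l0 d0] := D0P h Dh.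
 by rewrite /F /D0; field; rewrite P0 l0 d0.
rewrite (_ : (fun t => _) = fun t : TF F => D0 (sval t) ^+ L.+1 * (F (sval t))^-1).
 apply: (faM A); last exact: regF_inv.
 by apply: (@regf_poly k n (TF F) _ F (fun h => D0 h ^+ L.+1)) => //; exact: faX.
apply/funext=> -[h h0] /=; have [P0 Dh] := FP h h0.
by rewrite PE // /F exprS; field; rewrite P0 Dh expf_neq0.
Qed.
End SemiInvariants.

(** * Basic opens of the flag variety and sheaves of regular functions *)

Section FlagTopology.
Variables (k : closedFieldType) (n : nat).
Notation T := (flag k n).
Notation B := (borel k n).
Implicit Types (F : 'M[k]_n -> k) (g h : 'M[k]_n) (U V W : opens T).

Definition bbF V F : Prop := semi F /\ forall h, frames V h <-> F h != 0.
Definition BB : set (opens T) := [set V | exists F, bbF V F].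

Lemma frames_capI V W h : frames (capI V W) h <-> frames V h /\ frames W h.
split=> [[x [Vx Wx] ax]|[[x Vx ax] [y Wy ay]]]; first by split; exists x.
by exists x => //; split=> //; rewrite (flag_ext ax ay).
Qed.

Lemma bbF_capI V W F F' : bbF V F -> bbF W F' -> bbF (capI V W) (fun h => F h * F' h).
move=> [sF VF] [sF' WF']; split; first exact: semiM.
by move=> h; rewrite frames_capI VF WF' mulf_eq0 negb_or; split=> [[-> ->]|/andP].
Qed.

Lemma BB_capI V W : BB V -> BB W -> BB (capI V W).
by move=> [F VF] [F' WF']; exists (fun h => F h * F' h); exact: bbF_capI. Qed.
Lemma bbF_full : bbF (opens_full T) determinant.
by split; [exact: semi_det|move=> h; rewrite -[opens_set _]/setT framesTP unitmxE unitfE]. Qed.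
Lemma sub_frames (A A' : set T) : (forall h, frames A h -> frames A' h) -> A `<=` A'.
move=> H x Ax; have [g ag] := adapted_ex x.
by apply/(framesP _ ag)/H/(framesP _ ag).
Qed.

Lemma bbF_ex F : semi F -> (forall h, F h != 0 -> h \in unitmx) -> exists V, bbF V F.
move=> sF Fu; pose A : set T := [set x | exists2 g, adapted x g & F g != 0].
have AP h : frames A h <-> F h != 0.
 split=> [[x [g ag Fg] ah]|Fh]; last first.
  by exists (flag_of (Fu _ Fh)); [exists h|].
 have [b tb hE] := adapted_trans ag ah.
 have ub : b \in unitmx by have := adapted_unit ah; rewrite hE unitmx_mul => /andP[].
 have Bb : mgS B b by apply/borelP.
 by rewrite hE -[b]/(\val (mgE Bb)) semi0.
have oA : flag_open A.
 move=> g /AP Fg; have [[P PE] _] := sF; exists P; first by rewrite -PE.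
 by move=> h _ Ph; apply/AP; rewrite PE.
by exists (Opens (oA : open A)).
Qed.

Lemma local_chart V g0 : frames V g0 -> exists F,
 [/\ semi F, F g0 != 0, forall h, F h != 0 -> frames V h &
  (forall h, F h != 0 -> lmin (h *m invmx g0) != 0) /\
   regF F (fun t => (lmin (sval t *m invmx g0))^-1)].
move=> Vg0; have oV : flag_open V := opens_open V.
have [Q Q0 QV] := oV _ Vg0; have ug := frames_unit Vg0.
have [F [sF F0 FP [l1 _]]] := chart_ex ug (mpf_mxeval Q) Q0.
exists F; split=> //; last by split=> // h /FP[].
move=> h /FP[uh lh Qh]; have Bb := lub_borel lh.
apply/(frames_borel V (mgE Bb)); apply: QV=> //; apply/framesTP.
by rewrite unitmx_mul uh andbT; have /borelP[] := Bb.
Qed.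

Lemma BB_basis V x : (V : set T) x -> exists W F, [/\ bbF W F, (W : set T) x & W `<=` V].
move=> Vx; have [g ag] := adapted_ex x; have Vg : frames V g by exists x.
have [F [sF F0 FV _]] := local_chart Vg.
have [|W WF] := bbF_ex sF; first by move=> h /FV/frames_unit.
exists W, F; split=> //; first by apply/(framesP _ ag)/WF.2.
by apply: sub_frames=> h /WF.2/FV.
Qed.

(** Nullstellensatz for the ideal generated by the equations of basic neighbourhoods of the points:
    a power of F is a finite combination of these equations, and the neighbourhoods occurring in it
    cover. *)
Lemma BB_qc : finely_qc BB.
move=> V.
move=> [F [sF VF]] N NP; have PA := mpf_alg k n.
have ch x : exists u : opens T * ('M[k]_n -> k), (V : set T) x ->
  [/\ bbF u.1 u.2, (u.1 : set T) x & u.1 `<=` N x].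
 have [Vx|nVx] := pselect ((V : set T) x); last by exists (V, F).
 by have [W [F' H]] := BB_basis (NP x Vx); exists (W, F').
pose Wx x := (projT1 (cid (ch x))).1; pose Fx x := (projT1 (cid (ch x))).2.
have WP x : (V : set T) x -> [/\ bbF (Wx x) (Fx x), (Wx x : set T) x & Wx x `<=` N x].
 exact: projT2 (cid (ch x)).
pose J : set ('M[k]_n -> k) := [set a | exists r (xs : 'I_r -> T) (c : 'I_r -> 'M[k]_n -> k),
 [/\ forall i, (V : set T) (xs i), forall i, mpf (c i) &
  forall h, a h = \sum_i c i h * Fx (xs i) h]].
have [|f1 f2 [r [xs [c [Vx pc fE]]]] [r' [xs' [c' [Vx' pc' fE']]]]|f1 f2 pf [r [xs [c [Vx pc fE]]]]|h H|L] :=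
 @nullstellensatz k n J F sF.1.
- have x0 : 'I_0 -> T by case.
 by exists 0%N, x0, (fun _ _ => 0); split=> [[]|[]|h] //; rewrite big_ord0.
- pose xx (i : 'I_(r + r')) := match fintype.split i with inl a => xs a | inr b => xs' b end.
 pose cc (i : 'I_(r + r')) := match fintype.split i with inl a => c a | inr b => c' b end.
 exists (r + r')%N, xx, cc; split=> [i|i|h]; rewrite /xx /cc; try by case: (fintype.split i).
 rewrite fE fE' big_split_ord; congr (_ + _); apply: eq_bigr=> i _.
  by have -> : fintype.split (lshift r' i) = inl i by exact: (unsplitK (inl i)).
 by have -> : fintype.split (rshift r i) = inr i by exact: (unsplitK (inr i)).
- exists r, xs, (fun i h => f1 h * c i h); split=> // [i|h]; first exact: (faM PA).
 by rewrite fE mulr_sumr; apply: eq_bigr=> i _; rewrite mulrA.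
- apply/eqP; apply: contraT=> Fh; have [x Vx ax] := (VF h).2 Fh.
 have [[sx WFx] Wxx _] := WP x Vx.
 have Fxh : Fx x h != 0 by apply/WFx; exists x.
 move/eqP: Fxh; case; apply: H; last exact: sx.1.
 exists 1%N, (fun=> x), (fun _ _ => 1); split=> // [i|y]; first exact: (faC PA).
 by rewrite big_ord1 mul1r.
move=> [r [xs [c [Vxs pc FE]]]]; exists r, (fun i => Wx (xs i)), xs; split=> //.
- by move=> i; have [b _ _] := WP _ (Vxs i); exists (Fx (xs i)).
- by move=> i; have [_ _] := WP _ (Vxs i).
move=> x Vx; have [g ag] := adapted_ex x; have Vg : frames V g by exists x.
have Fg := (VF g).1 Vg; apply: contrapT=> no.
have := FE g; rewrite big1 => [/eqP|i _]; first by rewrite expf_eq0 (negPf Fg) andbF.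
have [->|Fi] := eqVneq (Fx (xs i) g) 0; first by rewrite mulr0.
case: no; exists i; have [[_ WF] _ _] := WP _ (Vxs i).
by apply/(framesP _ ag); apply/WF.
Qed.

(** The e-th powers of the equations have no common zero on the open, so a power of F is a
    combination of them. The exponent e is left free to absorb poles. *)
Lemma partition_of_unity V F r (U : 'I_r -> opens T) (Fi : 'I_r -> 'M[k]_n -> k) e :
 bbF V F -> (forall i, bbF (U i) (Fi i)) ->
 (forall x, (V : set T) x -> exists i, (U i : set T) x) ->
 exists M (a : 'I_r -> 'M[k]_n -> k), (forall i, mpf (a i)) /\
  forall h, F h ^+ M = \sum_i a i h * Fi i h ^+ e.
move=> [sF VF] bU UV; have PA := mpf_alg k n.
pose J : set ('M[k]_n -> k) := [set b | exists a : 'I_r -> 'M[k]_n -> k,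
 (forall i, mpf (a i)) /\ forall h, b h = \sum_i a i h * Fi i h ^+ e].
have [|f1 f2 [a [pa fE]] [a' [pa' fE']]|f1 f2 pf [a [pa fE]]|h H|M [a [pa aE]]] :=
 @nullstellensatz k n J F sF.1; last by exists M, a.
- exists (fun _ _ => 0); split=> [i|h]; first exact: (faC PA).
 by rewrite big1 // => i _; rewrite mul0r.
- exists (fun i h => a i h + a' i h); split=> [i|h]; first exact: (faD PA).
 by rewrite fE fE' -big_split; apply: eq_bigr=> i _; rewrite mulrDl.
- exists (fun i h => f1 h * a i h); split=> [i|h]; first exact: (faM PA).
 by rewrite fE mulr_sumr; apply: eq_bigr=> i _; rewrite mulrA.
apply/eqP; apply: contraT=> Fh; have [x Vx ax] := (VF h).2 Fh.
have [i Ui] := UV x Vx; have [si UF] := bU i.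
have Fih : Fi i h != 0 by apply/UF; exists x.
have Ji : J (fun h => Fi i h ^+ e); last first.
 by have /eqP := H _ Ji (faX PA e si.1); rewrite expf_eq0 (negPf Fih) andbF.
exists (fun j h => (j == i)%:R); split=> [j|y]; first exact: (faC PA).
rewrite (bigD1 i) //= eqxx mul1r big1 ?addr0 // => j ji.
by rewrite (negPf ji) mul0r.
Qed.

Section RegularSheaf.
Variable M : lmodType k.
Implicit Types f : 'M[k]_n -> M.

(** Sections are functions on all matrices that are 0 off the frames over the open, so restriction
    is truncation and all sections have one type of values. *)
Definition gg (A : set T) f : Prop := (forall g, ~ frames A g -> f g = 0) /\
 forall g, frames A g -> exists F,
  [/\ semi F, F g != 0, forall h, F h != 0 -> frames A h & reg F f].

Lemma gg_of V F f : bbF V F -> reg F f -> (forall g, ~ frames V g -> f g = 0) -> gg V f.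
by move=> [sF VF] rf f0; split=> // g /VF Fg; exists F; split=> // h /VF. Qed.
(** The polynomials clearing the denominators of f form an ideal without zeros on the basic open, so
    this ideal contains a power of F. *)
Lemma gg_global V F f : bbF V F -> gg V f -> reg F f.
move=> [sF VF] [_ lf]; have PA := mpf_alg k n.
pose J : set ('M[k]_n -> k) := [set a | exists m : 'M[k]_n -> M, fsp mpf m /\
 forall h, F h != 0 -> a h *: f h = m h].
have [|f1 f2 [m [pm mE]] [m' [pm' mE']]|f1 f2 pf [m [pm mE]]|h H|L [m [pm mE]]] :=
 @nullstellensatz k n J F sF.1.
- by exists (fun=> 0); split=> [|h _]; [exact: fsp0|rewrite scale0r].
- exists (fun h => m h + m' h); split; first exact: fsp_add.
 by move=> h Fh; rewrite scalerDl mE // mE'.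
- exists (fun h => f1 h *: m h); split; last by move=> h Fh; rewrite -mE // scalerA.
 by apply: fsp_mul pm => b pb; exact: (faM PA).
- apply/eqP; apply: contraT=> Fh; have [F1 [sF1 F1h F1V rf]] := lf h ((VF h).2 Fh).
 have [L [m [pm mE]]] := reg_poly sF1.1 rf.
 have J1 : J (fun h => F1 h ^+ L.+1); last first.
  by have /eqP := H _ J1 (faX PA _ sF1.1); rewrite expf_eq0 (negPf F1h).
 exists (fun h => F1 h *: m h); split.
  by apply: fsp_mul pm => b pb; apply: (faM PA) => //; exact: sF1.1.
 move=> y _; have [->|F1y] := eqVneq (F1 y) 0; first by rewrite expr0n !scale0r.
 by rewrite -mE // scalerA exprS.
exact: (reg_of_poly sF.1 pm mE).
Qed.

Definition cut (A : set T) f : 'M[k]_n -> M := fun g => if `[< frames A g >] then f g else 0.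

Lemma cutT A f g : frames A g -> cut A f g = f g.
by rewrite /cut; case: asboolP. Qed.
Lemma cutF A f g : ~ frames A g -> cut A f g = 0.
by rewrite /cut; case: asboolP. Qed.
Lemma gg_local V f : (forall g, ~ frames V g -> f g = 0) ->
 (forall g, frames V g -> exists F, [/\ semi F, F g != 0 & reg F f]) -> gg V f.
move=> f0 lf; split=> // g Vg; have [F [sF Fg rf]] := lf g Vg.
have [F' [sF' F'g F'V _]] := local_chart Vg.
exists (fun h => F h * F' h); split; first exact: semiM.
- by rewrite mulf_neq0.
- by move=> h; rewrite mulf_eq0 negb_or => /andP[_ /F'V].
by apply: reg_mulr=> //; [exact: sF.1|exact: sF'.1].
Qed.

Lemma gg_cut U V f : V `<=` U -> gg U f -> gg V (cut V f).
move=> VU [f0 lf]; split=> [g|g Vg]; first exact: cutF.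
have [F [sF Fg FU rf]] := lf g (frames_sub VU Vg).
have [F' [sF' F'g F'V _]] := local_chart Vg.
exists (fun h => F h * F' h); split; first exact: semiM.
- by rewrite mulf_neq0.
- by move=> h; rewrite mulf_eq0 negb_or => /andP[_ /F'V].
apply: (@reg_ext _ _ _ _ f); last by apply: reg_mulr=> //; [exact: sF.1|exact: sF'.1].
by move=> h; rewrite mulf_eq0 negb_or => /andP[_ /F'V Vh]; rewrite cutT.
Qed.

Definition gg_pred (V : opens T) : {pred ('M[k]_n -> M)} := fun f => `[< gg V f >].
Record gg_sec (V : opens T) : Type := GGSec { ggf :> 'M[k]_n -> M ; ggP : ggf \in gg_pred V }.

Lemma gg_submod V : submod_closed (gg_pred V).
split.
 apply/asboolP; split=> // g Vg; have [F [sF Fg FV _]] := local_chart Vg.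
 by exists F; split=> //; exact: fsp0.
move=> c f1 f2 /asboolP[f10 l1] /asboolP[f20 l2]; apply/asboolP/gg_local=> g.
 by move=> nV; rewrite -[LHS]/(c *: f1 g + f2 g) f10 // f20 // scaler0 addr0.
move=> Vg; have [F1 [s1 F1g _ r1]] := l1 g Vg; have [F2 [s2 F2g _ r2]] := l2 g Vg.
exists (fun h => F1 h * F2 h); split; [exact: semiM|by rewrite mulf_neq0|].
by apply: regL; [apply: reg_mulr|apply: reg_mull] => //; do ?[exact: s1.1|exact: s2.1].
Qed.

HB.instance Definition _ V := GRing.isSubmodClosed.Build k ('M[k]_n -> M) (gg_pred V)
  (GRing.submod_closed_semi (gg_submod V)).
HB.instance Definition _ V := [isSub for @ggf V].
HB.instance Definition _ V := [Choice of gg_sec V by <:].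
HB.instance Definition _ V := [SubChoice_isSubLmodule of gg_sec V by <:].

Definition mkgg V f (h : gg V f) : gg_sec V := GGSec (asboolT h).

Lemma ggsP V (s : gg_sec V) : gg V s.
by apply/asboolP; exact: ggP. Qed.
Lemma gg_ext V (s t : gg_sec V) : (forall h, frames V h -> s h = t h) -> s = t.
move=> st; apply/val_inj/funext=> h; have [/st //|nh] := pselect (frames V h).
by have [s0 _] := ggsP s; have [t0 _] := ggsP t; rewrite -[LHS]/(s h) -[RHS]/(t h) s0 // t0.
Qed.

Definition gg_res U V (h : V `<=` U) : {linear gg_sec U -> gg_sec V}.
unshelve refine (@mkLin k (gg_sec U) (gg_sec V) (fun s => mkgg (gg_cut h (ggsP s))) _).
by move=> c s t; apply: gg_ext=> g Vg; rewrite /= -[RHS]/(c *: cut V s g + cut V t g) !cutT.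
Defined.

Lemma gg_resE U V (h : V `<=` U) (s : gg_sec U) g : frames V g -> gg_res h s g = s g.
exact: cutT. Qed.
Lemma gg_glue U (C : set (opens T)) : U = \bigcup_(V in C) V :> set T ->
 forall s : (forall V, gg_sec V),
 (forall V1 V2 W (h1 : W `<=` V1) (h2 : W `<=` V2), C V1 -> C V2 ->
  gg_res h1 (s V1) = gg_res h2 (s V2)) ->
 exists! x : gg_sec U, forall V (hVU : V `<=` U), C V -> gg_res hVU x = s V.
move=> UC s compat; have sU V : C V -> V `<=` U by rewrite UC => CV y Vy; exists V.
pose f g := if pselect (exists V, C V /\ frames V g) is left h then s (projT1 (cid h)) g else 0.
have fE V g : C V -> frames V g -> f g = s V g.
 move=> CV Vg; rewrite /f; case: pselect=> [h|[]]; last by exists V.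
 have [CV' V'g] := projT2 (cid h); move: (projT1 _) CV' V'g => V' CV' V'g.
 have Wg : frames (capI V' V) g by apply/frames_capI.
 have := congr1 (fun F : gg_sec _ => F g) (compat _ _ _ (@capIl _ V' V) (@capIr _ V' V) CV' CV).
 by rewrite !gg_resE.
have fP : gg U f.
 apply: gg_local=> g.
  move=> nU; rewrite /f; case: pselect=> // -[V [CV Vg]]; case: nU.
  exact: frames_sub (sU V CV) _ Vg.
 move=> [x]; rewrite UC => -[V CV Vx] ax; have Vg : frames V g by exists x.
 have [_ /(_ g Vg)[F [sF Fg FV rf]]] := ggsP (s V).
 exists F; split=> //; apply: reg_ext rf => h /FV Vh; symmetry; exact: fE.
exists (mkgg fP); split=> [V h CV|y yE].
 by apply: gg_ext=> g Vg; rewrite gg_resE //; exact: fE.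
apply: gg_ext=> g [x]; rewrite UC => -[V CV Vx] ax; have Vg : frames V g by exists x.
by rewrite -[LHS]/(f g) (fE V) // -(yE V (sU V CV) CV) gg_resE.
Qed.

Definition GG : sheaf k T.
refine (@Sheaf k T (fun V => gg_sec V : lmodType k) gg_res _ _ gg_glue).
- by move=> U h s; apply: gg_ext=> g Ug; rewrite gg_resE.
- move=> U V W h1 h2 h3 s; apply: gg_ext=> g Wg; rewrite !gg_resE //; exact: frames_sub Wg.
Defined.

Lemma bbF_cap r (U : 'I_r -> opens T) (Fi : 'I_r -> 'M[k]_n -> k) s V F :
 (forall i, bbF (U i) (Fi i)) -> bbF V F ->
 bbF (cap U V s) (fun h => F h * \prod_(j <- s) Fi j h).
move=> bU; elim: s V F => [|i s IH] V F bV /=.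
 rewrite (_ : (fun h => _) = F) //; apply/funext=> h; by rewrite big_nil mulr1.
rewrite (_ : (fun h => _) = fun h => F h * Fi i h * \prod_(j <- s) Fi j h).
 by apply: IH; exact: bbF_capI.
by apply/funext=> h; rewrite big_cons mulrA.
Qed.

(** In the partition of unity the weight of U_i is a multiple of Fi^e, with e above the pole orders
    of the finitely many components involved. So the product of a component with its weight extends
    by zero from the part inside U_i. *)
Lemma cech_GG : cacyc BB (sp_full GG).
have PA := mpf_alg k n.
apply: (@cacyc_pu k T BB GG 'M[k]_n (fun V => frames V) M (fun V (s : gg_sec V) => ggf s)) => //.
- by move=> V W h s y Wy; exact: gg_resE.
- by move=> V s t; exact: gg_ext.
- by move=> V W y h; exact: frames_sub.
- by move=> V W y Vy Wy; apply/frames_capI.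
move=> V r U [F VF] bU UV m c.
pose Fi i := projT1 (cid (bU i)); have UF i : bbF (U i) (Fi i) := projT2 (cid (bU i)).
pose Pi s h := \prod_(j <- s) Fi j h.
have pPi s : mpf (Pi s).
 by apply: (fa_prod PA) => i _; have [[]] := UF i.
have bs s := bbF_cap s UF VF.
have rp i s : exists u : nat * ('M[k]_n -> M), fsp mpf u.2 /\
  forall h, F h * Pi (i :: s) h != 0 -> (F h * Pi (i :: s) h) ^+ u.1 *: ggf (c (i :: s)) h = u.2 h.
 have bis := bs (i :: s); have [L [mm H]] := reg_poly bis.1.1 (gg_global bis (ggsP (c (i :: s)))).
 by exists (L, mm).
pose Lf i s := (projT1 (cid (rp i s))).1; pose mf i s := (projT1 (cid (rp i s))).2.
have [pm mE] : (forall i s, fsp mpf (mf i s)) /\ (forall i s h, F h * Pi (i :: s) h != 0 ->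
  (F h * Pi (i :: s) h) ^+ Lf i s *: ggf (c (i :: s)) h = mf i s h).
 by split=> i s; have [] := projT2 (cid (rp i s)).
(* Strictly above every pole order in length m, so that a factor Fi survives and the product is 0
   where Fi vanishes. *)
pose e := (\sum_(i < r) \sum_(t : m.-tuple 'I_r) Lf i t).+1.
have Le i s : size s = m -> (Lf i s < e)%N.
 move=> sm; have sm' : size s == m by exact/eqP.
 by rewrite ltnS (bigD1 i) //= (bigD1 (Tuple sm')) //= -addnA leq_addr.
have [N [a [pa aE]]] := partition_of_unity e VF UF UV.
pose w i h := a i h * Fi i h ^+ e / F h ^+ N.
have ex s : exists b : gg_sec (cap U V s), size s = m -> forall h, frames (cap U V s) h ->
  b h = \sum_i w i h *: ggf (c (i :: s)) h.
 have [sm|sm] := eqVneq (size s) m; last by exists 0 => sm'; rewrite sm' eqxx in sm.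
 pose f h := \sum_i w i h *: ggf (c (i :: s)) h.
 have rf : reg (fun h => F h * Pi s h) f.
  rewrite /reg /f; apply: fsp_sum=> i; pose L := Lf i s.
  apply: (@reg_of_poly _ _ _ _ (fun h => w i h *: ggf (c (i :: s)) h)
   (fun h => (Pi s h ^+ N * a i h * Fi i h ^+ (e - L)) *: mf i s h) (N + L)%N).
  - exact: (bs s).1.1.
  - apply: fsp_mul (pm i s) => b pb; apply: (faM PA) => //.
   apply: (faM PA); last by apply: (faX PA); have [[]] := UF i.
   by apply: (faM PA) => //; apply: (faX PA).
  move=> h; rewrite mulf_eq0 negb_or => /andP[Fh Ph].
  have eL : (0 < e - L)%N by rewrite subn_gt0; exact: Le.
  have [Fi0|Fi0] := eqVneq (Fi i h) 0.
   by rewrite /w Fi0 !expr0n (gtn_eqF eL) /= mulr0 mul0r !scale0r mulr0 scaler0 scale0r.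
  have Pis : Pi (i :: s) h = Fi i h * Pi s h by rewrite /Pi big_cons.
  rewrite -mE; last by rewrite Pis !mulf_neq0.
  rewrite Pis !scalerA; congr (_ *: _); rewrite /w -/L.
  have -> : Fi i h ^+ e = Fi i h ^+ (e - L) * Fi i h ^+ L by rewrite -exprD subnK // ltnW // Le.
  rewrite exprD !exprMn; move: (expf_neq0 N Fh).
  move: (F h ^+ N) (Pi s h ^+ N) (Fi i h ^+ (e - L)) (Fi i h ^+ L) (F h ^+ L) (Pi s h ^+ L) (a i h).
  by move=> x1 x2 x3 x4 x5 x6 x7 x10; field.
 have gf : gg (cap U V s) (cut (cap U V s) f).
  apply: (gg_of (bs s)); last by move=> h; exact: cutF.
  by apply: reg_ext rf => h /(bs s).2 Vh; rewrite cutT.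
 by exists (mkgg gf) => _ h Vh; rewrite -[LHS]/(cut _ f h) cutT.
exists (fun s => projT1 (cid (ex s))), w; split.
- move=> h /VF.2 Fh; rewrite /w -mulr_suml -aE mulfV // expf_neq0 //.
- move=> i h wi _; apply/(UF i).2; apply: contraNneq wi => Fi0.
 by rewrite /w Fi0 expr0n /= mulr0 mul0r.
by move=> s h sm Vh; rewrite (projT2 (cid (ex s)) sm).
Qed.
End RegularSheaf.
End FlagTopology.

(** * Functions of two variables *)

Section Currying.
Context k (X Y : Type) (P : set (X -> k)) (Q : set (Y -> k)) (W : lmodType k).
Hypotheses (hP : falg P) (hQ : falg Q).

Definition dsp : set (X * Y -> k) := [set f | dspan P Q (fun x y => f (x, y))].

Lemma dsp_alg : falg dsp. Proof. exact: dspan_alg. Qed.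
(** Associativity of tensor products, read on functions. *)
Lemma fsp_curry (F : X * Y -> W) : fsp dsp F ->
 forall l : Y -> fmod P W, (forall y x, l y x = F (x, y)) -> fsp Q l.
elim=> [|a w f ra rf IH] l lE.
 by apply: fsp_eq0=> t; apply: fm_ext=> x; rewrite lE.
have fa y : fsp P (fun x => a (x, y) *: w).
 by apply: (@fsp1 k X P W (fun x => a (x, y))); exact: (dspan_l y (fa_sub hP) ra).
have ff y : fsp P (fun x => f (x, y)).
 by apply: (@fsp_pull k (X * Y) X dsp P (fun x => (x, y)) W f _ rf) => b rb; exact: (dspan_l y (fa_sub hP) rb).
pose l1 y : fmod P W := mkfm (fa y).
pose l2 y : fmod P W := mkfm (ff y).
rewrite (_ : l = fun t => l1 t + l2 t); last first.
 by apply/funext=> t; apply: fm_ext=> x; rewrite lE.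
apply: fsp_add; last by apply: IH.
by apply: (dspan_fsp (w := w) ra).
Qed.

Lemma fsp_uncurry (l : Y -> fmod P W) : fsp Q l -> fsp dsp (fun p => l p.2 p.1).
elim=> [|a w f Qa _ IH]; first by rewrite (_ : (fun p => _) = fun=> 0) //; exact: fsp0.
apply: (@fsp_add k (X * Y) dsp W (fun p => a p.2 *: (w : fmod P W) p.1) _ _ IH).
apply: fsp_mul.
 move=> b rb; apply: (faM dsp_alg) => //.
 exact: (dspan_snd hP Qa).
apply: (@fsp_pull k X (X * Y) P dsp (fun p => p.1) W w) (fmP w) => b Pb.
exact: (dspan_fst hQ Pb).
Qed.

Lemma dsp_tau (tau : X * Y -> X * Y) :
 (forall a, P a -> dsp (fun p => a (tau p).1)) -> (forall b, Q b -> dsp (fun p => b (tau p).2)) ->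
 forall f, dsp f -> dsp (fun p => f (tau p)).
move=> Pt Qt f df; suff H (g : X -> Y -> k) : dspan P Q g -> dsp (fun p => g (tau p).1 (tau p).2).
 rewrite (_ : (fun p => _) = fun p => f ((tau p).1, (tau p).2)); first exact: (H (fun x y => f (x, y))).
 by apply/funext=> p; rewrite -surjective_pairing.
elim=> [|a b h Pa Qb _ IH]; first exact: (faC dsp_alg 0).
by apply: (faD dsp_alg) => //; apply: (faM dsp_alg); [exact: Pt|exact: Qt].
Qed.
End Currying.

(** * The differential of the resolution *)

Section Differential.
Variables (k : closedFieldType) (n : nat).
Notation T := (flag k n).
Notation B := (borel k n).
Notation Bg := (mgr B).
Implicit Types (F : 'M[k]_n -> k) (g h : 'M[k]_n) (U V W : opens T).

Lemma regF_char_inv F (c : gchar Bg) (X : Type) (A : set (X -> k)) (x : X -> Bg) (u : X -> 'M[k]_n) :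
 falg A -> (forall (b : B) g, F (\val b *m g) = c b * F g) ->
 (forall a, @agO k Bg a -> A (fun y => a (x y))) -> A (fun y => (F (u y))^-1) ->
 A (fun y => (F (\val (x y) *m u y))^-1).
move=> hA cE xA FA; rewrite (_ : (fun y => _) = fun y => c (agV (x y)) * (F (u y))^-1).
 by apply: (faM hA) => //; apply: (xA (fun b => c (agV b))); apply: agO_inv; exact: gcO.
apply/funext=> y; rewrite cE invfM; congr (_ * _).
by apply: (mulfI (gc_neq0 c (x y))); rewrite gcVr mulfV // gc_neq0.
Qed.

Definition lact F (sF : semi F) (x : B) (t : TF F) : TF F :=
 exist (fun h => F h != 0) (\val x *m sval t) (etrans (semi0 x (sval t) sF) (proj2_sig t)).

Lemma regF_coact F (sF : semi F) a : regF F a ->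
 dspan (@agO k Bg) (regF F) (fun x t => a (lact sF x t)).
move=> ra; have hA := dspan_alg (mgO_alg B) (regF_alg sF.1).
apply: (@regF_comp k n F _ _ (fun p : Bg * TF F => lact sF p.1 p.2) a hA _ _ ra).
 apply: (fa_mulmx hA (M := fun p : Bg * TF F => \val p.1) (N := fun p => sval p.2)) => i j /=.
  by apply: (dspan_fst (regF_alg sF.1) (a := fun x : Bg => \val x i j)); exact: mgO_entry.
 apply: (dspan_snd (mgO_alg B) (b := fun t : TF F => sval t i j)); exact: regF_entry sF.1.
have [pF [c cE]] := sF.
apply: (@regF_char_inv F c _ _ (fun p : Bg * TF F => p.1) (fun p => sval p.2) hA cE) => /=.
 by move=> b Ob; exact: (dspan_fst (regF_alg pF) Ob).
by apply: (dspan_snd (mgO_alg B) (b := fun t : TF F => (F (sval t))^-1)); exact: regF_inv.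
Qed.

Section Module.
Variable M : rmod Bg.

Lemma rot_fsp0 F (sF : semi F) (f : TF F -> M) t : fsp (regF F) f ->
 fsp (@agO k Bg) (fun x => f (lact sF x t)).
apply: fsp_pull=> a ra; exact: (dspan_l t (agO_sub Bg) (regF_coact sF ra)).
Qed.

Lemma rot_fsp V (s : gg_sec M V) g : fsp (@agO k Bg) (fun x : Bg => s (\val x *m g)).
have [s0 ls] := ggsP s; have [Vg|nVg] := pselect (frames V g).
 have [F [sF Fg _ rf]] := ls g Vg.
 exact: (rot_fsp0 sF (exist (fun h => F h != 0) g Fg) rf).
by apply: fsp_eq0=> x; apply: s0=> /frames_borel.
Qed.

Definition rot V (s : gg_sec M V) g : fmod (@agO k Bg) M := mkfm (rot_fsp s g).

Lemma reg_rot F (sF : semi F) (f : TF F -> M) : fsp (regF F) f ->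
 forall l : TF F -> fmod (@agO k Bg) M, (forall t x, l t x = f (lact sF x t)) -> fsp (regF F) l.
move=> rf l lE; apply: (fsp_curry (mgO_alg B) (F := fun p => f (lact sF p.1 p.2))) => [|t x].
 by apply: fsp_pull rf => a; exact: regF_coact.
exact: lE.
Qed.

(** The defect of B-equivariance of a section, recorded as a function with values in [csz M]. *)
Definition dfun V (s : gg_sec M V) g : csz M := norm (rot s g).

Lemma dfunE V (s : gg_sec M V) g (x : Bg) : dfun s g x = s (\val x *m g) - ra x (s g).
by rewrite normE -[rot s g ag1]/(s (1%:M *m g)) mul1mx. Qed.
Lemma reg_dfun F V (s : gg_sec M V) : semi F -> reg F s -> reg F (dfun s).
move=> sF rf; have := reg_rot (sF := sF) rf (l := fun t => rot s (sval t)) (fun t x => erefl).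
exact: (fsp_lin (@norm_lin k Bg M)).
Qed.

Lemma gg_dfun V (s : gg_sec M V) : gg V (dfun s).
have [s0 ls] := ggsP s; split=> [g nVg|g Vg].
 apply: pc_ext=> x; rewrite dfunE s0 => [|/frames_borel //].
 by rewrite s0 // ra0 subrr.
by have [F [sF Fg FV rf]] := ls g Vg; exists F; split=> //; exact: reg_dfun.
Qed.

Lemma dfun_lin V : linear (fun s : gg_sec M V => mkgg (gg_dfun s)).
move=> c s t; apply: gg_ext=> g _; apply: pc_ext=> x.
rewrite -[RHS]/(c *: dfun s g x + dfun t g x) -[LHS]/(dfun (c *: s + t) g x) !dfunE.
have E h : (c *: s + t : gg_sec M V) h = c *: s h + t h by [].
by rewrite !E raD raZ scalerBr opprD addrACA.
Qed.

Lemma dfun_res U V (h : V `<=` U) (s : gg_sec M U) :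
 mkgg (gg_dfun (gg_res M h s)) = gg_res _ h (mkgg (gg_dfun s)).
apply: gg_ext=> g Vg; apply: pc_ext=> x; rewrite gg_resE //.
rewrite -[RHS]/(dfun s g x) -[LHS]/(dfun (gg_res M h s) g x) !dfunE !gg_resE //.
exact/frames_borel.
Qed.

Definition dG : sheafHom (GG n M) (GG n (csz M)) :=
 @SheafHom k T (GG n M) (GG n (csz M)) (fun V => mkLin (@dfun_lin V)) dfun_res.

Lemma dGE V (s : gg_sec M V) g (x : Bg) :
 (dG V s : gg_sec (csz M) V) g x = s (\val x *m g) - ra x (s g).
exact: dfunE. Qed.
Lemma dG0P V (s : gg_sec M V) : dG V s = 0 <->
 forall g (x : Bg), frames V g -> s (\val x *m g) = ra x (s g).
split=> [d0 g x _|H].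
 have := congr1 (fun u : gg_sec (csz M) V => u g x) d0; rewrite dGE => /eqP.
 by rewrite -[X in _ == X]/(0 : M) subr_eq0 => /eqP.
apply: gg_ext=> g Vg; apply: pc_ext=> x; rewrite dGE H // subrr //.
Qed.
End Module.

Lemma fa_lub F g0 : semi F -> (forall h, F h != 0 -> lmin (h *m invmx g0) != 0) ->
 regF F (fun t => (lmin (sval t *m invmx g0))^-1) ->
 (forall i j, regF F (fun t => lub (sval t *m invmx g0) i j)) /\
 regF F (fun t => (\det (lub (sval t *m invmx g0)))^-1).
move=> [pF _] l0 li; have A := regF_alg pF.
have eC (i j : 'I_n) : regF F (fun t => (sval t *m invmx g0) i j).
 by apply: (fa_mulmx A) => a b; [exact: regF_entry|exact: (faC A)].
split; first by apply: fa_lead_inv=> // -[h h0] /=; exact: l0.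
rewrite (_ : (fun t => _) = fun t : TF F => \det (sval t *m invmx g0)); first exact: (fa_det A).
apply/funext=> -[h h0] /=; have e := det_lub (l0 _ h0).
have d0 : \det (lub (h *m invmx g0)) != 0.
 by apply/eqP=> d; move/eqP: e; rewrite d mul0r eq_sym oner_eq0.
by apply: (mulfI d0); rewrite e mulfV.
Qed.

(** On an LU chart g = b(g)^-1 u(g), where u is constant on cosets. An equivariant section y is then
    the differential of z(g) = y(u(g))(b(g)^-1), by the cocycle identity; most of the work is the
    regularity of z. *)
Lemma dG_exact (M : rmod Bg) : sheaf_exact (dG M) (dG (csz M)).
move=> V y; split=> [/dG0P H x Vx|loc]; last first.
 apply/dG0P=> g x [v Vv av]; have [W [h [Wv [z zE]]]] := loc v Vv.
 have Wg : frames W g by exists v.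
 have yE g' : frames W g' -> (y : gg_sec (csz M) V) g' = (dG M W z : gg_sec _ W) g'.
  by move=> Wg'; rewrite zE gg_resE.
 have Wxg : frames W (\val x *m g) by apply/frames_borel.
 apply: pc_ext=> t; rewrite !yE // dGE -[RHS]/(pc_act x _ t) pc_actE !dGE raB -ra_M.
 have -> : \val (agM t x : Bg) *m g = \val t *m (\val x *m g) by rewrite mulmxA.
 by rewrite opprB addrA subrK.
have [g0 ag0] := adapted_ex x; have Vg0 : frames V g0 by exists x.
have [_ /(_ g0 Vg0)[F1 [sF1 F1g F1V rf]]] := ggsP (y : gg_sec (csz M) V).
have [F2 [sF2 F2g F2V [lm li]]] := local_chart Vg0.
pose c := invmx g0; pose F h := F1 h * F2 h.
have sF : semi F by exact: semiM.
have F12 h : F h != 0 -> F1 h != 0 /\ F2 h != 0 by rewrite mulf_eq0 negb_or => /andP[].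
have [|W WF] := bbF_ex sF; first by move=> h /F12[_ /F2V/frames_unit].
have WV : W `<=` V by apply: sub_frames=> h /WF.2/F12[/F1V].
exists W, WV; split; first by apply/(framesP _ ag0)/WF.2; rewrite mulf_neq0.
have lmF h : F h != 0 -> lmin (h *m c) != 0 by move=> /F12[_ /lm].
have A := regF_alg sF.1.
have liF : regF F (fun t => (lmin (sval t *m c))^-1).
 pose u (t : TF F) : TF F2 := exist (fun h => F2 h != 0) (sval t) (F12 _ (proj2_sig t)).2.
 apply: (@regF_comp k n F2 (TF F) _ u (fun t => (lmin (sval t *m c))^-1) A _ _ li).
  by move=> i j; exact: regF_entry sF.1.
 rewrite (_ : (fun t => _) = fun t : TF F => F1 (sval t) * (F (sval t))^-1).
  by apply: (faM A); [apply: regf_poly; exact: sF1.1|exact: regF_inv sF.1].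
 by apply/funext=> -[h /= Fh]; have [F1h F2h] := F12 h Fh; rewrite /F invfM mulrA mulfV // mul1r.
have [eL dL] := fa_lub sF lmF liF.
pose be (t : TF F) : Bg := mgE (lub_borel (lmF _ (proj2_sig t))).
have beA a : @agO k Bg a -> regF F (fun t => a (be t)) by move=> Oa; apply: (mgO_comp A) Oa.
have F1s (t : TF F) : F1 (\val (be t) *m sval t) != 0.
 by rewrite semi0 //; have [] := F12 _ (proj2_sig t).
pose sg (t : TF F) : TF F1 := exist (fun h => F1 h != 0) (\val (be t) *m sval t) (F1s t).
have sgA a : regF F1 a -> regF F (fun t => a (sg t)).
 apply: (regF_comp A).
  by apply: (fa_mulmx A) => i j; [exact: eL|exact: regF_entry sF.1].
 have [pF1 [c1 c1E]] := sF1.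
 apply: (@regF_char_inv F1 c1 _ _ be (fun t => sval t) A c1E beA).
 rewrite (_ : (fun t => _) = fun t : TF F => F2 (sval t) * (F (sval t))^-1).
  by apply: (faM A); [apply: regf_poly; exact: sF2.1|exact: regF_inv sF.1].
 by apply/funext=> -[h /= Fh]; have [F1h F2h] := F12 h Fh; rewrite /F invfM mulrCA mulfV // mulr1.
pose z0 (t : TF F) : M := (y : gg_sec (csz M) V) (sval (sg t)) (agV (be t)).
have rz0 : fsp (regF F) z0.
 suff Hf f : fsp (regF F1) f -> fsp (regF F) (fun t => (f (sg t) : csz M) (agV (be t))).
  exact: (Hf _ rf).
 elim=> [|a w f0 ra _ IH].
  by rewrite (_ : (fun t => _) = fun=> 0) //; exact: fsp0.
 have Ef : (fun t => ((a (sg t) *: w + f0 (sg t)) : csz M) (agV (be t))) =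
   (fun t => a (sg t) *: (w : csz M) (agV (be t)) + (f0 (sg t) : csz M) (agV (be t))).
  by apply/funext=> t; rewrite pcED pcEZ.
 rewrite Ef; apply: fsp_add IH; apply: fsp_mul.
  by move=> b rb; apply: (faM A) => //; exact: sgA.
 apply: (@fsp_pull k Bg (TF F) (@agO k Bg) _ (fun t => agV (be t)) M (fun b => w b)) => [b Ob|].
  by apply: (beA (fun x => b (agV x))); exact: agO_inv.
 exact: fmP.
pose z (h : 'M[k]_n) : M := if pselect (F h != 0) is left Fh then z0 (exist _ h Fh) else 0.
have zE h (Fh : F h != 0) : z h = z0 (exist _ h Fh).
 by rewrite /z; case: pselect=> // Fh'; congr (z0 (exist _ h _)); exact: bool_irrelevance.
have gz : gg W z.
 apply: (gg_of WF) => [|h nW].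
  rewrite /reg (_ : (fun t => _) = z0) //; apply/funext=> -[h Fh]; exact: zE.
 by rewrite /z; case: pselect=> // Fh; case: nW; apply/WF.2.
exists (mkgg gz); apply: gg_ext=> g Wg; apply: pc_ext=> b.
have Fg : F g != 0 by apply/WF.2.
have Fbg : F (\val b *m g) != 0 by rewrite semi0.
have Vg : frames V g := frames_sub WV Wg.
rewrite dGE -[mkgg gz _]/(z _) -[mkgg gz g]/(z g) (zE _ Fg) (zE _ Fbg) gg_resE // /z0 /=.
set t : TF F := exist (fun h => F h != 0) g Fg; set t' : TF F := exist (fun h => F h != 0) _ Fbg.
have lg : lmin (g *m c) != 0 by apply: (lmF _ Fg).
have beE : be t' = agM (be t) (agV b).
 apply: val_inj; rewrite /= -mulmxA; exact: lub_borelM.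
have -> : \val (be t') *m (\val b *m g) = \val (be t) *m g.
 rewrite mulmxA -[\val (be t') *m \val b]/(\val (agM (be t') b)) beE -agMA agVM agM1 //.
have -> : mg_inv (be t') = agM b (agV (be t)).
 rewrite -[LHS]/(agV (be t')).
 have cancel (u v w : Bg) : agM w u = agM w v -> u = v.
  by move=> /(congr1 (agM (agV w))); rewrite !agMA agVM !ag1M.
 apply: (cancel _ _ (be t')); rewrite agMV beE agMA -(agMA _ (agV b)) agVM agM1 agMV //.
have Vbg : frames V (\val (be t) *m g) by apply/frames_borel.
have gE : g = \val (agV (be t)) *m (\val (be t) *m g).
 have e1 : \val (agM (agV (be t)) (be t)) = 1%:M by rewrite agVM.
 by rewrite mulmxA -[_ *m \val (be t)]/(\val (agM (agV (be t)) (be t))) e1 mul1mx.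
rewrite [in RHS]gE (H (\val (be t) *m g) (agV (be t)) Vbg).
by rewrite -[RHS]/(pc_act (agV (be t)) (y (\val (be t) *m g)) b) pc_actE.
Qed.
End Differential.

Lemma csz_predP k (S : agr k) (N : rmod S) (f : fmod (@agO k S) N) :
 f ag1 = 0 -> f \in @csz_pred k S N.
by move=> e; apply/eqP. Qed.

Definition mk_csz k (S : agr k) (N : rmod S) (f : S -> N)
  (Pf : fsp (@agO k S) f) (f1 : f ag1 = 0) : csz N :=
 CosyzCar (csz_predP (f := mkfm Pf) f1).

Lemma fmL k X (P : set (X -> k)) (W : lmodType k) c (f f' : fmod P W) x :
 (c *: f + f') x = c *: f x + f' x.
by []. Qed.
Lemma pcL k (S : agr k) (N : rmod S) c (f f' : csz N) x :
 (c *: f + f' : csz N) x = c *: f x + f' x.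
by []. Qed.
Lemma pc0 k (S : agr k) (N : rmod S) x : (0 : csz N) x = 0.
by []. Qed.

(** * Global sections of the resolution as a standard complex *)

Section Shift.
Context k (S : agr k) (E : gspace S) (M : rmod S).
Hypothesis hE : falg (@gP k S E).
Let hS : falg (@agO k S) := FAlg (agO_sub S) (agO_1 S) (@agO_mul k S).
Notation D := (dsp (@gP k S E) (@agO k S)).
Notation D' := (dsp (@agO k S) (@gP k S E)).

Lemma dsp_sym (X Y : Type) (P : set (X -> k)) (Q : set (Y -> k)) f :
 dsp P Q f -> dsp Q P (fun p => f (p.2, p.1)).
rewrite /dsp /=; suff H g : dspan P Q g -> dspan Q P (fun y x => g x y) by exact: (H (fun x y => f (x, y))).
elim=> [|a b h Pa Qb _ IH]; first exact: dspan0.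
rewrite (_ : (fun y x => _) = fun y x => b y * a x + h x y); first exact: dspanD.
by apply/funeq2P=> y x; rewrite mulrC.
Qed.

Lemma fsp_swap (X Y : Type) (P : set (X -> k)) (Q : set (Y -> k)) (W : lmodType k) (f : X * Y -> W) :
 fsp (dsp P Q) f -> fsp (dsp Q P) (fun p => f (p.2, p.1)).
by apply: (@fsp_pull k (X * Y) (Y * X) _ _ (fun p => (p.2, p.1))) => a; exact: dsp_sym. Qed.
Lemma dsp_fst (a : E -> k) : gP E a -> D (fun p => a p.1).
exact: (dspan_fst hS). Qed.
Lemma dsp_snd (b : S -> k) : agO b -> D (fun p => b p.2).
exact: (dspan_snd hE). Qed.
Lemma dsp_act (f : E * S -> k) : D f -> D (fun p => f (gact p.1 p.2, p.2)).
move=> Df; refine (@dsp_tau k E S (gP E) agO hE hS (fun p : E * S => (gact p.1 p.2, p.2)) _ _ f Df).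
 by move=> a Pa; exact (gP_co Pa).
by move=> b Ob; exact (dsp_snd Ob).
Qed.

Lemma dsp_actV (f : E * S -> k) : D f -> D (fun p => f (gact p.1 (agV p.2), p.2)).
move=> Df; refine (@dsp_tau k E S (gP E) agO hE hS (fun p : E * S => (gact p.1 (agV p.2), p.2)) _ _ f Df).
 move=> a Pa; have h : D (fun p => a (gact p.1 p.2)) by exact (gP_co Pa).
 refine (@dsp_tau k E S (gP E) agO hE hS (fun p : E * S => (p.1, agV p.2)) _ _ _ h).
  by move=> c Pc; exact (dsp_fst Pc).
 by move=> c Oc; exact (@dsp_snd (fun x => c (agV x)) (agO_inv Oc)).
by move=> b Ob; exact (dsp_snd Ob).
Qed.

Let h2 (h : FM E (csz M)) (p : E * S) : M := (fm_fun h p.1 : csz M) p.2.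
Let u2 (u : csz (FM E M)) (p : E * S) : M := ((u : csz_car _) p.2 : fmod _ _) p.1.

Lemma h2_lin c h h' p : h2 (c *: h + h') p = c *: h2 h p + h2 h' p.
exact (etrans (congr1 (fun u : csz M => u p.2) (fmL c (h : fmod _ _) h' p.1)) (pcL c _ _ p.2)).
Qed.

Lemma h2_ra b h g x : h2 (ra b h) (g, x) =
 h2 h (gact g b, agM x b) - ra x (h2 h (gact g b, b)).
exact (pc_actE b (fm_fun h (gact g b) : csz M) x). Qed.
Lemma h2_fsp h : fsp D (h2 h).
have lp : linear (fun c : csz M => (pc_fun c : fmod agO M)) by [].
have := fsp_uncurry hS hE (fsp_lin lp (fmP h)).
by move=> /fsp_swap.
Qed.

Lemma u2_fsp u : fsp D (u2 u).
exact: (fsp_uncurry hE hS (fmP (pc_fun u))). Qed.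
Lemma th_fsp h : fsp D (fun p => - h2 h (gact p.1 p.2, p.2)).
apply: (@fsp_lin k (E * S) D M M (fun v => - v)); first by move=> c v w; rewrite opprD scalerN.
exact: (fsp_pull dsp_act (h2_fsp h)).
Qed.

Lemma th_slice h x : fsp (gP E) (fun g : E => - h2 h (gact g x, x)).
apply: (@fsp_pull k (E * S) E D (gP E) (fun g => (g, x)) M _ _ (th_fsp h)) => b Db.
exact: (dspan_l x (fa_sub hE) Db).
Qed.

Let th0 h x : FM E M := mkfm (th_slice h x).

Lemma th0_fsp h : fsp agO (th0 h).
pose l x : fmod (gP E) M := mkfm (th_slice h x).
have H : fsp agO l by apply: (fsp_curry hE (th_fsp h)).
exact H.
Qed.

Lemma th0_1 h : th0 h ag1 = 0.
apply: fm_ext=> g; have e : h2 h (gact g ag1, ag1) = 0 by exact: pc1.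
by exact (etrans (congr1 (fun v : M => - v) e) (oppr0 M)).
Qed.

(** The tensor identity: functions on E with values in [csz M] are [csz] of the functions on E with
    values in [M]. Evaluation at the point moved by x makes the map equivariant, and the sign makes
    it match coboundaries. *)
Definition th h : csz (FM E M) := mk_csz (th0_fsp h) (th0_1 h).

Lemma thE h x g : ((th h : csz_car _) x : fmod _ _) g = - (fm_fun h (gact g x) : csz M) x.
by []. Qed.
Lemma th_lin : linear th.
move=> c h h'; apply: pc_ext=> x; apply: fm_ext=> g.
rewrite thE -[RHS]/(c *: (- h2 h (gact g x, x)) + - h2 h' (gact g x, x)).
by rewrite -[X in - X]/(h2 (c *: h + h') (gact g x, x)) h2_lin opprD scalerN.
Qed.

Lemma th_eq b h : mkLin th_lin (ra b h) = ra b (mkLin th_lin h).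
apply: pc_ext=> x; apply: fm_ext=> g.
have e : ((ra b (th h) : csz (FM E M)) x : fmod _ _) g =
  - h2 h (gact g (agM x b), agM x b) - ra x (- h2 h (gact (gact g x) b, b)).
 exact (congr1 (fun F : fmod (gP E) M => F g) (pc_actE b (th h) x)).
have e' : ((th (ra b h) : csz (FM E M)) x : fmod _ _) g = - h2 (ra b h) (gact g x, x) by [].
apply: (etrans e'); apply: etrans (esym e).
by rewrite h2_ra gactM raN opprK opprB addrC.
Qed.

Definition theta : rhom (FM E (csz M)) (csz (FM E M)) := RHom th_eq.

Lemma ps_fsp u : fsp D (fun p => - u2 u (gact p.1 (agV p.2), p.2)).
apply: (@fsp_lin k (E * S) D M M (fun v => - v)); first by move=> c v w; rewrite opprD scalerN.
exact: (fsp_pull dsp_actV (u2_fsp u)).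
Qed.

Lemma ps_slice u g : fsp agO (fun x : S => - u2 u (gact g (agV x), x)).
apply: (@fsp_pull k (E * S) S D agO (fun x => (g, x)) M _ _ (ps_fsp u)) => b Db.
exact: (dspan_r g (fa_sub hS) Db).
Qed.

Lemma ps_slice1 u g : - u2 u (gact g (agV ag1), ag1) = 0.
have e : u2 u (gact g (agV ag1), ag1) = 0 by rewrite /u2 pc1.
by rewrite e oppr0.
Qed.

Let ps0 u g : csz M := mk_csz (ps_slice u g) (ps_slice1 u g).

Lemma ps0_fsp u : fsp (gP E) (ps0 u).
have H := fsp_curry hS (fsp_swap (ps_fsp u)) (l := fun g => mkfm (ps_slice u g)) (fun g x => erefl).
have := fsp_lin (@norm_lin k S M) H.
rewrite (_ : (fun x => norm _) = ps0 u) //; apply/funext=> g; apply: pc_ext=> x.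
by rewrite normE -[mkfm _ ag1]/(- u2 u (gact g (agV ag1), ag1)) ps_slice1 ra0 subr0.
Qed.

Lemma theta_bij : (forall h, theta h = 0 -> h = 0) /\ forall u, exists h, theta h = u.
split=> [h h0|u].
 apply: fm_ext=> g; apply: pc_ext=> x.
 have e1 : ((0 : csz (FM E M)) x : fmod (gP E) M) (gact g (agV x)) = 0.
  exact (congr1 (fun F : fmod (gP E) M => F (gact g (agV x))) (@pc0 k S (FM E M) x)).
 have e2 : - h2 h (gact (gact g (agV x)) x, x) = 0.
  exact (etrans (congr1 (fun u : csz (FM E M) => ((u : csz_car _) x : fmod _ _) (gact g (agV x))) h0) e1).
 have e3 : ((0 : fmod (gP E) (csz M)) g : csz M) x = 0 by exact (@pc0 k S M x).
 apply: etrans (esym e3); move/eqP: e2; rewrite oppr_eq0 -gactM agVM gact1 => /eqP e2.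
 exact e2.
exists (mkfm (ps0_fsp u)); apply: pc_ext=> x; apply: fm_ext=> g.
have e : ((th (mkfm (ps0_fsp u)) : csz (FM E M)) x : fmod _ _) g = - - u2 u (gact (gact g x) (agV x), x).
 by [].
by apply: (etrans e); rewrite opprK -gactM agMV gact1.
Qed.

Lemma bd_theta (f : FM E M) (h : FM E (csz M)) :
 (forall g x, h2 h (g, x) = fm_fun f (gact g (agV x)) - ra x (fm_fun f g)) ->
 theta h = bd f.
move=> hE'; apply: pc_ext=> x; apply: fm_ext=> g.
have e : ((th h : csz (FM E M)) x : fmod _ _) g = - h2 h (gact g x, x) by [].
apply: (etrans e); rewrite hE' -gactM agMV gact1 opprB.
have e' := congr1 (fun F : fmod (gP E) M => F g) (bdE f x).
by apply: etrans (esym e').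
Qed.
End Shift.
Section Iterate.
Context k (S : agr k) (E : gspace S) (M : rmod S).
Hypothesis hE : falg (@gP k S E).

Lemma csz_map_bij (N N' : rmod S) (f : rhom N N') : (forall v, f v = 0 -> v = 0) ->
 (forall w, exists v, f v = w) ->
 (forall v, csz_map f v = 0 -> v = 0) /\ forall w, exists v, csz_map f v = w.
move=> f0 fs; have fi : injective f.
 by move=> u v uv; apply/eqP; rewrite -subr_eq0; apply/eqP/f0; rewrite linearB uv subrr.
have [g gf] := choice fs.
have fg v : g (f v) = v by apply: fi; rewrite gf.
have lg : linear g by move=> c u v; apply: fi; rewrite linearP !gf.
have eg x v : g (ra x v) = ra x (g v) by apply: fi; rewrite rh_eq !gf.
split=> [v v0|w].
 apply: pc_ext=> x; apply: f0; have := congr1 (fun u : csz N' => u x) v0.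
 by rewrite csz_mapE => ->.
exists (csz_map (mkrh lg eg) w); apply: pc_ext=> x.
by rewrite !csz_mapE; exact: gf.
Qed.

(** Moves the iterated cosyzygies outside, so that the complex of global sections becomes the
    standard complex of the single module k[E] tensor M. *)
Fixpoint shift j : rhom (FM E (Pr M j)) (Pr (FM E M) j) :=
 match j return rhom (FM E (Pr M j)) (Pr (FM E M) j) with
 | 0%N => mkrh (fun c u v => erefl (c *: u + v : FM E M)) (fun g v => erefl)
 | i.+1 => rhcomp (csz_map (shift i)) (theta (Pr M i) hE)
 end.

Lemma shift_bij j : (forall h, shift j h = 0 -> h = 0) /\ forall u, exists h, shift j h = u.
elim: j=> [|j [i0 is0]]; first by split=> // u; exists u.
have [c0 cs] := csz_map_bij i0 is0; have [t0 ts] := theta_bij (Pr M j) hE.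
split=> [h /c0/t0 //|u]; have [v vu] := cs u; have [h hv] := ts v.
by exists h; rewrite -vu -hv.
Qed.

Lemma shift_bd j (f : FM E (Pr M j)) (h : FM E (Pr M j.+1)) :
 (forall g x, (fm_fun h g : csz (Pr M j)) x =
  fm_fun f (gact g (agV x)) - ra x (fm_fun f g)) ->
 shift j.+1 h = bd (shift j f).
move=> hf; rewrite -csz_map_bd -(@bd_theta k S E (Pr M j) hE f h) //.
Qed.
End Iterate.

(** * Cohomology of line bundles on the flag variety *)

Section LineBundle.
Variables (k : closedFieldType) (n : nat) (lam : 'I_n -> int) (E : nat -> int).
Hypothesis EE : forall i : 'I_n, E i = - lam (rev_ord i).
Notation T := (flag k n).
Notation B := (borel k n).
Notation Bg := (mgr B).
Notation wE := (@bwt k n E).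
Notation N0 := (tw wE (triv Bg k^o)).
Implicit Types (F : 'M[k]_n -> k) (g h : 'M[k]_n) (U V W : opens T).

Lemma trig_weightE (b : 'M[k]_n) : trig_weight lam b = \prod_i b i i ^ lam (rev_ord i).
rewrite /trig_weight (reindex_inj rev_ord_inj); apply: eq_bigr=> i _.
by rewrite rev_ordK.
Qed.

Lemma bwt_trig (b : Bg) : wE b * trig_weight lam (\val (b : B)) = 1.
rewrite trig_weightE -[wE b]/(\prod_i (\val (b : B)) i i ^ E i) -big_split big1 // => i _.
have b0 := isol0 (@borel_isol k n i) (mgP (b : B)).
by rewrite EE -[LHS]/(_ ^ _ * _ ^ _) -expfzDr // addNr expr0z.
Qed.

Definition frm U g (h : frames U g) : frames U := exist _ g (mem_set h).

Definition lbf U (s : lb_section lam U) g : N0 :=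
 if pselect (frames U g) is left h then s (frm h) else 0.

Lemma lbfE U (s : lb_section lam U) (g : frames U) : lbf s (\val g) = s g.
rewrite /lbf; case: pselect=> [h|[]]; last exact: set_valP.
by congr (s _); exact: val_inj.
Qed.

Lemma lbfE' U (s : lb_section lam U) g (h : frames U g) : lbf s g = s (frm h).
by rewrite -lbfE. Qed.
Lemma lbf_borel U (s : lb_section lam U) (b : Bg) g : frames U g ->
 lbf s (\val (b : B) *m g) = wE b * lbf s g.
move=> Ug; have Ubg : frames U (\val (b : B) *m g) by apply/frames_borel.
have /asboolP[e _] := lb_funP s.
have := e (frm Ug) (frm Ubg) (\val (b : B)) (borel_trig b) erefl.
rewrite (lbfE' s Ug) (lbfE' s Ubg) => <-.
by rewrite mulrCA bwt_trig mulr1.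
Qed.

Lemma regF_mull F F' a : mpf F -> mpf F' ->
 (forall h, F h != 0 -> F' h != 0) -> (exists2 c, mpf c & forall h, F h != 0 -> (F' h)^-1 = c h / F h) ->
 regF F' a -> forall u : TF F -> TF F', (forall t, sval (u t) = sval t) -> regF F (fun t => a (u t)).
move=> pF pF' FF' [c pc cE] ra u uE; have A := regF_alg pF.
apply: (regF_comp A) ra => [i j|].
 rewrite (_ : (fun x => _) = fun t : TF F => sval t i j); first exact: regF_entry.
 by apply/funext=> t; rewrite uE.
rewrite (_ : (fun x => _) = fun t : TF F => c (sval t) * (F (sval t))^-1).
 by apply: (faM A); [exact: regf_poly|exact: regF_inv].
by apply/funext=> t; rewrite uE cE //; exact: proj2_sig t.
Qed.

(** The denominators of a section are arbitrary polynomials. By semi-invariance the value at h is a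
    character times the value at [urep], and there [chart_ex] supplies a semi-invariant
    denominator. *)
Lemma gg_lbf U (s : lb_section lam U) : gg U (lbf s).
apply: gg_local=> [g nU|g0 Ug0]; first by rewrite /lbf; case: pselect.
have /asboolP[_ rs] := lb_funP s.
have [P [Q [Q0 PQ]]] := rs (frm Ug0).
have [F1 [sF1 F1g F1P [li Qi]]] := chart_ex (frames_unit Ug0) (mpf_mxeval Q) Q0.
have [F2 [sF2 F2g F2U _]] := local_chart Ug0.
pose F h := F1 h * F2 h; have sF : semi F by exact: semiM.
have F12 h : F h != 0 -> F1 h != 0 /\ F2 h != 0 by rewrite mulf_eq0 negb_or => /andP[].
exists F; split; [exact: sF|by rewrite mulf_neq0|].
have A := regF_alg sF.1; pose c := invmx g0.
pose u (t : TF F) : TF F1 := exist (fun h => F1 h != 0) (sval t) (F12 _ (proj2_sig t)).1.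
have uA a : regF F1 a -> regF F (fun t => a (u t)).
 move=> ra; apply: (regF_mull sF.1 sF1.1 _ _ ra) => [h /F12[]//||//].
 exists F2; first exact: sF2.1.
 by move=> h Fh; have [F1h F2h] := F12 h Fh; rewrite /F invfM mulrCA mulfV // mulr1.
have lmF h : F h != 0 -> lmin (h *m c) != 0 by move=> /F12[/F1P[]].
have [eL dL] := fa_lub sF lmF (uA _ li).
pose be (t : TF F) : Bg := mgE (lub_borel (lmF _ (proj2_sig t))).
have beA a : @agO k Bg a -> regF F (fun t => a (be t)) by move=> Oa; apply: (mgO_comp A) Oa.
have eS (i j : 'I_n) : regF F (fun t => urep c (sval t) i j).
 by apply: (fa_mulmx A) => a b; [exact: eL|exact: regF_entry sF.1].
pose a (t : TF F) : k := wE (agV (be t)) * (mxeval P (urep c (sval t)) * (mxeval Q (urep c (sval t)))^-1).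
have ra : regF F a.
 apply: (faM A); first by apply: (beA (fun b => wE (agV b))); apply: agO_inv; exact: gcO.
 apply: (faM A); first by apply: (fa_comp A eS); exact: mpf_mxeval.
 exact: (uA _ Qi).
rewrite /reg (_ : (fun t => _) = fun t => a t *: (1 : k^o)); first exact: fsp1.
apply/funext=> -[h Fh]; rewrite -[RHS]/(a (exist _ h Fh) * 1) mulr1.
set t : TF F := exist _ h Fh; have [/F1P[uh lh Qh] /F2U Uh] := F12 h Fh.
have Ush : frames U (\val (be t : B) *m h) by apply/frames_borel.
have := PQ (frm Ush) Qh; rewrite -lbfE lbf_borel //= => e.
rewrite /a -[urep c _]/(\val (be t : B) *m h) -e mulrA gcVl mul1r //.
Qed.

Lemma lbf_lin U : linear (fun s : lb_section lam U => mkgg (gg_lbf s)).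
move=> c s t; apply: gg_ext=> g Ug.
have e (s' : lb_section lam U) : mkgg (gg_lbf s') g = s' (frm Ug) := lbfE' s' Ug.
rewrite e -[RHS]/(c *: (mkgg (gg_lbf s) g : k^o) + mkgg (gg_lbf t) g) !e //.
Qed.

Lemma lbf_res U V (h : V `<=` U) (s : lb_section lam U) :
 mkgg (gg_lbf (lb_res lam h s)) = gg_res N0 h (mkgg (gg_lbf s)).
apply: gg_ext=> g Vg; rewrite gg_resE //.
have Ug := frames_sub h Vg.
rewrite -[LHS]/(lbf (lb_res lam h s) g) -[RHS]/(lbf s g) (lbfE' _ Vg) (lbfE' _ Ug) /=.
by congr (s _); exact: val_inj.
Qed.

Definition lb_aug : sheafHom (line_bundle k lam) (GG n N0) :=
 @SheafHom k T (line_bundle k lam) (GG n N0) (fun V => mkLin (@lbf_lin V)) lbf_res.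

Lemma lb_aug_mono : sheaf_mono lb_aug.
move=> U s t st; apply/val_inj/funext=> g.
rewrite -[LHS]/(s g) -[RHS]/(t g) -!lbfE.
exact: (congr1 (fun u : gg_sec N0 U => u (\val g)) st).
Qed.

Lemma lb_aug_exact : sheaf_exact lb_aug (dG N0).
move=> U y; split=> [/dG0P H|loc]; last first.
 apply/dG0P=> g x [v Uv av]; have [W [h [Wv [z zE]]]] := loc v Uv.
 have Wg : frames W g by exists v.
 have yE g' : frames W g' -> (y : gg_sec N0 U) g' = lbf z g'.
  by move=> Wg'; have := congr1 (fun u : gg_sec N0 W => u g') zE; rewrite gg_resE.
 by rewrite !yE ?lbf_borel //; apply/frames_borel.
have [y0 ly] := ggsP (y : gg_sec N0 U).
pose f (g : frames U) : k^o := (y : gg_sec N0 U) (\val g).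
have PA := mpf_alg k n.
have fP : is_section lam f.
 split=> [g h b tb hE|g].
  have ub : b \in unitmx.
   by have := frames_unit (set_valP h); rewrite hE unitmx_mul => /andP[].
  have Bb : mgS B b by apply/borelP.
  rewrite /f hE -[b]/(\val (mgE Bb)) (H _ (mgE Bb) (set_valP g)).
  by rewrite -[ra _ _]/(wE (mgE Bb : Bg) * _) mulrAC bwt_trig mul1r.
 have [F [sF Fg FU rf]] := ly _ (set_valP g).
 have [L [m [pm mE]]] := reg_poly sF.1 rf.
 have {}pm : mpf (m : 'M[k]_n -> k) := fsp_scalar (fa_sub PA) pm.
 have [P PE] := faM PA pm sF.1; have [Q QE] := faX PA L.+1 sF.1.
 exists P, Q; rewrite -QE expf_neq0 //; split=> // h; rewrite -QE -PE => Qh.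
 have Fh : F (\val h) != 0 by move: Qh; rewrite expf_eq0 /=.
 have e : m (\val h) = F (\val h) ^+ L * f h := esym (mE _ Fh).
 by rewrite e (mulrAC _ (f h)) -exprSr mulrAC mulfV ?mul1r // expf_neq0.
move=> x Ux; exists U, (@subset_refl _ U); split=> //; exists (LbSection (asboolT fP)).
rewrite res_id; apply: gg_ext=> g Ug.
by rewrite -[LHS]/(lbf _ g) (lbfE' _ Ug).
Qed.

Notation G := (gl k n).
Notation Gg := (mgr G).

(** Left translation by the inverse, because a [gspace] carries a right action. *)
Definition glact (g : G) (b : B) : G := mg_mul (mgE (@borel_gl k n _ (mgV (mgP b)))) g.

Lemma glact_val (g : G) (b : B) : \val (glact g b) = invmx (\val b) *m \val g.
by []. Qed.
Lemma glact1 (g : G) : glact g (@ag1 k Bg) = g.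
by apply: val_inj; rewrite glact_val invmx1 mul1mx. Qed.
Lemma glactM (g : G) (b c : Bg) : glact g (agM b c) = glact (glact g b) c.
apply: val_inj; rewrite !glact_val -[\val (agM b c : B)]/(\val (b : B) *m \val (c : B)).
by rewrite mulmxA; congr (_ *m _); have := congr1 (fun u : Bg => \val (u : B)) (agV_M b c).
Qed.

Lemma glact_co (p : G -> k) : mgO p -> dspan (@mgO k n G) (@agO k Bg) (fun (g : G) b => p (glact g b)).
move=> Op; have hA := dspan_alg (mgO_alg G) (mgO_alg B).
refine (@mgO_comp k n G _ _ (fun q : G * B => glact q.1 q.2) p hA _ _ Op).
 apply: (fa_mulmx hA (M := fun q : G * B => invmx (\val q.2)) (N := fun q => \val q.1)) => i j.
  exact: (dspan_snd (mgO_alg G) (mgO_inv_entry B i j)).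
 exact: (dspan_fst (mgO_alg B) (mgO_entry G i j)).
have H : dspan (@mgO k n G) (@mgO k n B) (fun x y => \det (\val y) * (\det (\val x))^-1).
 apply: (faM hA (f := fun q : G * B => \det (\val q.2)) (g := fun q : G * B => (\det (\val q.1))^-1)).
  by apply: (dspan_snd (mgO_alg G) (b := fun b : B => \det (\val b))); apply: (fa_det (mgO_alg B)) => i j; exact: mgO_entry.
 by apply: (dspan_fst (mgO_alg B) (a := fun b : G => (\det (\val b))^-1)); exact: regf_inv.
suff e : (fun (x : G) (y : B) => (\det (\val (glact x y)))^-1) =
  (fun x y => \det (\val y) * (\det (\val x))^-1) by rewrite -e in H.
apply/funeq2P=> x y.
by rewrite glact_val det_mulmx det_inv invfM invrK.
Qed.

Definition glsp : gspace Bg := @GSpace k Bg G glact glact1 glactM (@mgO k n G) (fa_sub (mgO_alg G)) glact_co.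

Section Global.
Variable M : rmod Bg.
Notation X := (opens_full T).

Lemma gl_det (g : G) : \det (\val g) != 0. Proof. exact: mg_det. Qed.
Lemma rst_fsp (u : gg_sec M X) : fsp (gP glsp) (fun g : G => u (\val g)).
have ru := gg_global (bbF_full k n) (ggsP u).
pose iv (g : G) : TF determinant := exist (fun h : 'M[k]_n => \det h != 0) (\val g) (gl_det g).
have FP a : regF determinant a -> gP glsp (fun g : G => a (iv g)).
 by move=> [p [L [pp aE]]]; exists p, L; split=> // t; exact: aE.
exact (fsp_pull FP ru).
Qed.

Definition rst (u : gg_sec M X) : FM glsp M := mkfm (rst_fsp u).

Lemma rst_lin : linear rst.
by move=> c u v; apply: fm_ext. Qed.
Lemma rst_inj u v : rst u = rst v -> u = v.
move=> uv; apply: gg_ext=> h /frames_unit/(glE (k := k) (n := n) h).2 Gh.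
exact: (congr1 (fun F : fmod _ M => F (mgE Gh)) uv).
Qed.

Lemma rst_surj (f : FM glsp M) : exists u, rst u = f.
pose u h : M := if pselect (mgS G h) is left Gh then (f : fmod _ _) (mgE Gh) else 0.
have uE (g : G) : u (\val g) = fm_fun f g.
 rewrite /u; case: pselect=> [Gh|[]]; last exact: mgP.
 by congr (fm_fun f _); exact: val_inj.
have gu : gg X u.
 apply: (gg_of (bbF_full k n)) => [|g nX]; last first.
  rewrite /u; case: pselect=> [Gh|//]; exfalso; apply: nX; apply/framesTP.
  exact: mgU Gh.
 pose v (t : TF (@determinant k n)) : G := mgE ((glE (k := k) (sval t)).2 (etrans (unitmxE _) (etrans (unitfE _) (proj2_sig t)))).
 rewrite /reg (_ : (fun t => _) = fun t => fm_fun f (v t)).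
  have FP a : gP glsp a -> regF determinant (fun t => a (v t)).
   by move=> [p [L [pp aE]]]; exists p, L; split=> // t; exact: aE.
  exact (fsp_pull FP (fmP (f : fmod _ _))).
 by apply/funext=> t; rewrite -uE.
by exists (mkgg gu); apply: fm_ext=> g; exact: uE.
Qed.

Lemma rst_inv u : dG M X u = 0 <-> invt (rst u).
split=> [/dG0P H b|H].
 apply: fm_ext=> g; rewrite -[LHS]/(ra b (u (\val (glact g b)))) glact_val.
 have Xg : frames X (invmx (\val (b : B)) *m \val g).
  by apply/framesTP; rewrite unitmx_mul unitmx_inv borel_unit; exact: mgU (mgP g).
 by rewrite -H // mulmxA mulmxV ?mul1mx //; exact: borel_unit.
apply/dG0P=> h b Xh; have Gh : mgS G h by apply/glE; exact: frames_unit Xh.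
pose g : G := mgE Gh; have := congr1 (fun F : fmod _ M => F (glact g (agV b))) (H b).
rewrite -[LHS]/(ra b (u (\val (glact (glact g (agV b)) b)))) -glactM agVM glact1.
rewrite -[RHS]/(u (\val (glact g (agV b)))) glact_val => ->.
by congr (u (_ *m _)); rewrite -[RHS]/(invmx (invmx (\val (b : B)))) invmxK.
Qed.
End Global.

Lemma rst_dG (M : rmod Bg) (u : gg_sec M (opens_full T)) (g : glsp) (x : Bg) :
 ((rst (dG M (opens_full T) u) : fmod _ _) g : csz M) x =
 (rst u : fmod _ _) (gact g (agV x)) - ra x ((rst u : fmod _ _) g).
rewrite -[LHS]/((dG M (opens_full T) u : gg_sec (csz M) _) (\val (g : G)) x) dGE.
congr (u _ - _); rewrite -[RHS]/(\val (glact g (agV x))) glact_val.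
by rewrite -[invmx _]/(invmx (invmx (\val (x : B)))) invmxK.
Qed.

(** Through [rst] and [shift] the cocycles among global sections become invariants and the
    differentials become [bd]. *)
Lemma hdim_sections j D : hdim (FM glsp N0) j D ->
 quotient_dim (@sec_cyc k T (fun j => GG n (Pr N0 j)) (fun j => dG (Pr N0 j)) j)
  (@sec_bnd k T (fun j => GG n (Pr N0 j)) (fun j => dG (Pr N0 j)) j) D.
have hE : falg (gP glsp) by exact: mgO_alg.
have sinj i (a b : FM glsp (Pr N0 i)) : shift N0 hE i a = shift N0 hE i b -> a = b.
 move=> ab; apply/eqP; rewrite -subr_eq0; apply/eqP/(shift_bij N0 hE i).1.
 by rewrite linearB ab subrr.
have inv i (a : FM glsp (Pr N0 i)) : invt (shift N0 hE i a) <-> invt a.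
 split=> [H b|H b]; last by rewrite -rh_eq H.
 by apply: sinj; rewrite rh_eq H.
have onto i v : exists u, v = shift N0 hE i (rst u).
 by have [h <-] := (shift_bij N0 hE i).2 v; have [u <-] := rst_surj h; exists u.
apply: (@qdim_iso k _ _ _ _ _ _ (fun v u => v = shift N0 hE j (rst u)) idfun).
- exact: bnd_sublin.
- exact: (@sec_bnd_sublin k T (fun j => GG n (Pr N0 j)) (fun j => dG (Pr N0 j))).
- exact: invt_sublin.
- exact: (@sec_cyc_sublin k T (fun j => GG n (Pr N0 j)) (fun j => dG (Pr N0 j))).
- by exists idfun.
- by rewrite -[rst 0]/(mkLin (@rst_lin _) 0) !linear0.
- by move=> c u v u' v' -> ->; have e : rst (idfun c *: u' + v') = c *: rst u' + rst v' := rst_lin c u' v'; rewrite e linearP.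
- by move=> v iv; have [u vu] := onto j v; exists u; split=> //; apply/rst_inv/inv; rewrite -vu.
- move=> u du; exists (shift N0 hE j (rst u)), u; split=> //; first by apply/inv/rst_inv.
 by rewrite subrr; exact: sl0 (@sec_bnd_sublin k T (fun j => GG n (Pr N0 j)) (fun j => dG (Pr N0 j)) j).
move=> v u _ _ -> {v}; case: j u => [|j] u; split.
- by move=> e; apply: (@rst_inj N0); apply: (sinj 0%N); rewrite [LHS]e -[rst 0]/(mkLin (@rst_lin _) 0) !linear0.
- by move=> ->; rewrite -[rst 0]/(mkLin (@rst_lin _) 0) !linear0.
- move=> [w wE]; have [z zE] := onto j w; exists z; apply: rst_inj; apply: (sinj j.+1).
 by rewrite wE zE; symmetry; apply: shift_bd=> g x; exact: rst_dG.
- move=> [z ->]; exists (shift N0 hE j (rst z)); apply: shift_bd=> g x; exact: rst_dG.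
Qed.

(** Inversion on GL_n exchanges left translation by B with the right regular action restricted to
    B. *)
Lemma ind_riso : riso (FM glsp N0)
 (tw (@bwt k n E) (rres (mg_sub (@borel_gl k n)) (ind Gg k^o))).
have fP (h : FM glsp N0) : fsp (@agO k Gg) (fun x : Gg => (h : fmod _ N0) (agV x) : k^o).
 by apply: (@fsp_pull k G Gg (@mgO k n G) _ (@agV k Gg) k^o _ _ (fmP (h : fmod _ N0))) => a Oa; exact: agO_inv.
pose f (h : FM glsp N0) : tw (@bwt k n E) (rres (mg_sub (@borel_gl k n)) (ind Gg k^o)) := mkfm (fP h).
have fl : linear f by move=> c h h'; apply: fm_ext.
have fe (b : Bg) (h : FM glsp N0) : mkLin fl (ra b h) = ra b (mkLin fl h).
 apply: fm_ext=> x.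
 rewrite -[LHS]/(wE b * ((h : fmod _ N0) (glact (agV x) b) : k)).
 rewrite -[RHS]/(wE b * ((h : fmod _ N0) (agV (agM x (mg_sub (@borel_gl k n) b))) : k)).
 have e : glact (agV (x : Gg)) b = agV (agM (x : Gg) (mg_sub (@borel_gl k n) b)).
  by apply: val_inj; rewrite agV_M.
 by rewrite e.
apply: (@riso_bij k Bg _ _ (RHom fe)).
 move=> h h' hh'; apply: fm_ext=> x.
 have := congr1 (fun u : fmod (@agO k Gg) k^o => u (@agV k Gg x)) hh'.
 have agVV : agV (agV (x : Gg)) = x.
  by rewrite -[LHS]agM1 -(agVM (x : Gg)) agMA agVM ag1M.
 by rewrite -[LHS]/((h : fmod _ N0) (agV (agV (x : Gg)))) -[RHS]/((h' : fmod _ N0) (agV (agV (x : Gg)))) agVV.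
move=> w; have gP' : fsp (gP glsp) (fun x : G => (w : fmod (@agO k Gg) k^o) (@agV k Gg x) : N0).
 by apply: (@fsp_pull k Gg G _ _ (@agV k Gg) k^o _ _ (fmP (w : fmod (@agO k Gg) k^o))) => a Oa; exact: (@agO_inv k Gg).
exists (mkfm gP'); apply: fm_ext=> x.
have agVV : agV (agV (x : Gg)) = x.
 by rewrite -[LHS]agM1 -(agVM (x : Gg)) agMA agVM ag1M.
by rewrite -[LHS]/((w : fmod (@agO k Gg) k^o) (agV (agV (x : Gg)))) agVV.
Qed.

Lemma line_bundle_cohomology j D :
 hdim (tw (@bwt k n E) (rres (mg_sub (@borel_gl k n)) (ind Gg k^o))) j D ->
 cohomology_dim (line_bundle k lam) j D /\
 forall d, cohomology_dim (line_bundle k lam) j d -> d = D.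
move=> /(riso_hdim (riso_sym ind_riso))/hdim_sections.
apply: (@comparison_ex k T (@BB k n) (@BB_capI k n) (@BB_qc k n) _ (line_bundle k lam)
 (fun j => GG n (Pr N0 j)) lb_aug (fun j => dG (Pr N0 j))).
- by exists determinant; exact: bbF_full.
- exact: lb_aug_mono.
- exact: lb_aug_exact.
- by move=> i; exact: dG_exact.
- by move=> i; exact: cech_GG.
Qed.
End LineBundle.

(** * Generating series of the stable dimensions *)

Section StableDimensions.
Variables (k : closedFieldType) (p : nat) (hp : p \in [pchar k]).

Lemma closed_poly_eq0 (P : {poly k}) : (forall t, t != 0 -> P.[t] = 0) -> P = 0.
move=> P0; apply/eqP; apply: contraT=> nP.
have /closed_nonrootP[t] : 'X * P != 0 by rewrite mulf_neq0 ?polyX_eq0.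
rewrite rootE hornerM hornerX mulf_eq0 negb_or => /andP[t0]; by rewrite P0 ?eqxx.
Qed.

Lemma closed_root_ex (c : k) : exists d, d ^+ p = c.
have p0 : (0 < p)%N by rewrite (prime_gt0 (pcharf_prime hp)).
have /closed_rootP[d] : size ('X^p - c%:P) != 1 by rewrite size_XnsubC // eqSS -lt0n.
by rewrite rootE !hornerE subr_eq0 => /eqP; exists d.
Qed.

Notation kinf := closed_poly_eq0.
Notation kroot := closed_root_ex.

Definition hookf b d : nat -> nat := projT1 (cid (hookdim_ex hp kinf kroot d b)).

Lemma hookfP b d : hookdim k b d (hookf b d).
by have [] := projT2 (cid (hookdim_ex hp kinf kroot d b)). Qed.
Lemma hookf_gt b d j : (d < j)%N -> hookf b d j = 0%N.
by have [_] := projT2 (cid (hookdim_ex hp kinf kroot d b)); apply. Qed.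
Lemma hookfE b d f : hookdim k b d f -> hookf b d =1 f.
exact: hookdim_uniq (hookfP b d). Qed.
(** For every large n the dimension exists and is unique, which forces the value returned by
    [xget]. *)
Lemma h_st_hook a b j : (0 < a)%N ->
 h_st k (hook_weight a b) j = if (b <= j)%N then hookf b (a + b) (j - b) else 0%N.
move=> a0; set D := (if _ then _ else _).
have [q0 hq] := hookdim_weight hp kinf j a0 (hookfP b (a + b)).
have coh q : (maxn q0 b <= q)%N -> cohomology_dim (flag_bundle k q.+2 (hook_weight a b)) j D /\
  forall d, cohomology_dim (flag_bundle k q.+2 (hook_weight a b)) j d -> d = D.
 rewrite geq_max => /andP[q0q bq].
 apply: (@line_bundle_cohomology k q.+2 _ (wH q (a + b) a (q - b))); last exact: hq.
 (* The Borel weight is minus the hook read backwards: position i of the matrix corresponds to the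
    entry [rev_ord i]. *)
 move=> i; rewrite /wH /hook_weight /= subSS; have iq := ltn_ord i.
 have [->|i1] := eqVneq (nat_of_ord i) q.+1; first by rewrite subnn /= opprK PoszD.
 have [->|i2] := eqVneq (nat_of_ord i) q; first by rewrite subSnn.
 have -> : (q.+1 - i = (q - i.+1).+2)%N by lia.
 rewrite /= nth_nseq.
 have -> : ((q - b <= i)%N && (i < q)%N) = (q - i.+1 < b)%N.
  by apply/idP/idP=> H; lia.
 by case: ifP=> _; rewrite ?oppr0.
apply: xget_unique.
 exists (maxn q0 b).+2 => -[|[|q]] // Nq; exact: (coh q Nq).1.
move=> y [N Ny]; pose q := maxn (maxn q0 b) N.
have := Ny q.+2; rewrite leqW ?leqW ?leq_maxr // => /(_ isT); apply: (coh q _).2.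
exact: leq_maxl.
Qed.

(* the Poincare polynomials of the cohomology, degrees shifted by b *)
Definition hooks b : fps := fun d => \sum_(j < d.+1) (hookf b d j)%:R * tvar ^+ j.

Lemma hooksE b d N : (d < N)%N -> hooks b d = \sum_(j < N) (hookf b d j)%:R * tvar ^+ j.
move=> dN; rewrite /hooks (big_ord_widen N (fun j => (hookf b d j)%:R * tvar ^+ j)) //.
rewrite big_mkcond; apply: eq_bigr=> j _; case: ifP=> // /negbT; rewrite -leqNgt => dj.
by rewrite hookf_gt // mul0r.
Qed.

Lemma H_series_hook a b : (0 < a)%N -> H_series k a b = tvar ^+ b * hooks b (a + b)%N.
move=> a0; rewrite /H_series; pose F j := (h_st k (hook_weight a b) j)%:R * tvar ^+ j : coefT.
(* Only the degrees from b to a + 2b can contribute, since the shifted degree is at most d = a +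
   b. *)
rewrite -(@fsbig_widen _ _ 0 +%R [set` iota 0 ((a + b).+1 + b)] setT F) //; last first.
 move=> j [_ nj]; have jN : ((a + b).+1 + b <= j)%N.
  rewrite leqNgt; apply/negP=> jN; apply: nj.
  by have jI : j \in iota 0 ((a + b).+1 + b) by rewrite mem_iota.
 rewrite /= /F h_st_hook // hookf_gt ?if_same ?mul0r //; lia.
rewrite -fsbig_seq ?iota_uniq //.
have -> : iota 0 ((a + b).+1 + b) = index_iota 0 ((a + b).+1 + b) by rewrite /index_iota subn0.
rewrite (@big_cat_nat _ _ _ b) ?leq_addl //=.
rewrite big_nat big1 ?add0r; last first.
 by move=> j /andP[_ jb]; rewrite /F h_st_hook // leqNgt jb mul0r.
rewrite -{1}(add0n b) big_addn addnK big_mkord /hooks mulr_sumr; apply: eq_bigr=> j _.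
by rewrite /F h_st_hook // leq_addl addnK exprD (mulrC (tvar ^+ j)) mulrCA.
Qed.

Lemma hooks0 b : hooks b 0 = 1.
by rewrite /hooks big_ord1 (hookfE (hookdim0 hp kinf b)) expr0 mulr1. Qed.
Lemma p_gt1 : (1 < p)%N. Proof. exact: prime_gt1 (pcharf_prime hp). Qed.
Lemma hooks_top b : hooks (p * b + p.-1) = fps_subst p (hooks b).
have p0 := ltnW p_gt1; apply/funext=> d; rewrite /fps_subst; case: ifP=> [/dvdnP[e ->]|/negbT nd].
 rewrite mulnK // (@hooksE b e (e * p).+1); last by rewrite ltnS leq_pmulr.
 have He : hookdim k (p * b + p.-1) (e * p) (hookf b e).
  by rewrite (mulnC e p); exact: (hookdim_top hp kinf kroot (hookfP b e)).
 by apply: eq_bigr=> j _; rewrite (hookfE He).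
rewrite /hooks big1 // => j _.
by rewrite (hookfE (hookdim_ndvd hp kinf b nd)) mul0r.
Qed.

Definition fshift e (f : fps) : fps := fun d => if (e <= d)%N then f (d - e)%N else 0.

Lemma hooks_residue b i : (i.+1 < p)%N -> forall d,
 hooks (p * b + i) d = fps_subst p (hooks b) d + tvar * fshift (p * b + i).+1 (hooks (p - i.+2)) d.
move=> ip d; rewrite -hooks_top.
pose D := if (p * b + i < d)%N then hookf (p - i.+2) (d - (p * b + i).+1) else fun=> 0%N.
have hD : if (p * b + i < d)%N then hookdim k (p - i.+2) (d - (p * b + i).+1) D else forall j, D j = 0%N.
 by rewrite /D; case: (p * b + i < d)%N => //; exact: hookfP.
have E := hookfE (hookdim_residue hp kinf kroot ip (hookfP (p * b + p.-1) d) hD).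
rewrite (@hooksE _ d d.+2) // (@hooksE (p * b + p.-1) d d.+2) //.
have -> : \sum_(j < d.+2) (hookf (p * b + i) d j)%:R * tvar ^+ j =
  \sum_(j < d.+2) (if nat_of_ord j is j'.+1 then (D j' + hookf (p * b + p.-1) d j)%N
   else hookf (p * b + p.-1) d 0)%:R * tvar ^+ j.
 by apply: eq_bigr=> j _; rewrite E.
rewrite big_ord_recl [in X in _ = X + _]big_ord_recl /= -addrA; congr (_ + _).
under eq_bigr => j _ do rewrite /bump /= add1n natrD mulrDl.
pose G j := (hookf (p * b + p.-1) d j)%:R * tvar ^+ j : coefT.
rewrite -[X in _ = X + _]/(\sum_(j < d.+1) G j.+1) big_split /=.
rewrite -[X in _ + X = _]/(\sum_(j < d.+1) G j.+1) addrC; congr (_ + _).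
rewrite /fshift; case: ifP=> h; last first.
 by rewrite mulr0 big1 // => j _; rewrite /D h mul0r.
rewrite (@hooksE _ _ d.+1); last by rewrite ltnS leq_subr.
by rewrite mulr_sumr; apply: eq_bigr=> j _; rewrite /D h exprS mulrCA.
Qed.

(** These coefficients correspond to a <= 0. In the recursion the shifted term begins beyond d, and
    division of d and b by p keeps the inequality. *)
Lemma hooks_small b d : (0 < d <= b)%N -> hooks b d = 0.
have p0 := ltnW p_gt1; elim/ltn_ind: d b => d IH b /andP[d0 db].
pose b' := (b %/ p)%N; pose i := (b %% p)%N.
have bE : b = (p * b' + i)%N by rewrite mulnC -divn_eq.
have ip : (i < p)%N by rewrite ltn_mod.
have top : fps_subst p (hooks b') d = 0.
 rewrite /fps_subst; case: ifP=> // /dvdnP[e de]; rewrite de mulnK //.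
 have e0 : (0 < e)%N by move: d0; rewrite de; case: (e).
 have ed : (e < d)%N by rewrite de ltn_Pmulr // p_gt1.
 apply: IH=> //; rewrite e0 /b' leq_divRL //; lia.
have [ii|ii] := eqVneq i p.-1; first by rewrite bE ii hooks_top.
rewrite bE hooks_residue ?top; last by lia.
by rewrite /fshift add0r -bE leqNgt ltnS db mulr0.
Qed.

Lemma fps_mul_mono c e f : fps_mul (fps_mono c e) f = fun d => c * fshift e f d.
apply/funext=> d; rewrite /fps_mul /fps_mono /fshift; case: ifP=> ed.
 rewrite (bigD1 (Ordinal (ed : (e < d.+1)%N))) //= eqxx big1 ?addr0 // => i ie.
 case: eqP=> [ii|_]; last by rewrite mul0r.
 by case/eqP: ie; apply: val_inj.
rewrite mulr0 big1 // => i _; case: eqP=> [ie|_]; last by rewrite mul0r.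
by have := ltn_ord i; rewrite ie ltnS ed.
Qed.

Lemma tvar_neq0 : tvar != 0.
by rewrite /tvar tofrac_eq0 polyX_eq0. Qed.
(** [N_series] starts at a = 1, that is at d > b; below that [hooks b] vanishes except for its
    constant term 1, which is absent from [N_series]. *)
Lemma N_seriesE b d : N_series k b d = if d == 0%N then 0 else hooks b d.
rewrite /N_series fps_mul_mono /fshift; have [bd|db] := leqP b d.
 have [bd'|db'] := ltnP b d.
  have e : H_series k (d - b) b = tvar ^+ b * hooks b d.
   have bd2 : (0 < d - b)%N by rewrite subn_gt0.
   by rewrite (@H_series_hook (d - b) b bd2) (subnK bd).
  rewrite subn_gt0 bd' e mulrA mulVf ?expf_neq0 ?tvar_neq0 //.
  by rewrite mul1r; case: eqP=> // d0; rewrite d0 ltn0 in bd'.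
 have -> : d = b by apply/eqP; rewrite eqn_leq db' bd.
 by rewrite subnn ltnn mulr0; case: eqP=> // /eqP b0; rewrite hooks_small // lt0n b0 leqnn.
by rewrite mulr0; case: eqP=> // /eqP d0; rewrite hooks_small // lt0n d0 ltnW.
Qed.

(** * Truncated series and the infinite product *)

Record eqN N (P Q : {poly coefT}) : Prop := EqN { eqNE : forall m, (m < N)%N -> P`_m = Q`_m }.

Lemma eqN_refl N P : eqN N P P. Proof. by []. Qed.
Lemma eqN_sym N P Q : eqN N P Q -> eqN N Q P. Proof. by move=> H; split=> m mN; rewrite (eqNE H). Qed.
Lemma eqN_trans N P Q R : eqN N P Q -> eqN N Q R -> eqN N P R.
by move=> H K; split=> m mN; rewrite (eqNE H) // (eqNE K). Qed.
Lemma eqND N P Q P' Q' : eqN N P Q -> eqN N P' Q' -> eqN N (P + P') (Q + Q').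
by move=> H K; split=> m mN; rewrite !coefD (eqNE H) // (eqNE K). Qed.
Lemma eqNB N P Q P' Q' : eqN N P Q -> eqN N P' Q' -> eqN N (P - P') (Q - Q').
by move=> H K; split=> m mN; rewrite !coefB (eqNE H) // (eqNE K). Qed.
Lemma eqNM N P Q P' Q' : eqN N P Q -> eqN N P' Q' -> eqN N (P * P') (Q * Q').
move=> H K; split=> m mN; rewrite !coefM; apply: eq_bigr=> i _.
have im : (i <= m)%N by rewrite -ltnS.
by rewrite (eqNE H) ?(eqNE K) // (leq_ltn_trans _ mN) // leq_subr.
Qed.

(** Polynomial truncations modulo X^N, on which series identities are proved by [ring]. *)
Record apx N (f : fps) (P : {poly coefT}) : Prop := Apx { apxE : forall m, (m < N)%N -> f m = P`_m }.
Definition tr N (f : fps) : {poly coefT} := \poly_(d < N) f d.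

Lemma apx_tr N f : apx N f (tr N f). Proof. by split=> m mN; rewrite coef_poly mN. Qed.
Lemma apx_eqN N f P Q : apx N f P -> apx N f Q -> eqN N P Q.
by move=> H K; split=> m mN; rewrite -(apxE H) // (apxE K). Qed.
Lemma apxM N f g P Q : apx N f P -> apx N g Q -> apx N (fps_mul f g) (P * Q).
move=> H K; split=> m mN; rewrite /fps_mul coefM; apply: eq_bigr=> i _.
have im : (i <= m)%N by rewrite -ltnS.
by rewrite (apxE H) ?(apxE K) // (leq_ltn_trans _ mN) // leq_subr.
Qed.
Lemma apx_mono N c e : apx N (fps_mono c e) (c%:P * 'X^e).
by split=> m mN; rewrite coefCM coefXn /fps_mono; case: eqP; rewrite ?mulr1 ?mulr0. Qed.
Lemma apx1 N : apx N fps1 1.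
by rewrite -[1]mulr1 -{1}(expr0 'X) -polyC1; exact: apx_mono. Qed.
Lemma apxD N f g P Q : apx N f P -> apx N g Q -> apx N (f + g) (P + Q).
by move=> H K; split=> m mN; rewrite coefD -(apxE H) // -(apxE K). Qed.
Lemma apx_shift N c e f P : apx N f P -> apx N (fun d => c * fshift e f d) (c%:P * 'X^e * P).
by rewrite -fps_mul_mono; apply: apxM; exact: apx_mono. Qed.
Lemma coef_monoX (c : coefT) q j m :
 ((c%:P * 'X^q) ^+ j)`_m = if m == (q * j)%N then c ^+ j else 0.
by rewrite exprMn -rmorphXn /= coefCM -exprM coefXn; case: eqP; rewrite ?mulr1 ?mulr0.
Qed.

Definition geo N q : {poly coefT} := \sum_(j < N) ((tvar ^+ 2)%:P * 'X^q) ^+ j.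

Lemma apx_geom N q : (0 < q)%N -> apx N (fps_geom (fps_mono (tvar ^+ 2) q)) (geo N q).
move=> q0; split=> m mN; pose x : {poly coefT} := (tvar ^+ 2)%:P * 'X^q.
have it j : apx N (iter j (fps_mul (fps_mono (tvar ^+ 2) q)) fps1) (x ^+ j).
 elim: j=> [|j IH]; first exact: apx1.
 by rewrite iterS (exprS x j); exact: (apxM (@apx_mono N (tvar ^+ 2) q) IH).
rewrite /fps_geom coef_sum (big_ord_widen N (fun j => iter j (fps_mul (fps_mono (tvar ^+ 2) q)) fps1 m)) //.
rewrite big_mkcond; apply: eq_bigr=> j _; rewrite ltnS; case: ifP=> jm; first exact: (apxE (it j)).
rewrite coef_monoX; case: eqP=> // mE.
by move: jm; rewrite mE leq_pmull.
Qed.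

Lemma geo_inv N q : (0 < q)%N -> eqN N (geo N q * (1 - (tvar ^+ 2)%:P * 'X^q)) 1.
move=> q0; split=> m mN; set x := _ * 'X^q.
have -> : geo N q * (1 - x) = 1 - x ^+ N by rewrite -(opprB x 1) -(opprB (x ^+ N) 1) subrX1 mulrN mulrC.
rewrite coefB coef_monoX ltn_eqF ?subr0 //.
by rewrite (leq_trans mN) // leq_pmull.
Qed.

Lemma geo_big N q : (N <= q)%N -> eqN N (geo N q) 1.
move=> Nq; split=> m mN; case: N Nq mN => // N Nq mN.
rewrite /geo big_ord_recl expr0 coefD coef_sum big1 ?addr0 // => j _.
rewrite coef_monoX ltn_eqF //.
by rewrite lift0 (leq_trans mN) // (leq_trans Nq) // leq_pmulr.
Qed.

Lemma subst_comp P q f : (0 < P)%N -> (0 < q)%N ->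
 fps_subst P (fps_subst q f) = fps_subst (P * q) f.
move=> P0 q0; apply/funext=> d; rewrite /fps_subst.
have [/dvdnP[e ->]|nd] := boolP (P %| d)%N.
 by rewrite mulnK // (mulnC e P) dvdn_pmul2l // divnMl.
by case: ifP=> // /(dvdn_trans (dvdn_mulr q (dvdnn P))); rewrite (negPf nd).
Qed.

Lemma subst_shift P c f : (0 < P)%N -> fps_subst P (fshift c f) = fshift (c * P) (fps_subst P f).
move=> P0; apply/funext=> d; rewrite /fps_subst /fshift.
have [/dvdnP[e ->]|nd] := boolP (P %| d)%N.
 rewrite mulnK // leq_pmul2r //; case: ifP=> // _.
 by rewrite -mulnBl dvdn_mull // mulnK.
case: ifP=> // cd; case: ifP=> // dv; case/negP: nd.
by rewrite -(subnK cd) dvdn_addr // dvdn_mull.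
Qed.

Definition Gi i : fps := fps_subst (p ^ i) (hooks 0).

Lemma hooks_rec q : (q.+1 < p)%N -> forall d,
 hooks q d = Gi 1 d + tvar * fshift q.+1 (hooks (p - q.+2)) d.
by move=> qp d; have := hooks_residue 0 qp d; rewrite muln0 add0n /Gi expn1. Qed.

Section Truncated.
Variable N : nat.
Notation t := (tvar%:P : {poly coefT}).
Notation t2 := ((tvar ^+ 2)%:P : {poly coefT}).

(** The recursion sends q to p - 2 - q, so two applications return to q. Solving the resulting
    linear equation gives the numerator 1 + t u^(q+1) and the denominator 1 - t^2 u^p. *)
Lemma hooks_trunc q : (q.+1 < p)%N ->
 eqN N (tr N (hooks q) * (1 - t2 * 'X^p)) ((1 + t * 'X^(q.+1)) * tr N (Gi 1)).
move=> qp; have st r : (r.+1 < p)%N ->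
  eqN N (tr N (hooks r)) (tr N (Gi 1) + t * 'X^(r.+1) * tr N (hooks (p - r.+2))).
 move=> rp; apply: (apx_eqN (apx_tr N _)); split=> m mN; rewrite hooks_rec // coefD.
 by rewrite -(apxE (apx_tr N (Gi 1)) mN) -(apxE (apx_shift tvar r.+1 (apx_tr N (hooks (p - r.+2)))) mN).
have e1 := st q qp; have e2 : eqN N (tr N (hooks (p - q.+2)))
  (tr N (Gi 1) + t * 'X^(p - q.+1) * tr N (hooks q)).
 have := st (p - q.+2)%N; have -> : (p - (p - q.+2).+2 = q)%N by lia.
 have -> : ((p - q.+2).+1 = p - q.+1)%N by lia.
 by apply; lia.
have e3 := eqN_trans e1 (eqND (@eqN_refl N _) (eqNM (@eqN_refl N (t * 'X^(q.+1))) e2)).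
rewrite mulrBr mulr1; apply: eqN_trans (eqNB e3 (@eqN_refl N _)) _.
have -> : 'X^p = 'X^(q.+1) * 'X^(p - q.+1) :> {poly coefT} by rewrite -exprD subnKC // ltnW.
rewrite rmorphXn /= (_ : _ - _ = (1 + t * 'X^(q.+1)) * tr N (Gi 1)); first exact: eqN_refl.
by ring.
Qed.

(** The case q = 0 after substituting u^(p^i) for u, which turns [Gi 1] into [Gi i.+1]. *)
Lemma Gi_trunc i : eqN N (tr N (Gi i) * (1 - t2 * 'X^(p ^ i.+1))) ((1 + t * 'X^(p ^ i)) * tr N (Gi i.+1)).
have p1 := p_gt1; have p0 := ltnW p1; have pi0 : (0 < p ^ i)%N by rewrite expn_gt0 p0.
have G1E : Gi 1 = fps_subst p (hooks 0) by rewrite /Gi expn1.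
have r0 : hooks 0 = fun d => Gi 1 d + tvar * fshift 1 (Gi 1) d + tvar ^+ 2 * fshift p (hooks 0) d.
 apply/funext=> d; rewrite hooks_rec // -addrA; congr (_ + _).
 case: d=> [|d]; first by rewrite /fshift /= leqn0 (gtn_eqF p0) !mulr0 addr0.
 rewrite {1 2}/fshift /= !subn1 /= hooks_rec; last by lia.
 rewrite mulrDr mulrA -expr2; congr (_ + _ * _); rewrite /fshift.
 have -> : (p - (p - 2).+2 = 0)%N by lia.
 have -> : ((p - 2).+1 <= d)%N = (p <= d.+1)%N by apply/idP/idP=> ?; lia.
 by case: ifP=> // pd; congr (hooks 0 _); lia.
have rE : Gi i = fun d => Gi i.+1 d + tvar * fshift (p ^ i) (Gi i.+1) d + tvar ^+ 2 * fshift (p ^ i.+1) (Gi i) d.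
 have GS : fps_subst (p ^ i) (Gi 1) = Gi i.+1 by rewrite G1E subst_comp // -expnSr.
 rewrite {1}/Gi r0; apply/funext=> d.
 have := subst_shift 1 (Gi 1) pi0; rewrite mul1n GS => <-.
 have := subst_shift p (hooks 0) pi0; rewrite -expnS -/(Gi i) => <-.
 rewrite -GS /fps_subst; case: ifP=> // _.
 by rewrite !mulr0 !addr0.
have H : eqN N (tr N (Gi i)) (tr N (Gi i.+1) + t * 'X^(p ^ i) * tr N (Gi i.+1) + t2 * 'X^(p ^ i.+1) * tr N (Gi i)).
 apply: (apx_eqN (apx_tr N _)); split=> m mN; rewrite {1}rE !coefD.
 rewrite -(apxE (apx_tr N (Gi i.+1)) mN) -(apxE (apx_shift tvar (p ^ i) (apx_tr N (Gi i.+1))) mN).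
 by rewrite -(apxE (apx_shift (tvar ^+ 2) (p ^ i.+1) (apx_tr N (Gi i))) mN).
rewrite mulrBr mulr1; apply: eqN_trans (eqNB H (@eqN_refl N _)) _.
rewrite (_ : _ - _ = (1 + t * 'X^(p ^ i)) * tr N (Gi i.+1)); first exact: eqN_refl.
by ring.
Qed.

Lemma geo_cancel q P Q : (0 < q)%N -> eqN N (P * (1 - t2 * 'X^q)) Q -> eqN N P (geo N q * Q).
move=> q0 PQ; apply: eqN_trans (eqNM (@eqN_refl N (geo N q)) PQ).
rewrite mulrCA -{1}[P]mulr1; apply: eqNM; first exact: eqN_refl.
exact: eqN_sym (geo_inv N q0).
Qed.

Definition Api J : {poly coefT} := \prod_(1 <= i < J) ((1 + t * 'X^(p ^ i)) * geo N (p ^ i)).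

(** [Gi_trunc] pairs the numerator of one factor of A with the denominator of the next; the initial
    [geo N p] realigns them, and the product telescopes. *)
Lemma Api_chain J : (0 < J)%N ->
 eqN N (geo N p * tr N (Gi 1)) (Api J * (geo N (p ^ J) * tr N (Gi J))).
have p0 := ltnW p_gt1; case: J=> // J _; elim: J=> [|J IH].
 by rewrite /Api big_geq // mul1r expn1; exact: eqN_refl.
apply: eqN_trans IH _; rewrite /Api (big_nat_recr J.+1) //= -/(Api J.+1).
have pJ : (0 < p ^ J.+2)%N by rewrite expn_gt0 p0.
have g := geo_cancel pJ (Gi_trunc J.+1).
apply: (eqN_trans (eqNM (eqN_refl N (Api J.+1)) (eqNM (eqN_refl N (geo N (p ^ J.+1))) g))).
rewrite (_ : _ * _ = Api J.+1 * ((1 + t * 'X^(p ^ J.+1)) * geo N (p ^ J.+1)) * (geo N (p ^ J.+2) * tr N (Gi J.+2))).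
 exact: eqN_refl.
by ring.
Qed.

(** Once p^J >= N, both [geo N (p ^ J)] and [Gi J] are 1 modulo X^N. *)
Lemma Api_lim J : (0 < J)%N -> (N <= p ^ J)%N -> eqN N (geo N p * tr N (Gi 1)) (Api J).
move=> J0 NJ; apply: eqN_trans (Api_chain J0) _; rewrite -[X in eqN _ _ X]mulr1.
apply: eqNM; first exact: eqN_refl.
rewrite -[X in eqN _ _ X]mulr1; apply: eqNM; first exact: geo_big.
apply: (apx_eqN (apx_tr N _)); split=> m mN; rewrite coef1 /Gi /fps_subst.
case: m mN => [|m] mN; first by rewrite dvdn0 div0n hooks0.
by rewrite gtnNdvd // (leq_trans mN).
Qed.

Lemma A_apx J : apx N (\big[fps_mul/fps1]_(1 <= i < J) A_factor p i) (Api J).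
have p0 := ltnW p_gt1; apply: (big_ind2 (apx N)); first exact: apx1.
 by move=> f P g Q; exact: apxM.
move=> i _; apply: apxM; last by apply: apx_geom; rewrite expn_gt0 p0.
by apply: apxD; [exact: apx1|exact: apx_mono].
Qed.
End Truncated.

Lemma A_seriesE : A_series p = fps_mul (fps_geom (fps_mono (tvar ^+ 2) p)) (Gi 1).
have p1 := p_gt1; have p0 := ltnW p1; apply/funext=> m; rewrite /A_series (apxE (A_apx m.+1 _) (ltnSn m)).
rewrite (apxE (apxM (apx_geom m.+1 p0) (apx_tr m.+1 (Gi 1))) (ltnSn m)).
symmetry; apply: (eqNE (@Api_lim m.+1 m.+1 _ _)) => //; exact: ltnW (ltn_expl _ p1).
Qed.

(** [A_seriesE] absorbs both the denominator 1 - t^2 u^p and [Gi 1] into A, leaving the numerator 1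
    + t u^(q+1) of [hooks_trunc]. *)
Lemma hooks_A q : (q.+1 < p)%N -> forall d,
 hooks q d = A_series p d + tvar * fshift q.+1 (A_series p) d.
have p0 := ltnW p_gt1; move=> qp d; pose N := d.+1.
have aA : apx N (A_series p) (geo N p * tr N (Gi 1)).
 by rewrite A_seriesE; apply: apxM; [exact: apx_geom|exact: apx_tr].
rewrite (apxE (apx_tr N (hooks q)) (ltnSn d)) (eqNE (geo_cancel p0 (hooks_trunc N qp)) (ltnSn d)).
rewrite (apxE aA (ltnSn d)) (apxE (apx_shift tvar q.+1 aA) (ltnSn d)) -coefD.
suff -> : geo N p * ((1 + tvar%:P * 'X^(q.+1)) * tr N (Gi 1)) =
 geo N p * tr N (Gi 1) + tvar%:P * 'X^(q.+1) * (geo N p * tr N (Gi 1)) by [].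
by ring.
Qed.
End StableDimensions.

Theorem mainTheorem3 (k : closedFieldType) (p : nat) (hp : p \in [pchar k]) :
  (forall b : nat,
     N_series k (p * b + p - 1)%N = fps_subst p (N_series k b)) /\
  (forall b i : nat, (i <= p - 2)%N ->
     N_series k (p * b + i)%N =
       fps_subst p (N_series k b) +
       fps_mul (fps_mono tvar (p * b + i + 1)%N +
                fps_mono (tvar ^+ 2) (p * b + p)%N)
               (A_series p)).
Proof.
have p1 := p_gt1 hp; have p0 := ltnW p1.
(* [N_series] and [hooks] differ only in the constant coefficient, which is treated apart. *)
have sN b d : (0 < d)%N -> fps_subst p (N_series k b) d = fps_subst p (hooks hp b) d.
  move=> d0; rewrite /fps_subst; case: ifP => // /dvdnP[e de].
  rewrite (N_seriesE hp) de mulnK //; case: eqP => // e0.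
  by rewrite de e0 in d0.
have N0 b : N_series k b 0 = 0 by rewrite (N_seriesE hp).
have s0 b : fps_subst p (N_series k b) 0 = 0 by rewrite /fps_subst dvdn0 div0n N0.
have mulD f g h d : fps_mul (f + g) h d = fps_mul f h d + fps_mul g h d.
  by rewrite /fps_mul -big_split; apply: eq_bigr => i _; exact: mulrDl.
split=> [b|b i ip]; apply/funext => -[|d].
- by rewrite N0 s0.
- by rewrite sN // (N_seriesE hp) /= -addnBA // subn1 (hooks_top hp).
- rewrite N0 -[RHS]/(fps_subst p (N_series k b) 0 + fps_mul _ _ 0) s0 mulD !fps_mul_mono.
  by rewrite /fshift addn1 /= leqn0 addn_eq0 (gtn_eqF p0) andbF !mulr0 !addr0.
have ip' : (i.+1 < p)%N by lia.
rewrite -[RHS]/(fps_subst p (N_series k b) d.+1 + fps_mul _ _ d.+1) sN // mulD !fps_mul_mono.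
rewrite (N_seriesE hp) /= (hooks_residue hp b ip'); congr (_ + _).
have qp : ((p - i.+2).+1 < p)%N by lia.
rewrite /fshift addn1; case: ifP => h; last first.
  by rewrite ifF ?mulr0 ?addr0 //; apply/negbTE; rewrite -ltnNge; move/negbT: h; rewrite -ltnNge => h; lia.
(* With q = p - 2 - i the exponents add up to (pb + i + 1) + (p - 1 - i) = pb + p, which gives the
   term in t^2. *)
rewrite (hooks_A hp qp) mulrDr mulrA -expr2; congr (_ + _ * _); rewrite /fshift.
have -> : ((p - i.+2).+1 <= d.+1 - (p * b + i).+1)%N = (p * b + p <= d.+1)%N.
  by apply/idP/idP => ?; lia.
by case: ifP => // ?; congr (A_series p _); lia.
Qed.
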